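(* Let $d\in(-\tfrac12,\tfrac12)\setminus\{0\}$ and let $X=(X_n)_{n\in\mathbb Z}$ be a centered, weakly stationary, real-valued process with spectral density $$f(\lambda)=\left|\frac{\theta(e^{i\lambda})}{\phi(e^{i\lambda})}\right|^2 f_0(\lambda),\qquad \lambda\in(-\pi,\pi],$$ where $$f_0(\lambda)=c(d)\,|1-e^{i\lambda}|^2\sum_{k=-\infty}^{\infty}|\lambda+2\pi k|^{-2d-2},\qquad c(d)=\frac1{2\pi}\Gamma(2d+2)\cos(\pi d),$$ is the spectral density of fractional Gaussian noise. Assume that the polynomials $\phi$ and $\theta$ (with real coefficients, of degrees $p$ and $q$, normalized by $\phi(0)=\theta(0)=1$) are relatively prime, that $\phi$ has no zeros in the closed unit disk $\{z\in\mathbb C:|z|\le1\}$, and that $\theta$ has no zeros on the unit circle $\{z\in\mathbb C:|z|=1\}$. Then the partial correlation coefficients of $X$ satisfy $$\alpha(n)\sim\frac dn,\qquad n\to\infty,$$ and the relative prediction error satisfies $$\delta(n)\sim\left(\prod_{j:|z_j|<1}\frac1{z_j^2}\right)\sigma_0^2\,\frac{d^2}{n},\qquad n\to\infty,$$ where $z_1,\dots,z_q$ are the zeros of $\theta$ and $$\sigma_0^2=2\pi\exp\left(\frac1{2\pi}\int_{-\pi}^{\pi}\log f_0(\lambda)\,d\lambda\right).$$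
   Context: The covariance sequence is $\gamma(k)=\mathsf E X_0X_k$ and the spectral density is related to it by $f(\lambda)=\frac1{2\pi}\sum_{k\in\mathbb Z}\gamma(k)e^{i\lambda k}$, i.e. $\gamma(k)=\int_{-\pi}^{\pi}f(\lambda)e^{-i\lambda k}d\lambda$. For integers $k\le m$, $P_{[k,m]}$ is the orthogonal projection (in $L^2$ of the probability space) onto the linear span of $\{X_k,\dots,X_m\}$. The prediction error is $\sigma^2(n)=\mathsf E(X_n-P_{[1,n-1]}X_n)^2$, its limit is $\sigma^2=\lim_{n\to\infty}\sigma^2(n)=2\pi\exp\big(\frac1{2\pi}\int_{-\pi}^{\pi}\log f(\lambda)d\lambda\big)$, and the relative prediction error is $\delta(n)=\sigma^2(n)-\sigma^2$. The partial correlation coefficients are $\alpha(1)=\gamma(1)/\gamma(0)$ and, for $n>1$, $\alpha(n)=\rho\big(X_0-P_{[1,n-1]}X_0,\;X_n-P_{[1,n-1]}X_n\big)$, where $\rho(\xi,\eta)=\mathsf{Cov}(\xi,\eta)/\sqrt{\mathsf{Var}(\xi)\mathsf{Var}(\eta)}$. The notation $x_n\sim y_n$ means $x_n=y_n(1+o(1))$ as $n\to\infty$. Zeros are listed with multiplicity, so $\theta(z)=\prod_{j=1}^q(1-z_j^{-1}z)$. *)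

(* Defs.v *)
From HB Require Import structures.
From mathcomp Require Import all_boot all_order all_algebra.
From mathcomp Require Export complex.
From mathcomp Require Import all_classical all_reals all_analysis.
Set Implicit Arguments.
Unset Strict Implicit.
Unset Printing Implicit Defensive.
Import Order.TTheory GRing.Theory Num.Theory.
Import numFieldNormedType.Exports.
Local Open Scope classical_set_scope.
Local Open Scope ring_scope.

Section Functions.
Context {R : realType}.
Local Notation mu := (@lebesgue_measure R).

(* Euler's Gamma function, for x > 0. *)
Definition Gamma (x : R) : R :=
  Rintegral mu `]0, +oo[ (fun t => t `^ (x - 1) * expR (- t)).

Definition expi (l : R) : R[i] := (cos l +i* sin l)%C.

Definition cRintegral (D : set R) (g : R -> R[i]) : R[i] :=
  (Rintegral mu D (fun l => complex.Re (g l)) +i*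
   Rintegral mu D (fun l => complex.Im (g l)))%C.

(* `|z| lives in R[i] (with zero imaginary part); this is its value in R. *)
Definition cmod (z : R[i]) : R := complex.Re `|z|.

Definition cpoly (p : {poly R}) : {poly R[i]} := map_poly (real_complex R) p.

(* The sum has nonnegative terms, so that it is unambiguously an esum. It is
   finite for d > -1/2. At l = 0, where the formula reads 0 * infinity, the
   conventions on powers and inverses give the value 0. *)
Definition fgn_density (d : R) (l : R) : R :=
  (2 * pi)^-1 * Gamma (2 * d + 2) * cos (pi * d) * cmod (1 - expi l) ^+ 2 *
  fine (\esum_(k in [set: int])
          (`|l + 2 * pi * k%:~R| `^ (- 2 * d - 2))%:E).

Definition farima_fgn_density (d : R) (phi theta : {poly R}) (l : R) : R :=
  cmod ((cpoly theta).[expi l] / (cpoly phi).[expi l]) ^+ 2 * fgn_density d l.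

Definition kolmogorov_variance (f : R -> R) : R :=
  2 * pi * expR ((2 * pi)^-1 * Rintegral mu `]- pi, pi] (fun l => ln (f l))).

End Functions.

Section Processes.
Context {disp : measure_display} {T : measurableType disp} {R : realType}
  {P : probability T R}.
Implicit Types (X : int -> {RV P >-> R}) (Y Z W : T -> R).

Definition centered X := forall k, ('E_P[X k] = 0)%E.

Definition weakly_stationary X :=
  [/\ forall k, (X k : T -> R) \in Lfun P 2%:E,
      forall m n, ('E_P[X m] = 'E_P[X n])%E &
      forall m n k,
        covariance P (X (m + k)) (X (n + k)) = covariance P (X m) (X n)].

Definition gamma X (k : int) : R := fine ('E_P[(X 0 \* X k)%R])%E.

(* Integrals over (-pi, pi] and over [-pi, pi] agree. *)
Definition spectral_density X (f : R -> R) :=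
  [/\ forall l, l \in `]- pi, pi] -> 0 <= f l,
      lebesgue_measure.-integrable `]- pi, pi] (EFin \o f) &
      forall k : int,
        cRintegral `]- pi, pi] (fun l => (f l)%:C%C * expi (- (k%:~R * l)))
        = (gamma X k)%:C%C].

(* The linear span of {X k, ..., X m}, which is {0} if m < k. *)
Definition lin_span X (k m : int) : set (T -> R) :=
  [set Y | exists2 s : seq int, all (fun j => k <= j <= m) s &
           exists c : int -> R, Y = fun w => \sum_(j <- s) c j * X j w].

(* For square-integrable X and Z, orthogonal projections of Z exist, and are
   equal almost surely; one of them is chosen. *)
Definition orth_proj X (k m : int) Z : T -> R :=
  xget (cst 0) [set Y | lin_span X k m Y /\
                        forall W, lin_span X k m W ->
                          ('E_P[((Z \- Y) \* W)%R] = 0)%E].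

Definition residual X (k m : int) Z : T -> R := Z \- orth_proj X k m Z.

Definition pred_error X (n : nat) : R :=
  fine ('E_P[(residual X 1 (n%:Z - 1) (X n%:Z) ^+ 2)%R])%E.

Definition pred_error_lim X : R := lim (pred_error X n @[n --> \oo]).

Definition rel_pred_error X (n : nat) : R := pred_error X n - pred_error_lim X.

Definition correlation Y Z : R :=
  fine (covariance P Y Z) / Num.sqrt (fine ('V_P[Y])%E * fine ('V_P[Z])%E).

(* Only meaningful for n >= 1. *)
Definition partial_corr X (n : nat) : R :=
  if (n <= 1)%N then gamma X 1 / gamma X 0
  else correlation (residual X 1 (n%:Z - 1) (X 0))
                   (residual X 1 (n%:Z - 1) (X n%:Z)).

End Processes.

(* Main.v *)
(* Off the origin the spectral density is
     exp (l0 + 2 sum_(k >= 1) L_k cos (k l)) |1 - exp (i l)|^(-2 d)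
   with L_k = O(k^-2). For the rational factor this comes from expanding
   log |1 - w|^2 for |w| < 1: a zero z_j of theta inside the disk is first
   reflected to 1 / conj z_j, at the price of the constant |z_j|^-2. For
   fractional Gaussian noise, log f_0 + d log |1 - exp (i l)|^2 is even, and its
   second derivative on ]0, pi] is O(1 + l^(2 d)).

   Partial correlations and prediction errors are computed by the Levinson
   recursion. For a density |h|^2 with h outer in the Wiener algebra, the
   prediction polynomial of degree n is obtained by inverting 1 - H^2, where H
   is a Hankel matrix (psi_(n+1+j+k)) of the phase psi = conj h / h. Replace
   1 - exp (i l) by 1 - r exp (i l) with r < 1. The phase psi0 of the pure
   singular weight has real part at least cos (pi d) > 0, so its Hankel operator
   has norm at most |sin (pi d)| < 1, uniformly in r; the smooth factor
   contributes a vanishing tail, and psi - psi0 has coefficients O(n^(-3/2)).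
   Hence the reflection coefficients of the two weights differ by O(n^(-3/2)),
   and the prediction error is kappa (1 + O(n^(-1/2))), uniformly in r. For the
   pure singular weight at r = 1 the n-th reflection coefficient is exactly
   -d / (n - d), by a hypergeometric recurrence. This gives
   alpha(n) = d / n + O(n^(-3/2)), and summing
   v_(n-1) - v_n = v_(n-1) alpha(n)^2 gives the rate of the error. *)
Require Import Defs.
From HB Require Import structures.
From mathcomp Require Import all_boot all_order all_algebra.
From mathcomp Require Import all_classical all_reals all_analysis.
From mathcomp Require Import finmap ring lra zify measurable_realfun.
Set Implicit Arguments.
Unset Strict Implicit.
Unset Printing Implicit Defensive.
Import Order.TTheory GRing.Theory Num.Theory.
Import numFieldNormedType.Exports.
Local Open Scope classical_set_scope.
Local Open Scope ring_scope.

(** * Absolutely summable families *)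

(** Working with r < 1 is forced by the algebra: the logarithm of the singular factor has
    coefficients d / k, which are not absolutely summable, whereas d r^k / k are, so that for r < 1
    the outer factor and its inverse are exponentials of summable sequences. The passage to r = 1 is
    elementary because the Levinson recursion of order n involves finitely many covariances. These
    converge, and a lower bound on the prediction variances, uniform in r, keeps the divisions
    continuous. The orders of magnitude balance as follows. The solution of the Hankel equations is
    1 up to an l2 error n^(-1/2). The difference of the two phases has l2 tails of order n^(-1) and
    a Hankel operator of norm only O(n^(-1/2)); but this norm always meets an error of size
    n^(-1/2). Every contribution to the difference of the last coefficients is therefore
    O(n^(-3/2)). All sequences are real. Index reversal plays the part of complex conjugation, and a
    transform is handled through its real and imaginary parts. *)

Section RealSums.
Context {R : realType}.

Section General.
Context {I : choiceType}.
Implicit Types f g : I -> R.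

Definition nsum f : \bar R := \esum_(i in [set: I]) (f i)%:E.
Definition summ f : Prop := (nsum (fun i => `|f i|)%R < +oo)%E.
(** Sums are unordered, over any index type, so that reindexing and Fubini hold without choosing an
    enumeration. The value is meaningful under [summ f]. *)
Definition rsum f : R :=
  fine (nsum (fun i => Num.max (f i) 0)) - fine (nsum (fun i => Num.max (- f i) 0)).

Lemma nsum_ge0 f : (forall i, 0 <= f i) -> (0 <= nsum f)%E.
Proof. by move=> f0; apply: esum_ge0 => i _; rewrite lee_fin. Qed.

Lemma le_nsum f g : (forall i, f i <= g i) -> (nsum f <= nsum g)%E.
Proof. by move=> fg; apply: le_esum => i _; rewrite lee_fin. Qed.

Lemma nsumD f g : (forall i, 0 <= f i) -> (forall i, 0 <= g i) ->
  nsum (fun i => f i + g i) = (nsum f + nsum g)%E.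
Proof.
by move=> f0 g0; rewrite /nsum -esumD// => i _; rewrite lee_fin.
Qed.

Lemma summ_fin f : summ f -> (forall i, 0 <= f i) -> nsum f \is a fin_num.
Proof.
move=> sf f0; rewrite ge0_fin_numE ?nsum_ge0//; apply: le_lt_trans sf.
by apply: le_nsum => i; exact: ler_norm.
Qed.

Lemma le_summ f g : (forall i, `|f i| <= `|g i|) -> summ g -> summ f.
Proof. by move=> fg; apply: le_lt_trans; apply: le_nsum. Qed.

Lemma le_summ_ge0 f g : (forall i, `|f i| <= g i) -> summ g -> summ f.
Proof. by move=> fg; apply: le_summ => i; apply: le_trans (fg i) (ler_norm _). Qed.

Lemma summN f : summ f -> summ (fun i => - f i).
Proof. by apply: le_summ => i; rewrite normrN. Qed.

Lemma summ_abs f : summ f -> summ (fun i => `|f i|).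
Proof. by apply: le_summ => i; rewrite normr_id. Qed.

Lemma summD f g : summ f -> summ g -> summ (fun i => f i + g i).
Proof. by move=> sf sg; exact: (@summableD _ R setT (EFin \o f) (EFin \o g) sf sg). Qed.

Lemma summB f g : summ f -> summ g -> summ (fun i => f i - g i).
Proof. by move=> sf /summN; exact: summD. Qed.

Lemma summ_max f : summ f -> summ (fun i => Num.max (f i) 0).
Proof.
apply: le_summ => i; rewrite ger0_norm ?le_max ?lexx ?orbT//.
by rewrite ge_max ler_norm normr_ge0.
Qed.

Lemma summ_ub f (M : R) : (forall s : seq I, uniq s -> \sum_(i <- s) `|f i| <= M) ->
  summ f.
Proof.
move=> h; apply: (@le_lt_trans _ _ M%:E); last exact: ltry.
apply: ge_ereal_sup => _ [X [fX _] <-].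
rewrite fsbig_finite//= sumEFin lee_fin; apply: h; exact: fset_uniq.
Qed.

Lemma sum_le_nsum f (s : seq I) : uniq s -> (forall i, 0 <= f i) ->
  ((\sum_(i <- s) f i)%R%:E <= nsum f)%E.
Proof.
move=> us f0; rewrite /nsum; apply: esum_ge; exists [set` s].
  by split => //; exact: finite_seq.
by rewrite -fsbig_seq// sumEFin lexx.
Qed.

(** Any splitting into summable nonnegative parts gives the same value, because
    [Num.max f 0 + h = Num.max (- f) 0 + g] pointwise and [nsum] is additive on nonnegative
    functions. Linearity of [rsum] rests on this. *)
Lemma rsum_split f g (h : I -> R) : (forall i, 0 <= g i) -> (forall i, 0 <= h i) ->
  summ g -> summ h -> (forall i, f i = g i - h i) ->
  rsum f = fine (nsum g) - fine (nsum h).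
Proof.
move=> g0 h0 sg sh E.
have sf : summ f.
  by rewrite (_ : f = fun i => g i - h i); [exact: summB|apply/funext].
have H : (nsum (fun i => Num.max (f i) 0)%R + nsum h = nsum (fun i => Num.max (- f i) 0)%R + nsum g)%E.
  rewrite -!nsumD// => [|i|i]; [|by rewrite le_max lexx orbT..].
  congr nsum; apply/funext => i; rewrite E.
  by case: (lerP 0 (g i - h i)) => a; case: (lerP 0 (- (g i - h i))) => b; lra.
have fp := summ_fin (summ_max sf) (fun i => ltac:(by rewrite le_max lexx orbT)).
have fn := summ_fin (summ_max (summN sf)) (fun i => ltac:(by rewrite le_max lexx orbT)).
have gF := summ_fin sg g0; have hF := summ_fin sh h0.
move/(congr1 fine): H; rewrite !fineD// /rsum => H; lra.
Qed.

Lemma rsum_ge0E f : (forall i, 0 <= f i) -> summ f -> rsum f = fine (nsum f).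
Proof.
move=> f0 sf; rewrite (@rsum_split f f (fun=> 0))//.
- rewrite (_ : nsum (fun=> 0) = 0%E) ?subr0//; by rewrite /nsum esum1.
- by apply: (le_summ _ sf) => i; rewrite normr0.
- by move=> i; rewrite subr0.
Qed.

Lemma rsum_EFin f : (forall i, 0 <= f i) -> summ f -> nsum f = (rsum f)%:E.
Proof. by move=> f0 sf; rewrite rsum_ge0E// fineK// summ_fin. Qed.

Lemma rsumB0 f g : (forall i, 0 <= f i) -> (forall i, 0 <= g i) -> summ f -> summ g ->
  rsum (fun i => f i - g i) = rsum f - rsum g.
Proof. by move=> f0 g0 sf sg; rewrite (@rsum_split _ f g)// !rsum_ge0E. Qed.

Lemma rsumD0 f g : (forall i, 0 <= f i) -> (forall i, 0 <= g i) -> summ f -> summ g ->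
  rsum (fun i => f i + g i) = rsum f + rsum g.
Proof.
move=> f0 g0 sf sg; rewrite !rsum_ge0E//; last 2 first.
- by move=> i; rewrite addr_ge0.
- exact: summD.
by rewrite nsumD// fineD ?summ_fin.
Qed.

Let mx f i : 0 <= Num.max (f i) 0. Proof. by rewrite le_max lexx orbT. Qed.
Let mxE f i : f i = Num.max (f i) 0 - Num.max (- f i) 0.
Proof. by case: (lerP 0 (f i)) => a; case: (lerP 0 (- f i)) => b; lra. Qed.

Lemma rsum_posneg f : summ f ->
  rsum f = rsum (fun i => Num.max (f i) 0) - rsum (fun i => Num.max (- f i) 0).
Proof.
move=> sf; rewrite [in LHS](_ : f = (fun i => Num.max (f i) 0 - Num.max (- f i) 0)).
  apply: rsumB0; [exact: mx|move=> i; exact: (mx (fun i => - f i))|exact: summ_max|].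
  exact/summ_max/summN.
by apply/funext => i; exact: mxE.
Qed.

Lemma rsumD f g : summ f -> summ g -> rsum (fun i => f i + g i) = rsum f + rsum g.
Proof.
move=> sf sg.
have m1 := summ_max sf; have m2 := summ_max (summN sf).
have m3 := summ_max sg; have m4 := summ_max (summN sg).
transitivity (rsum (fun i => (Num.max (f i) 0 + Num.max (g i) 0) -
                     (Num.max (- f i) 0 + Num.max (- g i) 0))).
  by congr rsum; apply/funext => i; rewrite [in LHS](mxE f) [in LHS](mxE g); lra.
rewrite rsumB0; [|by move=> i; rewrite addr_ge0// le_max lexx orbT..|exact: summD|exact: summD].
rewrite (rsum_posneg sf) (rsum_posneg sg) !rsumD0//; [lra|..]; by move=> i; rewrite le_max lexx orbT.
Qed.

Lemma rsumN f : rsum (fun i => - f i) = - rsum f.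
Proof.
rewrite /rsum opprB; congr (fine _ - fine _); congr nsum.
by apply/funext => i; rewrite opprK.
Qed.

Lemma rsumB f g : summ f -> summ g -> rsum (fun i => f i - g i) = rsum f - rsum g.
Proof. by move=> sf sg; rewrite rsumD//; [rewrite rsumN|exact: summN]. Qed.

Lemma rsum_ge0 f : (forall i, 0 <= f i) -> 0 <= rsum f.
Proof.
move=> f0; rewrite /rsum (_ : (fun i => Num.max (- f i) 0) = fun=> 0); last first.
  by apply/funext => i; apply/max_idPr; rewrite oppr_le0.
rewrite [X in _ - fine X](_ : _ = 0%E) ?subr0; last by rewrite /nsum esum1.
by rewrite fine_ge0// nsum_ge0// => i; rewrite le_max f0.
Qed.

Lemma ler_rsum f g : summ f -> summ g -> (forall i, f i <= g i) -> rsum f <= rsum g.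
Proof.
move=> sf sg fg; rewrite -subr_ge0 -rsumB//; apply: rsum_ge0 => i.
by rewrite subr_ge0.
Qed.

Lemma ler_norm_rsum f : summ f -> `|rsum f| <= rsum (fun i => `|f i|).
Proof.
move=> sf; have sa := summ_abs sf; rewrite ler_norml -rsumN; apply/andP; split.
  by apply: ler_rsum => //; [exact: summN|move=> i; have := ler_norm (- f i); rewrite normrN; lra].
by apply: ler_rsum => // i; exact: ler_norm.
Qed.

Lemma rsum0 : rsum (fun _ : I => 0) = 0.
Proof. by have := @rsumN (fun=> 0); rewrite oppr0 => /eqP; rewrite -addr_eq0 -mulr2n mulrn_eq0/= => /eqP. Qed.

Lemma eq_rsum f g : f =1 g -> rsum f = rsum g.
Proof. by move=> /funext ->. Qed.

Lemma summ0 : summ (fun _ : I => 0).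
Proof. by apply: (@summ_ub _ 0) => s _; rewrite big1// => i _; rewrite normr0. Qed.

Lemma summ_sum_le f (s : seq I) : uniq s -> summ f ->
  \sum_(i <- s) `|f i| <= rsum (fun i => `|f i|).
Proof.
move=> us sf; rewrite -lee_fin -rsum_EFin//; last exact: summ_abs.
exact: sum_le_nsum.
Qed.

Lemma summ_fine f (M : R) : (forall s : seq I, uniq s -> \sum_(i <- s) `|f i| <= M) ->
  rsum (fun i => `|f i|) <= M.
Proof.
move=> h; rewrite -lee_fin -rsum_EFin//; last exact/summ_abs/(summ_ub h).
apply: ge_ereal_sup => _ [X [fX _] <-].
rewrite fsbig_finite//= sumEFin lee_fin; apply: h; exact: fset_uniq.
Qed.

Lemma summZ f (c : R) : summ f -> summ (fun i => c * f i).
Proof.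
move=> sf; apply: (@summ_ub _ (`|c| * rsum (fun i => `|f i|))) => s us.
under eq_bigr do rewrite normrM; rewrite -mulr_sumr.
by apply: ler_wpM2l => //; exact: summ_sum_le.
Qed.

Lemma rsum_absZ f (c : R) : summ f -> rsum (fun i => `|c| * `|f i|) = `|c| * rsum (fun i => `|f i|).
Proof.
have le1 (e : R) g : summ g -> rsum (fun i => `|e| * `|g i|) <= `|e| * rsum (fun i => `|g i|).
  move=> sg; rewrite (_ : (fun i => _) = fun i => `|e * g i|); last first.
    by apply/funext => i; rewrite normrM.
  apply: summ_fine => s us; under eq_bigr do rewrite normrM; rewrite -mulr_sumr.
  by apply: ler_wpM2l => //; exact: summ_sum_le.
move=> sf; have [->|c0] := eqVneq c 0.
  by rewrite normr0 mul0r -[RHS]rsum0; apply: eq_rsum => i; rewrite mul0r.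
apply/eqP; rewrite eq_le le1//= -ler_pdivlMl ?normr_gt0//.
(* The reverse inequality is [le1] for the factor [c^-1] and the family [c * f]. *)
have := le1 c^-1 (fun i => c * f i) (summZ c sf).
rewrite (_ : (fun i => `|c^-1| * _) = fun i => `|f i|); last first.
  by apply/funext => i; rewrite -normrM mulKf.
rewrite normfV; congr (_ <= _ * _); apply: eq_rsum => i; exact: normrM.
Qed.

Lemma rsumZ f (c : R) : summ f -> rsum (fun i => c * f i) = c * rsum f.
Proof.
move=> sf.
have H0 (e : R) g : 0 <= e -> (forall i, 0 <= g i) -> summ g -> rsum (fun i => e * g i) = e * rsum g.
  move=> e0 g0 sg; have := rsum_absZ e sg; rewrite (ger0_norm e0).
  by under eq_rsum do rewrite ger0_norm//; move=> ->; congr (_ * _); apply: eq_rsum => i; rewrite ger0_norm.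
have H1 (e : R) : 0 <= e -> rsum (fun i => e * f i) = e * rsum f.
  move=> e0; rewrite (rsum_posneg sf) mulrBr -(H0 e (fun i => Num.max (f i) 0) e0 (mx f) (summ_max sf)).
  rewrite -(H0 e (fun i => Num.max (- f i) 0) e0 (mx (fun i => - f i)) (summ_max (summN sf))).
  rewrite -rsumB0; [|by move=> i; rewrite mulr_ge0// le_max lexx orbT..|exact/summZ/summ_max|exact/summZ/summ_max/summN].
  by apply: eq_rsum => i; rewrite -mulrBr -mxE.
case: (lerP 0 c) => c0; first exact: H1.
have := H1 (- c); rewrite oppr_ge0 ltW// => /(_ isT).
rewrite (@eq_rsum (fun i => - c * f i) (fun i => - (c * f i))); last by move=> i; rewrite mulNr.
by rewrite rsumN => e; lra.
Qed.

Lemma rsum_single f (i0 : I) : (forall i, i != i0 -> f i = 0) -> rsum f = f i0 /\ summ f.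
Proof.
move=> h.
have key g : (forall i, i != i0 -> g i = 0) -> (forall i, 0 <= g i) -> nsum g = (g i0)%:E.
  move=> hg g0; rewrite /nsum (esumID [set i0])//; last by move=> i _; rewrite lee_fin.
  rewrite setTI setTI esum_set1 ?lee_fin// esum1 ?adde0// => i /= /eqP ii; by rewrite hg.
have sf : summ f.
  rewrite /summ key => [|i ii|//]; first exact: ltry.
  by rewrite h// normr0.
split => //; rewrite /rsum !key /= => [|i ii|i|i ii|i].
- by case: (lerP 0 (f i0)) => a; case: (lerP 0 (- f i0)) => b; lra.
- by rewrite h// oppr0 maxxx.
- by rewrite le_max lexx orbT.
- by rewrite h// maxxx.
- by rewrite le_max lexx orbT.
Qed.

Lemma summ_bigsum (J : Type) (s : seq J) (F : J -> I -> R) : (forall j, summ (F j)) ->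
  summ (fun i => \sum_(j <- s) F j i) /\
  rsum (fun i => \sum_(j <- s) F j i) = \sum_(j <- s) rsum (F j).
Proof.
move=> sF; elim: s => [|j s [IH1 IH2]].
  rewrite big_nil; split.
    by apply: (le_summ _ summ0) => i; rewrite big_nil normr0.
  by rewrite -[RHS]rsum0; apply: eq_rsum => i; rewrite big_nil.
split; first by under [X in summ X]eq_fun do rewrite big_cons; exact: summD.
by under eq_rsum do rewrite big_cons; rewrite rsumD// IH2 big_cons.
Qed.

Lemma rsum_finite f (s : seq I) : uniq s -> (forall i, i \notin s -> f i = 0) ->
  rsum f = \sum_(i <- s) f i /\ summ f.
Proof.
move=> us h; pose F j i := if i == j then f j else 0.
have FE : f = (fun i => \sum_(j <- s) F j i).
  apply/funext => i; have [is_|ns] := boolP (i \in s).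
    rewrite (bigD1_seq i)//= /F eqxx big1 ?addr0// => j ji.
    by rewrite eq_sym (negbTE ji).
  rewrite h// big_seq big1// => j js; rewrite /F; case: eqP => // ij.
  by move: ns; rewrite ij js.
have Fs j : rsum (F j) = F j j /\ summ (F j).
  by apply: rsum_single => i ij; rewrite /F (negbTE ij).
have [a b] := @summ_bigsum _ s F (fun j => (Fs j).2).
split; last by rewrite FE.
rewrite FE b; apply: eq_bigr => j _; rewrite (Fs j).1 -[RHS]/((fun i => \sum_(j <- s) F j i) j) -FE.
by rewrite /F eqxx.
Qed.

End General.

Lemma rsum_reindex (I J : choiceType) (e : I -> J) (e' : J -> I) (f : J -> R) :
  cancel e e' -> cancel e' e -> rsum f = rsum (f \o e) /\ (summ f -> summ (f \o e)).
Proof.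
move=> k1 k2.
have be : set_bij [set: I] [set: J] e.
  split => //; first by move=> x y _ _ /(congr1 e'); rewrite !k1.
  by move=> y _; exists (e' y).
have key g : nsum g = nsum (g \o e).
  by rewrite /nsum (reindex_esum setT setT e).
split; first by rewrite /rsum !key.
by rewrite /summ key.
Qed.

Section Fubini.
Context {I J : choiceType}.
Implicit Types f : I * J -> R.

Lemma nsum_pair f : (forall i, 0 <= f i) ->
  nsum f = (\esum_(i in [set: I]) nsum (fun j => f (i, j)))%E.
Proof.
move=> f0; rewrite /nsum (@esum_esum R I J setT (fun=> setT) (fun i j => (f (i, j))%:E)).
  rewrite (_ : setT `*`` _ = setT) //; last by apply/seteqP; split => // -[].
  by apply: eq_esum => -[i j].
by move=> i j _ _; rewrite lee_fin.
Qed.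

Lemma summ_slice f i : summ f -> summ (fun j => f (i, j)).
Proof.
rewrite /summ nsum_pair// => h; apply: le_lt_trans h.
rewrite (esumID [set i])//=; last by move=> k _; exact: nsum_ge0.
rewrite setTI esum_set1; last exact: nsum_ge0.
by rewrite leeDl// esum_ge0// => k _; exact: nsum_ge0.
Qed.

Lemma fubini0 f : (forall i, 0 <= f i) -> summ f ->
  summ (fun i => rsum (fun j => f (i, j))) /\
  rsum f = rsum (fun i => rsum (fun j => f (i, j))).
Proof.
move=> f0 sf.
have sl i := summ_slice i sf.
have E : nsum f = nsum (fun i => rsum (fun j => f (i, j))).
  by rewrite nsum_pair// /nsum; apply: eq_esum => i _; rewrite -rsum_EFin.
have s2 : summ (fun i => rsum (fun j => f (i, j))).
  rewrite /summ (_ : (fun i => `|_|) = fun i => rsum (fun j => f (i, j))); last first.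
    by apply/funext => i; rewrite ger0_norm// rsum_ge0.
  rewrite -E; move: sf; rewrite /summ (_ : (fun i => `|_|) = f)//.
  by apply/funext => i; rewrite ger0_norm.
by split => //; apply: EFin_inj; rewrite -!rsum_EFin// => i; rewrite rsum_ge0.
Qed.

Lemma fubini f : summ f ->
  summ (fun i => rsum (fun j => f (i, j))) /\
  rsum f = rsum (fun i => rsum (fun j => f (i, j))).
Proof.
move=> sf; have sp := summ_max sf; have sn := summ_max (summN sf).
have p0 g (i : I * J) : 0 <= Num.max (g i) 0 :> R by rewrite le_max lexx orbT.
have [a1 b1] := fubini0 (p0 f) sp.
have [a2 b2] := fubini0 (p0 (fun i => - f i)) sn.
have E : (fun i => rsum (fun j => f (i, j))) = fun i =>
    rsum (fun j => Num.max (f (i, j)) 0) - rsum (fun j => Num.max (- f (i, j)) 0).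
  by apply/funext => i; rewrite rsum_posneg//; exact: summ_slice.
rewrite E; split; first exact: summB.
by rewrite rsumB// rsum_posneg// b1 b2.
Qed.

Lemma summ_prod (f : I -> R) (g : J -> R) : summ f -> summ g ->
  summ (fun k : I * J => f k.1 * g k.2).
Proof.
move=> sf sg; rewrite /summ nsum_pair//.
rewrite (@eq_esum _ _ _ _ (fun i => (`|f i| * rsum (fun j => `|g j|))%:E)); last first.
  move=> i _ /=; rewrite rsum_EFin//; last exact/summ_abs/summZ.
  congr EFin; rewrite -rsumZ; last exact: summ_abs.
  by apply: eq_rsum => j; rewrite normrM.
have := summZ (rsum (fun j => `|g j|)) sf; rewrite /summ /nsum.
congr (_ < _)%E; apply: eq_esum => i _.
by rewrite normrM mulrC [X in _ * X]ger0_norm// rsum_ge0.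
Qed.

End Fubini.

Lemma fubini_swap (I J : choiceType) (f : I * J -> R) : summ f ->
  rsum (fun i => rsum (fun j => f (i, j))) = rsum (fun j => rsum (fun i => f (i, j))).
Proof.
move=> sf; have [_ <-] := fubini sf.
pose e (k : J * I) := (k.2, k.1); pose e' (k : I * J) := (k.2, k.1).
have [-> s] := @rsum_reindex _ _ e e' f (fun k => ltac:(by case: k)) (fun k => ltac:(by case: k)).
by have [_ ->] := fubini (s sf).
Qed.

Lemma rsumZr (I : choiceType) (f : I -> R) (c : R) : summ f ->
  rsum (fun i => f i * c) = rsum f * c.
Proof. by move=> sf; rewrite mulrC -rsumZ//; apply: eq_rsum => i; rewrite mulrC. Qed.

Lemma summZr (I : choiceType) (f : I -> R) (c : R) : summ f -> summ (fun i => f i * c).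
Proof. by move=> sf; apply: (le_summ _ (summZ c sf)) => i; rewrite mulrC. Qed.

Lemma rsum_ge_term (I : choiceType) (f : I -> R) i : summ f ->
  `|f i| <= rsum (fun i => `|f i|).
Proof. by move=> sf; have := summ_sum_le (s := [:: i]) isT sf; rewrite big_seq1. Qed.

Section IntSums.
Implicit Types f : int -> R.

(** As [Negz i] is [- (i + 1)], the window is [- N <= k < N]; every finite set of integers lies in
    such a window. *)
Definition itrunc (N : nat) f := \sum_(i < N) (f (Posz i) + f (Negz i)).

Local Notation iseq N := ([seq Posz i | i <- iota 0 N] ++ [seq Negz i | i <- iota 0 N]).

Lemma itruncE N f : itrunc N f = \sum_(i <- iseq N) f i.
Proof.
rewrite big_cat !big_map /itrunc big_split/=.
by rewrite -(big_mkord xpredT (fun i => f (Posz i))) -(big_mkord xpredT (fun i => f (Negz i))) /index_iota !subn0.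
Qed.

Lemma iseq_uniq N : uniq (iseq N).
Proof.
rewrite cat_uniq !map_inj_uniq ?iota_uniq//=; [|by move=> ? ? []..].
by rewrite andbT; apply/hasPn => _ /mapP[i _ ->]; apply/negP => /mapP[].
Qed.

Lemma mem_iseq N (k : int) : (k \in iseq N) = (- N%:Z <= k < N%:Z).
Proof.
rewrite mem_cat; case: k => n.
  rewrite mem_map; last by move=> ? ? [].
  rewrite (_ : (Posz n \in [seq Negz i | i <- _]) = false) ?orbF; last by apply/negP => /mapP[].
  by rewrite mem_iota; lia.
rewrite (_ : (Negz n \in [seq Posz i | i <- _]) = false)/=; last by apply/negP => /mapP[].
by rewrite mem_map ?mem_iota; [lia|move=> ? ? []].
Qed.

Lemma summ_itrunc f (M : R) : (forall N, itrunc N (fun k => `|f k|) <= M) ->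
  summ f /\ rsum (fun k => `|f k|) <= M.
Proof.
move=> h.
have H (s : seq int) : uniq s -> \sum_(i <- s) `|f i| <= M.
  move=> us; pose N := (\sum_(i <- s) `|i|%N).+1.
  apply: le_trans (h N); rewrite itruncE.
  have ss : {subset s <= iseq N}.
    move=> i is_; rewrite mem_iseq.
    have : (`|i| <= \sum_(i <- s) `|i|)%N by rewrite (bigD1_seq i)//= leq_addr.
    rewrite /N; lia.
  rewrite [leRHS](bigID (mem s))/= -[leLHS]addr0 lerD//; last exact: sumr_ge0.
  rewrite -[leRHS]big_filter (perm_big [seq i <- iseq N | i \in s])//.
  rewrite uniq_perm// ?filter_uniq ?iseq_uniq// => i.
  by rewrite mem_filter; case: (boolP (i \in s)) => // /ss ->.
by split; [exact: summ_ub H|exact: summ_fine].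
Qed.

Lemma rsum_tail f (e : R) : summ f -> 0 < e -> exists N0, forall N, (N0 <= N)%N ->
  rsum (fun k => if - N%:Z <= k < N%:Z then 0 else `|f k|) <= e.
Proof.
move=> sf e0; have sa := summ_abs sf.
have /ub_ereal_sup_adherent : ereal_sup [set (\sum_(x \in A) `|f x|%:E)%E | A in fsets [set: int]] \is a fin_num.
  by have := summ_fin sa (fun i => normr_ge0 _).
move=> /(_ e e0)[_ [X [fX _] <-]].
rewrite -/(esum _ _) -/(nsum _) rsum_EFin// fsbig_finite//= sumEFin -EFinB lte_fin => h.
have [N0 HN] : exists N0, forall k, k \in fset_set X -> - N0%:Z <= k < N0%:Z.
  exists (\sum_(i <- fset_set X) `|i|%N).+1 => k kX.
  have : (`|k| <= \sum_(i <- fset_set X) `|i|)%N by rewrite (bigD1_seq k) ?fset_uniq//= leq_addr.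
  lia.
exists N0 => N N0N.
have st : summ (fun k => if - N%:Z <= k < N%:Z then 0 else `|f k|).
  by apply: (le_summ _ sa) => k; case: ifP => // _; rewrite normr0.
have sh : summ (fun k => if - N%:Z <= k < N%:Z then `|f k| else 0).
  by apply: (le_summ _ sa) => k; case: ifP => // _; rewrite normr0.
have E : rsum (fun k => `|f k|) = rsum (fun k => if - N%:Z <= k < N%:Z then 0 else `|f k|) +
   rsum (fun k => if - N%:Z <= k < N%:Z then `|f k| else 0).
  by rewrite -rsumD//; apply: eq_rsum => k; case: ifP; rewrite ?add0r ?addr0.
have : \sum_(i <- fset_set X) `|f i| <= rsum (fun k => if - N%:Z <= k < N%:Z then `|f k| else 0).
  rewrite -lee_fin -rsum_EFin//; last by move=> i; case: ifP.
  apply: le_trans (sum_le_nsum (fset_uniq (fset_set X)) _); last by move=> i; case: ifP.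
  rewrite lee_fin big_seq [leRHS]big_seq; apply: ler_sum => k kX.
  case: ifPn => // /negP[]; have := HN k kX; lia.
lra.
Qed.

End IntSums.
End RealSums.

(** * The Wiener algebra *)

(* Absolutely summable sequences on Z; the product below is convolution. *)
Record wiener (R : realType) := Wiener { wv :> int -> R ; wvP : `[< summ wv >] }.

HB.instance Definition _ (R : realType) := gen_eqMixin (wiener R).
HB.instance Definition _ (R : realType) := gen_choiceMixin (wiener R).

Section WienerAlgebra.
Context {R : realType}.
Local Notation W := (wiener R).
Implicit Types x y z : W.

(** Summability is stored as a boolean, whose proofs are all equal; hence equality is pointwise. *)
Lemma wiener_ext x y : (forall k, x k = y k) -> x = y.
Proof.
case: x y => [x px] [y py] /= /funext e; case: _ / e in py *.
by congr Wiener; exact: bool_irrelevance.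
Qed.

Lemma wap x y : x = y -> forall k, x k = y k. Proof. by move=> ->. Qed.

Lemma wsumm x : summ x. Proof. exact/asboolP/wvP. Qed.

Definition mkW (f : int -> R) (sf : summ f) : W := Wiener (introT (asboolP _) sf).

Let wadd x y := mkW (summD (wsumm x) (wsumm y)).
Let wopp x := mkW (summN (wsumm x)).
Let wzero := mkW (@summ0 R int).

Definition cauchy (f g : int -> R) (k : int) : R := rsum (fun j => f j * g (k - j)).

(** The bijection from (k, j) to (j, k - j) carries this family to a product family. Summability and
    associativity of convolution both come from it. *)
Lemma cauchy_pair (f g : int -> R) : summ f -> summ g ->
  summ (fun p : int * int => f p.2 * g (p.1 - p.2)).
Proof.
move=> sf sg; pose e (p : int * int) := (p.2, p.1 - p.2).
pose e' (p : int * int) := (p.1 + p.2, p.1).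
have k1 : cancel e e' by case=> a b; rewrite /e /e'/=; congr (_, _); ring.
have k2 : cancel e' e by case=> a b; rewrite /e /e'/=; congr (_, _); ring.
have [_ H] := @rsum_reindex R _ _ e e' (fun p => f p.1 * g p.2) k1 k2.
exact/H/summ_prod.
Qed.

Lemma cauchy_summ (f g : int -> R) : summ f -> summ g -> summ (cauchy f g).
Proof. by move=> sf sg; have [] := fubini (cauchy_pair sf sg). Qed.

Lemma cauchy_slice (f g : int -> R) k : summ f -> summ g ->
  summ (fun j => f j * g (k - j)).
Proof. by move=> sf sg; have := summ_slice k (cauchy_pair sf sg). Qed.

Fact wmul_key : unit. Proof. by []. Qed.
Definition wmul : W -> W -> W :=
  locked_with wmul_key (fun x y => mkW (cauchy_summ (wsumm x) (wsumm y))).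
Let wmulE x y k : wmul x y k = rsum (fun j => x j * y (k - j)).
Proof. by rewrite /wmul unlock. Qed.
Definition delta (n k : int) : R := (k == n)%:R.
Lemma delta_summ n : summ (delta n).
Proof. by have [] := @rsum_single R _ (delta n) n (fun i => ltac:(by rewrite /delta => /negbTE ->)). Qed.
(** On transforms this is the monomial [exp (i n l)]; multiplying by it shifts indices by n. *)
Definition zpow n : W := mkW (delta_summ n).

Let waddA : associative wadd.
Proof. by move=> x y z; apply: wiener_ext => k /=; rewrite addrA. Qed.
Let waddC : commutative wadd.
Proof. by move=> x y; apply: wiener_ext => k /=; rewrite addrC. Qed.
Let wadd0 : left_id wzero wadd.
Proof. by move=> x; apply: wiener_ext => k /=; rewrite add0r. Qed.
Let waddN : left_inverse wzero wopp wadd.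
Proof. by move=> x; apply: wiener_ext => k /=; rewrite addNr. Qed.

HB.instance Definition _ := GRing.isZmodule.Build W waddA waddC wadd0 waddN.

Let reflK (k : int) : involutive (fun j : int => k - j).
Proof. by move=> j; ring. Qed.

Let wmulC : commutative wmul.
Proof.
move=> x y; apply: wiener_ext => k; rewrite !wmulE.
have [-> _] := @rsum_reindex R _ _ (fun j : int => k - j) _ (fun j => x j * y (k - j)) (reflK k) (reflK k).
by apply: eq_rsum => j /=; rewrite mulrC; congr (_ * _); congr (wv _ _); ring.
Qed.

Let wmulA : associative wmul.
Proof.
move=> x y z; apply: wiener_ext => k; rewrite !wmulE; symmetry.
pose F (p : int * int) := x p.2 * y (p.1 - p.2) * z (k - p.1).
have sF : summ F.
  apply: (le_summ_ge0 _ (summZr (rsum (fun i => `|z i|)) (summ_abs (cauchy_pair (wsumm x) (wsumm y))))).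
  by move=> p; rewrite normrM ler_wpM2l//; exact: (rsum_ge_term (k - p.1) (wsumm z)).
transitivity (rsum (fun m => rsum (fun j => F (m, j)))).
  apply: eq_rsum => m; rewrite wmulE -rsumZr//; exact: (cauchy_slice m (wsumm x) (wsumm y)).
rewrite (fubini_swap sF); apply: eq_rsum => j; rewrite wmulE.
have sh : cancel (fun i : int => i + j) (fun i => i - j) by move=> i; ring.
have sh' : cancel (fun i : int => i - j) (fun i => i + j) by move=> i; ring.
have [-> _] := @rsum_reindex R _ _ _ _ (fun m => F (m, j)) sh sh'.
rewrite -rsumZ; last exact: cauchy_slice (wsumm y) (wsumm z).
apply: eq_rsum => i; rewrite /F/= -mulrA; congr (_ * (wv _ _ * wv _ _)); ring.
Qed.

Let wmul1 : left_id (zpow 0) wmul.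
Proof.
move=> x; apply: wiener_ext => k; rewrite wmulE.
have [-> _] := @rsum_single R _ (fun j => delta 0 j * x (k - j)) 0 (fun j => ltac:(by rewrite /delta => /negbTE ->; rewrite mul0r)).
by rewrite /delta eqxx mul1r subr0.
Qed.

Let wmulDl : left_distributive wmul wadd.
Proof.
move=> x y z; apply: wiener_ext => k; rewrite /= !wmulE -rsumD;
  [|exact: cauchy_slice (wsumm _) (wsumm _)..].
by apply: eq_rsum => j; rewrite mulrDl.
Qed.

Let wone_neq0 : zpow 0 != 0.
Proof.
apply/eqP => /(congr1 (fun x : W => x 0)) /=; rewrite /delta eqxx => /eqP.
by rewrite oner_eq0.
Qed.

HB.instance Definition _ := GRing.Zmodule_isComNzRing.Build W wmulA wmulC wmul1 wmulDl wone_neq0.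

Lemma wD x y k : (x + y) k = x k + y k. Proof. by []. Qed.
Lemma wN x k : (- x) k = - x k. Proof. by []. Qed.
Lemma wB x y k : (x - y) k = x k - y k. Proof. by []. Qed.
Lemma w0 k : (0 : W) k = 0. Proof. by []. Qed.
Lemma w1 k : (1 : W) k = (k == 0)%:R. Proof. by []. Qed.
Lemma wM x y k : (x * y) k = rsum (fun j => x j * y (k - j)). Proof. exact: wmulE. Qed.
Lemma wsum (I : Type) (s : seq I) (P : pred I) (F : I -> W) k :
  (\sum_(i <- s | P i) F i) k = \sum_(i <- s | P i) F i k.
Proof. by elim/big_rec2: _ => // i a b _ <-. Qed.

Arguments zpow : simpl never.
Lemma zpowE n k : zpow n k = (k == n)%:R. Proof. by []. Qed.
Lemma zpowM n x k : (zpow n * x) k = x (k - n).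
Proof.
rewrite wM.
have h j : j != n -> zpow n j * x (k - j) = 0 by rewrite zpowE => /negbTE ->; rewrite mul0r.
rewrite (rsum_single h).1.
by rewrite zpowE eqxx mul1r.
Qed.

Lemma zpowD m n : zpow (m + n) = zpow m * zpow n.
Proof.
apply: wiener_ext => k; rewrite zpowM !zpowE; congr (_%:R); congr nat_of_bool; lia.
Qed.

Lemma zpowV n : zpow n * zpow (- n) = 1.
Proof. by rewrite -zpowD subrr. Qed.

Lemma cst_summ (c : R) : summ (fun k : int => c * delta 0 k).
Proof. exact/summZ/delta_summ. Qed.
Definition wcst (c : R) : W := mkW (cst_summ c).

Arguments wcst : simpl never.
Lemma wcstM c x k : (wcst c * x) k = c * x k.
Proof.
rewrite wM.
have [-> _] := @rsum_single R _ (fun j => wcst c j * x (k - j)) 0 (fun j => ltac:(by rewrite /wcst/= /delta => /negbTE ->; rewrite mulr0 mul0r)).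
by rewrite /wcst/= /delta eqxx mulr1 subr0.
Qed.

Lemma wcstE c k : wcst c k = c * (k == 0)%:R. Proof. by []. Qed.
Lemma wcst1 : wcst 1 = 1. Proof. by apply: wiener_ext => k; rewrite wcstE mul1r. Qed.
Lemma wcst0 : wcst 0 = 0. Proof. by apply: wiener_ext => k; rewrite wcstE mul0r. Qed.
Lemma wcst_mul a b : wcst (a * b) = wcst a * wcst b.
Proof. by apply: wiener_ext => k; rewrite wcstM !wcstE mulrA. Qed.
Lemma wcst_add a b : wcst (a + b) = wcst a + wcst b.
Proof. by apply: wiener_ext => k; rewrite wD !wcstE mulrDl. Qed.
Lemma wcst_opp a : wcst (- a) = - wcst a.
Proof. by apply: wiener_ext => k; rewrite wN !wcstE mulNr. Qed.

Lemma rev_summ (f : int -> R) : summ f -> summ (fun k => f (- k)).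
Proof.
move=> sf.
by have [_] := @rsum_reindex R _ _ (fun k : int => - k) (fun k : int => - k) f (@opprK _) (@opprK _); apply.
Qed.
(** The coefficients being real, reversal is complex conjugation of the transform on the circle, and
    [x * rev x] is its squared modulus. *)
Definition rev x : W := mkW (rev_summ (wsumm x)).
Arguments rev : simpl never.
Lemma revE x k : rev x k = x (- k). Proof. by []. Qed.
Lemma revK x : rev (rev x) = x. Proof. by apply: wiener_ext => k; rewrite !revE opprK. Qed.
Lemma revD x y : rev (x + y) = rev x + rev y. Proof. exact: wiener_ext. Qed.
Lemma revN x : rev (- x) = - rev x. Proof. exact: wiener_ext. Qed.
Lemma revB x y : rev (x - y) = rev x - rev y. Proof. exact: wiener_ext. Qed.
Lemma rev0 : rev 0 = 0. Proof. exact: wiener_ext. Qed.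
Lemma rev_cst c : rev (wcst c) = wcst c.
Proof. by apply: wiener_ext => k; rewrite revE !wcstE oppr_eq0. Qed.
Lemma rev1 : rev 1 = 1. Proof. by rewrite -wcst1 rev_cst. Qed.
Lemma rev_zpow n : rev (zpow n) = zpow (- n).
Proof. by apply: wiener_ext => k; rewrite revE !zpowE; congr (_%:R); congr nat_of_bool; lia. Qed.
Lemma revM x y : rev (x * y) = rev x * rev y.
Proof.
apply: wiener_ext => k; rewrite revE !wM.
have [-> _] := @rsum_reindex R _ _ (fun k : int => - k) (fun k : int => - k)
  (fun j => x j * y (- k - j)) (@opprK _) (@opprK _).
apply: eq_rsum => j; rewrite !revE -[LHS]/(x (- j) * y (- k - - j)); congr (_ * wv _ _); ring.
Qed.
Lemma revX x n : rev (x ^+ n) = rev x ^+ n.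
Proof. by elim: n => [|n IH]; rewrite ?expr0 ?rev1// !exprS revM IH. Qed.

Definition n1 x : R := rsum (fun k => `|x k|).
Lemma n1_ge0 x : 0 <= n1 x. Proof. exact: rsum_ge0. Qed.
Lemma n1_coef x k : `|x k| <= n1 x. Proof. exact: rsum_ge_term (wsumm x). Qed.
Lemma n1D x y : n1 (x + y) <= n1 x + n1 y.
Proof.
rewrite /n1 -rsumD; [|exact/summ_abs/wsumm..].
apply: ler_rsum; [exact/summ_abs/wsumm|apply: summD; exact/summ_abs/wsumm|].
by move=> k; exact: ler_normD.
Qed.
Lemma n1N x : n1 (- x) = n1 x.
Proof. by apply: eq_rsum => k; rewrite wN normrN. Qed.
Lemma n1_rev x : n1 (rev x) = n1 x.
Proof.
rewrite /n1; symmetry.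
by have [-> _] := @rsum_reindex R _ _ (fun k : int => - k) (fun k : int => - k)
  (fun j => `|x j|) (@opprK _) (@opprK _).
Qed.
Lemma n1_cst c : n1 (wcst c) = `|c|.
Proof.
have h j : j != 0 -> `|wcst c j| = 0 by rewrite wcstE => /negbTE ->; rewrite mulr0 normr0.
rewrite /n1 (rsum_single h).1.
by rewrite wcstE eqxx mulr1.
Qed.
Lemma n1_1 : n1 1 = 1. Proof. by rewrite -wcst1 n1_cst normr1. Qed.
Lemma n1_0 : n1 0 = 0. Proof. by rewrite -wcst0 n1_cst normr0. Qed.
Lemma n1M x y : n1 (x * y) <= n1 x * n1 y.
Proof.
have sp := cauchy_pair (summ_abs (wsumm x)) (summ_abs (wsumm y)).
have [s1 e1] := fubini sp.
apply: (@le_trans _ _ (rsum (fun k => rsum (fun j => `|x j| * `|y (k - j)|)))).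
  apply: ler_rsum => //; first exact/summ_abs/wsumm.
  move=> k; rewrite wM; apply: le_trans (ler_norm_rsum (cauchy_slice k (wsumm x) (wsumm y))) _.
  by rewrite (@eq_rsum _ _ (fun i => `|x i * y (k - i)|) (fun j => `|x j| * `|y (k - j)|))// => j; rewrite normrM.
rewrite (fubini_swap sp) (@eq_rsum _ _ _ (fun j => `|x j| * n1 y)); last first.
  move=> j /=; rewrite rsumZ; last first.
    have := cauchy_slice j (summ_abs (wsumm y)) (delta_summ 0).
    have sh : cancel (fun i : int => i - j) (fun i => i + j) by move=> i; ring.
    have sh' : cancel (fun i : int => i + j) (fun i => i - j) by move=> i; ring.
    by have [_] := @rsum_reindex R _ _ _ _ (fun i => `|y i|) sh sh' => /(_ (summ_abs (wsumm y))).
  congr (_ * _); rewrite /n1.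
  have sh : cancel (fun i : int => i - j) (fun i => i + j) by move=> i; ring.
  have sh' : cancel (fun i : int => i + j) (fun i => i - j) by move=> i; ring.
  by have [-> _] := @rsum_reindex R _ _ _ _ (fun i => `|y i|) sh sh'.
by rewrite rsumZr//; exact/summ_abs/wsumm.
Qed.
Lemma n1X x n : n1 (x ^+ n) <= n1 x ^+ n.
Proof.
elim: n => [|n IH]; first by rewrite !expr0 n1_1.
by rewrite !exprS; apply: le_trans (n1M _ _) _; rewrite ler_wpM2l// n1_ge0.
Qed.

(** The constant coefficient of x times the conjugate of y is the l2 inner product (Parseval). In
    this form multiplication by a unimodular element is visibly an isometry. *)
Definition dot x y : R := (x * rev y) 0.
Lemma dotE x y : dot x y = rsum (fun k => x k * y k).
Proof. by rewrite /dot wM; apply: eq_rsum => k; rewrite revE; congr (_ * wv _ _); ring. Qed.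
Lemma dotC x y : dot x y = dot y x.
Proof. by rewrite !dotE; apply: eq_rsum => k; rewrite mulrC. Qed.
Lemma dotDl x y z : dot (x + y) z = dot x z + dot y z. Proof. by rewrite /dot mulrDl. Qed.
Lemma dotDr x y z : dot x (y + z) = dot x y + dot x z. Proof. by rewrite !(dotC x) dotDl. Qed.
Lemma dotNl x y : dot (- x) y = - dot x y. Proof. by rewrite /dot mulNr. Qed.
Lemma dotNr x y : dot x (- y) = - dot x y. Proof. by rewrite !(dotC x) dotNl. Qed.
Lemma dotZl c x y : dot (wcst c * x) y = c * dot x y.
Proof. by rewrite /dot -mulrA wcstM. Qed.
Lemma dotZr c x y : dot x (wcst c * y) = c * dot x y.
Proof. by rewrite !(dotC x) dotZl. Qed.
Lemma dot_ge0 x : 0 <= dot x x.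
Proof. by rewrite dotE; apply: rsum_ge0 => k; rewrite -expr2 sqr_ge0. Qed.

Lemma dot_CS x y : dot x y ^+ 2 <= dot x x * dot y y.
Proof.
have P t s : 0 <= t ^+ 2 * dot x x - 2 * t * s * dot x y + s ^+ 2 * dot y y.
  have := dot_ge0 (wcst t * x - wcst s * y).
  by rewrite dotDl !dotDr !dotNl !dotNr !dotZl !dotZr (dotC y x); lra.
have [y0|y0] := eqVneq (dot y y) 0; last first.
  have yp : 0 < dot y y by rewrite lt0r y0 dot_ge0.
  have := P (dot y y) (dot x y).
  rewrite -(@pmulr_rge0 _ (dot y y))// => h.
  rewrite -(ler_pM2l yp); nra.
have := P 1 ((dot x x + 1) * dot x y); rewrite y0 mulr0 addr0 => h.
have := dot_ge0 x => x0; rewrite mulr0.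
(* If [dot x y] were nonzero, this multiplier would make the quadratic form equal to
   [dot x x - (dot x x + 1) = - 1]. *)
have := P 1 (((dot x x + 1) / 2) / dot x y).
have [->|xy] := eqVneq (dot x y) 0; first by rewrite expr0n.
set t := _ / dot x y; have tt : t * dot x y = (dot x x + 1) / 2 by rewrite divfK.
by rewrite y0 mulr0 addr0 -[2 * 1 * t * _]mulrA tt; lra.
Qed.

Definition n2 x : R := Num.sqrt (dot x x).
Lemma n2_ge0 x : 0 <= n2 x. Proof. exact: sqrtr_ge0. Qed.
Lemma n2sq x : n2 x ^+ 2 = dot x x. Proof. by rewrite sqr_sqrtr// dot_ge0. Qed.
Lemma dot_le x y : `|dot x y| <= n2 x * n2 y.
Proof.
rewrite -(@ler_pXn2r _ 2)// ?nnegrE ?normr_ge0 ?mulr_ge0 ?n2_ge0//.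
by rewrite exprMn !n2sq real_normK ?num_real ?dot_CS.
Qed.
Lemma n2D x y : n2 (x + y) <= n2 x + n2 y.
Proof.
rewrite -(@ler_pXn2r _ 2)// ?nnegrE ?addr_ge0 ?n2_ge0//.
rewrite n2sq dotDl !dotDr sqrrD !n2sq (dotC y x).
by have := ler_norm (dot x y); have := dot_le x y; lra.
Qed.
Lemma n2N x : n2 (- x) = n2 x. Proof. by rewrite /n2 dotNl dotNr opprK. Qed.
Lemma n2B x y : n2 (x - y) <= n2 x + n2 y.
Proof. by rewrite -(n2N y); exact: n2D. Qed.
Lemma n2_cst c x : n2 (wcst c * x) = `|c| * n2 x.
Proof. by rewrite /n2 dotZl dotZr mulrA -expr2 sqrtrM ?sqr_ge0// sqrtr_sqr. Qed.
Lemma n2_rev x : n2 (rev x) = n2 x.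
Proof. by rewrite /n2 /dot revK mulrC. Qed.
Lemma n2_uni x y : x * rev x = 1 -> n2 (x * y) = n2 y.
Proof.
move=> x1; rewrite /n2 /dot revM (_ : x * y * _ = (x * rev x) * (y * rev y)); last by ring.
by rewrite x1 mul1r.
Qed.
Lemma n2_zpow n x : n2 (zpow n * x) = n2 x.
Proof. by apply: n2_uni; rewrite rev_zpow zpowV. Qed.
Lemma n2_1 : n2 1 = 1.
Proof. by rewrite /n2 /dot mul1r rev1 w1 eqxx sqrtr1. Qed.
Lemma coef_le x y k : `|(x * y) k| <= n2 x * n2 y.
Proof.
have -> : (x * y) k = dot x (rev (zpow (- k) * y)).
  by rewrite /dot revK mulrCA zpowM sub0r opprK.
by apply: le_trans (dot_le _ _) _; rewrite n2_rev n2_zpow.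
Qed.
Lemma n2_coef x k : `|x k| <= n2 x.
Proof. by have := coef_le x 1 k; rewrite mulr1 n2_1 mulr1. Qed.
(** By duality: the product is tested against itself, and each coefficient of [y * rev (x * y)] is
    at most [n2 y * n2 (x * y)] by Cauchy-Schwarz. *)
Lemma young x y : n2 (x * y) <= n1 x * n2 y.
Proof.
have [->|ne0] := eqVneq (n2 (x * y)) 0; first by rewrite mulr_ge0 ?n1_ge0 ?n2_ge0.
have gt0 : 0 < n2 (x * y) by rewrite lt0r ne0 n2_ge0.
rewrite -(ler_pM2r gt0) -expr2 n2sq /dot -mulrA wM.
apply: le_trans (ler_norm _) _.
apply: le_trans (ler_norm_rsum (cauchy_slice 0 (wsumm x) (wsumm _))) _.
have -> : n1 x * n2 y * n2 (x * y) = rsum (fun k => `|x k| * (n2 y * n2 (x * y))).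
  by rewrite rsumZr ?mulrA//; exact/summ_abs/wsumm.
apply: ler_rsum; [exact/summ_abs/cauchy_slice/wsumm/wsumm|exact/summZr/summ_abs/wsumm|].
by move=> k; rewrite normrM ler_wpM2l//; apply: le_trans (coef_le _ _ _) _; rewrite n2_rev.
Qed.
Definition wproj_summ (P : pred int) (f : int -> R) (sf : summ f) :
  summ (fun k => if P k then f k else 0).
Proof. by apply: (le_summ _ sf) => k; case: ifP => // _; rewrite normr0. Qed.
Definition wproj P x : W := mkW (wproj_summ P (wsumm x)).
Arguments wproj : simpl never.
Lemma wprojE P x k : wproj P x k = if P k then x k else 0. Proof. by []. Qed.
Lemma wprojD P x y : wproj P (x + y) = wproj P x + wproj P y.
Proof. by apply: wiener_ext => k; rewrite wD !wprojE wD; case: ifP; rewrite ?addr0. Qed.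
Lemma wprojN P x : wproj P (- x) = - wproj P x.
Proof. by apply: wiener_ext => k; rewrite wN !wprojE wN; case: ifP; rewrite ?oppr0. Qed.
Lemma dot_summ x y : summ (fun k => x k * y k).
Proof.
apply: (le_summ_ge0 _ (summZr (n1 y) (summ_abs (wsumm x)))) => k.
by rewrite normrM ler_wpM2l// n1_coef.
Qed.
Lemma n2_proj P x : n2 (wproj P x) <= n2 x.
Proof.
rewrite /n2 ler_sqrt ?dot_ge0// !dotE; apply: ler_rsum; [exact: dot_summ..|] => k.
by rewrite wprojE; case: ifP => // _; rewrite mul0r -expr2 sqr_ge0.
Qed.

Lemma n1_trunc x (e : R) : 0 < e -> exists N0, forall N, (N0 <= N)%N ->
  n1 (x - wproj (fun k => - N%:Z <= k < N%:Z) x) <= e.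
Proof.
move=> e0; have [N0 h] := rsum_tail (wsumm x) e0; exists N0 => N /h; apply: le_trans.
rewrite le_eqVlt; apply/orP; left; apply/eqP; apply: eq_rsum => k.
by rewrite wB wprojE; case: ifP; rewrite ?subrr ?normr0 ?subr0.
Qed.

End WienerAlgebra.

Section NatSums.
Context {R : realType}.
Implicit Types f : nat -> R.

Lemma summ_nat f (M : R) : (forall N, \sum_(i < N) `|f i| <= M) ->
  summ f /\ rsum (fun k => `|f k|) <= M.
Proof.
move=> h.
have H (s : seq nat) : uniq s -> \sum_(i <- s) `|f i| <= M.
  move=> us; pose N := (\sum_(i <- s) i).+1.
  apply: le_trans (h N); rewrite -(big_mkord xpredT (fun i => `|f i|)).
  have ss : {subset s <= index_iota 0 N}.
    move=> i is_; rewrite mem_index_iota /= ltnS.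
    by rewrite (bigD1_seq i)//= leq_addr.
  rewrite [leRHS](bigID (mem s))/= -[leLHS]addr0 lerD//; last exact: sumr_ge0.
  rewrite -[leRHS]big_filter (perm_big [seq i <- index_iota 0 N | i \in s])//.
  rewrite uniq_perm// ?filter_uniq ?iota_uniq// => i.
  by rewrite mem_filter; case: (boolP (i \in s)) => // /ss ->.
by split; [exact: summ_ub H|exact: summ_fine].
Qed.

Lemma sum_le_rsum f N : summ f -> (forall i, 0 <= f i) -> \sum_(i < N) f i <= rsum f.
Proof.
move=> sf f0; rewrite -(big_mkord xpredT f) -lee_fin -rsum_EFin//.
exact/sum_le_nsum/f0/iota_uniq.
Qed.

Lemma rsum_le_bound f (M : R) : (forall i, 0 <= f i) -> (forall N, \sum_(i < N) f i <= M) ->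
  summ f /\ rsum f <= M.
Proof.
move=> f0 h; have e : (fun k => `|f k|) = f by apply/funext => k; rewrite ger0_norm.
have [|a b] := @summ_nat f M; last by rewrite e in b.
by move=> N; under eq_bigr do rewrite ger0_norm//.
Qed.

End NatSums.

Section SummPair.
Context {R : realType} {I J : choiceType}.

Lemma summ_pair_le (f : I * J -> R) (b : I -> R) :
  (forall i, summ (fun j => f (i, j))) ->
  (forall i, rsum (fun j => `|f (i, j)|) <= b i) -> summ b -> summ f.
Proof.
move=> sf fb sb; rewrite /summ nsum_pair//; apply: le_lt_trans sb.
apply: le_esum => i _; rewrite rsum_EFin//; last exact: summ_abs.
by rewrite lee_fin; apply: le_trans (fb i) (ler_norm _).
Qed.

Lemma summ_swap (f : I * J -> R) : summ f -> summ (fun p : J * I => f (p.2, p.1)).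
Proof.
pose e (p : J * I) := (p.2, p.1); pose e' (p : I * J) := (p.2, p.1).
have k1 : cancel e e' by case.
have k2 : cancel e' e by case.
by have [_] := @rsum_reindex R _ _ e e' f k1 k2.
Qed.
End SummPair.

Section Limits.
Context {R : realType}.
Local Notation W := (wiener R).
Implicit Types (x y : W) (X Y : nat -> W).

Definition wlim X x := forall e : R, 0 < e ->
  exists N0, forall N, (N0 <= N)%N -> n1 (X N - x) <= e.

Lemma wlim_fun X x (phi : W -> R) (C : R) :
  (forall a b, `|phi a - phi b| <= C * n1 (a - b)) -> wlim X x -> phi \o X @ \oo --> phi x.
Proof.
move=> hphi h; apply/cvgrPdist_le => e e0.
have C0 : 0 < `|C| + 1 by rewrite ltr_wpDl.
have [N0 H] := h (e / (`|C| + 1)) (divr_gt0 e0 C0).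
exists N0 => // N /= /H; rewrite ler_pdivlMr// => hN.
rewrite distrC; apply: le_trans (hphi _ _) _; apply: le_trans hN.
rewrite mulrC ler_wpM2l ?n1_ge0//; have := ler_norm C; lra.
Qed.

Lemma wlim_coef X x k : wlim X x -> (fun N => X N k) @ \oo --> x k.
Proof.
apply: (wlim_fun (phi := fun x => x k) (C := 1)) => a b.
by rewrite mul1r -wB n1_coef.
Qed.

Lemma wlim_unique X x y : wlim X x -> wlim X y -> x = y.
Proof.
move=> hx hy; apply: wiener_ext => k.
have := cvg_unique _ (wlim_coef (k := k) hx) (wlim_coef (k := k) hy).
by apply; exact: Rhausdorff.
Qed.

Lemma wlimM X Y x y : wlim X x -> wlim Y y -> wlim (fun N => X N * Y N) (x * y).
Proof.
move=> hx hy e e0; pose M := n1 x + n1 y + 1.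
have M0 : 0 < M by rewrite ltr_wpDl// addr_ge0// n1_ge0.
have e1 : 0 < Num.min 1 (e / (2 * M)).
  by rewrite lt_min ltr01/= divr_gt0// mulr_gt0.
have [N1 H1] := hx _ e1; have [N2 H2] := hy _ e1.
exists (maxn N1 N2) => N; rewrite geq_max => /andP[/H1 h1 /H2 h2].
have -> : X N * Y N - x * y = (X N - x) * Y N + x * (Y N - y) by ring.
apply: le_trans (n1D _ _) _.
have := n1M (X N - x) (Y N); have := n1M x (Y N - y).
have := n1D (Y N - y) y; rewrite subrK.
move: h1 h2; rewrite !le_min => /andP[_ h1] /andP[h21 h22].
have := n1_ge0 x; have := n1_ge0 y; have := n1_ge0 (X N - x); have := n1_ge0 (Y N - y).
have h : e / (2 * M) * M = e / 2 by field; rewrite gt_eqF.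
rewrite /M in h h1 h22 M0 *; nra.
Qed.

Lemma wlim_rev X x : wlim X x -> wlim (fun N => rev (X N)) (rev x).
Proof. by move=> h e /h[N0 H]; exists N0 => N /H; rewrite -revB n1_rev. Qed.

Lemma wlim_shift X x : wlim X x -> wlim (fun N => X N.+1) x.
Proof. by move=> h e /h[N0 H]; exists N0 => N NN; apply: H; exact: leqW. Qed.

Lemma wlim_near X Y x (c : nat -> R) : wlim X x -> (forall N, n1 (Y N - X N) <= c N) ->
  c @ \oo --> 0 -> wlim Y x.
Proof.
move=> hx hc /cvgrPdist_le c0 e e0; have e1 : 0 < e / 2 by lra.
have [N1 H1] := hx _ e1; have [N2 _ H2] := c0 _ e1.
exists (maxn N1 N2) => N; rewrite geq_max => /andP[/H1 h1 /H2 h2].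
have -> : Y N - x = (Y N - X N) + (X N - x) by ring.
apply: le_trans (n1D _ _) _; have := hc N; have := ler_norm (0 - c N).
move: h2; rewrite sub0r normrN => h2 _; have := ler_norm (c N); lra.
Qed.

End Limits.

(** * Exponentials in the Wiener algebra *)

Section Exponential.
Context {R : realType}.
Local Notation W := (wiener R).
Implicit Types (x y : W).

Definition ifact (m : nat) : R := m`!%:R^-1.
Lemma ifact_ge0 m : 0 <= ifact m. Proof. by rewrite invr_ge0. Qed.

Definition expN N x : W := \sum_(m < N) wcst (ifact m) * x ^+ m.
Definition expNR N (a : R) : R := \sum_(m < N) ifact m * a ^+ m.

Lemma expNR_cvg a : expNR ^~ a @ \oo --> expR a.
Proof.
rewrite /expR; have := @is_cvg_series_exp_coeff R a.
rewrite /series/= (_ : (fun n => _) = expNR ^~ a)//.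
apply/funext => N; rewrite /expNR big_mkord; apply: eq_bigr => i _.
by rewrite /exp_coeff/= mulrC.
Qed.

Lemma expNR_le (a : R) N : 0 <= a -> expNR N a <= expR a.
Proof.
move=> a0; have c := @expNR_cvg a.
rewrite -(cvg_lim (@Rhausdorff R) c); apply: nondecreasing_cvgn_le; last by apply/cvg_ex; exists (expR a).
apply/nondecreasing_seqP => n; rewrite /expNR big_ord_recr/= lerDl.
by rewrite mulr_ge0 ?ifact_ge0 ?exprn_ge0.
Qed.

Lemma expR_summ (a : R) : 0 <= a -> summ (fun m => ifact m * a ^+ m).
Proof.
move=> a0.
have h i : 0 <= ifact i * a ^+ i by rewrite mulr_ge0 ?ifact_ge0 ?exprn_ge0.
by have [] := @rsum_le_bound R (fun m => ifact m * a ^+ m) (expR a) h (fun N => expNR_le N a0).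
Qed.

Lemma exp_summ_pair x : summ (fun p : nat * int => ifact p.1 * (x ^+ p.1) p.2).
Proof.
have s1 := expR_summ (n1_ge0 x).
apply: (summ_pair_le _ _ s1) => m /=; first exact/summZ/wsumm.
rewrite (@eq_rsum _ _ _ (fun j => ifact m * `|(x ^+ m) j|)); last first.
  by move=> j; rewrite normrM ger0_norm ?ifact_ge0.
rewrite rsumZ; last exact/summ_abs/wsumm.
by rewrite ler_wpM2l ?ifact_ge0//; exact: n1X.
Qed.

Lemma exp_summ x : summ (fun k => rsum (fun m => ifact m * (x ^+ m) k)).
Proof.
by have [] := fubini (summ_swap (exp_summ_pair x)).
Qed.

Definition Exp x : W := mkW (exp_summ x).
Arguments Exp : simpl never.

Lemma expN_coef N x k : expN N x k = \sum_(m < N) ifact m * (x ^+ m) k.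
Proof. by rewrite wsum; apply: eq_bigr => m _; rewrite wcstM. Qed.

(** The n1 distance to the truncation is at most the tail of the scalar exponential series at
    [n1 x]; Fubini exchanges the sums over powers and over coefficients. *)
Lemma Exp_lim x : wlim (fun N => expN N x) (Exp x).
Proof.
have H N : n1 (Exp x - expN N x) <= expR (n1 x) - expNR N (n1 x).
  pose F (p : nat * int) := if (p.1 < N)%N then 0 else ifact p.1 * (x ^+ p.1) p.2.
  have sF : summ F.
    by apply: (le_summ _ (exp_summ_pair x)) => p; rewrite /F; case: ifP => // _; rewrite normr0.
  have sFe := summ_swap sF.
  have sl k : summ (fun m => ifact m * (x ^+ m) k).
    exact: (summ_slice k (summ_swap (exp_summ_pair x))).
  have cE k : (Exp x - expN N x) k = rsum (fun m => F (m, k)).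
    rewrite wB expN_coef -[Exp x k]/(rsum (fun m => ifact m * (x ^+ m) k)).
    have [e1 s1] := @rsum_finite R _ (fun m => if (m < N)%N then ifact m * (x ^+ m) k else 0) (iota 0 N) (iota_uniq _ _)
       (fun m => ltac:(by rewrite mem_iota /= add0n => /negbTE ->)).
    have -> : \sum_(m < N) ifact m * (x ^+ m) k = rsum (fun m => if (m < N)%N then ifact m * (x ^+ m) k else 0).
      rewrite e1 -(big_mkord xpredT (fun m => ifact m * (x ^+ m) k)) /index_iota subn0.
      by rewrite big_seq [RHS]big_seq; apply: eq_bigr => m; rewrite mem_iota /= add0n => ->.
    rewrite -rsumB//; apply: eq_rsum => m; rewrite /F/=; case: ifP => _; by rewrite ?subrr ?subr0.
  apply: (@le_trans _ _ (rsum (fun k => rsum (fun m => `|F (m, k)|)))).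
    have [s2 _] := fubini (summ_abs sFe).
    apply: ler_rsum => //; first exact/summ_abs/wsumm.
    by move=> k; rewrite cE; apply: ler_norm_rsum; exact: (summ_slice k sFe).
  rewrite -(fubini_swap (summ_abs sF)).
  have [s3 _] := fubini (summ_abs sF).
  apply: (@le_trans _ _ (rsum (fun m => if (m < N)%N then 0 else ifact m * n1 x ^+ m))).
    have [s4 _] : summ (fun m => if (m < N)%N then 0 else ifact m * n1 x ^+ m) /\ True.
      split => //; apply: (@le_summ _ _ _ (fun m => ifact m * n1 x ^+ m)) => [m|].
        by case: ifP => // _; rewrite normr0.
      exact/expR_summ/n1_ge0.
    apply: ler_rsum => // m; rewrite /F/=; case: ifP => _.
      by rewrite (@eq_rsum _ _ _ (fun=> 0)) ?rsum0// => j; rewrite normr0.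
    rewrite (@eq_rsum _ _ _ (fun j => ifact m * `|(x ^+ m) j|)); last first.
      by move=> j; rewrite normrM ger0_norm ?ifact_ge0.
    rewrite rsumZ; last exact/summ_abs/wsumm.
    by rewrite ler_wpM2l ?ifact_ge0//; exact: n1X.
  have [||_ ] := @rsum_le_bound R (fun m => if (m < N)%N then 0 else ifact m * n1 x ^+ m) (expR (n1 x) - expNR N (n1 x)); last by [].
    by move=> i; case: ifP => // _; rewrite mulr_ge0 ?ifact_ge0 ?exprn_ge0 ?n1_ge0.
  move=> M; have /= := expNR_le (maxn M N) (n1_ge0 x).
  suff : \sum_(i < M) (if (i < N)%N then 0 else ifact i * n1 x ^+ i) + expNR N (n1 x) <= expNR (maxn M N) (n1 x) by lra.
  rewrite /expNR -!(big_mkord xpredT (fun m => ifact m * n1 x ^+ m)) -(big_mkord xpredT (fun i => if (i < N)%N then 0 : R else ifact i * n1 x ^+ i)).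
  have p0 i : 0 <= ifact i * n1 x ^+ i by rewrite mulr_ge0 ?ifact_ge0 ?exprn_ge0 ?n1_ge0.
  rewrite (@big_cat_nat _ _ _ N 0 (maxn M N))//= ?leq_maxr// [leLHS]addrC lerD2l.
  case: (leqP M N) => MN.
    rewrite big_nat big1 ?sumr_ge0// => i /andP[_ iM]; by rewrite (leq_trans iM MN).
  have MN' := ltnW MN.
  rewrite (@big_cat_nat _ _ _ N 0 M)//= [X in X + _]big1_seq ?add0r; last by move=> i /andP[_]; rewrite mem_index_iota => /andP[_ ->].
  by rewrite big_nat [leRHS]big_nat; apply: ler_sum => i /andP[Ni _]; rewrite ltnNge Ni.
move=> ee e0; have /cvgrPdist_le/(_ ee e0)[N0 _ h] := @expNR_cvg (n1 x).
exists N0 => N /h /= hN; rewrite -n1N opprB; apply: le_trans (H N) _.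
exact: le_trans (ler_norm _) hN.
Qed.

Lemma rev_expN N x : rev (expN N x) = expN N (rev x).
Proof.
rewrite /expN; elim: N => [|N IH]; first by rewrite !big_ord0 rev0.
by rewrite !big_ord_recr/= revD IH revM rev_cst revX.
Qed.

Lemma Exp_rev x : rev (Exp x) = Exp (rev x).
Proof.
apply: wlim_unique (wlim_rev (Exp_lim x)) _.
have e : (fun N => rev (expN N x)) = (fun N => expN N (rev x)) by apply/funext => N; exact: rev_expN.
by rewrite e; exact: Exp_lim.
Qed.

Lemma triangle (A : nmodType) (F : nat -> nat -> A) N :
  \sum_(m < N) \sum_(i < m.+1) F i (m - i)%N = \sum_(i < N) \sum_(j < N - i) F i j.
Proof.
elim: N => [|N IH]; first by rewrite !big_ord0.
rewrite big_ord_recr/= IH [RHS]big_ord_recr/= subSnn big_ord1.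
rewrite [X in _ + X]big_ord_recr/= subnn addrA; congr (_ + _).
rewrite -big_split/=; apply: eq_bigr => i _.
by rewrite subSn ?(ltnW (ltn_ord i))// big_ord_recr.
Qed.

(** Stated for any commutative ring because [ExpD] needs it twice, in the Wiener algebra and for
    real numbers. *)
Lemma exp_binom (A : comNzRingType) (c : nat -> A) (a b : A) N :
  (forall i j, c i * c j = c (i + j)%N *+ 'C(i + j, i)) ->
  \sum_(m < N) c m * (a + b) ^+ m =
  \sum_(i < N) \sum_(j < N - i) (c i * a ^+ i) * (c j * b ^+ j).
Proof.
move=> hc; rewrite -(triangle (fun i j => (c i * a ^+ i) * (c j * b ^+ j))); apply: eq_bigr => m _.
rewrite addrC exprDn mulr_sumr; apply: eq_bigr => i _.
have im : (i <= m)%N by rewrite -ltnS.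
rewrite mulrACA hc subnKC// mulrnAl mulrnAr; congr (_ *+ _).
by rewrite [b ^+ _ * _]mulrC.
Qed.

Lemma ifact_mul i j : ifact i * ifact j = ifact (i + j) *+ 'C(i + j, i).
Proof.
rewrite /ifact -mulr_natr.
have e : ((i + j)`!%:R = 'C(i + j, i)%:R * (i`!%:R * j`!%:R) :> R).
  by rewrite -!natrM -(bin_fact (leq_addr j i)) addKn.
have h n : n`!%:R != 0 :> R by rewrite pnatr_eq0 -lt0n fact_gt0.
have h' : 'C(i + j, i)%:R != 0 :> R by rewrite pnatr_eq0 -lt0n bin_gt0 leq_addr.
by rewrite e; field; rewrite !h h'.
Qed.

Lemma wcst_natmul (c : R) n : wcst c *+ n = wcst (c *+ n).
Proof.
by elim: n => [|n IH]; rewrite ?mulr0n ?wcst0// !mulrS IH wcst_add.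
Qed.

Lemma expN_diff (A : comNzRingType) (F G : nat -> A) N :
  (\sum_(i < N) F i) * (\sum_(j < N) G j) - \sum_(i < N) \sum_(j < N - i) F i * G j =
  \sum_(i < N) \sum_(N - i <= j < N) F i * G j.
Proof.
rewrite mulr_suml -sumrB; apply: eq_bigr => i _.
rewrite mulr_sumr -(big_mkord xpredT (fun j => F i * G j)) -(big_mkord xpredT (fun j => F i * G j)).
by rewrite [X in X - _](@big_cat_nat _ _ _ (N - i) 0 N)//= ?leq_subr// addrAC subrr add0r.
Qed.

Lemma n1_sum (I : Type) (s : seq I) (P : pred I) (F : I -> W) :
  n1 (\sum_(i <- s | P i) F i) <= \sum_(i <- s | P i) n1 (F i).
Proof.
elim/big_rec2: _ => [|i a b _ h]; first by rewrite n1_0.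
by apply: le_trans (n1D _ _) _; rewrite lerD2l.
Qed.

Lemma n1_term i x : n1 (wcst (ifact i) * x ^+ i) <= ifact i * n1 x ^+ i.
Proof.
apply: le_trans (n1M _ _) _; rewrite n1_cst ger0_norm ?ifact_ge0//.
by rewrite ler_wpM2l ?ifact_ge0 ?n1X.
Qed.

(** The product of the truncations exceeds the truncation at [x + y] by the corner
    [i, j < N <= i + j]. Its norm is at most the same corner of the scalar series at [n1 x] and
    [n1 y], which vanishes in the limit by [expRD]. *)
Lemma ExpD x y : Exp (x + y) = Exp x * Exp y.
Proof.
apply: wlim_unique (Exp_lim (x + y)) _.
pose a := n1 x; pose b := n1 y.
have a0 : 0 <= a := n1_ge0 x; have b0 : 0 <= b := n1_ge0 y.
apply: (wlim_near (X := fun N => expN N x * expN N y)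
  (c := fun N => expNR N a * expNR N b - expNR N (a + b))).
- exact: wlimM (Exp_lim x) (Exp_lim y).
- move=> N; rewrite -n1N opprB /expNR /expN.
  rewrite (@exp_binom R ifact a b N ifact_mul).
  rewrite (@exp_binom W (fun i => wcst (ifact i)) x y N); last first.
    by move=> i j; rewrite -wcst_mul ifact_mul wcst_natmul.
  rewrite (@expN_diff W (fun i => wcst (ifact i) * x ^+ i) (fun i => wcst (ifact i) * y ^+ i)).
  rewrite (@expN_diff R (fun i => ifact i * a ^+ i) (fun i => ifact i * b ^+ i)).
  apply: le_trans (n1_sum _ _ _) _; apply: ler_sum => i _.
  apply: le_trans (n1_sum _ _ _) _; apply: ler_sum => j _.
  apply: le_trans (n1M _ _) _; apply: ler_pM; rewrite ?n1_ge0//; exact: n1_term.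
- rewrite -(subrr (expR (a + b))) [X in _ --> X - _]expRD.
  by apply: cvgB; [apply: cvgM|]; exact: expNR_cvg.
Qed.

Lemma expN0 N : expN N.+1 0 = 1.
Proof.
rewrite /expN big_ord_recl/= expr0 mulr1 /ifact fact0 invr1 wcst1 big1 ?addr0// => i _.
by rewrite expr0n/= mulr0.
Qed.

Lemma Exp0 : Exp 0 = 1.
Proof.
apply: wlim_unique (wlim_shift (Exp_lim 0)) _ => e e0; exists 0%N => N _.
by rewrite expN0 subrr n1_0 ltW.
Qed.

Lemma ExpN x : Exp x * Exp (- x) = 1.
Proof. by rewrite -ExpD subrr Exp0. Qed.

Lemma coef_lim_eq X x (c : R) k : wlim X x -> (forall N, X N.+1 k = c) -> x k = c.
Proof.
move=> h e; have := wlim_coef (k := k) (wlim_shift h).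
rewrite (_ : (fun N => X N.+1 k) = fun=> c); last exact/funext.
by move=> H; apply: (cvg_unique (@Rhausdorff R) H); exact: cvg_cst.
Qed.

(** For n >= 0: the transform extends analytically to the disk, with a zero of order at least n at
    the origin. *)
Definition supp_ge (n : int) x := forall k, k < n -> x k = 0.

Lemma supp_geM m n x y : supp_ge m x -> supp_ge n y -> supp_ge (m + n) (x * y).
Proof.
move=> hx hy k kmn; rewrite wM (@eq_rsum _ _ _ (fun=> 0)) ?rsum0// => j.
have [jm|jm] := ltP j m; first by rewrite hx ?mul0r.
by rewrite hy ?mulr0//; lia.
Qed.

Lemma supp_ge_coef x y : supp_ge 0 x -> supp_ge 0 y -> (x * y) 0 = x 0 * y 0.
Proof.
move=> hx hy; rewrite wM.
have h j : j != 0 -> x j * y (0 - j) = 0.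
  move=> j0; have [jm|jm] := ltP j 0; first by rewrite hx ?mul0r.
  by rewrite hy ?mulr0//; lia.
by rewrite (rsum_single h).1 subr0.
Qed.

Lemma supp_geX x n : supp_ge 1 x -> supp_ge n%:Z (x ^+ n).
Proof.
move=> hx; elim: n => [|n IH]; first by move=> k k0; rewrite expr0 w1 lt_eqF.
by rewrite exprS -[n.+1]addn1 PoszD addrC; exact: supp_geM.
Qed.

Lemma Exp_supp x : supp_ge 1 x -> supp_ge 0 (Exp x) /\ Exp x 0 = 1.
Proof.
move=> hx; split.
  move=> k k0; apply: (coef_lim_eq (Exp_lim x)) => N.
  rewrite expN_coef big1// => m _; rewrite (supp_geX (n := m) hx) ?mulr0//; lia.
apply: (coef_lim_eq (Exp_lim x)) => N.
rewrite expN_coef -(big_mkord xpredT (fun m => ifact m * (x ^+ m) 0)) big_nat_recl//.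
rewrite expr0 w1 /ifact fact0 invr1 mulr1 big1 ?addr0// => m _.
by rewrite (supp_geX (n := m.+1) hx) ?mulr0.
Qed.

(* On transforms, wderiv is the derivation z d/dz. *)
Definition wderiv x y := forall k : int, y k = k%:~R * x k.

Lemma wderivM a b a' b' : wderiv a a' -> wderiv b b' -> wderiv (a * b) (a' * b + a * b').
Proof.
move=> ha hb k; rewrite wD !wM -rsumD; [|exact: cauchy_slice (wsumm _) (wsumm _)..].
rewrite -rsumZ; last exact: cauchy_slice (wsumm _) (wsumm _).
apply: eq_rsum => j; rewrite ha hb.
have -> : (k - j)%:~R = k%:~R - j%:~R :> R by rewrite intrB.
ring.
Qed.

Lemma wderiv_cst (c : R) : wderiv (wcst c) 0.
Proof. by move=> k; rewrite wcstE w0; case: eqP => [->|_]; rewrite ?mul0r ?mulr0. Qed.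

Lemma wderivD a b a' b' : wderiv a a' -> wderiv b b' -> wderiv (a + b) (a' + b').
Proof. by move=> ha hb k; rewrite !wD ha hb mulrDr. Qed.

Lemma wderivX x x' n : wderiv x x' -> wderiv (x ^+ n.+1) (x' * x ^+ n *+ n.+1).
Proof.
move=> hx; elim: n => [|n IH]; first by rewrite expr0 mulr1 expr1 mulr1n.
have := wderivM hx IH; rewrite -exprS => h.
rewrite (_ : _ *+ n.+2 = x' * x ^+ n.+1 + x * (x' * x ^+ n *+ n.+1))//.
by rewrite mulrS; congr (_ + _); rewrite mulrnAr exprS; congr (_ *+ _); rewrite mulrCA.
Qed.

Lemma wderiv_expN x x' N : wderiv x x' -> wderiv (expN N.+1 x) (x' * expN N x).
Proof.
move=> hx; elim: N => [|N IH].
  rewrite /expN big_ord_recl !big_ord0 addr0 mulr0 expr0 mulr1; exact: wderiv_cst.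
rewrite /expN big_ord_recr/= -/(expN N.+1 x) [X in x' * X]big_ord_recr/= mulrDr; apply: wderivD => //.
have := wderivM (wderiv_cst (ifact N.+1)) (wderivX N hx).
rewrite mul0r add0r (_ : wcst (ifact N.+1) * (x' * x ^+ N *+ N.+1) = x' * (wcst (ifact N) * x ^+ N)); first by [].
rewrite mulrnAr -mulrnAl wcst_natmul mulrCA; congr (_ * (wcst _ * _)).
rewrite -[LHS]mulr_natr /ifact factS natrM invfM mulrAC mulVf ?mul1r// pnatr_eq0.
Qed.

Lemma Exp_deriv x x' : wderiv x x' -> wderiv (Exp x) (x' * Exp x).
Proof.
move=> hx k.
have c1 : wlim (fun N => x') x' by move=> e e0; exists 0%N => N _; rewrite subrr n1_0 ltW.
have h1 := wlim_coef (k := k) (wlimM c1 (Exp_lim x)).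
have h2 := wlim_coef (k := k) (wlim_shift (Exp_lim x)).
apply: (cvg_unique (@Rhausdorff R) h1).
rewrite (_ : (fun N => (x' * expN N x) k) = fun N => k%:~R * expN N.+1 x k); last first.
  by apply/funext => N; exact: wderiv_expN.
by apply: cvgM h2; exact: cvg_cst.
Qed.

End Exponential.

(** * Quadratic decay of coefficients *)

Section Decay.
Context {R : realType}.
Local Notation W := (wiener R).
Implicit Types (x y : W).

Definition omega (k : int) : R := (1 + `|k|%N%:R) ^- 2.

Lemma omega_gt0 k : 0 < omega k.
Proof. by rewrite invr_gt0 exprn_gt0// ltr_wpDr. Qed.

Lemma sum_inv_sq N : \sum_(i < N) (1 + i%:R : R) ^- 2 <= 2.
Proof.
suff : \sum_(i < N.+1) (1 + i%:R : R) ^- 2 <= 2 - N.+1%:R^-1.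
  rewrite big_ord_recr/= => h; apply: le_trans (_ : _ <= 2 - N.+1%:R^-1) _; last first.
    by rewrite gerBl.
  by apply: le_trans h; rewrite lerDl invr_ge0 exprn_ge0// addr_ge0.
elim: N => [|N IH]; first by rewrite big_ord1 addr0 expr1n invr1; lra.
rewrite big_ord_recr/=; apply: le_trans (lerD IH (lexx _)) _.
have -> : N.+2%:R = N.+1%:R + 1 :> R by rewrite -natr1.
set t : R := N.+1%:R; have t0 : 0 < t by rewrite ltr0n.
have E : t^-1 - (t + 1)^-1 - (1 + t) ^- 2 = t^-1 * (1 + t) ^- 2 by field; lra.
have P : 0 <= t^-1 * (1 + t) ^- 2.
  by rewrite mulr_ge0 ?invr_ge0 ?exprn_ge0 ?addr_ge0// ltW.
rewrite -E in P; rewrite -subr_ge0; apply: le_trans P _.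
by rewrite le_eqVlt; apply/orP; left; apply/eqP; ring.
Qed.

Lemma omega_summ : summ omega /\ rsum omega <= 4.
Proof.
have [N|a b] := @summ_itrunc R omega 4; last first.
  by rewrite (_ : (fun k => `|omega k|) = omega) in b;
    [|apply/funext => k; rewrite gtr0_norm ?omega_gt0].
rewrite /itrunc (_ : 4 = 2 + 2 :> R); last by lra.
rewrite big_split/=; apply: lerD.
  apply: le_trans (sum_inv_sq N); apply: ler_sum => i _.
  by rewrite gtr0_norm ?omega_gt0//= /omega.
apply: le_trans (sum_inv_sq N); apply: ler_sum => i _.
rewrite gtr0_norm ?omega_gt0//= /omega lef_pV2 ?posrE ?exprn_gt0 ?ltr_wpDr//.
by rewrite ler_pXn2r ?nnegrE ?addr_ge0// lerD2l ler_nat.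
Qed.

(** One of [|j|], [|k - j|] is at least [|k| / 2], and at that index omega is at most
    [4 * omega k]. *)
Lemma omega_split (j k : int) : omega j * omega (k - j) <= 4 * omega k * (omega j + omega (k - j)).
Proof.
have aux (a b : int) : (`|k| <= 2 * `|a|)%N -> omega a * omega b <= 4 * omega k * omega b.
  move=> h; rewrite ler_pM2r ?omega_gt0// /omega.
  rewrite ler_pdivlMr ?exprn_gt0 ?ltr_wpDr// mulrC ler_pdivrMr ?exprn_gt0 ?ltr_wpDr//.
  have h' : `|k|%N%:R <= 2 * `|a|%N%:R :> R by rewrite -natrM ler_nat.
  have k0 : 0 <= `|k|%N%:R :> R by rewrite ler0n.
  by nra.
have p1 := omega_gt0 j; have p2 := omega_gt0 (k - j); have p3 := omega_gt0 k.
have [h|h] := leqP `|k| (2 * `|j|)%N.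
  by apply: le_trans (aux j (k - j) h) _; nra.
have : (`|k| <= 2 * `|k - j|)%N by lia.
by move=> H; have := aux (k - j) j H; nra.
Qed.

(** Hence sequences of order k^-2 form an algebra. The constant 32 is 4 times two sums of omega,
    each at most 4. *)
Lemma omega_conv (k : int) : rsum (fun j => omega j * omega (k - j)) <= 32 * omega k /\
  summ (fun j => omega j * omega (k - j)).
Proof.
have [so o4] := omega_summ.
have sh : cancel (fun j : int => k - j) (fun j => k - j) by move=> j; ring.
have [e s1] := @rsum_reindex R _ _ _ _ omega sh sh.
have {}s1 := s1 so.
have s2 : summ (fun j => omega j * omega (k - j)) by exact: cauchy_slice.
split => //; apply: (@le_trans _ _ (rsum (fun j => 4 * omega k * (omega j + omega (k - j))))).
  apply: ler_rsum => //; first by apply/summZ/summD.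
  by move=> j; exact: omega_split.
rewrite rsumZ; last exact: summD.
rewrite rsumD// -[rsum (fun i => omega (k - i))]e.
have := omega_gt0 k; nra.
Qed.

Definition decays (M : R) x := forall k, `|x k| <= M * omega k.

Lemma decaysM M N x y : 0 <= M -> 0 <= N -> decays M x -> decays N y -> decays (32 * M * N) (x * y).
Proof.
move=> M0 N0 hx hy k; rewrite wM.
apply: le_trans (ler_norm_rsum (cauchy_slice k (wsumm x) (wsumm y))) _.
have [c1 c2] := omega_conv k.
apply: (@le_trans _ _ (rsum (fun j => M * N * (omega j * omega (k - j))))).
  apply: ler_rsum; [exact/summ_abs/cauchy_slice/wsumm/wsumm|exact: summZ|] => j.
  rewrite normrM (_ : M * N * _ = (M * omega j) * (N * omega (k - j))); last by ring.
  exact: ler_pM.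
have p : 0 <= M * N by rewrite mulr_ge0.
rewrite rsumZ//; apply: le_trans (ler_wpM2l p c1) _.
by rewrite le_eqVlt; apply/orP; left; apply/eqP; ring.
Qed.

Lemma decays1 : decays 1 (1 : W).
Proof.
move=> k; rewrite w1 mul1r; case: eqP => [->|_].
  by rewrite normr1 /omega absz0 addr0 expr1n invr1.
by rewrite normr0 ltW ?omega_gt0.
Qed.

Lemma decaysX M x m : 0 <= M -> decays M x -> decays ((32 * M) ^+ m) (x ^+ m).
Proof.
move=> M0 hx; elim: m => [|m IH]; first by rewrite !expr0; exact: decays1.
by rewrite !exprS; apply: decaysM => //; rewrite exprn_ge0//; lra.
Qed.

(** The m-th power decays with constant [(32 * M) ^+ m], and these constants sum to an exponential.
    This transfers quadratic decay from the logarithm of a weight to its phase. *)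
Lemma Exp_decays M x : 0 <= M -> decays M x -> decays (expR (32 * M)) (Exp x).
Proof.
move=> M0 hx k.
have M32 : 0 <= 32 * M by lra.
have h := wlim_coef (k := k) (Exp_lim x).
have {}h : (fun N => `|expN N x k|) @ \oo --> `|Exp x k| by exact: cvg_norm.
rewrite -(cvg_lim (@Rhausdorff R) h); apply: limr_le; first by apply/cvg_ex; exists `|Exp x k|.
near=> N; rewrite expN_coef; apply: le_trans (ler_norm_sum _ _ _) _.
apply: (@le_trans _ _ (expNR N (32 * M) * omega k)); last first.
  by rewrite ler_pM2r ?omega_gt0// expNR_le.
rewrite /expNR mulr_suml; apply: ler_sum => m _.
rewrite normrM ger0_norm ?ifact_ge0// -mulrA ler_wpM2l ?ifact_ge0//; exact: decaysX.
Unshelve. all: by end_near.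
Qed.

End Decay.

(** * Transforms on the circle *)

Section Transform.
Context {R : realType}.
Local Notation W := (wiener R).
Implicit Types (x y : W) (l : R).

(** [wcos] and [wsin] are the real and imaginary parts of the transform at [exp (i l)]. *)
Definition wcos x l : R := rsum (fun k => x k * cos (k%:~R * l)).
Definition wsin x l : R := rsum (fun k => x k * sin (k%:~R * l)).

Lemma wcos_summ x l : summ (fun k => x k * cos (k%:~R * l)).
Proof.
apply: (le_summ_ge0 _ (summ_abs (wsumm x))) => k.
by rewrite normrM ler_piMr ?cos_max.
Qed.
Lemma wsin_summ x l : summ (fun k => x k * sin (k%:~R * l)).
Proof.
apply: (le_summ_ge0 _ (summ_abs (wsumm x))) => k.
by rewrite normrM ler_piMr ?sin_max.
Qed.

Lemma wcos_le x l : `|wcos x l| <= n1 x.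
Proof.
apply: le_trans (ler_norm_rsum (wcos_summ x l)) _.
apply: ler_rsum; [exact/summ_abs/wcos_summ|exact/summ_abs/wsumm|] => k.
by rewrite normrM ler_piMr ?cos_max.
Qed.

Lemma wcosD x y l : wcos (x + y) l = wcos x l + wcos y l.
Proof. by rewrite /wcos -rsumD; [|exact: wcos_summ..]; apply: eq_rsum => k; rewrite wD mulrDl. Qed.
Lemma wsinD x y l : wsin (x + y) l = wsin x l + wsin y l.
Proof. by rewrite /wsin -rsumD; [|exact: wsin_summ..]; apply: eq_rsum => k; rewrite wD mulrDl. Qed.
Lemma wcosN x l : wcos (- x) l = - wcos x l.
Proof. by rewrite /wcos -rsumN; apply: eq_rsum => k; rewrite wN mulNr. Qed.
Lemma wsinN x l : wsin (- x) l = - wsin x l.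
Proof. by rewrite /wsin -rsumN; apply: eq_rsum => k; rewrite wN mulNr. Qed.
Lemma wcosB x y l : wcos (x - y) l = wcos x l - wcos y l.
Proof. by rewrite wcosD wcosN. Qed.

Lemma wcos_rev x l : wcos (rev x) l = wcos x l.
Proof.
rewrite /wcos.
have [-> _] := @rsum_reindex R _ _ (fun k : int => - k) (fun k : int => - k)
  (fun j => x j * cos (j%:~R * l)) (@opprK _) (@opprK _).
apply: eq_rsum => k; rewrite revE -[RHS]/(x (- k) * cos ((- k)%:~R * l)).
by rewrite intrN mulNr cosN.
Qed.
Lemma wsin_rev x l : wsin (rev x) l = - wsin x l.
Proof.
rewrite /wsin.
have [-> _] := @rsum_reindex R _ _ (fun k : int => - k) (fun k : int => - k)
  (fun j => x j * sin (j%:~R * l)) (@opprK _) (@opprK _).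
rewrite -rsumN; apply: eq_rsum => k; rewrite revE -[RHS]/(- (x (- k) * sin ((- k)%:~R * l))).
by rewrite intrN mulNr sinN mulrN opprK.
Qed.

Lemma wcos_cst (c : R) l : wcos (wcst c) l = c.
Proof.
have h j : j != 0 -> wcst c j * cos (j%:~R * l) = 0.
  by rewrite wcstE => /negbTE ->; rewrite mulr0 mul0r.
by rewrite /wcos (rsum_single h).1 wcstE eqxx mul0r cos0 !mulr1.
Qed.
Lemma wsin_cst (c : R) l : wsin (wcst c) l = 0.
Proof.
rewrite /wsin (@eq_rsum _ _ _ (fun=> 0)) ?rsum0// => k; rewrite wcstE.
by case: eqP => [->|_]; rewrite ?mul0r ?sin0 ?mulr0 ?mul0r.
Qed.

Let conv_sum x y (g : int -> int -> R) : (forall i j, `|g i j| <= 1) ->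
  rsum (fun k => rsum (fun j => x j * y (k - j) * g j (k - j))) =
  rsum (fun j => rsum (fun i => x j * y i * g j i)).
Proof.
move=> hg.
pose F (p : int * int) := x p.2 * y (p.1 - p.2) * g p.2 (p.1 - p.2).
have sF : summ F.
  apply: (le_summ_ge0 _ (summ_abs (cauchy_pair (wsumm x) (wsumm y)))) => p.
  by rewrite normrM ler_piMr.
rewrite (fubini_swap sF); apply: eq_rsum => j.
have sh : cancel (fun i : int => i + j) (fun i => i - j) by move=> i; ring.
have sh' : cancel (fun i : int => i - j) (fun i => i + j) by move=> i; ring.
have [-> _] := @rsum_reindex R _ _ _ _ (fun m => F (m, j)) sh sh'.
apply: eq_rsum => i; rewrite /F/=; have -> : i + j - j = i by ring.
by [].
Qed.

Lemma wcosM x y l : wcos (x * y) l = wcos x l * wcos y l - wsin x l * wsin y l.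
Proof.
rewrite {1}/wcos (@eq_rsum _ _ _ (fun k => rsum (fun j => x j * y (k - j) * cos ((j%:~R + (k - j)%:~R) * l)))); last first.
  move=> k; rewrite wM -rsumZr; last exact: cauchy_slice (wsumm _) (wsumm _).
  by apply: eq_rsum => j; congr (_ * cos (_ * _)); rewrite -intrD; congr _%:~R; ring.
rewrite (conv_sum x y (g := fun j i => cos ((j%:~R + i%:~R) * l))); last by move=> *; exact: cos_max.
rewrite -rsumZr; last exact: wcos_summ.
rewrite -[X in _ = _ - X]rsumZr; last exact: wsin_summ.
rewrite -rsumB; last 2 first; [exact/summZr/wcos_summ|exact/summZr/wsin_summ|].
apply: eq_rsum => j; rewrite -[X in _ = X - _]rsumZ; last exact: wcos_summ.
rewrite -[X in _ = _ - X]rsumZ; last exact: wsin_summ.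
rewrite -rsumB; last 2 first; [exact/summZ/wcos_summ|exact/summZ/wsin_summ|].
by apply: eq_rsum => i; rewrite mulrDl cosD; ring.
Qed.

Lemma wsinM x y l : wsin (x * y) l = wsin x l * wcos y l + wcos x l * wsin y l.
Proof.
rewrite {1}/wsin (@eq_rsum _ _ _ (fun k => rsum (fun j => x j * y (k - j) * sin ((j%:~R + (k - j)%:~R) * l)))); last first.
  move=> k; rewrite wM -rsumZr; last exact: cauchy_slice (wsumm _) (wsumm _).
  by apply: eq_rsum => j; congr (_ * sin (_ * _)); rewrite -intrD; congr _%:~R; ring.
rewrite (conv_sum x y (g := fun j i => sin ((j%:~R + i%:~R) * l))); last by move=> *; exact: sin_max.
rewrite -rsumZr; last exact: wsin_summ.
rewrite -[X in _ = _ + X]rsumZr; last exact: wcos_summ.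
rewrite -rsumD; last 2 first; [exact/summZr/wsin_summ|exact/summZr/wcos_summ|].
apply: eq_rsum => j; rewrite -[X in _ = X + _]rsumZ; last exact: wcos_summ.
rewrite -[X in _ = _ + X]rsumZ; last exact: wsin_summ.
rewrite -rsumD; last 2 first; [exact/summZ/wcos_summ|exact/summZ/wsin_summ|].
by apply: eq_rsum => i; rewrite mulrDl sinD; ring.
Qed.

Lemma wcos_lim X x l : wlim X x -> (fun N => wcos (X N) l) @ \oo --> wcos x l.
Proof.
apply: (wlim_fun (phi := fun x => wcos x l) (C := 1)) => a b.
by rewrite mul1r -wcosB wcos_le.
Qed.

Lemma wcosX_even x l m : rev x = x -> wcos (x ^+ m) l = wcos x l ^+ m.
Proof.
move=> hx; have s0 : wsin x l = 0 by have := wsin_rev x l; rewrite hx; lra.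
elim: m => [|m IH]; first by rewrite !expr0 -wcst1 wcos_cst.
by rewrite exprS wcosM s0 mul0r subr0 IH exprS.
Qed.

Lemma wcos_expN x l N : wcos (expN N x) l = \sum_(m < N) ifact m * wcos (x ^+ m) l.
Proof.
elim: N => [|N IH]; first by rewrite /expN !big_ord0 -wcst0 wcos_cst.
rewrite /expN !big_ord_recr/= wcosD -/(expN N x) IH; congr (_ + _).
by rewrite wcosM wsin_cst wcos_cst mul0r subr0.
Qed.

Lemma wcos_Exp_even x l : rev x = x -> wcos (Exp x) l = expR (wcos x l).
Proof.
move=> hx; have h := wcos_lim (l := l) (Exp_lim x).
apply: (cvg_unique (@Rhausdorff R) h).
rewrite (_ : (fun N => wcos (expN N x) l) = fun N => expNR N (wcos x l)).
  exact: expNR_cvg.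
by apply/funext => N; rewrite wcos_expN; apply: eq_bigr => m _; rewrite wcosX_even.
Qed.

Lemma wX_odd x l m : rev x = - x ->
  [/\ wcos (x ^+ m.*2) l = (- 1) ^+ m * wsin x l ^+ m.*2, wsin (x ^+ m.*2) l = 0 &
   wcos (x ^+ m.*2.+1) l = 0].
Proof.
move=> hx; have c0 : wcos x l = 0 by have := wcos_rev x l; rewrite hx wcosN; lra.
have step n : wsin (x ^+ n) l = 0 -> wcos (x ^+ n.+1) l = 0.
  by move=> sn; rewrite exprSr wcosM c0 sn mulr0 mul0r subr0.
elim: m => [|m [IH1 IH2 IH3]].
  rewrite double0 !expr0 expr1 -wcst1 wcos_cst wsin_cst mul1r; split => //.
rewrite doubleS; have e1 : wsin (x ^+ m.*2.+1) l = (- 1) ^+ m * wsin x l ^+ m.*2.+1.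
  by rewrite exprSr wsinM IH1 IH2 mul0r add0r -mulrA -exprSr.
have e2 : wsin (x ^+ m.*2.+2) l = 0 by rewrite exprSr wsinM c0 IH3 mul0r mulr0 addr0.
split => //; last exact: step.
by rewrite exprSr wcosM IH3 mul0r e1 sub0r [(- 1) ^+ m.+1]exprS [wsin x l ^+ m.*2.+2]exprSr; ring.
Qed.

Lemma wcos_Exp_odd x l : rev x = - x -> wcos (Exp x) l = cos (wsin x l).
Proof.
move=> hx; have h := wcos_lim (l := l) (Exp_lim x).
(* Odd powers have a purely imaginary transform, so the even truncations are exactly the partial
   sums of the cosine series. *)
have d : (fun N => wcos (expN N.*2 x) l) @ \oo --> wcos (Exp x) l.
  have := @cvg_comp _ _ _ (fun N => N.*2) (fun N => wcos (expN N x) l) \oo \oo (nbhs (wcos (Exp x) l)).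
  apply => //; apply/cvgnyPge => A; exists A => // n /= An.
  by rewrite -addnn; exact: leq_trans An (leq_addr _ _).
apply: (cvg_unique (@Rhausdorff R) d).
rewrite (_ : (fun N => _) = series (cos_coeff' (wsin x l))); first exact: cvg_cos_coeff'.
apply/funext => N; rewrite wcos_expN /series/= big_mkord.
elim: N => [|N IH]; first by rewrite double0 !big_ord0.
have [E1 _ E3] := wX_odd l N hx.
rewrite doubleS !big_ord_recr/= IH E1 E3 mulr0 addr0; congr (_ + _).
by rewrite /cos_coeff' /ifact mulrC.
Qed.

End Transform.

Section TailBounds.
Context {R : realType}.

Lemma tele_bound (f : int -> R) (N : nat) (F : nat -> R) :
  (forall k : int, k < N%:Z -> f k = 0) -> (forall i, 0 <= F i) ->
  (forall i, (N <= i)%N -> `|f i| <= F i - F i.+1) ->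
  summ f /\ rsum (fun k => `|f k|) <= F N.
Proof.
move=> f0 F0 hF; apply: summ_itrunc => M.
have e : itrunc M (fun k => `|f k|) = \sum_(i < M) `|f (Posz i)|.
  rewrite /itrunc; apply: eq_bigr => i _.
  by rewrite (f0 (Negz i)) ?normr0 ?addr0//; lia.
rewrite e; suff : \sum_(i < M) `|f (Posz i)| <= F N - (if (M <= N)%N then F N else F M).
  by case: ifP => _; have := F0 M; have := F0 N; lra.
elim: M {e} => [|M IH]; first by rewrite big_ord0 leq0n subrr.
rewrite big_ord_recr/=; move: IH; case: (leqP M.+1 N) => MN.
  rewrite (ltnW MN) !subrr => h; rewrite (f0 (Posz M)) ?normr0 ?addr0//; lia.
have := hF M; rewrite -ltnS => /(_ MN) h1.
case: (leqP M N) => MN' h; last lra.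
have e : M = N by apply/eqP; rewrite eqn_leq MN'.
by move: h h1; rewrite e subrr; lra.
Qed.

(** The majorant telescopes: [1 / i^2 <= 2 / i - 2 / (i + 1)] for i >= 1. *)
Lemma tail_sq (N : nat) (f : int -> R) (K : R) : (0 < N)%N -> 0 <= K ->
  (forall k : int, k < N%:Z -> f k = 0) ->
  (forall i, (N <= i)%N -> `|f (Posz i)| <= K / i%:R ^+ 2) ->
  summ f /\ rsum (fun k => `|f k|) <= 2 * K / N%:R.
Proof.
move=> N0 K0 f0 hf.
apply: (@tele_bound f N (fun i => 2 * K / i%:R)) => // [i|i Ni].
  by rewrite divr_ge0// mulr_ge0.
apply: le_trans (hf i Ni) _.
have i0 : 1 <= i%:R :> R by rewrite ler1n (leq_trans N0 Ni).
rewrite -[i.+1%:R]natr1; set t : R := i%:R in i0 *.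
have -> : 2 * K / t - 2 * K / (t + 1) = K * (2 / (t * (t + 1))) by field; apply/andP; split; apply/eqP; lra.
rewrite ler_wpM2l// ler_pdivlMr; last nra.
rewrite mulrC ler_pdivrMr; last nra.
nra.
Qed.

Lemma tail_cube (N : nat) (f : int -> R) (K : R) : (0 < N)%N -> 0 <= K ->
  (forall k : int, k < N%:Z -> f k = 0) ->
  (forall i, (N <= i)%N -> `|f (Posz i)| <= K / i%:R ^+ 3) ->
  summ f /\ rsum (fun k => `|f k|) <= 2 * K / N%:R ^+ 2.
Proof.
move=> N0 K0 f0 hf.
apply: (@tele_bound f N (fun i => 2 * K / i%:R ^+ 2)) => // [i|i Ni].
  by rewrite divr_ge0 ?mulr_ge0// exprn_ge0.
apply: le_trans (hf i Ni) _.
have i0 : 1 <= i%:R :> R by rewrite ler1n (leq_trans N0 Ni).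
rewrite -[i.+1%:R]natr1; set t : R := i%:R in i0 *.
have -> : 2 * K / t ^+ 2 - 2 * K / (t + 1) ^+ 2 = K * (2 * (2 * t + 1) / (t ^+ 2 * (t + 1) ^+ 2)) by field; apply/andP; split; apply/eqP; lra.
rewrite ler_wpM2l// ler_pdivlMr; last by rewrite mulr_gt0 ?exprn_gt0//; lra.
rewrite mulrC ler_pdivrMr; last by rewrite exprn_gt0//; lra.
have -> : 2 * (2 * t + 1) * t ^+ 3 = t ^+ 2 * (2 * (2 * t + 1) * t) by ring.
by rewrite ler_wpM2l ?sqr_ge0//; nra.
Qed.

End TailBounds.

(** * Hankel operators and prediction polynomials *)

Section HankelOperator.
Context {R : realType}.
Local Notation W := (wiener R).
Implicit Types (x y a b psi : W).

Definition geP (n : int) : pred int := fun k => n <= k.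
Definition supp_le0 x := forall k : int, 0 < k -> x k = 0.

(* The Hankel matrix (psi_(N+j+k)) acting on sequences indexed by the
   nonpositive integers -k; the outer rev brings the result back there. *)
Definition hankel (N : int) psi a : W := rev (wproj (geP 0) (zpow (- N) * psi * a)).

Lemma hankelE N psi a k : hankel N psi a k = if k <= 0 then (psi * a) (N - k) else 0.
Proof.
rewrite revE wprojE /geP oppr_ge0; case: ifP => // _.
by rewrite -mulrA zpowM; congr (wv _ _); ring.
Qed.

Lemma hankel_supp N psi a : supp_le0 (hankel N psi a).
Proof. by move=> k k0; rewrite hankelE leNgt k0. Qed.

Lemma hankelD N psi a b : hankel N psi (a + b) = hankel N psi a + hankel N psi b.
Proof. by rewrite /hankel mulrDr wprojD revD. Qed.
Lemma hankelN N psi a : hankel N psi (- a) = - hankel N psi a.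
Proof. by rewrite /hankel mulrN wprojN revN. Qed.
Lemma hankelB N psi a b : hankel N psi (a - b) = hankel N psi a - hankel N psi b.
Proof. by rewrite hankelD hankelN. Qed.
Lemma hankelDs N psi psi' a : hankel N (psi + psi') a = hankel N psi a + hankel N psi' a.
Proof. by rewrite /hankel mulrDr mulrDl wprojD revD. Qed.
Lemma hankelNs N psi a : hankel N (- psi) a = - hankel N psi a.
Proof. by rewrite /hankel mulrN mulNr wprojN revN. Qed.
Lemma hankelBs N psi psi' a : hankel N (psi - psi') a = hankel N psi a - hankel N psi' a.
Proof. by rewrite hankelDs hankelNs. Qed.

Lemma hankel_le N psi a : n2 (hankel N psi a) <= n2 (psi * a).
Proof.
rewrite /hankel n2_rev; apply: le_trans (n2_proj _ _) _.
by rewrite -mulrA n2_zpow.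
Qed.

(** As a lives on nonpositive indices, the coefficient k of the product involves only psi_j with
    [k <= j]. A Hankel operator thus sees only the tail of its symbol. *)
Lemma mul_proj n psi a : supp_le0 a -> forall k, n <= k ->
  (psi * a) k = (wproj (geP n) psi * a) k.
Proof.
move=> sa k nk; rewrite [psi * a]mulrC [_ * a]mulrC !wM; apply: eq_rsum => j.
rewrite wprojE /geP; case: ifPn => // h.
by rewrite sa ?mul0r//; lia.
Qed.

Lemma hankel_proj N psi a : supp_le0 a -> hankel N psi a = hankel N (wproj (geP N) psi) a.
Proof.
move=> sa; apply: wiener_ext => k; rewrite !hankelE; case: ifP => // k0.
by rewrite (mul_proj (n := N)) //; lia.
Qed.

Lemma hankel_coef_le N psi a (k : int) : supp_le0 a -> k <= 0 ->
  `|hankel N psi a k| <= n2 (wproj (geP (N - k)) psi) * n2 a.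
Proof. by move=> sa k0; rewrite hankelE k0 (mul_proj (n := N - k))//; exact: coef_le. Qed.

(* The bound is on the Hilbert-Schmidt norm of the Hankel matrix. *)
Lemma hankel_HS (N : nat) psi a (K : R) : (0 < N)%N -> 0 <= K -> supp_le0 a ->
  (forall i : nat, (N <= i)%N -> psi (Posz i) ^+ 2 <= K / i%:R ^+ 3) ->
  n2 (hankel N psi a) ^+ 2 <= 4 * K / N%:R * n2 a ^+ 2.
Proof.
move=> N0 K0 sa hpsi.
have P (M : nat) : (N <= M)%N -> n2 (wproj (geP M) psi) ^+ 2 <= 2 * K / M%:R ^+ 2.
  move=> NM; rewrite n2sq dotE.
  have [|||s b] := @tail_cube R M (fun k => wproj (geP M) psi k * wproj (geP M) psi k) K _ K0.
  - exact: leq_trans N0 NM.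
  - by move=> k kM; rewrite wprojE /geP leNgt kM/= mul0r.
  - move=> i Mi; rewrite wprojE /geP lez_nat Mi -expr2 ger0_norm ?sqr_ge0//.
    exact/hpsi/(leq_trans NM).
  apply: le_trans b; apply: ler_rsum => //; first exact: summ_abs.
  by move=> k; exact: ler_norm.
rewrite n2sq dotE.
pose f k := hankel N psi a (- (k - N%:Z)) * hankel N psi a (- (k - N%:Z)).
have sh : cancel (fun k : int => - (k - N%:Z)) (fun j => N%:Z - j) by move=> j; ring.
have sh' : cancel (fun j : int => N%:Z - j) (fun k => - (k - N%:Z)) by move=> j; ring.
have [-> _] := @rsum_reindex R _ _ _ _ (fun k => hankel N psi a k * hankel N psi a k) sh sh'.
have K1 : 0 <= 2 * K * n2 a ^+ 2 by rewrite mulr_ge0 ?sqr_ge0// mulr_ge0.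
have [||s b] := @tail_sq R N f (2 * K * n2 a ^+ 2) N0 K1.
- by move=> k kN; rewrite /f hankel_supp ?mul0r//; lia.
- move=> i Ni; rewrite /f -expr2 ger0_norm ?sqr_ge0//.
  have k0 : - (i%:Z - N%:Z) <= 0 by lia.
  have := hankel_coef_le N psi sa k0.
  rewrite (_ : N%:Z - - (i%:Z - N%:Z) = i%:Z); last by ring.
  move=> h; rewrite -real_normK ?num_real//.
  apply: (@le_trans _ _ ((n2 (wproj (geP i) psi) * n2 a) ^+ 2)).
    by rewrite ler_pXn2r// nnegrE// mulr_ge0 ?n2_ge0.
  rewrite exprMn (_ : 2 * K * _ / _ = 2 * K / i%:R ^+ 2 * n2 a ^+ 2); last by ring.
  by rewrite ler_wpM2r ?sqr_ge0// P.
rewrite (_ : 4 * K / N%:R * n2 a ^+ 2 = 2 * (2 * K * n2 a ^+ 2) / N%:R); last by ring.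
apply: le_trans b; apply: ler_rsum => //; first exact: summ_abs.
by move=> k; exact: ler_norm.
Qed.

Lemma hankel_one (N : int) psi : n2 (hankel N psi 1) = n2 (wproj (geP N) psi).
Proof.
rewrite /hankel n2_rev mulr1 (_ : wproj _ _ = zpow (- N) * wproj (geP N) psi) ?n2_zpow//.
apply: wiener_ext => k; rewrite wprojE !zpowM wprojE /geP opprK.
by rewrite [N <= _](_ : _ = (0 <= k))//; lia.
Qed.

End HankelOperator.

Section PredictionPolynomial.
Context {R : realType}.
Local Notation W := (wiener R).

(* h is the outer factor of the weight, g its inverse, psi the phase. *)
Record outer_factor (h g psi : W) : Prop := OuterFactor {
  of_inv : h * g = 1;
  of_h : supp_ge 0 h; of_g : supp_ge 0 g;
  of_h0 : h 0 = 1; of_g0 : g 0 = 1;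
  of_psi : psi = rev h * g }.

Lemma of_uni h g psi : outer_factor h g psi -> psi * rev psi = 1.
Proof.
case=> hg _ _ _ _ ->; rewrite revM revK.
have -> : rev h * g * (h * rev g) = (h * g) * rev (h * g) by rewrite revM; ring.
by rewrite hg rev1 mulr1.
Qed.

(** The Yule-Walker equations for the covariance [gam], normalised at index 0: the combination of
    the variables 0 to n with coefficients p is uncorrelated with those of index 1 to n. *)
Record pred_poly (gam : W) (n : nat) (p : W) : Prop := PredPoly {
  pp_supp : forall k : int, k < 0 \/ n%:Z < k -> p k = 0;
  pp_0 : p 0 = 1;
  pp_orth : forall k : int, 1 <= k <= n%:Z -> (gam * p) k = 0 }.

Variables (h g psi p : W) (n : nat).
Hypothesis of_ : outer_factor h g psi.
Hypothesis pp : pred_poly (h * rev h) n p.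

Let N : int := n.+1.

(** The product of the weight and p vanishes between 0 and n + 1, hence splits into an antianalytic
    part and z^(n+1) times an analytic part. Dividing by conj h, and then multiplying by psi, gives
    two expressions to compare with the known supports of [p * h] and [rev h * p]: the first has no
    negative coefficients and constant 1, the second none above n. The two comparisons are the
    Hankel equations, and the last coefficient of p and the error variance are read off from a. *)
Lemma pred_hankel : exists a b : W, [/\ supp_le0 a, supp_le0 b,
  a = 1 - hankel N psi b & b = - hankel N psi a] /\
  (p n = (psi * a) n /\ (h * rev h * p) 0 = a 0).
Proof.
have [hg sh sg h0 g0 epsi] := of_.
have [sp p0 orth] := pp.
have rhg : rev h * rev g = 1 by rewrite -revM hg rev1.
pose U := p * h; pose V := rev h * U.
have VE : V = h * rev h * p by rewrite /V /U; ring.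
pose A' := wproj (fun k => k <= 0) V; pose B' := zpow (- N) * wproj (geP N) V.
have V_eq : V = A' + zpow N * B'.
  rewrite /B' mulrA zpowV mul1r; apply: wiener_ext => k; rewrite wD !wprojE /geP.
  case: ifPn => k0; case: ifPn => kn; rewrite ?addr0 ?add0r//; first by rewrite /N in kn; lia.
  by rewrite VE orth//; rewrite /N in kn; lia.
pose A := rev g * A'; pose B := B' * g.
have upsi := of_uni of_.
have U_eq : U = A + zpow N * (rev psi * B).
  have -> : U = rev g * V by rewrite /V mulrA [rev g * _]mulrC rhg mul1r.
  rewrite {1}V_eq mulrDr; congr (_ + _).
  rewrite epsi revM revK /B.
  by transitivity (zpow N * (rev g * B') * (h * g)); [rewrite hg mulr1; ring|ring].
have sA' : supp_ge 0 (rev A') by move=> k k0; rewrite revE wprojE oppr_le0 leNgt k0.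
have sA : supp_le0 A.
  have s1 : supp_ge 0 (rev A) by rewrite /A revM revK -[0]addr0; exact: supp_geM.
  by move=> k k0; have := s1 (- k); rewrite revE opprK oppr_lt0; exact.
have A0 : A 0 = V 0.
  have : rev A 0 = V 0; last by rewrite revE oppr0.
  rewrite /A revM revK supp_ge_coef// g0 mul1r revE oppr0 wprojE lexx//.
have sB' : supp_ge 0 B'.
  by move=> k k0; rewrite /B' zpowM wprojE /geP; case: ifP => //; lia.
have sB : supp_ge 0 B by rewrite /B -[0]addr0; exact: supp_geM.
have sB_ : supp_le0 (rev B) by move=> k k0; rewrite revE sB// oppr_lt0.
have sp0 : supp_ge 0 p by move=> k k0; apply: sp; left.
have sU : supp_ge 0 U by rewrite /U -[0]addr0; exact: supp_geM.
have U0 : U 0 = 1 by rewrite /U supp_ge_coef// p0 h0 mulr1.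
have psiU : psi * U = rev h * p.
  rewrite epsi /U; transitivity (rev h * p * (h * g)); first ring.
  by rewrite hg mulr1.
have psiU' : psi * U = psi * A + zpow N * B.
  rewrite U_eq mulrDr; congr (_ + _).
  by transitivity (zpow N * B * (psi * rev psi)); [ring|rewrite upsi mulr1].
have hp0 (k : int) : n%:Z < k -> (rev h * p) k = 0.
  move=> nk; rewrite wM (@eq_rsum _ _ _ (fun=> 0)) ?rsum0// => j.
  have [j0|j0] := ltP 0 j; first by rewrite revE sh ?mul0r// oppr_lt0.
  by rewrite (sp (k - j)) ?mulr0//; right; lia.
have hpn : (rev h * p) n = p n.
  rewrite wM.
  have hj j : j != 0 -> rev h j * p (n%:Z - j) = 0.
    move=> jn; have [j0|j0] := ltP 0 j; first by rewrite revE sh ?mul0r// oppr_lt0.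
    by rewrite (sp (n%:Z - j)) ?mulr0//; right; lia.
  by rewrite (rsum_single hj).1 revE oppr0 h0 mul1r subr0.
(* The second unknown is reversed so that both live on nonpositive indices and one operator serves
   both equations. *)
exists A, (rev B); split; [split => //|split].
- apply: wiener_ext => k; rewrite wB w1 hankelE.
  have e k' : k' <= 0 -> (zpow N * (rev psi * B)) k' = (psi * rev B) (N - k').
    move=> _; have -> : psi * rev B = rev (rev psi * B) by rewrite revM revK.
    by rewrite revE zpowM; congr (wv _ _); ring.
  case: ifPn => k0; last first.
    rewrite subr0 sA ?(gt_eqF)//; lia.
  rewrite -e//; have := wap U_eq k; rewrite wD => E.
  have -> : (k == 0)%:R = U k.
    by case: eqP => [->|kn]; [rewrite U0|rewrite sU//; lia].
  by rewrite E; ring.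
- apply: wiener_ext => k; rewrite wN revE hankelE; case: ifPn => k0; last first.
    by rewrite oppr0 sB//; lia.
  have := wap psiU' (N - k); rewrite psiU hp0; last by rewrite /N; lia.
  rewrite wD zpowM (_ : N - k - N = - k); last by ring.
  by move/eqP; rewrite eq_sym addrC addr_eq0 => /eqP.
- rewrite -hpn -psiU psiU' wD zpowM (sB (n%:Z - N)) ?addr0// /N; lia.
- by rewrite -VE -A0.
Qed.

End PredictionPolynomial.

(** * Perturbation of the Hankel equations *)

Section Perturbation.
Context {R : realType}.
Local Notation W := (wiener R).
Implicit Types (psi a b : W).

Definition hankel_contr (N : int) psi (rho : R) := forall a, supp_le0 a ->
  n2 (hankel N psi a) <= rho * n2 a.

Lemma supp_le0_1 : supp_le0 (1 : W).
Proof. by move=> k k0; rewrite w1 gt_eqF. Qed.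
Lemma supp_le0B a b : supp_le0 a -> supp_le0 b -> supp_le0 (a - b).
Proof. by move=> ha hb k k0; rewrite wB ha// hb// subr0. Qed.

(** Eliminate between [n2 (a - 1) <= rho * n2 b] and [n2 b <= xi + rho * n2 (a - 1)], where xi
    bounds the Hankel image of 1. *)
Lemma resolvent_bound N psi rho xi a b : 0 <= rho < 1 -> hankel_contr N psi rho ->
  supp_le0 a -> supp_le0 b -> a = 1 - hankel N psi b -> b = - hankel N psi a ->
  n2 (wproj (geP N) psi) <= xi ->
  n2 (a - 1) <= xi / (1 - rho) /\ n2 b <= xi / (1 - rho).
Proof.
move=> /andP[r0 r1] hc sa sb ea eb hxi.
have sy : supp_le0 (a - 1) by apply: supp_le0B => //; exact: supp_le0_1.
have h1 : n2 (a - 1) <= rho * n2 b.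
  by rewrite {1}ea addrAC subrr add0r n2N; exact: hc.
have h2 : n2 b <= xi + rho * n2 (a - 1).
  have e : b = - hankel N psi 1 - hankel N psi (a - 1).
    by rewrite {1}eb hankelB; ring.
  rewrite {1}e; apply: le_trans (n2B _ _) _; rewrite n2N hankel_one.
  by apply: lerD => //; exact: hc.
have := n2_ge0 (a - 1); have := n2_ge0 b; move=> b0 y0.
have x0 : 0 <= xi by exact: le_trans (n2_ge0 _) hxi.
have r1' : 0 < 1 - rho by lra.
by split; rewrite ler_pdivlMr//; nra.
Qed.

(** Subtract the two systems. The perturbation acts on 1, where it costs only its tail eta, and on
    [b0] and [a0 - 1], where it costs eps but meets quantities already of size xi. Two bounds are
    kept apart because using eps everywhere would lose a factor n^(1/2). *)
Lemma resolvent_diff N psi psi0 rho xi eta eps a b a0 b0 : 0 <= rho < 1 ->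
  hankel_contr N psi rho -> hankel_contr N psi0 rho -> 0 <= eps ->
  hankel_contr N (psi - psi0) eps ->
  supp_le0 a -> supp_le0 b -> a = 1 - hankel N psi b -> b = - hankel N psi a ->
  supp_le0 a0 -> supp_le0 b0 -> a0 = 1 - hankel N psi0 b0 -> b0 = - hankel N psi0 a0 ->
  n2 (wproj (geP N) psi0) <= xi -> n2 (wproj (geP N) (psi - psi0)) <= eta ->
  n2 (a - a0) <= (eta + eps * (2 * xi / (1 - rho))) / (1 - rho).
Proof.
move=> rho01 hc hc0 eps0 he sa sb ea eb sa0 sb0 ea0 eb0 hxi heta.
have [y0 bb0] := resolvent_bound rho01 hc0 sa0 sb0 ea0 eb0 hxi.
have /andP[r0 r1] := rho01.
have sy0 : supp_le0 (a0 - 1) by apply: supp_le0B => //; exact: supp_le0_1.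
have h1 : n2 (a - a0) <= rho * n2 (b - b0) + eps * n2 b0.
  have -> : a - a0 = - hankel N psi (b - b0) - hankel N (psi - psi0) b0.
    by rewrite {1}ea {1}ea0 hankelB hankelBs; ring.
  apply: le_trans (n2B _ _) _; rewrite n2N; apply: lerD; last exact: he.
  by apply: hc; exact: supp_le0B.
have h2 : n2 (b - b0) <= eta + rho * n2 (a - a0) + eps * n2 (a0 - 1).
  have -> : b - b0 = - hankel N (psi - psi0) 1 - hankel N psi (a - a0) - hankel N (psi - psi0) (a0 - 1).
    by rewrite {1}eb {1}eb0 !hankelB !hankelBs; ring.
  apply: le_trans (n2B _ _) _; apply: lerD; last exact: he.
  apply: le_trans (n2B _ _) _; rewrite n2N hankel_one; apply: lerD => //.
  by apply: hc; exact: supp_le0B.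
have x0 : 0 <= xi by exact: le_trans (n2_ge0 _) hxi.
have r1' : 0 < 1 - rho by lra.
have q0 : eps * n2 b0 <= eps * (xi / (1 - rho)) by rewrite ler_wpM2l.
have q1 : eps * n2 (a0 - 1) <= eps * (xi / (1 - rho)) by rewrite ler_wpM2l.
rewrite ler_pdivlMr// (_ : 2 * xi / (1 - rho) = xi / (1 - rho) + xi / (1 - rho)); last by ring.
rewrite mulrDr; have := n2_ge0 (b - b0); have := n2_ge0 (a - a0); nra.
Qed.

(* psi0 is the phase of the pure singular weight. All bounds depend only on
   rho and K, hence survive the limit r -> 1. *)
Lemma pred_diff (n : nat) psi psi0 (rho K : R) a b a0 b0 : (0 < n)%N -> 0 <= rho < 1 -> 0 <= K ->
  hankel_contr n.+1 psi rho -> hankel_contr n.+1 psi0 rho ->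
  (forall k : nat, (0 < k)%N -> psi0 k ^+ 2 <= K / k%:R ^+ 2) ->
  (forall k : nat, (0 < k)%N -> (psi k - psi0 k) ^+ 2 <= K / k%:R ^+ 3) ->
  supp_le0 a -> supp_le0 b -> a = 1 - hankel n.+1 psi b -> b = - hankel n.+1 psi a ->
  supp_le0 a0 -> supp_le0 b0 -> a0 = 1 - hankel n.+1 psi0 b0 -> b0 = - hankel n.+1 psi0 a0 ->
  `|(psi * a) n - (psi0 * a0) n| <= (1 + 64 * (1 + K) ^+ 2 / (1 - rho) ^+ 2) * (1 + K) / (n%:R * Num.sqrt n%:R) /\
  n2 (a - 1) <= 4 * (1 + K) / (1 - rho) / Num.sqrt n%:R.
Proof.
move=> n0 rho01 K0 hc hc0 hp hd sa sb ea eb sa0 sb0 ea0 eb0.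
have /andP[r0 r1] := rho01; have r1' : 0 < 1 - rho by lra.
pose s : R := Num.sqrt n%:R.
have n0' : 1 <= n%:R :> R by rewrite ler1n.
have s2 : s ^+ 2 = n%:R by rewrite sqr_sqrtr.
have s1 : 1 <= s by rewrite -(@ler_pXn2r _ 2) ?nnegrE ?sqrtr_ge0// s2 expr1n.
have s0 : 0 < s by lra.
have KK : 0 <= 1 + K by lra.
(* Replacing the square root of c by [1 + c] keeps all constants polynomial in K. *)
have sq1 (x c t : R) : 0 <= x -> 0 <= c -> 0 < t -> x ^+ 2 <= c / t ^+ 2 -> x <= (1 + c) / t.
  move=> x0 c0 t0; rewrite ler_pdivlMr ?exprn_gt0// -exprMn => h.
  rewrite ler_pdivlMr//; have : 0 <= x * t by rewrite mulr_ge0// ltW.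
  nra.
have tail2 (m : nat) : (n <= m)%N -> n2 (wproj (geP m) psi0) <= (1 + 2 * K) / s.
  move=> nm; apply: sq1 => //; [exact: n2_ge0|lra|].
  have [|||su b1] := @tail_sq R m (fun k => wproj (geP m) psi0 k * wproj (geP m) psi0 k) K _ K0.
  - exact: leq_trans n0 nm.
  - by move=> k kM; rewrite wprojE /geP leNgt kM/= mul0r.
  - move=> i Mi; rewrite wprojE /geP lez_nat Mi -expr2 ger0_norm ?sqr_ge0//.
    by apply: hp; apply: leq_trans Mi; exact: leq_trans n0 nm.
  rewrite n2sq dotE s2; apply: (@le_trans _ _ (2 * K / m%:R)).
    apply: le_trans b1; apply: ler_rsum => //; first exact: summ_abs.
    by move=> k; exact: ler_norm.
  by rewrite ler_wpM2l ?mulr_ge0// lef_pV2 ?posrE ?ler_nat// ltr0n// (leq_trans n0 nm).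
have tail3 (m : nat) : (n <= m)%N -> n2 (wproj (geP m) (psi - psi0)) <= (1 + 2 * K) / n%:R.
  move=> nm; apply: sq1 => //; [exact: n2_ge0|lra|lra|].
  have [|||su b1] := @tail_cube R m (fun k => wproj (geP m) (psi - psi0) k * wproj (geP m) (psi - psi0) k) K _ K0.
  - exact: leq_trans n0 nm.
  - by move=> k kM; rewrite wprojE /geP leNgt kM/= mul0r.
  - move=> i Mi; rewrite wprojE /geP lez_nat Mi -expr2 ger0_norm ?sqr_ge0//.
    by apply: hd; apply: leq_trans Mi; exact: leq_trans n0 nm.
  rewrite n2sq dotE; apply: (@le_trans _ _ (2 * K / m%:R ^+ 2)).
    apply: le_trans b1; apply: ler_rsum => //; first exact: summ_abs.
    by move=> k; exact: ler_norm.
  rewrite ler_wpM2l ?mulr_ge0// lef_pV2 ?posrE ?exprn_gt0 ?ltr0n ?(leq_trans n0 nm)//.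
  by rewrite ler_pXn2r ?nnegrE// ler_nat.
have he : hankel_contr n.+1 (psi - psi0) ((1 + 4 * K) / s).
  move=> x sx.
  have := @hankel_HS R n.+1 (psi - psi0) x K isT K0 sx.
  move=> /(_ (fun i ni => hd i (leq_trans (ltn0Sn n) ni))) h.
  have xx := n2_ge0 x; have hx := n2_ge0 (hankel n.+1 (psi - psi0) x).
  have h' : n2 (hankel n.+1 (psi - psi0) x) ^+ 2 <= 4 * K * n2 x ^+ 2 / s ^+ 2.
    apply: le_trans h _; rewrite s2 mulrAC ler_wpM2l ?mulr_ge0 ?sqr_ge0//.
    by rewrite lef_pV2 ?posrE ?ltr0n// ler_nat.
  rewrite mulrAC ler_pdivlMr//; move: h'; rewrite ler_pdivlMr ?exprn_gt0// -exprMn.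
  set X := _ * s; have X0 : 0 <= X by rewrite mulr_ge0// ltW.
  have X1 : 0 <= (1 + 4 * K) * n2 x by rewrite mulr_ge0//; lra.
  move=> h'; rewrite -(@ler_pXn2r _ 2) ?nnegrE//.
  by apply: le_trans h' _; rewrite exprMn ler_wpM2r ?sqr_ge0//; nra.
have e0 : 0 <= (1 + 4 * K) / s by rewrite divr_ge0 ?ltW//; lra.
have t2 := tail2 n.+1 (leqnSn n); have t3 := tail3 n.+1 (leqnSn n).
have hD := resolvent_diff rho01 hc hc0 e0 he sa sb ea eb sa0 sb0 ea0 eb0 t2 t3.
have psiE : psi = psi0 + (psi - psi0) by ring.
have tpsi : n2 (wproj (geP n.+1) psi) <= 2 * (1 + 2 * K) / s.
  rewrite psiE wprojD; apply: le_trans (n2D _ _) _.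
  rewrite mulrDl mul1r mulrDl; apply: lerD => //; apply: le_trans t3 _.
  rewrite ler_wpM2l//; first lra.
  by rewrite lef_pV2 ?posrE//; [rewrite -s2; nra|lra].
have [hy _] := resolvent_bound rho01 hc sa sb ea eb tpsi.
split; last first.
  apply: le_trans hy _; rewrite -/s [leRHS]mulrAC ler_pM2r ?invr_gt0// ler_pM2r ?invr_gt0//.
  lra.
(* Three terms of order n^(-3/2): the direct difference; a tail n^(-1) of [psi - psi0] against
   [a - 1] of size n^(-1/2); a tail n^(-1/2) of psi0 against [a - a0] of size n^(-1). *)
have -> : (psi * a) n - (psi0 * a0) n = (psi n - psi0 n) + ((psi - psi0) * (a - 1)) n + (psi0 * (a - a0)) n.
  by rewrite -!wB -!wD; congr (wv _ _); ring.
have d1 : `|psi n - psi0 n| <= (1 + K) / (n%:R * s).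
  apply: sq1 => //; [rewrite mulr_gt0//; lra|].
  rewrite real_normK ?num_real// exprMn s2 -exprSr; exact: hd.
have d2 : `|((psi - psi0) * (a - 1)) n| <= (1 + 2 * K) / n%:R * (2 * (1 + 2 * K) / s / (1 - rho)).
  rewrite (mul_proj (n := n))//; last by apply: supp_le0B => //; exact: supp_le0_1.
  apply: le_trans (coef_le _ _ _) _; apply: ler_pM; rewrite ?n2_ge0//.
  exact: tail3.
have d3 : `|(psi0 * (a - a0)) n| <= (1 + 2 * K) / s * (((1 + 2 * K) / n%:R + (1 + 4 * K) / s * (2 * ((1 + 2 * K) / s) / (1 - rho))) / (1 - rho)).
  rewrite (mul_proj (n := n))//; last exact: supp_le0B.
  apply: le_trans (coef_le _ _ _) _; apply: ler_pM; rewrite ?n2_ge0//.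
  exact: tail2.
apply: le_trans (ler_normD _ _) _; apply: le_trans (lerD (ler_normD _ _) (lexx _)) _.
apply: le_trans (lerD (lerD d1 d2) d3) _.
rewrite -/s -s2.
pose e : R := (1 - rho)^-1; have e1 : 1 <= e by rewrite invf_ge1//; lra.
have -> : (1 + K) / (s ^+ 2 * s) + (1 + 2 * K) / s ^+ 2 * (2 * (1 + 2 * K) / s / (1 - rho)) +
  (1 + 2 * K) / s * (((1 + 2 * K) / s ^+ 2 + (1 + 4 * K) / s * (2 * ((1 + 2 * K) / s) / (1 - rho))) / (1 - rho)) =
  ((1 + K) + 3 * (1 + 2 * K) ^+ 2 * e + 2 * (1 + 2 * K) ^+ 2 * (1 + 4 * K) * e ^+ 2) / (s ^+ 2 * s).
  by rewrite /e; field; apply/andP; split; apply/eqP; lra.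
have -> : (1 + 64 * (1 + K) ^+ 2 / (1 - rho) ^+ 2) * (1 + K) = (1 + K) + 64 * (1 + K) ^+ 3 * e ^+ 2.
  by rewrite /e; field; apply/eqP; lra.
rewrite ler_wpM2r//; first by rewrite invr_ge0 mulr_ge0 ?sqr_ge0// ltW.
have ee : e <= e ^+ 2 by nra.
have b1 : 3 * (1 + 2 * K) ^+ 2 * e <= 12 * (1 + K) ^+ 3 * e ^+ 2.
  by apply: ler_pM => //; [rewrite mulr_ge0 ?sqr_ge0|lra|nra].
have b2 : 2 * (1 + 2 * K) ^+ 2 * (1 + 4 * K) * e ^+ 2 <= 32 * (1 + K) ^+ 3 * e ^+ 2.
  by rewrite ler_wpM2r ?sqr_ge0//; nra.
have b3 : 0 <= (1 + K) ^+ 3 * e ^+ 2 by apply: mulr_ge0; [exact: exprn_ge0|exact: sqr_ge0].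
lra.
Qed.

End Perturbation.

(** * The phase of the pure singular weight *)

Section PureFactor.
Context {R : realType}.
Local Notation W := (wiener R).
Variables (r d : R).
Hypothesis r0 : 0 <= r.
Hypothesis r1 : r < 1.

(** The coefficients of [1 / (1 - r z)]. *)
Definition geo_fun (k : int) : R := if 0 <= k then r ^+ `|k|%N else 0.

Lemma geo_summ : summ geo_fun.
Proof.
suff h N : itrunc N (fun k => `|geo_fun k|) <= (1 - r)^-1 by have [] := summ_itrunc h.
have -> : itrunc N (fun k => `|geo_fun k|) = \sum_(i < N) r ^+ i.
  rewrite /itrunc; apply: eq_bigr => i _.
  by rewrite /geo_fun /= normr0 addr0 ger0_norm// exprn_ge0.
have r1' : 0 < 1 - r by have := r1; lra.
rewrite -[leRHS]mul1r ler_pdivlMr// mulrC.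
have := @subrX1 R r N; have := exprn_ge0 N r0; nra.
Qed.

Definition geo : W := mkW geo_summ.
Arguments geo : simpl never.
Lemma geoE k : geo k = if 0 <= k then r ^+ `|k|%N else 0. Proof. by []. Qed.

Lemma lpure_summ : summ (fun k : int => if 0 < k then d * r ^+ `|k|%N / `|k|%N%:R else 0).
Proof.
apply: (le_summ _ (summZ d geo_summ)) => k; rewrite /geo_fun.
case: (ltP 0 k) => k0; last by rewrite normr0.
rewrite (ltW k0) normrM ler_piMr// ger0_norm ?invr_ge0// invf_le1.
  by rewrite ler1n; lia.
by rewrite ltr0n; lia.
Qed.

(** The function [- d log (1 - r z)], so that [Exp lpure] is [(1 - r z)^(-d)]. *)
Definition lpure : W := mkW lpure_summ.
Arguments lpure : simpl never.
Lemma lpureE k : lpure k = if 0 < k then d * r ^+ `|k|%N / `|k|%N%:R else 0. Proof. by []. Qed.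

Lemma lpure_supp : supp_ge 1 lpure.
Proof. by move=> k k1; rewrite lpureE ltNge; case: (leP k 0) => //; lia. Qed.

Definition psi_pure : W := Exp (rev lpure - lpure).

Local Notation z := (zpow (R := R) 1).
Local Notation q := geo.
Local Notation qb := (rev geo).
Local Notation rc := (wcst r).

Lemma geo_inv : (1 - rc * z) * q = 1.
Proof.
rewrite mulrBl mul1r; apply: wiener_ext => k.
rewrite wB -mulrA wcstM zpowM w1 !geoE.
case: (ltrgtP k 0) => k0.
- by rewrite ifF; [rewrite mulr0 subrr|lia].
- rewrite ifT; last lia.
  rewrite (_ : `|k|%N = `|k - 1|%N.+1); last lia.
  by rewrite exprS subrr.
- by rewrite k0 /= mulr0 subr0.
Qed.

Lemma geo_rec : rc * (z * q) = q - 1.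
Proof. by have := geo_inv; rewrite mulrBl mul1r -mulrA => <-; ring. Qed.

Lemma geob_rec : rc * (zpow (-1) * qb) = qb - 1.
Proof. by have := congr1 rev geo_rec; rewrite !revM rev_cst rev_zpow revB rev1. Qed.

(** The Poisson kernel, [(1 - r^2) / |1 - r z|^2] on the circle. *)
Definition poisson : W := q + qb - 1.
Local Notation P := poisson.

Lemma zz : z * zpow (-1) = 1 :> W. Proof. exact: zpowV. Qed.

Lemma poissonE : P = wcst (1 - r ^+ 2) * (q * qb).
Proof.
have e1 := geo_rec; have e2 := geob_rec.
rewrite /poisson wcst_add wcst_opp wcst1 expr2 wcst_mul mulrBl mul1r.
have -> : rc * rc * (q * qb) = (rc * (z * q)) * (rc * (zpow (-1) * qb)).
  by transitivity (rc * rc * (q * qb) * (z * zpow (-1))); [rewrite zz mulr1|ring].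
by rewrite e1 e2; ring.
Qed.

Lemma lpure_deriv : wderiv lpure (wcst d * (q - 1)).
Proof.
move=> k; rewrite wcstM wB w1 geoE lpureE.
case: (ltrgtP k 0) => k0; rewrite ?mulr0 ?subr0 ?mulr0//; last by rewrite k0 /= expr0 subrr mulr0.
rewrite (_ : k%:~R = `|k|%N%:R :> R); last by rewrite -[in LHS](gez0_abs (ltW k0)).
by field; rewrite pnatr_eq0; lia.
Qed.

Lemma wderiv_rev (x y : W) : wderiv x y -> wderiv (rev x) (- rev y).
Proof. by move=> h k; rewrite wN !revE h intrN; ring. Qed.
Lemma wderivN (x y : W) : wderiv x y -> wderiv (- x) (- y).
Proof. by move=> h k; rewrite !wN h mulrN. Qed.

Lemma psi_deriv : wderiv psi_pure (- wcst d * (P - 1) * psi_pure).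
Proof.
rewrite (_ : - wcst d * (P - 1) = - rev (wcst d * (q - 1)) - wcst d * (q - 1)).
  apply: Exp_deriv; apply: wderivD; first exact/wderiv_rev/lpure_deriv.
  exact/wderivN/lpure_deriv.
by rewrite revM rev_cst revB rev1 /poisson; ring.
Qed.

Lemma psi_uni : psi_pure * rev psi_pure = 1.
Proof.
rewrite /psi_pure Exp_rev revB revK -ExpD.
by rewrite (_ : _ + _ = 0) ?Exp0//; ring.
Qed.

Lemma psi_n2 : n2 psi_pure = 1.
Proof. by rewrite -[psi_pure]mulr1 (n2_uni _ psi_uni) n2_1. Qed.

Local Notation T := (P * psi_pure).

(** The logarithmic derivative of the phase is [- d * (P - 1)]. With its constant part moved to the
    left, the coefficients of the phase become explicit multiples of those of T, and the latter stay
    bounded as r tends to 1. *)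
Lemma psi_T (k : int) : (k%:~R - d) * psi_pure k = - d * T k.
Proof.
have := psi_deriv k; rewrite -mulrA -wcst_opp wcstM mulrBl mul1r wB => h.
by rewrite mulrBl -h; ring.
Qed.

Let w : R := 1 - r ^+ 2.
Let w_gt0 : 0 < w. Proof. by have := r0; have := r1; rewrite /w; nra. Qed.

Lemma geo0 : q 0 = 1. Proof. by rewrite geoE. Qed.
Lemma geo_supp : supp_ge 0 q.
Proof. by move=> k k0; rewrite geoE leNgt k0. Qed.
Lemma poisson0 : P 0 = 1.
Proof. by rewrite /poisson wB wD w1 revE oppr0 geo0 /=; ring. Qed.
Lemma poisson_sq0 : (P * P) 0 = 2 / w - 1.
Proof.
have -> : P * P = q * q + rev (q * q) + 1 + wcst 2 * (q * qb) - wcst 2 * q - wcst 2 * qb.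
  rewrite revM /poisson (_ : 2 = 1 + 1 :> R)// wcst_add wcst1; ring.
rewrite !wB !wD !wcstM !revE oppr0 w1 eqxx mulr1n supp_ge_coef; [|exact: geo_supp..].
have e : (q * qb) 0 = w^-1.
  have := poisson0; rewrite poissonE wcstM -/w => h.
  by rewrite -[RHS]mulr1 -h mulKf// gt_eqF.
by rewrite e geo0; ring.
Qed.

Lemma n2_geo : n2 q ^+ 2 = w^-1.
Proof.
rewrite n2sq /dot; have := poisson0; rewrite poissonE wcstM -/w => h.
by rewrite -[RHS]mulr1 -h mulKf// gt_eqF.
Qed.

Lemma poisson_rev : rev P = P.
Proof. by rewrite /poisson revB revD revK rev1; ring. Qed.

Lemma n2_poisson : n2 P ^+ 2 <= 2 / w.
Proof. by rewrite n2sq /dot poisson_rev poisson_sq0; lra. Qed.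

Lemma n2_geosq : n2 (q * q) ^+ 2 <= 2 / w ^+ 3.
Proof.
have := n2_poisson; rewrite n2sq /dot poisson_rev poissonE -/w => h.
rewrite n2sq /dot revM.
have e : wcst w * (q * qb) * (wcst w * (q * qb)) = wcst (w * w) * (q * q * (qb * qb)).
  by rewrite wcst_mul; ring.
move: h; rewrite e wcstM => h.
have w3 : 0 < w ^+ 3 by rewrite exprn_gt0.
rewrite ler_pdivlMr//; move: h; rewrite ler_pdivlMr//; rewrite (_ : w ^+ 3 = w * w * w); last by ring.
by move=> h; apply: le_trans h; rewrite le_eqVlt; apply/orP; left; apply/eqP; ring.
Qed.

Let psi_mul x : n2 (x * psi_pure) = n2 x.
Proof. by rewrite mulrC (n2_uni _ psi_uni). Qed.

(** P is [w * (q * qb)] and q has squared l2 norm [1 / w], so Cauchy-Schwarz loses no power of w. *)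
Lemma T_le k : `|T k| <= 1.
Proof.
rewrite poissonE -!mulrA wcstM -/w normrM gtr0_norm//.
have := coef_le q (qb * psi_pure) k; rewrite psi_mul n2_rev -expr2 n2_geo => h.
by rewrite mulrC -ler_pdivlMr// mul1r.
Qed.

(* w |qb P psi| <= sqrt 2, via w |(q^2)(qb psi)| with |q^2|^2 <= 2/w^3, |q|^2 = 1/w *)
Lemma geoP_le x k : n2 x = n2 q -> w * `|(q * q * x) k| <= 3 / (2 * w).
Proof.
move=> hx; have := coef_le (q * q) x k; rewrite hx => h.
have a0 := n2_ge0 (q * q); have b0 := n2_ge0 q.
have h2 : (w * `|(q * q * x) k|) ^+ 2 <= (3 / (2 * w)) ^+ 2.
  apply: (@le_trans _ _ ((w * (n2 (q * q) * n2 q)) ^+ 2)).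
    by rewrite ler_pXn2r ?nnegrE ?mulr_ge0 ?(ltW w_gt0)// ler_wpM2l// ltW.
  rewrite !exprMn n2_geo; apply: (@le_trans _ _ (w ^+ 2 * (2 / w ^+ 3 / w))).
    by rewrite ler_wpM2l ?sqr_ge0// ler_wpM2r ?invr_ge0 ?(ltW w_gt0)// n2_geosq.
  have -> : w ^+ 2 * (2 / w ^+ 3 / w) = 2 / w ^+ 2 by field; rewrite gt_eqF.
  have -> : 3 ^+ 2 * (2 * w)^-1 ^+ 2 = 9 / 4 / w ^+ 2 :> R by field; rewrite gt_eqF.
  by rewrite ler_pM2r ?invr_gt0 ?exprn_gt0//; lra.
move: h2; rewrite ler_pXn2r// nnegrE ?mulr_ge0 ?(ltW w_gt0)//.
by rewrite invr_ge0 mulr_ge0// ltW.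
Qed.

Hypothesis rhalf : 1 / 2 <= r.

(** The factor [1 - z] cancels one [1 / (1 - r z)] up to a remainder weighted by [1 - r]; uniformity
    in r is kept this way in the estimates of T. *)
Lemma one_sub_z_q : rc * ((1 - z) * q) = 1 - wcst (1 - r) * q.
Proof.
rewrite wcst_add wcst_opp wcst1.
have -> : rc * ((1 - z) * q) = rc * q - rc * (z * q) by ring.
by rewrite geo_rec; ring.
Qed.
Lemma one_sub_z_qb : rc * ((1 - z) * qb) = - z * (1 - wcst (1 - r) * qb).
Proof.
have e := congr1 rev one_sub_z_q; rewrite !(revM, revB, rev1, rev_cst, rev_zpow) in e.
rewrite -e.
by transitivity (rc * ((z * zpow (-1) - z) * qb)); [rewrite zz|ring].
Qed.

Definition geo' : W := rc * (z * (q * q)).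
(** Both sides vanish below index 1 and satisfy the same first-order recurrence, obtained by
    multiplying by [1 - r z]. *)
Lemma geo_deriv : wderiv q geo'.
Proof.
have e : (1 - rc * z) * geo' = rc * (z * q).
  transitivity (rc * (z * (q * ((1 - rc * z) * q)))); first by rewrite /geo'; ring.
  by rewrite geo_inv mulr1.
have gen (x y : W) k : (1 - rc * z) * x = y -> x k = r * x (k - 1) + y k.
  by move=> E; have := wap E k; rewrite mulrBl mul1r wB -mulrA wcstM zpowM; lra.
have rec k : geo' k = r * geo' (k - 1) + r * q (k - 1).
  by rewrite (gen _ _ k e) wcstM zpowM.
have s : supp_ge 1 geo'.
  move=> k k1; rewrite /geo' wcstM zpowM (@supp_geM _ 0 0) ?mulr0//; [exact: geo_supp|exact: geo_supp|lia].
move=> k; case: (ltP k 1) => k1.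
  rewrite s// geoE; case: ifP => k0; last by rewrite mulr0.
  by rewrite (_ : k = 0) ?mul0r//; lia.
have -> : k = (`|k|.-1)%:Z + 1 by lia.
elim: (`|k|.-1) => [|n IH].
  by rewrite add0r rec subrr geo0 s ?mulr0 ?add0r// mul1r mulr1 geoE.
have qrec : q (n.+1%:Z + 1) = r * q (n%:Z + 1).
  rewrite (gen _ _ (n.+1%:Z + 1) geo_inv) w1 (_ : n.+1%:Z + 1 - 1 = n%:Z + 1); last by lia.
  by rewrite [_ == _](_ : _ = false) ?addr0//; lia.
rewrite rec (_ : n.+1%:Z + 1 - 1 = n%:Z + 1); last by lia.
rewrite IH qrec (_ : n.+1%:Z + 1 = n%:Z + 1 + 1); last by lia.
by rewrite [in RHS]intrD; ring.
Qed.

Lemma P_deriv : wderiv P (wcst w * (geo' * qb - q * rev geo')).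
Proof.
rewrite poissonE -/w.
have h := wderivM geo_deriv (wderiv_rev geo_deriv).
by have := wderivM (wderiv_cst w) h; rewrite mul0r add0r mulrN.
Qed.

Lemma one_sub_z_dP : (1 - z) * (wcst w * (geo' * qb - q * rev geo')) =
  z * P + P - wcst (1 - r) * (z * (q * P) + qb * P).
Proof.
rewrite /geo' !revM rev_cst rev_zpow poissonE -/w.
have -> : (1 - z) * (wcst w * (rc * (z * (q * q)) * qb - q * (rc * (zpow (-1) * (qb * qb))))) =
  wcst w * (z * (q * qb) * (rc * ((1 - z) * q)) - (q * qb) * zpow (-1) * (rc * ((1 - z) * qb))) by ring.
rewrite one_sub_z_q one_sub_z_qb.
transitivity (wcst w * (z * (q * qb) * (1 - wcst (1 - r) * q) + (z * zpow (-1)) * (q * qb) * (1 - wcst (1 - r) * qb))).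
  by ring.
by rewrite zz; ring.
Qed.

Lemma one_sub_z_PP : rc * ((1 - z) * (P * P)) = wcst w * (qb * P) - wcst (1 - r) * (P * P).
Proof.
rewrite {1}poissonE -/w.
have -> : rc * ((1 - z) * (wcst w * (q * qb) * P)) = wcst w * (qb * P) * (rc * ((1 - z) * q)) by ring.
rewrite one_sub_z_q [in X in _ = _ - X]poissonE -/w.
by rewrite poissonE -/w; ring.
Qed.

Let qP_le k : (1 - r) * `|(q * P * psi_pure) k| <= 3 / 2.
Proof.
have -> : q * P * psi_pure = wcst w * (q * q * (qb * psi_pure)) by rewrite poissonE -/w; ring.
rewrite wcstM normrM gtr0_norm//.
have := geoP_le (x := qb * psi_pure) k; rewrite psi_mul n2_rev => /(_ erefl) h.
have hr0 := r0; have hr1 := r1; have r1' : 0 < 1 - r by lra.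
apply: le_trans (ler_wpM2l (ltW r1') h) _.
rewrite (_ : w = (1 - r) * (1 + r)); last by rewrite /w; ring.
have -> : (1 - r) * (3 / (2 * ((1 - r) * (1 + r)))) = 3 / 2 / (1 + r) by field; apply/andP; split; apply/eqP; lra.
by rewrite ler_pdivrMr; lra.
Qed.

Let wqbP_le k : w * `|(qb * P * psi_pure) k| <= 3 / 2.
Proof.
have e : qb * P * psi_pure = wcst w * (qb * qb * (q * psi_pure)) by rewrite poissonE -/w; ring.
have -> : (qb * P * psi_pure) k = w * (q * q * rev (q * psi_pure)) (- k).
  by rewrite e wcstM -[qb * qb * _](revK) revE !revM !revK.
have h := geoP_le (x := rev (q * psi_pure)) (- k).
rewrite n2_rev psi_mul in h; have {}h := h erefl.
rewrite normrM gtr0_norm//.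
apply: le_trans (ler_wpM2l (ltW w_gt0) h) _.
by rewrite le_eqVlt; apply/orP; left; apply/eqP; field; rewrite gt_eqF.
Qed.

Let qbP_le k : (1 - r) * `|(qb * P * psi_pure) k| <= 3 / 2.
Proof.
apply: le_trans (wqbP_le k); rewrite ler_wpM2r//.
by have := r0; have := r1; rewrite /w; nra.
Qed.

Let PP_le k : (1 - r) * `|(P * P * psi_pure) k| <= 2.
Proof.
have h := coef_le P (P * psi_pure) k; rewrite psi_mul -expr2 mulrA in h.
have hr0 := r0; have hr1 := r1; have r1' : 0 < 1 - r by lra.
apply: le_trans (ler_wpM2l (ltW r1') (le_trans h n2_poisson)) _.
rewrite (_ : w = (1 - r) * (1 + r)); last by rewrite /w; ring.
have -> : (1 - r) * (2 / ((1 - r) * (1 + r))) = 2 / (1 + r) by field; apply/andP; split; apply/eqP; lra.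
by rewrite ler_pdivrMr; lra.
Qed.

Hypothesis dhalf : `|d| <= 1 / 2.

(** Up to sign conventions this is a coefficient of the derivation applied to [(1 - z) * T].
    Differentiation raises the order of the singularity by one and [1 - z] lowers it again. What
    remains is T itself and terms weighted by [1 - r] or [w], each controlled by Cauchy-Schwarz
    uniformly in r. *)
Lemma T_diff (k : int) : `|k%:~R * (T k - T (k - 1))| <= 12.
Proof.
have e k' : ((1 - z) * T) k' = T k' - T (k' - 1) by rewrite mulrBl mul1r wB zpowM.
have dz : wderiv (1 - z) (- z).
  move=> j; rewrite wN wB w1 zpowE.
  case: (eqVneq j 1) => [->|j1]; first by rewrite /= mul1r sub0r.
  case: (eqVneq j 0) => [->|j0]; first by rewrite mul0r oppr0.
  by rewrite /= subrr mulr0 oppr0.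
have := wderivM dz (wderivM P_deriv psi_deriv) k.
rewrite e => <-.
have -> : - z * (P * psi_pure) + (1 - z) * (wcst w * (geo' * qb - q * rev geo') * psi_pure + P * (- wcst d * (P - 1) * psi_pure)) =
  - (z * T) + ((1 - z) * (wcst w * (geo' * qb - q * rev geo'))) * psi_pure + wcst d * ((1 - z) * T - (1 - z) * (P * P) * psi_pure).
  by ring.
rewrite one_sub_z_dP.
have -> : (z * P + P - wcst (1 - r) * (z * (q * P) + qb * P)) * psi_pure =
   z * T + T - wcst (1 - r) * (z * (q * P * psi_pure)) - wcst (1 - r) * (qb * P * psi_pure) by ring.
have hr0 := r0; have hr1 := r1; have hrh := rhalf.
have hPP : `|((1 - z) * (P * P) * psi_pure) k| <= 7.
  have : (wcst r * ((1 - z) * (P * P) * psi_pure)) k = (wcst w * (qb * P * psi_pure) - wcst (1 - r) * (P * P * psi_pure)) k.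
    congr (wv _ _); transitivity (rc * ((1 - z) * (P * P)) * psi_pure); first by ring.
    by rewrite one_sub_z_PP; ring.
  rewrite wB !wcstM => E.
  have h1 := wqbP_le k; have h2 := PP_le k.
  have : r * `|((1 - z) * (P * P) * psi_pure) k| <= 7 / 2.
    rewrite -[X in X * `|_|](ger0_norm r0) -normrM E; apply: le_trans (ler_normB _ _) _.
    by rewrite !normrM (gtr0_norm w_gt0) (@ger0_norm _ (1 - r)); lra.
  have := normr_ge0 (((1 - z) * (P * P) * psi_pure) k); nra.
rewrite !(wD, wB, wN, wcstM) e !zpowM.
have t1 := T_le k; have t2 := T_le (k - 1).
have q1 := qP_le (k - 1); have q2 := qbP_le k.
have r1' : 0 <= 1 - r by lra.
move: q1 q2; rewrite -[X in X * `|_|](ger0_norm r1') -normrM => q1.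
rewrite -[X in X * `|_|](ger0_norm r1') -normrM => q2.
have q3 : `|d * (T k - T (k - 1) - ((1 - z) * (P * P) * psi_pure) k)| <= 1 / 2 * (1 + 1 + 7).
  rewrite normrM; apply: ler_pM => //.
  by apply: le_trans (ler_normB _ _) _; apply: lerD => //; apply: le_trans (ler_normB _ _) _; apply: lerD.
apply: le_trans (ler_normD _ _) _.
have -> : - T (k - 1) + (T (k - 1) + T k - (1 - r) * (q * P * psi_pure) (k - 1) - (1 - r) * (qb * P * psi_pure) k) =
   T k - (1 - r) * (q * P * psi_pure) (k - 1) - (1 - r) * (qb * P * psi_pure) k by ring.
have : `|T k - (1 - r) * (q * P * psi_pure) (k - 1) - (1 - r) * (qb * P * psi_pure) k| <= 1 + 3 / 2 + 3 / 2.
  by apply: le_trans (ler_normB _ _) _; apply: lerD => //; apply: le_trans (ler_normB _ _) _; apply: lerD.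
lra.
Qed.

Lemma psi_pure_le (k : nat) : (0 < k)%N -> `|psi_pure k| <= k%:R^-1.
Proof.
move=> k0; have k1 : 1 <= k%:R :> R by rewrite ler1n.
have := psi_T k; have := T_le k => t h.
have dd := dhalf; rewrite ler_norml in dd.
have e : `|(k%:R - d) * psi_pure k| <= 1 / 2.
  rewrite -[k%:R]/(k%:~R) h normrM normrN -[leRHS]mulr1; exact: ler_pM.
move: e; rewrite normrM ger0_norm; last by lra.
move=> e; rewrite -[leRHS]mul1r ler_pdivlMr; last lra.
have := normr_ge0 (psi_pure k); nra.
Qed.

Lemma psi_pure_diff (k : nat) : (1 < k)%N -> `|psi_pure k - psi_pure (k%:Z - 1)| <= 12 / k%:R ^+ 2.
Proof.
move=> k1; set t : R := k%:R; have t2 : 2 <= t by rewrite /t ler_nat.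
have dd := dhalf; rewrite ler_norml in dd.
have a1 : t - d != 0 by apply/eqP; lra.
have a2 : t - 1 - d != 0 by apply/eqP; lra.
have e1 : psi_pure k = - d * T k / (t - d) by rewrite -psi_T mulrAC divff ?mul1r.
have e2 : psi_pure (k%:Z - 1) = - d * T (k%:Z - 1) / (t - 1 - d).
  by rewrite -psi_T intrB mulrAC divff ?mul1r.
have -> : psi_pure k - psi_pure (k%:Z - 1) =
   - d * ((T k - T (k%:Z - 1)) / (t - d) - T (k%:Z - 1) / ((t - d) * (t - 1 - d))).
  by rewrite e1 e2; field; rewrite a1 a2.
have hT : `|T k - T (k%:Z - 1)| <= 12 / t.
  have := T_diff k; rewrite normrM (_ : `|k%:~R| = t) => [h|]; last by rewrite ger0_norm.
  by rewrite ler_pdivlMr 1?mulrC//; lra.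
have b1 : `|(T k - T (k%:Z - 1)) / (t - d)| <= 12 / t * (4 / 3 / t).
  rewrite normrM; apply: ler_pM => //; rewrite normfV gtr0_norm; last lra.
  rewrite -[leLHS]mul1r ler_pdivrMr; last lra.
  by rewrite mulrAC ler_pdivlMr; lra.
have b2 : `|T (k%:Z - 1) / ((t - d) * (t - 1 - d))| <= 1 * (16 / 3 / t ^+ 2).
  rewrite normrM; apply: ler_pM => //; first exact: T_le.
  rewrite normfV gtr0_norm; last by rewrite mulr_gt0; lra.
  rewrite -[leLHS]mul1r ler_pdivrMr; last by rewrite mulr_gt0; lra.
  rewrite mulrAC ler_pdivlMr; last by rewrite exprn_gt0; lra.
  by nra.
rewrite normrM normrN; apply: (@le_trans _ _ (1 / 2 * (12 / t * (4 / 3 / t) + 1 * (16 / 3 / t ^+ 2)))).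
  by apply: ler_pM => //; apply: le_trans (ler_normB _ _) _; apply: lerD.
have -> : 1 / 2 * (12 / t * (4 / 3 / t) + 1 * (16 / 3 / t ^+ 2)) = (32 / 3) / t ^+ 2 by field; lra.
by rewrite ler_wpM2r ?invr_ge0 ?sqr_ge0//; lra.
Qed.

End PureFactor.

(** * Splitting a convolution at half the index *)

Section NearFar.
Context {R : realType}.
Variable n : nat.
Hypothesis n0 : (0 < n)%N.

Let near_part N :
  \sum_(i < N) (if (2 * i <= n)%N then (1 + i%:R : R)^-1 else 0) <= 2 * Num.sqrt (minn N n.+1)%:R.
Proof.
elim: N => [|N IH]; first by rewrite big_ord0 mulr_ge0// sqrtr_ge0.
rewrite big_ord_recr/=; case: ifPn => hN; last first.
  rewrite addr0; apply: le_trans IH _; rewrite ler_wpM2l// ler_wsqrtr// ler_nat; lia.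
apply: le_trans (lerD IH (lexx _)) _.
have -> : minn N n.+1 = N by lia.
have -> : minn N.+1 n.+1 = N.+1 by lia.
rewrite -[N.+1%:R]natr1; set a := Num.sqrt N%:R; set b := Num.sqrt (_ + 1).
have t0 : 0 <= N%:R :> R by [].
have a2 : a ^+ 2 = N%:R by rewrite sqr_sqrtr.
have b2 : b ^+ 2 = N%:R + 1 by rewrite sqr_sqrtr// addr_ge0.
have a0 : 0 <= a := sqrtr_ge0 _.
have b0 : 0 <= b := sqrtr_ge0 _.
have ab : a <= b by rewrite ler_wsqrtr// lerDl.
have b1 : 1 <= b by rewrite -(@ler_pXn2r _ 2) ?nnegrE// b2 expr1n lerDr.
rewrite addrC [1 + _]addrC -b2 -lerBrDr -mulrBr.
rewrite -[leLHS]mul1r ler_pdivrMr ?exprn_gt0//; last lra.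
have e : (b - a) * (b + a) = 1 by rewrite -subr_sqr b2 a2; ring.
nra.
Qed.

(** A harmonic sum up to n is bounded crudely by a square root. This is enough, since the far
    indices contribute n^(-3/2) anyway. *)
Lemma near_sum (f : int -> R) (M : R) : 0 <= M ->
  (forall k : int, `|f k| <= (if (2 * `|k| <= n)%N then M * (`|k|%N%:R * omega k) else 0)) ->
  summ f /\ rsum (fun k => `|f k|) <= 8 * M * Num.sqrt n%:R.
Proof.
move=> M0 hf; apply: summ_itrunc => N.
have g1 (k : int) (i : nat) : (i <= `|k|)%N -> `|f k| <= M * (if (2 * i <= n)%N then (1 + i%:R : R)^-1 else 0).
  move=> ik; apply: le_trans (hf k) _; case: ifPn => h1; last first.
    by rewrite mulr_ge0//; case: ifP => // _; rewrite invr_ge0 addr_ge0.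
  rewrite ifT; last lia.
  rewrite ler_wpM2l// /omega.
  have p : 0 < 1 + i%:R :> R by rewrite ltr_wpDr.
  have q : 0 < 1 + `|k|%N%:R :> R by rewrite ltr_wpDr.
  have iq : i%:R <= `|k|%N%:R :> R by rewrite ler_nat.
  rewrite ler_pdivrMr ?exprn_gt0// mulrC -[leLHS]mulr1 ler_pdivlMr//.
  have : 0 <= `|k|%N%:R :> R by [].
  have : 0 <= i%:R :> R by [].
  nra.
rewrite /itrunc big_split/=.
have S : \sum_(i < N) M * (if (2 * i <= n)%N then (1 + i%:R : R)^-1 else 0) <= 4 * M * Num.sqrt n%:R.
  rewrite -mulr_sumr -mulrA mulrCA ler_wpM2l//; apply: le_trans (near_part N) _.
  have -> : 4 * Num.sqrt n%:R = 2 * (2 * Num.sqrt n%:R) :> R by ring.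
  rewrite ler_wpM2l//.
  have -> : 2 * Num.sqrt n%:R = Num.sqrt (4 * n%:R) :> R.
    by rewrite sqrtrM// (_ : 4 = 2 ^+ 2) ?sqrtr_sqr ?ger0_norm// -natrX.
  by rewrite ler_wsqrtr// -natrM ler_nat; lia.
rewrite (_ : 8 * M * _ = 4 * M * Num.sqrt n%:R + 4 * M * Num.sqrt n%:R); last by ring.
by apply: lerD; apply: le_trans S; apply: ler_sum => i _; apply: g1; lia.
Qed.

Let far_part N : \sum_(i < N) (if (n < 2 * i)%N then (1 + i%:R : R) ^- 2 else 0) <=
  if (n < 2 * N)%N then 2 / n%:R - N%:R^-1 else 0.
Proof.
have n1 : 1 <= n%:R :> R by rewrite ler1n.
elim: N => [|N IH]; first by rewrite big_ord0 muln0.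
rewrite big_ord_recr/=; apply: le_trans (lerD IH (lexx _)) _.
case: (ltnP n (2 * N)) => h1.
  rewrite ifT; last lia.
  have N1 : 1 <= N%:R :> R by rewrite ler1n; lia.
  rewrite -[N.+1%:R]natr1; set t : R := N%:R in N1 *.
  have E : t^-1 - (t + 1)^-1 - (1 + t) ^- 2 = t^-1 * (1 + t) ^- 2 by field; apply/andP; split; apply/eqP; lra.
  have P : 0 <= t^-1 * (1 + t) ^- 2.
    by rewrite mulr_ge0 ?invr_ge0 ?exprn_ge0//; lra.
  rewrite -E in P; rewrite -subr_ge0; apply: le_trans P _.
  by rewrite le_eqVlt; apply/orP; left; apply/eqP; ring.
rewrite addr0; case: ifPn => // h2.
rewrite subr_ge0 -[leLHS]mul1r ler_pdivrMr// mulrAC ler_pdivlMr; last lra.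
by rewrite mul1r -natrM ler_nat; lia.
Qed.

Lemma far_sum (f : int -> R) (M : R) : 0 <= M ->
  (forall k : int, `|f k| <= (if (n < 2 * `|k|)%N then M * omega k else 0)) ->
  summ f /\ rsum (fun k => `|f k|) <= 4 * M / n%:R.
Proof.
move=> M0 hf; apply: summ_itrunc => N.
have n1 : 1 <= n%:R :> R by rewrite ler1n.
have S N' : \sum_(i < N') (if (n < 2 * i)%N then (1 + i%:R : R) ^- 2 else 0) <= 2 / n%:R.
  apply: le_trans (far_part N') _; case: ifP => _; last by rewrite divr_ge0//; lra.
  by rewrite gerBl invr_ge0.
rewrite /itrunc big_split/= (_ : 4 * M / n%:R = M * (2 / n%:R) + M * (2 / n%:R)); last by ring.
apply: lerD.
  apply: le_trans (ler_wpM2l M0 (S N)); rewrite mulr_sumr; apply: ler_sum => i _.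
  apply: le_trans (hf _) _; rewrite absz_nat; case: ifP => _; rewrite ?mulr0//.
apply: le_trans (ler_wpM2l M0 (S N.+1)); rewrite -(big_mkord xpredT (fun i => if (n < 2 * i)%N then (1 + i%:R : R) ^- 2 else 0)) big_nat_recl// muln0 ltn0 add0r big_mkord mulr_sumr; apply: ler_sum => i _.
by apply: le_trans (hf _) _; rewrite /omega /=; case: ifP => _; rewrite ?mulr0.
Qed.

End NearFar.

Section PhaseDifference.
Context {R : realType}.
Local Notation W := (wiener R).
Variables (r d M : R) (r0 : 0 <= r) (r1 : r < 1) (rhalf : 1 / 2 <= r) (dhalf : `|d| <= 1 / 2).
Variable u : W.
Hypothesis M0 : 0 <= M.
Hypothesis uM : decays M u.
Hypothesis u1 : rsum u = 1.

Local Notation psi0 := (psi_pure d r0 r1).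

Lemma psi_pure_step (n : nat) (j a : nat) : (0 < n)%N -> (0 < a)%N -> (n <= 2 * a)%N ->
  `|psi0 (a + j)%N - psi0 a| <= j%:R * (48 / n%:R ^+ 2).
Proof.
move=> n0 a0 na; elim: j => [|j IH]; first by rewrite addn0 subrr normr0 mul0r.
have -> : psi0 (a + j.+1)%N - psi0 a = (psi0 (a + j.+1)%N - psi0 ((a + j.+1)%N%:Z - 1)) + (psi0 (a + j)%N - psi0 a).
  by rewrite (_ : (a + j.+1)%N%:Z - 1 = (a + j)%N); [ring|lia].
apply: le_trans (ler_normD _ _) _; rewrite -natr1 mulrDl mul1r addrC; apply: lerD => //.
have aj : (1 < a + j.+1)%N by lia.
apply: le_trans (psi_pure_diff r0 r1 rhalf dhalf aj) _.
have n1 : 0 < n%:R :> R by rewrite ltr0n.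
rewrite ler_pdivrMr; last by rewrite exprn_gt0// ltr0n; lia.
rewrite mulrAC ler_pdivlMr ?exprn_gt0//.
have h : n%:R <= 2 * (a + j.+1)%:R :> R by rewrite -natrM ler_nat; lia.
nra.
Qed.

Lemma psi_pure_near (n : nat) (k : int) : (0 < n)%N -> (2 * `|k| <= n)%N ->
  `|psi0 (n%:Z - k) - psi0 n| <= `|k|%N%:R * (48 / n%:R ^+ 2).
Proof.
move=> n0 kn; case: (lerP 0 k) => k0.
  have := @psi_pure_step n `|k| (n - `|k|)%N n0.
  have -> : (n - `|k| + `|k|)%N = n by lia.
  rewrite distrC (_ : (n - `|k|)%N%:Z = n%:Z - k); last lia.
  by apply; lia.
have := @psi_pure_step n `|k| n n0 n0.
rewrite (_ : (n + `|k|)%N%:Z = n%:Z - k); last lia.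
by apply; lia.
Qed.

(** As u sums to 1, the difference is the sum of [u_k * (psi0_(n-k) - psi0_n)]. For [2 |k| <= n] the
    increments are bounded by [psi_pure_near]; the other indices carry mass O(1 / n), and their
    product with psi0 is bounded in l2. The constant is 392 = 8 * 48 + 4 + 4. *)
Lemma phase_diff (n : nat) : (0 < n)%N ->
  ((u * psi0) n - psi0 n) ^+ 2 <= (392 * M) ^+ 2 / n%:R ^+ 3.
Proof.
move=> n0; pose s : R := Num.sqrt n%:R.
have n1' : 1 <= n%:R :> R by rewrite ler1n.
have s2 : s ^+ 2 = n%:R by rewrite sqr_sqrtr.
have s1 : 1 <= s by rewrite -(@ler_pXn2r _ 2) ?nnegrE ?sqrtr_ge0// s2 expr1n.
have s0 : 0 < s by lra.
pose un := wproj (fun k : int => (2 * `|k| <= n)%N) u.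
pose uf := wproj (fun k : int => (n < 2 * `|k|)%N) u.
have uE : u = un + uf.
  apply: wiener_ext => k; rewrite wD !wprojE.
  by case: leqP; rewrite ?addr0 ?add0r.
have [sf bf] := @far_sum R n n0 uf M M0 (fun k => ltac:(by rewrite wprojE; case: ifP => // _; rewrite normr0)).
have snear (k : int) : `|un k * (psi0 (n%:Z - k) - psi0 n)| <= (if (2 * `|k| <= n)%N then 48 / n%:R ^+ 2 * M * (`|k|%N%:R * omega k) else 0).
  rewrite wprojE; case: ifP => h; last by rewrite mul0r normr0.
  rewrite normrM (_ : 48 / _ * M * _ = M * omega k * (`|k|%N%:R * (48 / n%:R ^+ 2))); last by ring.
  by apply: ler_pM => //; exact: psi_pure_near.
have c0 : 0 <= 48 / n%:R ^+ 2 * M by rewrite mulr_ge0// divr_ge0// exprn_ge0//; lra.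
have [sn bn] := @near_sum R n n0 (fun k => un k * (psi0 (n%:Z - k) - psi0 n)) _ c0 snear.
have E : (u * psi0) n - psi0 n = rsum (fun k => un k * (psi0 (n%:Z - k) - psi0 n)) - rsum uf * psi0 n + (uf * psi0) n.
  have e1 : (un * psi0) n = rsum (fun k => un k * (psi0 (n%:Z - k) - psi0 n)) + rsum un * psi0 n.
    rewrite wM -(rsumZr (psi0 n) (wsumm un)) -rsumD//; last exact/summZr/wsumm.
    by apply: eq_rsum => k; ring.
  have e2 : rsum un + rsum uf = 1.
    by rewrite -u1 -rsumD; [|exact: wsumm..]; apply: eq_rsum => k; rewrite -wD -uE.
  rewrite {1}uE mulrDl wD e1 (_ : rsum un = 1 - rsum uf); [ring|lra].
have b1 : `|rsum (fun k => un k * (psi0 (n%:Z - k) - psi0 n))| <= 384 * M / (n%:R * s).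
  apply: le_trans (ler_norm_rsum sn) _; apply: le_trans bn _.
  by rewrite -/s -s2 le_eqVlt; apply/orP; left; apply/eqP; field; lra.
have b2 : `|rsum uf * psi0 n| <= 4 * M / (n%:R * s).
  rewrite normrM; apply: (@le_trans _ _ (4 * M / n%:R * n%:R^-1)).
    apply: ler_pM => //; last exact: psi_pure_le.
    exact: le_trans (ler_norm_rsum sf) bf.
  rewrite invfM mulrA ler_wpM2l//; first by rewrite divr_ge0// mulr_ge0.
  by rewrite lef_pV2 ?posrE//; [rewrite -s2; nra|lra].
have b3 : `|(uf * psi0) n| <= 4 * M / (n%:R * s).
  apply: le_trans (coef_le _ _ _) _; rewrite psi_n2 mulr1.
  rewrite -(@ler_pXn2r _ 2) ?nnegrE ?n2_ge0//; last by rewrite divr_ge0 ?mulr_ge0//; lra.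
  rewrite n2sq dotE.
  apply: (@le_trans _ _ (rsum (fun k => 4 * M / n%:R ^+ 2 * `|uf k|))).
    apply: ler_rsum; [exact: dot_summ|exact/summZ/summ_abs/wsumm|] => k.
    apply: le_trans (ler_norm _) _; rewrite normrM ler_wpM2r// wprojE.
    case: ifPn => h; last by rewrite normr0 divr_ge0 ?exprn_ge0 ?mulr_ge0//; lra.
    apply: le_trans (uM k) _; rewrite mulrC -mulrA [M / _]mulrC mulrA ler_wpM2r// /omega.
    rewrite -[leLHS]mul1r ler_pdivrMr ?exprn_gt0 ?ltr_wpDr// mulrAC ler_pdivlMr ?exprn_gt0//; last lra.
    have nk : n%:R <= 2 * `|k|%N%:R :> R by rewrite -natrM ler_nat ltnW.
    have k0 : 0 <= `|k|%N%:R :> R by [].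
    rewrite mul1r (_ : 4 * _ = (2 * (1 + `|k|%N%:R)) ^+ 2); last by ring.
    rewrite ler_pXn2r ?nnegrE ?mulr_ge0 ?addr_ge0//.
    by apply: le_trans nk _; rewrite ler_wpM2l// lerDr.
  rewrite rsumZ; last exact/summ_abs/wsumm.
  apply: le_trans (ler_wpM2l _ bf) _; first by rewrite divr_ge0 ?exprn_ge0 ?mulr_ge0//; lra.
  by rewrite -s2 le_eqVlt; apply/orP; left; apply/eqP; field; lra.
have B : `|(u * psi0) n - psi0 n| <= 392 * M / (n%:R * s).
  rewrite E; apply: le_trans (ler_normD _ _) _.
  apply: le_trans (lerD (le_trans (ler_normB _ _) (lerD b1 b2)) b3) _.
  by rewrite -!mulrDl ler_wpM2r//; [rewrite invr_ge0 mulr_ge0//; lra|lra].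
rewrite -real_normK ?num_real//; apply: (@le_trans _ _ ((392 * M / (n%:R * s)) ^+ 2)).
  have P0 := le_trans (normr_ge0 _) B; by rewrite ler_pXn2r ?nnegrE.
by rewrite le_eqVlt; apply/orP; left; apply/eqP; rewrite expr_div_n [(n%:R * s) ^+ 2]exprMn s2 -exprSr.
Qed.

End PhaseDifference.

(** * Integrals over the circle *)

Section CircleIntegral.
Context {R : realType}.
Local Notation mu := (@lebesgue_measure R).
Local Notation D := [set` `](- (pi : R)), (pi : R)]%R].
Implicit Types f g : R -> R.

Lemma Rintegral_FTC (F f : R -> R) (a b : R) : a < b ->
  (forall x, a <= x <= b -> is_derive x 1 F (f x)) ->
  {within `[a, b], continuous f} ->
  Rintegral mu `[a, b] f = F b - F a.
Proof.
move=> ab hF cf; rewrite /Rintegral (@continuous_FTC2 _ f F a b)//.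
  have dF x : a <= x <= b -> derivable F x 1 by move=> /hF; case.
  have cF x : a <= x <= b -> {for x, continuous F}.
    by move=> /dF /derivable1_diffP /differentiable_continuous.
  split.
  - by move=> x; rewrite in_itv/= => /andP[ax xb]; apply: dF; rewrite !ltW.
  - by apply: cvg_at_right_filter; apply: cF; rewrite lexx ltW.
  - by apply: cvg_at_left_filter; apply: cF; rewrite lexx ltW.
move=> x; rewrite in_itv/= => /andP[ax xb].
have hx : a <= x <= b by rewrite !ltW.
by rewrite derive1E; have [_ ->] := hF x hx.
Qed.

Lemma cont_within (f : R -> R) (A : set R) : continuous f -> {within A, continuous f}.
Proof. by move=> cf; apply: continuous_subspaceT. Qed.

Lemma D_sub : D `<=` `[- pi, pi].
Proof. by move=> x /=; rewrite !in_itv/= => /andP[/ltW -> ->]. Qed.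

Lemma mD : measurable D. Proof. exact: measurable_itv. Qed.

Lemma cont_integrable f (a b : R) : continuous f -> mu.-integrable `[a, b] (EFin \o f).
Proof.
move=> cf; apply: continuous_compact_integrable; first exact: segment_compact.
exact: cont_within.
Qed.

Lemma cont_integrableD f : continuous f -> mu.-integrable D (EFin \o f).
Proof.
move=> cf; apply: (@integrableS _ _ _ mu `[- pi, pi]) => //.
  exact: D_sub.
exact: cont_integrable.
Qed.

Lemma muD : mu D = (2 * pi)%:E.
Proof.
rewrite lebesgue_measure_itv/= lte_fin ifT; last by have := pi_gt0 R; lra.
by rewrite -EFinD; congr EFin; ring.
Qed.

Lemma bounded_integrableD f (M : R) : measurable_fun D f -> (forall x, `|f x| <= M) ->
  mu.-integrable D (EFin \o f).
Proof.
move=> mf fM; apply: measurable_bounded_integrable => //.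
  by rewrite [X in (X < _)%E]muD ltry.
exists M; split; first exact: num_real.
by move=> y yM x _ /=; apply: le_trans (fM x) (ltW yM).
Qed.

Lemma RintegralD_le f (M : R) : mu.-integrable D (EFin \o f) -> (forall x, D x -> `|f x| <= M) ->
  `|Rintegral mu D f| <= 2 * pi * M.
Proof.
move=> intf fM; apply: le_trans (le_normr_Rintegral _ intf) _ => //.
have -> : 2 * pi * M = Rintegral mu D (cst M).
  by rewrite Rintegral_cst// [X in fine X]muD/=; ring.
apply: le_Rintegral => //.
- exact: (integrable_norm intf).
- by apply: cont_integrableD => x; exact: cst_continuous.
Qed.

Lemma eq_circle f g : (forall x, D x -> f x = g x) -> Rintegral mu D f = Rintegral mu D g.
Proof. by move=> fg; apply: eq_Rintegral => x /set_mem; exact: fg. Qed.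

Lemma sin_pi_int (k : int) : sin (k%:~R * pi) = 0 :> R.
Proof.
have nat_case (n : nat) : sin (n%:R * pi) = 0 :> R.
  elim: n => [|n IH]; first by rewrite mul0r sin0.
  by rewrite -natr1 mulrDl mul1r sinDpi IH oppr0.
case: k => n; first exact: nat_case.
by rewrite NegzE intrN mulNr sinN nat_case oppr0.
Qed.

Lemma is_derive_sin_lin (c x : R) : is_derive x 1 (fun t => sin (c * t)) (c * cos (c * x)).
Proof.
have h : is_derive x 1 (fun t : R => c * t) c.
  by rewrite -[X in is_derive _ _ _ X]mulr1; apply: is_deriveZ.
by rewrite mulrC; apply: (@is_derive1_comp _ sin (fun t : R => c * t)).
Qed.

Lemma is_derive_cos_lin (c x : R) : is_derive x 1 (fun t => cos (c * t)) (- c * sin (c * x)).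
Proof.
have h : is_derive x 1 (fun t : R => c * t) c.
  by rewrite -[X in is_derive _ _ _ X]mulr1; apply: is_deriveZ.
rewrite mulNr -mulrN mulrC; apply: (@is_derive1_comp _ cos (fun t : R => c * t)).
Qed.

Lemma cos_lin_continuous (c : R) : continuous (fun t : R => cos (c * t)).
Proof.
by move=> x; have [/derivable1_diffP /differentiable_continuous] := is_derive_cos_lin c x.
Qed.
Lemma RintegralD_closed f : mu.-integrable D (EFin \o f) ->
  Rintegral mu D f = Rintegral mu [set` `[- pi, pi]%R] f.
Proof. exact: Rintegral_itv_obnd_cbnd. Qed.

Lemma circle_cos (k : int) : Rintegral mu D (fun l : R => cos (k%:~R * l)) = if k == 0 then 2 * pi else 0.
Proof.
have cc := @cos_lin_continuous k%:~R.
case: eqP => [->|/eqP k0].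
  rewrite (@eq_circle _ (cst 1)); last by move=> x _; rewrite mul0r cos0.
  by rewrite Rintegral_cst// [X in fine X]muD/= mul1r.
rewrite RintegralD_closed; last exact: cont_integrableD.
have kR : k%:~R != 0 :> R by rewrite intr_eq0.
pose F t : R := k%:~R^-1 * sin (k%:~R * t).
transitivity (F pi - F (- pi)); last first.
  by rewrite /F mulrN sinN !sin_pi_int oppr0 !mulr0 subrr.
apply: Rintegral_FTC.
- by have := pi_gt0 R; lra.
- move=> x _; have -> : cos (k%:~R * x) = k%:~R^-1 * (k%:~R * cos (k%:~R * x)) by rewrite mulKf.
  by apply: is_deriveZ; exact: is_derive_sin_lin.
- exact: cont_within.
Qed.

Lemma circle_cos_cos (k n : int) :
  Rintegral mu D (fun l : R => cos (k%:~R * l) * cos (n%:~R * l)) =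
  pi * ((k == n)%:R + (k == - n)%:R).
Proof.
rewrite (@eq_circle _ (fun l => 1 / 2 * (cos ((k + n)%:~R * l) + cos ((k - n)%:~R * l)))); last first.
  by move=> l _; rewrite !intrD intrN !mulrDl mulNr cosB cosD; field.
have cc j : mu.-integrable D (EFin \o (fun l : R => cos (j%:~R * l))).
  by apply: cont_integrableD; exact: cos_lin_continuous.
rewrite RintegralZl//; last first.
  by apply: cont_integrableD => x; apply: cvgD; exact: cos_lin_continuous.
rewrite RintegralD// !circle_cos -addr_eq0 subr_eq0.
by case: (k == n); case: (k + n == 0); rewrite /=; field.
Qed.

End CircleIntegral.

Section TransformIntegral.
Context {R : realType}.
Local Notation W := (wiener R).
Local Notation mu := (@lebesgue_measure R).
Local Notation D := [set` `](- (pi : R)), (pi : R)]%R].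
Implicit Types x y : W.

Let trunc N x := wproj (fun k : int => - N%:Z <= k < N%:Z) x.

Let truncE N x l : wcos (trunc N x) l = \sum_(i < N) (x (Posz i) * cos ((Posz i)%:~R * l)) + \sum_(i < N) (x (Negz i) * cos ((Negz i)%:~R * l)).
Proof.
rewrite /wcos.
have [_ s] := @rsum_finite R int (fun k => trunc N x k * cos (k%:~R * l)) ([seq Posz i | i <- iota 0 N] ++ [seq Negz i | i <- iota 0 N]) (iseq_uniq N)
   (fun k => ltac:(by rewrite mem_iseq wprojE => /negbTE ->; rewrite mul0r)).
rewrite (@rsum_finite R int (fun k => trunc N x k * cos (k%:~R * l)) ([seq Posz i | i <- iota 0 N] ++ [seq Negz i | i <- iota 0 N]) (iseq_uniq N)
   (fun k => ltac:(by rewrite mem_iseq wprojE => /negbTE ->; rewrite mul0r))).1.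
rewrite -itruncE /itrunc big_split; congr (_ + _); apply: eq_bigr => i _; rewrite /trunc wprojE ifT//.
  by have := ltn_ord i; lia.
by have := ltn_ord i; lia.
Qed.

Let trunc_cont N x : continuous (wcos (trunc N x)).
Proof.
rewrite (_ : wcos (trunc N x) = fun l => \sum_(i < N) (x (Posz i) * cos ((Posz i)%:~R * l)) + \sum_(i < N) (x (Negz i) * cos ((Negz i)%:~R * l))); last first.
  by apply/funext => l; exact: truncE.
have cs (h : nat -> int) : continuous (fun l : R => \sum_(i < N) (x (h i) * cos ((h i)%:~R * l))).
  elim: N => [|n IH]; first by move=> l; under eq_fun do rewrite big_ord0; exact: cst_continuous.
  under eq_fun do rewrite big_ord_recr/=; move=> l; apply: cvgD; first exact: IH.
  by apply: cvgM; [exact: cvg_cst|exact: cos_lin_continuous].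
by move=> l; apply: cvgD; [exact: (cs Posz)|exact: (cs Negz)].
Qed.

Lemma trunc_lim x : wlim (fun N => trunc N x) x.
Proof.
by move=> e e0; have [N0 h] := n1_trunc x e0; exists N0 => N /h; rewrite -n1N opprB.
Qed.

Lemma wcos_continuous x : continuous (wcos x).
Proof.
move=> l; apply/cvgrPdist_lt => e e0; have e3 : 0 < e / 3 by rewrite divr_gt0.
have [N hN] := n1_trunc x e3; have {}hN := hN N (leqnn N).
have [r r0 hr] := (@cvgrPdist_lt _ _ _ _ _ _ _).1 (@trunc_cont N x l) _ e3.
exists r => // y /hr; have h z : `|wcos x z - wcos (trunc N x) z| <= e / 3.
  by rewrite -wcosB; exact: le_trans (wcos_le _ _) hN.
have := h l; have := h y; rewrite !ler_norml !ltr_norml => /andP[a1 a2] /andP[b1 b2] /andP[c1 c2].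
by apply/andP; split; lra.
Qed.

Lemma wcos_measurable x : measurable_fun D (wcos x).
Proof.
apply: (@measurable_fun_cvg _ _ _ _ (fun N => wcos (trunc N x))).
  by move=> N; apply: measurable_funTS; apply: continuous_measurable_fun; exact: trunc_cont.
by move=> l _; exact: wcos_lim (trunc_lim x).
Qed.

Lemma wcos_cos_integrable x (n : int) : mu.-integrable D (EFin \o (fun l : R => wcos x l * cos (n%:~R * l))).
Proof.
apply: (@bounded_integrableD _ _ (n1 x)).
  apply: measurable_funM; first exact: wcos_measurable.
  by apply: measurable_funTS; apply: continuous_measurable_fun; exact: cos_lin_continuous.
move=> l; rewrite normrM -[leRHS]mulr1; apply: ler_pM => //; [exact: wcos_le|exact: cos_max].
Qed.

Let circle_trunc N x (n : int) : - N%:Z < n < N%:Z ->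
  Rintegral mu D (fun l : R => wcos (trunc N x) l * cos (n%:~R * l)) = pi * (x n + x (- n)).
Proof.
move=> nN.
have cc j : continuous (fun l : R => cos (j%:~R * l) * cos (n%:~R * l)).
  by move=> l; apply: cvgM; exact: cos_lin_continuous.
have S (s : seq int) : continuous (fun l : R => \sum_(k <- s) x k * (cos (k%:~R * l) * cos (n%:~R * l))) /\
  Rintegral mu D (fun l : R => \sum_(k <- s) x k * (cos (k%:~R * l) * cos (n%:~R * l))) =
  \sum_(k <- s) x k * (pi * ((k == n)%:R + (k == - n)%:R)).
  elim: s => [|k s [IH1 IH2]].
    split; first by move=> l; under eq_fun do rewrite big_nil; exact: cst_continuous.
    rewrite big_nil (@eq_circle _ _ (cst 0)); last by move=> l _; rewrite big_nil.
    by rewrite Rintegral_cst// mul0r.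
  have c1 : continuous (fun l : R => x k * (cos (k%:~R * l) * cos (n%:~R * l))).
    by move=> l; apply: cvgM; [exact: cvg_cst|exact: cc].
  split.
    by under eq_fun do rewrite big_cons; move=> l; apply: cvgD; [exact: c1|exact: IH1].
  rewrite big_cons -IH2 -circle_cos_cos -RintegralZl//; last exact: cont_integrableD.
  rewrite -RintegralD//; [|exact: cont_integrableD..].
  by apply: eq_circle => l _; rewrite big_cons.
pose s := [seq Posz i | i <- iota 0 N] ++ [seq Negz i | i <- iota 0 N].
rewrite (@eq_circle _ _ (fun l : R => \sum_(k <- s) x k * (cos (k%:~R * l) * cos (n%:~R * l)))); last first.
  move=> l _; rewrite truncE -big_split/= -/(itrunc N (fun k => x k * cos (k%:~R * l))) itruncE mulr_suml.
  by apply: eq_bigr => k _; rewrite mulrA.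
rewrite (S s).2.
under eq_bigr do rewrite mulrCA mulrDr.
rewrite -mulr_sumr big_split/=; congr (_ * _).
have one m : m \in s -> \sum_(k <- s) x k * (k == m)%:R = x m.
  move=> ms; rewrite (bigD1_seq m)//=; last exact: iseq_uniq.
  by rewrite eqxx mulr1 big1 ?addr0// => i /negbTE ->; rewrite mulr0.
by rewrite !one// mem_iseq; lia.
Qed.

Lemma circle_wcos x (n : int) :
  Rintegral mu D (fun l : R => wcos x l * cos (n%:~R * l)) = pi * (x n + x (- n)).
Proof.
apply/eqP; rewrite -subr_eq0 -normr_le0; apply/ler_addgt0Pr => e e0; rewrite add0r.
have p0 := pi_gt0 R; have e1 : 0 < e / (2 * pi) by rewrite divr_gt0// mulr_gt0.
have [N0 h] := n1_trunc x e1; pose N := (N0 + `|n|.+1)%N.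
have hN := h N (leq_addr _ _).
rewrite -(@circle_trunc N x n); last by rewrite /N; lia.
rewrite -RintegralB//; [|exact: wcos_cos_integrable..].
rewrite (@eq_circle _ _ (fun l : R => wcos (x - trunc N x) l * cos (n%:~R * l))); last first.
  move=> l _; rewrite [wcos (x - trunc N x) l]wcosB; ring.
apply: le_trans (RintegralD_le (M := e / (2 * pi)) _ _) _.
- exact: wcos_cos_integrable.
- move=> l _; rewrite normrM -[leRHS]mulr1; apply: ler_pM => //; last exact: cos_max.
  exact: le_trans (wcos_le _ _) hN.
- by rewrite mulrC divfK// gt_eqF// mulr_gt0.
Qed.

Lemma coef0_ge0 x : rev x = x -> (forall l, 0 <= wcos x l) -> 0 <= x 0.
Proof.
move=> ex hx; have := circle_wcos x 0; rewrite oppr0 => h.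
have : 0 <= pi * (x 0 + x 0).
  by rewrite -h; apply: Rintegral_ge0 => l _; rewrite mul0r cos0 mulr1.
by rewrite pmulr_rge0 ?pi_gt0//; lra.
Qed.

(* Nehari: subtracting the constant c from the symbol does not change the
   Hankel operator, and |e^(i t) - c|^2 <= 1 - c^2 when cos t >= c. *)
Lemma unimodular_shift (psi : W) (c : R) : psi * rev psi = 1 -> 0 <= c ->
  (forall l, c <= wcos psi l) ->
  forall x, n2 ((psi - wcst c) * x) ^+ 2 <= (1 - c ^+ 2) * n2 x ^+ 2.
Proof.
move=> uni c0 hc x; rewrite !n2sq /dot revM revB rev_cst.
pose E := (psi + rev psi - wcst (2 * c)) * (x * rev x).
have E0 : 0 <= E 0.
  apply: coef0_ge0 => [|l].
    by rewrite /E !revM revB revD !revK rev_cst [rev psi + _]addrC [rev x * _]mulrC.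
  rewrite /E wcosM wcosB wcosD wcos_rev wcos_cst wsinD wsinN wsinD wsin_rev wsin_cst.
  rewrite [wcos (x * rev x) l]wcosM wcos_rev wsin_rev.
  have := hc l; have := sqr_ge0 (wcos x l); have := sqr_ge0 (wsin x l).
  by move=> a1 a2 a3; nra.
have -> : (psi - wcst c) * x * ((rev psi - wcst c) * rev x) = wcst (1 - c ^+ 2) * (x * rev x) - wcst c * E.
  rewrite /E wcst_add wcst_opp wcst1 expr2 !wcst_mul (_ : 2 = 1 + 1 :> R)// wcst_add wcst1.
  transitivity ((psi * rev psi) * (x * rev x) - wcst c * (psi + rev psi) * (x * rev x) + wcst c * wcst c * (x * rev x)); first by ring.
  by rewrite uni; ring.
by rewrite wB !wcstM; have := mulr_ge0 c0 E0; lra.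
Qed.

(** Write psi as [(psi - c) + c]. The first part is contracted by [unimodular_shift]; the constant
    leaves the symbol [c * u], whose Hankel operator is bounded by the n1 tail of u, small for large
    N. *)
Lemma hankel_contraction (psi u : W) (c : R) (N : int) : psi * rev psi = 1 -> u * rev u = 1 ->
  0 <= c <= 1 -> (forall l, c <= wcos psi l) ->
  hankel_contr N (u * psi) (Num.sqrt (1 - c ^+ 2) + c * n1 (wproj (geP N) u)).
Proof.
move=> unip uniu /andP[c0 c1] hc a sa.
have -> : u * psi = u * (psi - wcst c) + wcst c * u by ring.
rewrite hankelDs; apply: le_trans (n2D _ _) _; rewrite mulrDl; apply: lerD.
  apply: le_trans (hankel_le _ _ _) _; rewrite -mulrA n2_uni//.
  have c2 : 0 <= 1 - c ^+ 2 by nra.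
  rewrite -(@ler_pXn2r _ 2) ?nnegrE ?mulr_ge0 ?sqrtr_ge0 ?n2_ge0//.
  by rewrite exprMn [Num.sqrt (1 - c ^+ 2) ^+ 2]sqr_sqrtr//; exact: unimodular_shift.
rewrite hankel_proj// (_ : wproj (geP N) _ = wcst c * wproj (geP N) u); last first.
  by apply: wiener_ext => k; rewrite wcstM !wprojE wcstM; case: ifP; rewrite ?mulr0.
apply: le_trans (hankel_le _ _ _) _; rewrite -mulrA n2_cst ger0_norm// -mulrA.
by rewrite ler_wpM2l//; exact: young.
Qed.

End TransformIntegral.

(** * Rules for derivatives of explicit functions *)

Section PointwiseDerivatives.
Context {R : realType}.
Implicit Types (f g : R -> R) (x a b c : R).

Lemma dD f g x a b : is_derive x 1 f a -> is_derive x 1 g b ->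
  is_derive x 1 (fun t => f t + g t) (a + b).
Proof. by move=> hf hg; exact: is_deriveD. Qed.

Lemma d_ext f g x a b : is_derive x 1 f a -> (forall t, f t = g t) -> a = b ->
  is_derive x 1 g b.
Proof. by move=> h /funext <- <-. Qed.

Lemma dcst x c : is_derive x 1 (fun=> c) 0.
Proof. exact: is_derive_cst. Qed.

Lemma did x : is_derive x 1 (fun t : R => t) 1.
Proof. exact: is_derive_id. Qed.

Lemma dM f g x a b : is_derive x 1 f a -> is_derive x 1 g b ->
  is_derive x 1 (fun t => f t * g t) (a * g x + f x * b).
Proof.
move=> hf hg; have := is_deriveM hf hg.
by rewrite addrC; congr is_derive; rewrite /= /GRing.scale/= [a * _]mulrC.
Qed.

Lemma dZ f x a c : is_derive x 1 f a -> is_derive x 1 (fun t => c * f t) (c * a).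
Proof. by move=> hf; have := dM (dcst x c) hf; rewrite mul0r add0r. Qed.

Lemma dN f x a : is_derive x 1 f a -> is_derive x 1 (fun t => - f t) (- a).
Proof. by move=> hf; exact: is_deriveN. Qed.

Lemma dB f g x a b : is_derive x 1 f a -> is_derive x 1 g b ->
  is_derive x 1 (fun t => f t - g t) (a - b).
Proof. by move=> hf hg; exact: (dD hf (dN hg)). Qed.

Lemma dcomp f g x a b : is_derive (g x) 1 f a -> is_derive x 1 g b ->
  is_derive x 1 (fun t => f (g t)) (a * b).
Proof. by move=> hf hg; exact: is_derive1_comp. Qed.

Lemma dX f x a n : is_derive x 1 f a ->
  is_derive x 1 (fun t => f t ^+ n.+1) (n.+1%:R * f x ^+ n * a).
Proof.
move=> hf; elim: n => [|n IH]; first by rewrite expr0 mulr1 mul1r.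
apply: (d_ext (dM hf IH)) => [s|]; first by rewrite [RHS]exprS.
by rewrite -[n.+2%:R]natr1 [f x ^+ n.+1]exprS; ring.
Qed.

Lemma dV f x a : f x != 0 -> is_derive x 1 f a -> is_derive x 1 (fun t => (f t)^-1) (- a / f x ^+ 2).
Proof.
move=> f0 hf; have h := @is_deriveV R f x a 1 f0 hf.
by apply: (d_ext h) => // ; rewrite /GRing.scale/= !mulNr mulrC.
Qed.

Lemma dln f x a : 0 < f x -> is_derive x 1 f a -> is_derive x 1 (fun t => ln (f t)) (a / f x).
Proof. by move=> fx hf; rewrite mulrC; apply: dcomp hf; exact: is_derive1_ln. Qed.

Lemma dcos f x a : is_derive x 1 f a -> is_derive x 1 (fun t => cos (f t)) (- sin (f x) * a).
Proof. by move=> hf; apply: dcomp hf; exact: is_derive_cos. Qed.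

Lemma dsin f x a : is_derive x 1 f a -> is_derive x 1 (fun t => sin (f t)) (cos (f x) * a).
Proof. by move=> hf; apply: dcomp hf; exact: is_derive_sin. Qed.

Lemma datan f x a : is_derive x 1 f a -> is_derive x 1 (fun t => atan (f t)) ((1 + f x ^+ 2)^-1 * a).
Proof. by move=> hf; apply: dcomp hf; exact: is_derive1_atan. Qed.

Lemma dpowR f x a p : 0 < f x -> is_derive x 1 f a ->
  is_derive x 1 (fun t => f t `^ p) (p * f x `^ (p - 1) * a).
Proof.
move=> fx hf; apply: (dcomp (f := fun y => y `^ p)) hf.
have fI : f x \in `]0, +oo[ by rewrite in_itv/= fx.
have := @powR_derive1 R p _ fI; have := @derivable_powR R 1 p _ fI => h.
by rewrite derive1E => e; split.
Qed.

Lemma d_cont f x a : is_derive x 1 f a -> {for x, continuous f}.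
Proof. by move=> [/derivable1_diffP /differentiable_continuous]. Qed.

Lemma mvt_bound f (df : R -> R) a b M : a <= b ->
  (forall t, a <= t <= b -> is_derive t 1 f (df t)) ->
  (forall t, a < t < b -> `|df t| <= M) -> `|f b - f a| <= M * (b - a).
Proof.
rewrite le_eqVlt => /predU1P[->|ab] hf hM; first by rewrite !subrr normr0 mulr0.
have [|| c] := @MVT R f df a b ab.
- by move=> t; rewrite in_itv/= => /andP[at_ tb]; apply: hf; rewrite !ltW.
- apply: derivable_within_continuous => t; rewrite in_itv/= => tab.
  by have [] := hf t tab.
have ba : 0 <= b - a by rewrite subr_ge0 ltW.
by rewrite in_itv/= => cab ->; rewrite normrM (ger0_norm ba) ler_wpM2r// hM.
Qed.

End PointwiseDerivatives.

(** * The series of the complex logarithm in real form *)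

Section LogSeries.
Context {R : realType}.
Implicit Types (x y t m : R) (c : nat -> R).

Let Q x m t := 1 - 2 * t * x + t ^+ 2 * m.

(** For [w = x + i y] the sequences Re w^k and Im w^k satisfy this recurrence with [m = |w|^2], and
    Q is then [|1 - t w|^2]: the geometric series of w is summed without complex numbers. *)
Lemma geometric_rec c x m t N : (forall k, c k.+2 = 2 * x * c k.+1 - m * c k) ->
  (\sum_(k < N) t ^+ k * c k.+1) * Q x m t =
  c 1%N - t * m * c 0%N - t ^+ N * (c N.+1 - t * m * c N).
Proof.
move=> hc; elim: N => [|N IH]; first by rewrite big_ord0 mul0r expr0; ring.
by rewrite big_ord_recr/= mulrDl IH hc /Q [t ^+ N.+1]exprS; ring.
Qed.

Variables (x y rho : R).
Hypothesis rho0 : 0 <= rho.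
Hypothesis rho1 : rho < 1.
Hypothesis xy : x ^+ 2 + y ^+ 2 <= rho ^+ 2.
Let m := x ^+ 2 + y ^+ 2.

Let m0 : 0 <= m. Proof. by rewrite addr_ge0 ?sqr_ge0. Qed.
Let x_le : `|x| <= rho.
Proof.
rewrite -(@ler_pXn2r _ 2) ?nnegrE// real_normK ?num_real//.
by apply: le_trans xy; rewrite lerDl sqr_ge0.
Qed.

Let Q_ge t : 0 <= t <= 1 -> (1 - rho) ^+ 2 <= Q x m t.
Proof.
move=> /andP[t0 t1]; have := x_le; rewrite ler_norml => /andP[_ xr].
have hr0 := rho0; have hr1 := rho1.
have -> : Q x m t = (1 - t * x) ^+ 2 + (t * y) ^+ 2 by rewrite /Q /m; ring.
apply: (@le_trans _ _ ((1 - t * x) ^+ 2)); last by rewrite lerDl sqr_ge0.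
have h : t * x <= rho by case: (lerP 0 x) => xx; nra.
have h1 : 0 <= 1 - rho by lra.
have h2 : 1 - rho <= 1 - t * x by lra.
by rewrite !expr2; apply: ler_pM.
Qed.

Let Q_gt0 t : 0 <= t <= 1 -> 0 < Q x m t.
Proof. by move=> /Q_ge; apply: lt_le_trans; rewrite exprn_gt0// subr_gt0. Qed.

Let rem_le c t N : 0 <= t <= 1 -> (forall k, `|c k| <= rho ^+ k) ->
  `|t ^+ N * (c N.+1 - t * m * c N) / Q x m t| <= 2 * rho ^+ N / (1 - rho) ^+ 2.
Proof.
move=> t01 hc; have /andP[t0 t1] := t01; have hr0 := rho0; have hr1 := rho1.
rewrite normrM normfV (gtr0_norm (Q_gt0 t01)); apply: ler_pM => //.
- by rewrite invr_ge0 ltW// Q_gt0.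
- rewrite normrM; apply: (@le_trans _ _ (1 * (rho ^+ N + rho ^+ N))); last by rewrite mul1r mulr_natl mulr2n.
  apply: ler_pM => //; first by rewrite normrX (ger0_norm t0) exprn_ile1.
  apply: le_trans (ler_normB _ _) _; apply: lerD.
    by apply: le_trans (hc _) _; rewrite exprSr ler_piMr ?exprn_ge0// ltW.
  rewrite normrM -[leRHS]mul1r; apply: ler_pM => //.
  rewrite ger0_norm ?mulr_ge0// -[leRHS]mul1r; apply: ler_pM => //.
  by apply: le_trans xy _; rewrite exprn_ile1// ltW.
- by rewrite lef_pV2 ?posrE ?Q_gt0 ?exprn_gt0 ?subr_gt0// Q_ge.
Qed.

Let sum_deriv c N t : is_derive t 1 (fun t => \sum_(k < N) t ^+ k.+1 * (c k.+1 / k.+1%:R)) (\sum_(k < N) t ^+ k * c k.+1).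
Proof.
elim: N => [|N IH].
  by rewrite big_ord0 (_ : (fun t => _) = fun=> 0); [exact: dcst|apply/funext => s; rewrite big_ord0].
rewrite big_ord_recr (_ : (fun t => _) = fun t => \sum_(k < N) t ^+ k.+1 * (c k.+1 / k.+1%:R) + (c N.+1 / N.+1%:R) * t ^+ N.+1); last first.
  by apply/funext => s; rewrite big_ord_recr/= [s ^+ N.+1 * _]mulrC.
apply: dD => //.
apply: (d_ext (dZ (c N.+1 / N.+1%:R) (dX N (did t)))) => //=.
by rewrite mulr1 mulrA divfK ?pnatr_eq0// mulrC.
Qed.

(** The partial sums of [t^k c_k / k] have derivative dF up to the geometric remainder; the mean
    value theorem on [0, 1] turns the bound on the remainder into convergence at t = 1. It is used
    for the modulus and for the argument of [1 - w]. *)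
Let series_limit c (F dF : R -> R) :
  (forall k, c k.+2 = 2 * x * c k.+1 - m * c k) -> (forall k, `|c k| <= rho ^+ k) ->
  F 0 = 0 -> (forall t, 0 <= t <= 1 -> is_derive t 1 F (dF t)) ->
  (forall t, 0 <= t <= 1 -> dF t = (c 1%N - t * m * c 0%N) / Q x m t) ->
  (fun N => \sum_(k < N) c k.+1 / k.+1%:R) @ \oo --> F 1.
Proof.
move=> rc hc F0 hF edF; have hr0 := rho0; have hr1 := rho1.
have B N : `|F 1 - \sum_(k < N) c k.+1 / k.+1%:R| <= 2 / (1 - rho) ^+ 2 * rho ^+ N.
  have := @mvt_bound R (fun t => F t - \sum_(k < N) t ^+ k.+1 * (c k.+1 / k.+1%:R))
    (fun t => dF t - \sum_(k < N) t ^+ k * c k.+1) 0 1 (2 * rho ^+ N / (1 - rho) ^+ 2) ler01.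
  rewrite F0 (_ : \sum_(k < N) 0 ^+ k.+1 * _ = 0); last first.
    by rewrite big1// => i _; rewrite expr0n/= mul0r.
  rewrite !subr0 mulr1.
  rewrite (_ : \sum_(k < N) 1 ^+ k.+1 * _ = \sum_(k < N) c k.+1 / k.+1%:R); last first.
    by apply: eq_bigr => i _; rewrite expr1n mul1r.
  rewrite (_ : 2 * rho ^+ N / _ = 2 / (1 - rho) ^+ 2 * rho ^+ N); last by ring.
  apply => t t01; first by apply: dB; [exact: hF|exact: sum_deriv].
  have t01' : 0 <= t <= 1 by have /andP[/ltW -> /ltW ->] := t01.
  have q0 := Q_gt0 t01'.
  have -> : dF t - \sum_(k < N) t ^+ k * c k.+1 = t ^+ N * (c N.+1 - t * m * c N) / Q x m t.
    have := @geometric_rec c x m t N rc; rewrite edF// => E.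
    apply: (mulIf (lt0r_neq0 q0)); rewrite mulrBl E !divfK ?gt_eqF//; ring.
  apply: le_trans (rem_le N t01' hc) _.
  by rewrite le_eqVlt; apply/orP; left; apply/eqP; ring.
apply/cvgrPdist_le => e e0.
have cg : (fun N => 2 / (1 - rho) ^+ 2 * rho ^+ N) @ \oo --> 0.
  rewrite -[X in _ --> X](mulr0 (2 / (1 - rho) ^+ 2)).
  by apply: cvgM; [exact: cvg_cst|apply: cvg_expr; rewrite ger0_norm].
have [N0 _ h] := (@cvgrPdist_le _ _ _ _ _ _ _).1 cg e e0.
exists N0 => // N /h /= hN; apply: le_trans (B N) _.
by apply: le_trans hN; rewrite sub0r normrN ler_norm.
Qed.

Lemma log_series c : c 0%N = 1 -> c 1%N = x -> (forall k, c k.+2 = 2 * x * c k.+1 - m * c k) ->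
  (forall k, `|c k| <= rho ^+ k) ->
  (fun N => \sum_(k < N) c k.+1 / k.+1%:R) @ \oo --> - (ln ((1 - x) ^+ 2 + y ^+ 2) / 2).
Proof.
move=> c0 c1 rc hc.
have -> : (1 - x) ^+ 2 + y ^+ 2 = Q x m 1 by rewrite /Q /m; ring.
apply: (@series_limit c (fun t => - (ln (Q x m t) / 2)) (fun t => - ((- 2 * x + 2 * t * m) / Q x m t / 2))) => //.
- by rewrite /Q mulr0 mul0r subr0 expr0n mul0r addr0 ln1 mul0r oppr0.
- move=> t t01; apply: dN.
  have dQ : is_derive t 1 (Q x m) (- 2 * x + 2 * t * m).
    apply: (d_ext (dD (dD (dcst t 1) (dZ (- 2 * x) (did t))) (dZ m (dX 1 (did t))))) => [s|].
      by rewrite /Q; ring.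
    by rewrite expr1; ring.
  apply: (d_ext (dZ 2^-1 (dln (Q_gt0 t01) dQ))) => [s|]; by rewrite mulrC.
- move=> t t01; have q0 := Q_gt0 t01; rewrite c0 c1; field; exact: lt0r_neq0.
Qed.

(** As [1 - t x] stays positive on [0, 1], the argument of [1 - t w] never leaves the range of
    [atan], and no branch has to be chosen. *)
Lemma arg_series c : c 0%N = 0 -> c 1%N = y -> (forall k, c k.+2 = 2 * x * c k.+1 - m * c k) ->
  (forall k, `|c k| <= rho ^+ k) ->
  (fun N => \sum_(k < N) c k.+1 / k.+1%:R) @ \oo --> atan (y / (1 - x)).
Proof.
move=> c0 c1 rc hc.
have p0 t : 0 <= t <= 1 -> 0 < 1 - t * x.
  move=> /andP[t0 t1]; have := x_le; rewrite ler_norml => /andP[_ xr].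
  have hr0 := rho0; have hr1 := rho1; nra.
rewrite -[y in X in _ --> X]mul1r -[in X in _ --> X](mul1r x).
apply: (@series_limit c (fun t => atan (t * y / (1 - t * x))) (fun t => (1 + (t * y / (1 - t * x)) ^+ 2)^-1 * (y / (1 - t * x) ^+ 2))) => //.
- by rewrite !mul0r atan0.
- move=> t t01; have q0 := p0 t t01; apply: datan.
  have dQ : is_derive t 1 (fun t => 1 - t * x) (- x).
    by apply: (d_ext (dB (dcst t 1) (dZ x (did t)))) => [s|]; ring.
  have h := dM (dZ y (did t)) (@dV R (fun t => 1 - t * x) t (- x) (lt0r_neq0 q0) dQ).
  apply: (d_ext h) => [s|]; first by ring.
  by field; exact: lt0r_neq0.
- move=> t t01; have q0 := p0 t t01; have Q0 := Q_gt0 t01; rewrite c0 c1 mulr0 subr0.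
  have Q1 : (1 - t * x) ^+ 2 + (t * y) ^+ 2 = Q x m t by rewrite /Q /m; ring.
  rewrite -Q1 in Q0 *; field.
  by rewrite !lt0r_neq0.
Qed.

Lemma arg_series_le c : c 0%N = 0 -> c 1%N = y -> (forall k, c k.+2 = 2 * x * c k.+1 - m * c k) ->
  (forall k, `|c k| <= rho ^+ k) ->
  exists2 s, (fun N => \sum_(k < N) c k.+1 / k.+1%:R) @ \oo --> s & `|s| <= pi / 2.
Proof.
move=> c0 c1 rc hc; exists (atan (y / (1 - x))); first exact: arg_series.
by rewrite ler_norml !ltW ?atan_ltpi2 ?atan_gtNpi2.
Qed.

End LogSeries.

Section OneSided.
Context {R : realType}.
Local Notation W := (wiener R).

Lemma itrunc_cvg (f : int -> R) : summ f -> (fun N => itrunc N f) @ \oo --> rsum f.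
Proof.
move=> sf; apply/cvgrPdist_le => e e0; have [N0 h] := rsum_tail sf e0.
exists N0 => // N /= /h; apply: le_trans.
have [e1 s1] := @rsum_finite R int (fun k => if - N%:Z <= (k : int) < N%:Z then f k else 0) _ (iseq_uniq N)
   (fun k => ltac:(by rewrite mem_iseq => /negbTE ->)).
rewrite itruncE (_ : \sum_(i <- _) f i = rsum (fun k => if - N%:Z <= (k : int) < N%:Z then f k else 0)); last first.
  by rewrite e1; apply: eq_big_seq => i; rewrite mem_iseq => ->.
rewrite -rsumB//; apply: le_trans (ler_norm_rsum _) _.
  apply: (le_summ _ sf) => i; case: ifP => _; by rewrite ?subrr ?subr0 ?normr0.
rewrite le_eqVlt; apply/orP; left; apply/eqP; apply: eq_rsum => i.
by case: ifP => _; rewrite ?subrr ?subr0 ?normr0.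
Qed.

Lemma onesided_cvg (f : int -> R) : summ f -> (forall k, k <= 0 -> f k = 0) ->
  (fun N => \sum_(k < N) f k.+1) @ \oo --> rsum f.
Proof.
move=> sf f0; have := itrunc_cvg sf; rewrite -cvg_shiftS.
suff -> : (fun N => itrunc N.+1 f) = (fun N => \sum_(k < N) f k.+1) by [].
apply/funext => N; rewrite /itrunc big_ord_recl/= !f0// !add0r.
by apply: eq_bigr => i _; rewrite (f0 (Negz _))// addr0.
Qed.

Lemma wcos_onesided (x : W) (l : R) : supp_ge 1 x ->
  (fun N => \sum_(k < N) x k.+1 * cos (k.+1%:R * l)) @ \oo --> wcos x l.
Proof.
by move=> sx; apply: (onesided_cvg (wcos_summ x l)) => k k0; rewrite sx ?mul0r//; lia.
Qed.

Lemma wsin_onesided (x : W) (l : R) : supp_ge 1 x ->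
  (fun N => \sum_(k < N) x k.+1 * sin (k.+1%:R * l)) @ \oo --> wsin x l.
Proof.
by move=> sx; apply: (onesided_cvg (wsin_summ x l)) => k k0; rewrite sx ?mul0r//; lia.
Qed.

End OneSided.

Section PureTransform.
Context {R : realType}.
Local Notation W := (wiener R).
Variables (r : R) (r0 : 0 <= r) (r1 : r < 1).

Lemma cos_rec (k : nat) (l : R) :
  r ^+ k.+2 * cos (k.+2%:R * l) = 2 * (r * cos l) * (r ^+ k.+1 * cos (k.+1%:R * l)) - r ^+ 2 * (r ^+ k * cos (k%:R * l)).
Proof.
have -> : k.+2%:R * l = k.+1%:R * l + l by rewrite -[k.+2%:R]natr1; ring.
have -> : k%:R * l = k.+1%:R * l - l by rewrite -[k.+1%:R]natr1; ring.
rewrite cosD cosB !exprS; ring.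
Qed.

Lemma sin_rec (k : nat) (l : R) :
  r ^+ k.+2 * sin (k.+2%:R * l) = 2 * (r * cos l) * (r ^+ k.+1 * sin (k.+1%:R * l)) - r ^+ 2 * (r ^+ k * sin (k%:R * l)).
Proof.
have -> : k.+2%:R * l = k.+1%:R * l + l by rewrite -[k.+2%:R]natr1; ring.
have -> : k%:R * l = k.+1%:R * l - l by rewrite -[k.+1%:R]natr1; ring.
rewrite sinD sinB !exprS; ring.
Qed.

Lemma polar_sq (l : R) : (r * cos l) ^+ 2 + (r * sin l) ^+ 2 = r ^+ 2.
Proof. by rewrite !exprMn -mulrDr cos2Dsin2 mulr1. Qed.

(** The squared modulus of [1 - r exp (i l)]. *)
Definition wpoly (l : R) : R := 1 - 2 * r * cos l + r ^+ 2.

Lemma wpolyE (l : R) : (1 - r * cos l) ^+ 2 + (r * sin l) ^+ 2 = wpoly l.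
Proof. by have := polar_sq l; rewrite /wpoly => h; nra. Qed.

Lemma wcos_lpure (d l : R) : wcos (lpure d r0 r1) l = - (d / 2) * ln (wpoly l).
Proof.
have hsq : (r * cos l) ^+ 2 + (r * sin l) ^+ 2 <= r ^+ 2 by rewrite polar_sq.
have := @log_series R (r * cos l) (r * sin l) r r0 r1 hsq (fun k => r ^+ k * cos (k%:R * l)).
rewrite expr0 mul0r cos0 mulr1 expr1 mul1r polar_sq => /(_ erefl erefl (fun k => cos_rec k l)) h.
have {}h := h (fun k => ltac:(by rewrite normrM ger0_norm ?exprn_ge0// -[leRHS]mulr1 ler_wpM2l ?exprn_ge0 ?cos_max)).
have := cvgM (@cvg_cst R d nat \oo _) h.
have := @wcos_onesided R (lpure d r0 r1) l (lpure_supp d r0 r1).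
set f := (X in X @ \oo --> _ -> _) => h1 h2.
have {}h2 := h2 _ _; move: h2; set g := (X in (X @ \oo --> _)).
rewrite (_ : g = f) => [h2|]; last first.
  apply/funext => N; rewrite /f /g/= mulr_sumr; apply: eq_bigr => i _. ring.
rewrite -(cvg_lim (@Rhausdorff R) h1) (cvg_lim (@Rhausdorff R) (h2 _ _)) wpolyE; by field.
Qed.

Lemma wsin_lpure_le (d l : R) : `|wsin (lpure d r0 r1) l| <= `|d| * (pi / 2).
Proof.
have hsq : (r * cos l) ^+ 2 + (r * sin l) ^+ 2 <= r ^+ 2 by rewrite polar_sq.
have := @arg_series_le R (r * cos l) (r * sin l) r r0 r1 hsq (fun k => r ^+ k * sin (k%:R * l)).
rewrite expr0 mul0r sin0 mulr0 expr1 mul1r polar_sq => /(_ erefl erefl (fun k => sin_rec k l)) h.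
have [s {}h sle] := h (fun k => ltac:(by rewrite normrM ger0_norm ?exprn_ge0// -[leRHS]mulr1 ler_wpM2l ?exprn_ge0 ?sin_max)).
have := cvgM (@cvg_cst R d nat \oo _) h.
have := @wsin_onesided R (lpure d r0 r1) l (lpure_supp d r0 r1).
set f := (X in X @ \oo --> _ -> _) => h1 h2.
have {}h2 := h2 _ _; move: h2; set g := (X in (X @ \oo --> _)).
rewrite (_ : g = f) => [h2|]; last first.
  apply/funext => N; rewrite /f /g/= mulr_sumr; apply: eq_bigr => i _. ring.
rewrite -(cvg_lim (@Rhausdorff R) h1) (cvg_lim (@Rhausdorff R) (h2 _ _)) normrM.
exact: ler_wpM2l.
Qed.

(** The phase is [exp (- 2 i s)] with s the imaginary part of [lpure]. As [1 - r z] has argument at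
    most pi / 2, [|2 s|] is at most [pi * |d|]. *)
Lemma wcos_psi_pure (d l : R) : `|d| <= 1 / 2 -> cos (pi * d) <= wcos (psi_pure d r0 r1) l.
Proof.
move=> d2; rewrite /psi_pure wcos_Exp_odd; last by rewrite revB revK opprB.
rewrite wsinD wsinN wsin_rev.
have := wsin_lpure_le d l; set s := wsin _ _ => hs.
have -> : cos (pi * d) = cos (pi * `|d|) by rewrite -[LHS]cos_norm normrM ger0_norm ?pi_ge0.
rewrite -[leRHS]cos_norm.
have p0 := pi_gt0 R; have sp : `| - s - s| <= pi * `|d|.
  by rewrite -opprD normrN -mulr2n -mulr_natl normrM ger0_norm//; nra.
have s0 := normr_ge0 (- s - s); have d0 := normr_ge0 d.
by rewrite leNgt ltr_cos -?leNgt ?in_itv//=; apply/andP; split => //; nra.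
Qed.

End PureTransform.

(** * The Levinson recursion *)

Section Levinson.
Context {R : realType}.
Implicit Types (c p : nat -> R).

(** The state is the error polynomial, with coefficient 1 at index 0, together with its variance.
    The update k becomes the new last coefficient; its sign is opposite to that of the partial
    correlation. *)
Fixpoint levinson c (n : nat) : (nat -> R) * R :=
  if n is m.+1 then
    let p := (levinson c m).1 in let v := (levinson c m).2 in
    let k := - (\sum_(j < m.+1) p j * c (m.+1 - j)%N) / v in
    (fun j => p j + k * (if (j <= m.+1)%N then p (m.+1 - j)%N else 0), v * (1 - k ^+ 2))
  else (fun j => (j == 0%N)%:R, c 0%N).

Definition lpoly c n := (levinson c n).1.
Definition lvar c n := (levinson c n).2.
(** The coefficient of the step from order n to order n + 1; [lpoly_last] places it at index n +
    1. *)
Definition lrefl c n : R := - (\sum_(j < n.+1) lpoly c n j * c (n.+1 - j)%N) / lvar c n.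

Lemma lpolyS c n j : lpoly c n.+1 j = lpoly c n j + lrefl c n * (if (j <= n.+1)%N then lpoly c n (n.+1 - j)%N else 0).
Proof. by []. Qed.
Lemma lvarS c n : lvar c n.+1 = lvar c n * (1 - lrefl c n ^+ 2). Proof. by []. Qed.

Lemma lpoly_supp c n j : (n < j)%N -> lpoly c n j = 0.
Proof.
elim: n j => [|n IH] j nj; first by rewrite /lpoly/=; case: j nj.
by rewrite lpolyS IH ?(ltnW nj)// leqNgt nj/= mulr0 addr0.
Qed.

Lemma lpoly0 c n : lpoly c n 0 = 1.
Proof. by elim: n => [//|n IH]; rewrite lpolyS IH subn0 lpoly_supp//= mulr0 addr0. Qed.

Lemma lpoly_last c n : lpoly c n.+1 n.+1 = lrefl c n.
Proof. by rewrite lpolyS leqnn subnn lpoly0 mulr1 lpoly_supp// add0r. Qed.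

(* lerr c n m is the covariance of the n-step prediction error with the
   variable at distance m. *)
Definition lerr c n (m : int) : R := \sum_(j < n.+1) lpoly c n j * c `|m - j%:Z|%N.

Lemma lerrS c n m : lerr c n.+1 m = lerr c n m + lrefl c n * lerr c n (n.+1%:Z - m).
Proof.
rewrite /lerr; under eq_bigr do rewrite lpolyS mulrDl -mulrA.
rewrite big_split/= -mulr_sumr; congr (_ + _ * _).
  by rewrite big_ord_recr/= lpoly_supp// mul0r addr0.
rewrite (reindex_inj rev_ord_inj)/= big_ord_recr/= [X in _ + X](_ : _ = 0) ?addr0; last first.
  by rewrite subnn/= subn0 lpoly_supp// mul0r.
apply: eq_bigr => i _; have := ltn_ord i => hi.
rewrite ifT; last by lia.
congr (lpoly _ _ _ * c _); lia.
Qed.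

Lemma lerr_next c n : lerr c n n.+1 = \sum_(j < n.+1) lpoly c n j * c (n.+1 - j)%N.
Proof. by apply: eq_bigr => i _; congr (_ * c _); have := ltn_ord i; lia. Qed.

Lemma lreflE c n : lvar c n != 0 -> lrefl c n * lvar c n = - lerr c n n.+1.
Proof. by move=> v0; rewrite /lrefl -lerr_next divfK. Qed.

Lemma lerr_orth c n : (forall i, (i < n)%N -> lvar c i != 0) ->
  lerr c n 0 = lvar c n /\ forall m : int, 1 <= m <= n%:Z -> lerr c n m = 0.
Proof.
elim: n => [|n IH] v0.
  split; last by move=> m; lia.
  by rewrite /lerr big_ord_recl big_ord0 addr0 lpoly0 mul1r.
have [e0 eo] := IH (fun i hi => v0 i (ltnW hi)).
have vn := v0 n (ltnSn n); have kv := lreflE vn.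
split; first by rewrite lerrS subr0 e0 lvarS; have := kv; nra.
move=> m hm; rewrite lerrS; have [mn|mn] := eqVneq m n.+1%:Z.
  by rewrite mn subrr e0 kv subrr.
by rewrite !eo ?mulr0 ?addr0//; lia.
Qed.

(** The recursion divides by the variances; the uniform lower bound kappa keeps these divisions
    continuous in the limit. *)
Lemma levinson_cvg (C : nat -> nat -> R) c (kappa : R) : 0 < kappa ->
  (forall m n, kappa <= lvar (C m) n) -> (forall k, (fun m => C m k) @ \oo --> c k) ->
  forall n, [/\ kappa <= lvar c n, (fun m => lvar (C m) n) @ \oo --> lvar c n &
    forall j, (fun m => lpoly (C m) n j) @ \oo --> lpoly c n j].
Proof.
move=> k0 hv hC.
have ge n : (fun m => lvar (C m) n) @ \oo --> lvar c n -> kappa <= lvar c n.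
  move=> h; apply: (cvgr_to_ge h); exists 0%N => // m _; exact: hv.
elim=> [|n [vn cv cp]].
  have h : (fun m => lvar (C m) 0%N) @ \oo --> lvar c 0 by exact: hC.
  split => //; first exact: ge.
  by move=> j; exact: cvg_cst.
have cs N : (fun m => \sum_(j < N) lpoly (C m) n j * C m (n.+1 - j)%N) @ \oo --> \sum_(j < N) lpoly c n j * c (n.+1 - j)%N.
  elim: N => [|N IH]; first by under eq_fun do rewrite big_ord0; rewrite big_ord0; exact: cvg_cst.
  under eq_fun do rewrite big_ord_recr/=; rewrite big_ord_recr/=.
  by apply: cvgD; [exact: IH|apply: cvgM; [exact: cp|exact: hC]].
have v0 : lvar c n != 0 by rewrite gt_eqF// (lt_le_trans k0).
have ck : (fun m => lrefl (C m) n) @ \oo --> lrefl c n.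
  by apply: cvgM; [apply: cvgN|apply: cvgV].
have cv' : (fun m => lvar (C m) n.+1) @ \oo --> lvar c n.+1.
  rewrite lvarS; under eq_fun do rewrite lvarS.
  by apply: cvgM => //; apply: cvgB; [exact: cvg_cst|rewrite expr2; under eq_fun do rewrite expr2; exact: cvgM].
split => //; first exact: ge.
move=> j; rewrite lpolyS; under eq_fun do rewrite lpolyS.
apply: cvgD => //; apply: cvgM => //; case: ifP => _; [exact: cp|exact: cvg_cst].
Qed.

(* The functions lerr c n satisfy the two hypergeometric recurrences below,
   which determine the reflection coefficients. *)
Lemma pure_refl c (d : R) : (forall m : int, m%:~R != d) -> (forall m : int, m%:~R + d != 0) ->
  (forall k : nat, (k.+1%:R - d) * c k.+1 = (k%:R + d) * c k) ->
  (forall n, lvar c n != 0) -> forall n, lrefl c n = - d / (n.+1%:R - d).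
Proof.
move=> nd nd' rc v0.
have gam (m : int) : (m%:~R - d) * c `|m|%N = (m%:~R - 1 + d) * c `|m - 1|%N.
  case: m => [[|m]|m].
  - have := rc 0%N; rewrite (_ : `|0|%N = 0%N)// (_ : `|0 - 1|%N = 1%N)// => h; nra.
  - have := rc m; rewrite (_ : `|Posz m.+1|%N = m.+1)// (_ : `|m.+1%:Z - 1|%N = m); last lia.
    by rewrite -pmulrn -[m.+1%:R]natr1 => ->; ring.
  have := rc m.+1; rewrite (_ : `|Negz m|%N = m.+1)// (_ : `|Negz m - 1|%N = m.+2); last lia.
  rewrite (_ : (Negz m)%:~R = - m.+1%:R :> R); last by rewrite NegzE mulrNz.
  by rewrite -[m.+2%:R]natr1 => h; lra.
have S0 (m : int) (x : R) : m%:~R + x = 0 -> x = - m%:~R by move=> h; lra.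
have nz (m : int) : m%:~R - d != 0 by rewrite subr_eq0.
have main n : (forall m : int, (m%:~R - n.+1%:R + d) * lerr c n (n.+1%:Z - m) = (m%:~R - d) * lerr c n m) /\
   (forall m : int, (m%:~R - d) * (m%:~R - n.+1%:R) * lerr c n m = (m%:~R - 1) * (m%:~R - n.+1%:R + d) * lerr c n (m - 1)).
  elim: n => [|n [S T]].
    have e (m : int) : lerr c 0 m = c `|m|%N.
      by rewrite /lerr big_ord_recl big_ord0 addr0 lpoly0 mul1r subr0.
    split=> m; rewrite !e.
      by rewrite gam (_ : `|1%:Z - m|%N = `|m - 1|%N)// distnC.
    by rewrite -mulrA mulrCA gam; ring.
  (* [S] at 0 compares the error at distance n + 1 with the error at distance 0, which is the
     variance. *)
  have kn : lrefl c n = - d / (n.+1%:R - d).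
    have nn : n.+1%:R - d != 0 by have := nz n.+1%:Z; rewrite -pmulrn.
    apply: (mulIf nn); rewrite divfK//; apply: (mulIf (v0 n)); rewrite mulrAC lreflE//.
    have := S 0; rewrite subr0 (@lerr_orth c n (fun i _ => v0 i)).1 mulr0z; lra.
  pose N : R := n.+1%:R; pose cn := (N - 2 * d) / (N - d).
  have Nd : N - d != 0 by have := nz n.+1%:Z; rewrite -pmulrn.
  have pz (m : int) : m%:~R - N + d != 0 by have := nd' (m - n.+1%:Z); rewrite mulrzBr -pmulrn.
  (* [S] removes the reflected argument from the Levinson update, which becomes multiplication by a
     rational function of m; in [B] the recurrence [T] turns the result into a shift of m. *)
  have A (m : int) : lerr c n.+1 m * (m%:~R - N + d) = lerr c n m * (m%:~R - N) * cn.
    rewrite lerrS kn mulrDl -mulrA [lerr c n (_ - m) * _]mulrC S -/N /cn.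
    by move: (m%:~R) (lerr c n m) N Nd {cn pz} => x y N' Nd'; field.
  have B (m : int) : (m%:~R - d) * lerr c n.+1 m = cn * (m%:~R - 1) * lerr c n (m - 1).
    apply: (mulIf (pz m)); rewrite -[(m%:~R - d) * _ * _]mulrA A.
    transitivity (cn * ((m%:~R - d) * (m%:~R - n.+1%:R) * lerr c n m)); first by rewrite -/N; ring.
    by rewrite T -/N; ring.
  have N1 : n.+2%:R = N + 1 by rewrite -[n.+2%:R]natr1.
  split=> m; rewrite N1.
    rewrite B; have md : 1 - m%:~R + d != 0 by have := nd' (1 - m); rewrite mulrzBr.
    apply: (mulIf md).
    have := A (n.+2%:Z - m); rewrite mulrzBr -pmulrn N1 => hA.
    have := S (m - 1); rewrite mulrzBr -/N (_ : n.+1%:Z - (m - 1) = n.+2%:Z - m); last lia.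
    move=> hS.
    transitivity ((m%:~R - 1 - N + d) * (lerr c n.+1 (n.+2%:Z - m) * (N + 1 - m%:~R - N + d))); first by ring.
    rewrite hA; transitivity ((1 - m%:~R) * cn * ((m%:~R - 1%:~R - N + d) * lerr c n (n.+2%:Z - m))); first by ring.
    by rewrite hS; ring.
  have := A (m - 1); rewrite mulrzBr => hA.
  rewrite -mulrA mulrCA B.
  transitivity ((m%:~R - 1) * (lerr c n.+1 (m - 1) * (m%:~R - 1 - N + d))); last by ring.
  by rewrite hA; ring.
move=> n; have [S _] := main n; have nn : n.+1%:R - d != 0 by have := nz n.+1%:Z; rewrite -pmulrn.
apply: (mulIf nn); rewrite divfK//; apply: (mulIf (v0 n)); rewrite mulrAC lreflE//.
have := S 0; rewrite subr0 (@lerr_orth c n (fun i _ => v0 i)).1 mulr0z; lra.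
Qed.

End Levinson.

Section LevinsonWiener.
Context {R : realType}.
Local Notation W := (wiener R).
Definition wpol (n : nat) (p : nat -> R) : W :=
  \sum_(j < n.+1) wcst (p j) * zpow j%:Z.

Lemma wpol_mul n p x (k : int) : (x * wpol n p) k = \sum_(j < n.+1) p j * x (k - j%:Z).
Proof.
rewrite mulrC mulr_suml wsum; apply: eq_bigr => i _.
by rewrite -mulrA wcstM zpowM.
Qed.

Lemma wpolE n p (k : int) : wpol n p k = if 0 <= k <= n%:Z then p `|k|%N else 0.
Proof.
transitivity ((1 * wpol n p : W) k); first by rewrite mul1r.
rewrite wpol_mul; under eq_bigr do rewrite w1; case: ifP => hk.
  have kn : (`|k| < n.+1)%N by lia.
  rewrite (bigD1 (Ordinal kn))//= gez0_abs ?subrr ?eqxx ?mulr1; last by lia.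
  rewrite big1 ?addr0// => i ik; rewrite (_ : (_ == _) = false) ?mulr0//.
  by apply/negbTE; move: ik; apply: contra => /eqP e; apply/eqP/val_inj => /=; lia.
rewrite big1// => i _; rewrite (_ : (_ == _) = false) ?mulr0//.
by apply/negbTE/eqP => e; have := ltn_ord i; lia.
Qed.

Variables (h g psi : W) (kappa : R) (c : nat -> R).
Hypothesis of_ : outer_factor h g psi.
Hypothesis kappa0 : 0 < kappa.
Hypothesis hc : forall k : int, c `|k|%N = kappa * (h * rev h) k.

Lemma wpol_lerr n (k : int) : kappa * (h * rev h * wpol n (lpoly c n)) k = lerr c n k.
Proof.
rewrite wpol_mul mulr_sumr; apply: eq_bigr => i _; rewrite hc; ring.
Qed.

(** The variance is kappa times the squared l2 norm of [h * p], hence at least kappa times the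
    square of its constant coefficient 1. Lower bound and orthogonality come from one strong
    induction, since each order divides by the earlier variances. *)
Lemma lpoly_pred n : kappa <= lvar c n /\ pred_poly (h * rev h) n (wpol n (lpoly c n)).
Proof.
have kn : kappa != 0 by rewrite gt_eqF.
have aux m : (forall i, (i < m)%N -> lvar c i != 0) -> pred_poly (h * rev h) m (wpol m (lpoly c m)) /\ lvar c m = kappa * (h * rev h * wpol m (lpoly c m)) 0.
  move=> v0; have [e0 eo] := lerr_orth v0.
  split; last by rewrite wpol_lerr.
  split.
  - by move=> k hk; rewrite wpolE ifF//; lia.
  - by rewrite wpolE/= lpoly0.
  by move=> k hk; apply: (mulfI kn); rewrite wpol_lerr eo// mulr0.
have pos m : pred_poly (h * rev h) m (wpol m (lpoly c m)) -> 1 <= (h * rev h * wpol m (lpoly c m)) 0.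
  move=> pp; set p := wpol _ _.
  have -> : (h * rev h * p) 0 = ((h * p) * rev (h * p)) 0.
    rewrite revM (_ : h * p * (rev h * rev p) = h * rev h * p * rev p); last by ring.
    rewrite /p.
    have revp x : (x * rev (wpol m (lpoly c m))) 0 = \sum_(j < m.+1) lpoly c m j * x j.
      rewrite -[0 in LHS]oppr0 -revE revM revK wpol_mul; apply: eq_bigr => i _.
      by rewrite revE; congr (_ * x _); lia.
    rewrite revp big_ord_recl lpoly0 mul1r big1 ?addr0// => i _.
    by rewrite (pp_orth pp) ?mulr0//= /bump/=; have := ltn_ord i; lia.
  rewrite -[X in 1 <= X]/(dot (h * p) (h * p)) -n2sq; have [hg sh _ h0 _ _] := of_.
  have sp : supp_ge 0 p by move=> k k0; apply: (pp_supp pp); left.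
  have hp0 : (h * p) 0 = 1 by rewrite supp_ge_coef// h0 (pp_0 pp) mulr1.
  have h1 : 1 <= n2 (h * p) by rewrite -hp0; apply: le_trans (ler_norm _) (n2_coef _ _).
  by rewrite -[leLHS](expr1n _ 2) ler_pXn2r ?nnegrE ?n2_ge0.
elim: n {-2}n (leqnn n) => [|n IH] m mn.
  have := @aux m; case: m mn => // _ /(_ (fun i h => ltac:(by []))) [pp ->].
  by split => //; rewrite -[leLHS]mulr1 ler_pM2l//; exact: pos.
have [pp ->] : pred_poly (h * rev h) m (wpol m (lpoly c m)) /\ lvar c m = kappa * (h * rev h * wpol m (lpoly c m)) 0.
  apply: aux => i im; have [] := IH i; first by lia.
  by move=> ki _; rewrite gt_eqF// (lt_le_trans kappa0 ki).
by split => //; rewrite -[leLHS]mulr1 ler_pM2l//; exact: pos.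
Qed.

End LevinsonWiener.

(** * Comparison with the pure weight, uniformly in r *)

Section RegularWeight.
Context {R : realType}.
Local Notation W := (wiener R).
Variables (d M : R) (Ll : W).
Hypothesis dhalf : `|d| < 1 / 2.
Hypothesis M0 : 0 <= M.
Hypothesis LlM : decays M Ll.
Hypothesis Ll_supp : supp_ge 1 Ll.

Let u : W := Exp (rev Ll - Ll).
(** Serves both bounds required by [pred_diff]: the summand 1 for psi0, the square for the
    difference of the phases, where [2 * M] is the decay constant of [rev Ll - Ll]. *)
Let K : R := 1 + (392 * expR (32 * (2 * M))) ^+ 2.
Let c := cos (pi * d).
(** The midpoint between [|sin (pi d)|] and 1; the gap absorbs the tail of u for large orders. *)
Let rho := (1 + Num.sqrt (1 - c ^+ 2)) / 2.

Lemma exp_outer (L : W) : supp_ge 1 L -> outer_factor (Exp L) (Exp (- L)) (Exp (rev L - L)).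
Proof.
move=> sL; have sN : supp_ge 1 (- L) by move=> k k0; rewrite wN sL ?oppr0.
have [h1 h2] := Exp_supp sL; have [g1 g2] := Exp_supp sN.
by split => //; [exact: ExpN|rewrite Exp_rev -ExpD].
Qed.

Lemma phase_uni (L : W) : Exp (rev L - L) * rev (Exp (rev L - L)) = 1.
Proof. by rewrite Exp_rev revB revK -(opprB (rev L) L) ExpN. Qed.

(** The sum of the coefficients is the value at l = 0, where the odd argument of the phase
    vanishes. *)
Lemma phase_rsum : rsum u = 1.
Proof.
have -> : rsum u = wcos u 0 by apply: eq_rsum => k; rewrite mulr0 cos0 mulr1.
rewrite /u wcos_Exp_odd; last by rewrite revB revK opprB.
rewrite (_ : wsin _ 0 = 0) ?cos0// /wsin.
by rewrite (_ : (fun k => _) = (fun=> 0)) ?rsum0//; apply/funext => k; rewrite mulr0 sin0 mulr0.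
Qed.

Lemma phase_decays : decays (expR (32 * (2 * M))) u.
Proof.
apply: Exp_decays; first by rewrite mulr_ge0.
move=> k; rewrite wD wN revE; apply: le_trans (ler_normB _ _) _.
have := LlM k; have := LlM (- k); rewrite /omega abszN => h1 h2.
by rewrite mulr2n !mulrDl !mul1r lerD.
Qed.

Lemma rho01 : 0 <= rho < 1.
Proof.
have cp : 0 < c.
  rewrite /c cos_gt0_pihalf//; have := pi_gt0 R; move: dhalf; rewrite ltr_norml => /andP[d1 d2] p0.
  by apply/andP; split; nra.
have s0 := sqrtr_ge0 (1 - c ^+ 2).
have s1 : Num.sqrt (1 - c ^+ 2) < 1.
  rewrite -[ltRHS]sqrtr1 ltr_sqrt//; nra.
by rewrite /rho; apply/andP; split; lra.
Qed.

Lemma phase_tail : exists N0 : nat, forall N : nat, (N0 <= N)%N ->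
  n1 (wproj (geP N) u) <= rho - Num.sqrt (1 - c ^+ 2).
Proof.
have e0 : 0 < rho - Num.sqrt (1 - c ^+ 2) by have /andP[] := rho01; rewrite /rho; lra.
have [N0 h] := n1_trunc u e0; exists N0 => N /h; apply: le_trans.
apply: ler_rsum; [exact/summ_abs/wsumm..|] => k; rewrite wB !wprojE /geP.
case: ifP => hk; last by rewrite normr0.
by rewrite ifF ?subr0//; lia.
Qed.

Variable r : R.
Hypothesis (r0 : 0 <= r) (r1 : r < 1) (rhalf : 1 / 2 <= r).

Let L := Ll + lpure d r0 r1.

Lemma phase_factor : Exp (rev L - L) = u * psi_pure d r0 r1.
Proof. by rewrite -ExpD; congr Exp; rewrite /L revD; ring. Qed.

Lemma L_supp : supp_ge 1 L.
Proof. by move=> k k1; rewrite wD Ll_supp// lpure_supp// addr0. Qed.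

Lemma contr_of (v : W) (n : nat) : v * rev v = 1 ->
  n1 (wproj (geP n) v) <= rho - Num.sqrt (1 - c ^+ 2) ->
  hankel_contr n (v * psi_pure d r0 r1) rho.
Proof.
move=> vu hv a sa.
have cle : c <= 1 by exact: cos_le1.
have c0 : 0 <= c.
  rewrite /c cos_ge0_pihalf//; have := pi_gt0 R; move: dhalf; rewrite ltr_norml => /andP[d1 d2] p0.
  by apply/andP; split; nra.
have c01 : 0 <= c <= 1 by rewrite c0.
have := @hankel_contraction R (psi_pure d r0 r1) v c n (psi_uni d r0 r1) vu c01 _ a sa.
move=> /(_ (fun l => wcos_psi_pure r0 r1 l (ltW dhalf))) h.
apply: le_trans h _; rewrite ler_wpM2r ?n2_ge0//.
have := n1_ge0 (wproj (geP n) v); nra.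
Qed.

(* The constants do not depend on r. *)
Lemma levinson_compare (n N0 : nat) (c1 c0 : nat -> R) (k1 k0 : R) :
  (forall N : nat, (N0 <= N)%N -> n1 (wproj (geP N) u) <= rho - Num.sqrt (1 - c ^+ 2)) ->
  0 < k1 -> 0 < k0 ->
  (forall k : int, c1 `|k|%N = k1 * (Exp L * rev (Exp L)) k) ->
  (forall k : int, c0 `|k|%N = k0 * (Exp (lpure d r0 r1) * rev (Exp (lpure d r0 r1))) k) ->
  (N0 <= n)%N -> (0 < n)%N ->
  `|lpoly c1 n n - lpoly c0 n n| <= (1 + 64 * (1 + K) ^+ 2 / (1 - rho) ^+ 2) * (1 + K) / (n%:R * Num.sqrt n%:R) /\
  lvar c1 n <= k1 * (1 + 4 * (1 + K) / (1 - rho) / Num.sqrt n%:R).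
Proof.
move=> hN k1p k0p h1 h0 Nn n0.
have o1 := exp_outer L_supp; have o0 := exp_outer (lpure_supp d r0 r1).
have [_ p1] := lpoly_pred o1 k1p h1 n; have [_ p0] := lpoly_pred o0 k0p h0 n.
have [a [b [[sa sb ea eb] [pa va]]]] := pred_hankel o1 p1.
have [a0 [b0 [[sa0 sb0 ea0 eb0] [pa0 va0]]]] := pred_hankel o0 p0.
rewrite phase_factor in ea eb pa.
have hc : hankel_contr n.+1 (u * psi_pure d r0 r1) rho.
  by apply: contr_of; [exact: phase_uni|apply: hN; exact: leqW].
have hc0 : hankel_contr n.+1 (psi_pure d r0 r1) rho.
  rewrite -[psi_pure d r0 r1]mul1r; apply: contr_of; first by rewrite rev1 mulr1.
  rewrite (_ : wproj _ _ = 0); last first.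
    apply: wiener_ext => k; rewrite wprojE /geP w0 w1; case: ifP => // hk.
    by rewrite (_ : (k == 0) = false)//; apply/negbTE/eqP => k00; move: hk; rewrite k00.
  by rewrite n1_0; have /andP[] := rho01; rewrite /rho; lra.
have K0 : 0 <= K := addr_ge0 ler01 (sqr_ge0 _).
have K1 : 1 <= K by rewrite lerDl sqr_ge0.
have [] := pred_diff n0 rho01 K0 hc hc0 _ _ sa sb ea eb sa0 sb0 ea0 eb0.
- move=> k k00; have := psi_pure_le r0 r1 (ltW dhalf) k00 => h.
  apply: (@le_trans _ _ (k%:R^-1 ^+ 2)); first by rewrite -[leLHS]real_normK ?num_real// ler_pXn2r ?nnegrE// invr_ge0.
  by rewrite exprVn ler_peMl// invr_ge0 exprn_ge0.
- move=> k k00; have := @phase_diff R r d (expR (32 * (2 * M))) r0 r1 rhalf (ltW dhalf) u (expR_ge0 _) phase_decays phase_rsum k k00.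
  move/le_trans; apply; rewrite ler_wpM2r ?invr_ge0 ?exprn_ge0//.
  by rewrite lerDr.
rewrite -pa -pa0 !wpolE lexx le0z_nat !absz_nat => hd hv; split => //.
rewrite (_ : lvar c1 n = k1 * a 0); last first.
  rewrite -va (wpol_lerr h1) (lerr_orth _).1//.
  by move=> i _; have [ki _] := lpoly_pred o1 k1p h1 i; rewrite gt_eqF// (lt_le_trans k1p ki).
rewrite ler_pM2l//.
have h := le_trans (ler_norm _) (n2_coef (a - 1) 0); rewrite wB w1 eqxx in h.
by rewrite -lerBlDl; exact: le_trans h hv.
Qed.

End RegularWeight.

(** * Singular weights *)

Section EvenIntegrals.
Context {R : realType}.
Local Notation mu := (@lebesgue_measure R).
Local Notation D := [set` `](- (pi : R)), (pi : R)]%R].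
Implicit Types f F : R -> R.

Lemma circle_dct (Fn : nat -> R -> R) f (g : R -> R) :
  (forall n, measurable_fun D (Fn n)) -> measurable_fun D f -> mu.-integrable D (EFin \o g) ->
  (forall x, D x -> x != 0 -> (fun n => Fn n x) @ \oo --> f x) ->
  (forall n x, D x -> x != 0 -> `|Fn n x| <= g x) ->
  mu.-integrable D (EFin \o f) /\ (fun n => Rintegral mu D (Fn n)) @ \oo --> Rintegral mu D f.
Proof.
move=> mF mf ig cF bF.
have nul : mu.-negligible [set (0 : R)].
  by exists [set 0]; split => //; rewrite lebesgue_measure_set1.
have [||||i0 _ h] := @dominated_convergence _ _ R mu D (@mD R) (fun n => EFin \o Fn n) (EFin \o f) (EFin \o g) _ _ _ ig.
- by move=> n; apply/measurable_EFinP; exact: mF.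
- exact/measurable_EFinP.
- apply: negligibleS nul => x /=; apply: contra_notP => x0 Dx; apply: cvg_EFin; first by near=> n.
  by apply: cF => //; apply/eqP.
- apply: negligibleS nul => x /=; apply: contra_notP => x0 n Dx.
  by rewrite lee_fin; apply: bF => //; apply/eqP.
split => //; rewrite /Rintegral; apply: (@fine_cvg _ _ \oo _ (fun n => \int[mu]_(x in D) (Fn n x)%:E)%E).
by rewrite fineK//; exact: integrable_fin_num.
Unshelve. all: by end_near. Qed.

Lemma circle_split f (a : R) : 0 < a < pi -> mu.-integrable D (EFin \o f) -> (forall x, f (- x) = f x) ->
  (forall x, a <= x <= pi -> {for x, continuous f}) ->
  Rintegral mu D f = Rintegral mu `]- a, a[ f + 2 * Rintegral mu `[a, pi] f.
Proof.
move=> /andP[a0 ap] iF ev cf.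
have p0 := pi_gt0 R.
have E : D = (`]- pi, - a] `|` (`]- a, a[ `|` `[a, pi]))%classic.
  apply/seteqP; split => x /=; rewrite !in_itv/=.
    move=> /andP[x1 x2]; case: (lerP x (- a)) => h1; first by left; rewrite x1.
    by right; case: (ltrP x a) => h2; [left|right; rewrite x2].
  by move=> [/andP[x1 x2]|[/andP[x1 x2]|/andP[x1 x2]]]; apply/andP; split; lra.
have sub (A : set (measurableTypeR R)) : A `<=` D -> measurable A -> mu.-integrable A (EFin \o f).
  by move=> AD mA; apply: (@integrableS _ _ _ mu D) => //; exact: mD.
have s1 : `]- pi, - a]%classic `<=` D by rewrite E => x; left.
have s2 : (`]- a, a[ `|` `[a, pi])%classic `<=` D by rewrite E => x; right.
rewrite {1}E Rintegral_setU//; last 2 first.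
- by rewrite -E.
- apply/disj_setPS => x /= [] ; rewrite !in_itv/= => /andP[x1 x2] [/andP[x3 x4]|/andP[x3 x4]]; lra.
rewrite Rintegral_setU//; last 2 first.
- by apply: sub => //; exact: measurableU.
- by apply/disj_setPS => x /= []; rewrite !in_itv/= => /andP[x1 x2] /andP[x3 x4]; lra.
rewrite Rintegral_itv_obnd_cbnd; last exact: sub.
have cf' : {within `[- pi, - a], continuous f}.
  apply: continuous_in_subspaceT => x /set_mem/=; rewrite in_itv/= => /andP[x1 x2].
  have e : f = f \o -%R by apply/funext => y; rewrite /= ev.
  have h : {for - x, continuous f} by apply: cf; apply/andP; split; lra.
  by rewrite e; apply: continuous_comp; [exact: opp_continuous|exact: h].
have -> : Rintegral mu `[- pi, - a] f = Rintegral mu `[a, pi] f.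
  rewrite /Rintegral integration_by_substitution_oppr//; last exact: ltW.
  by congr fine; apply: eq_integral => x _; rewrite /= ev.
  by ring.
exact: measurableU.
Qed.

(** Meant for integrands singular at 0: the fundamental theorem applies on [[pi / (n + 2), pi]], and
    the shrinking middle interval contributes nothing in the limit, by dominated convergence. *)
Lemma circle_antiderivative f F (L : R) : mu.-integrable D (EFin \o f) -> (forall x, f (- x) = f x) ->
  (forall x, 0 < x <= pi -> is_derive x 1 F (f x)) -> (forall x, 0 < x <= pi -> {for x, continuous f}) ->
  (fun n : nat => F (pi / n.+2%:R)) @ \oo --> L ->
  Rintegral mu D f = 2 * (F pi - L).
Proof.
move=> iF ev dF cf cL.
pose a n : R := pi / n.+2%:R.
have p0 := pi_gt0 R.
have a01 n : 0 < a n < pi.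
  by rewrite divr_gt0//= ltr_pdivrMr// ltr_pMr// ltr1n.
have E n : Rintegral mu D f = Rintegral mu `]- a n, a n[ f + 2 * (F pi - F (a n)).
  have /andP[an0 anp] := a01 n.
  rewrite (circle_split (a01 n) iF ev) => [|x /andP[x1 x2]]; last by apply: cf; rewrite (lt_le_trans an0).
  suff -> : Rintegral mu `[a n, pi] f = F pi - F (a n) by [].
  apply: Rintegral_FTC => // [x /andP[x1 x2]|].
    by apply: dF; rewrite (lt_le_trans an0).
  apply: continuous_in_subspaceT => x /set_mem/=; rewrite in_itv/= => /andP[x1 x2].
  by apply: cf; rewrite (lt_le_trans an0).
have a0 : a @ \oo --> 0.
  rewrite -[X in _ --> X](mulr0 (pi : R)); apply: cvgM; first exact: cvg_cst.
  have := @cvg_harmonic R; rewrite -cvg_shiftS; exact.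
have [_ h0] : mu.-integrable D (EFin \o (cst 0 : R -> R)) /\
    (fun n => Rintegral mu D (f \_ `]- a n, a n[)) @ \oo --> Rintegral mu D (cst 0).
  apply: (@circle_dct _ _ (fun x => `|f x|)).
  - move=> n; have /integrableP[/measurable_EFinP mf _] := iF.
    apply/(measurable_restrict f (measurable_itv _) (@mD R)).
    by apply: measurable_funS mf => // x [].
  - exact: measurable_cst.
  - exact: integrable_norm iF.
  - move=> x Dx x0; apply: cvg_near_cst.
    have [N _ hN] := (@cvgrPdist_lt _ _ _ _ _ _ _).1 a0 `|x| (ltac:(by rewrite normr_gt0)).
    exists N => // n /hN; rewrite sub0r normrN ger0_norm; last by have /andP[/ltW] := a01 n.
    move=> /= ax; rewrite patchE; case: ifPn => // /set_mem; rewrite /= in_itv => /andP[h1 h2].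
    have h : `|x| < a n by rewrite ltr_norml; apply/andP; split.
    by have := lt_trans ax h; rewrite ltxx.
  - by move=> n x _ _; rewrite patchE; case: ifP => // _; rewrite normr0.
have hh n : Rintegral mu D (f \_ `]- a n, a n[) = Rintegral mu `]- a n, a n[ f.
  rewrite -Rintegral_mkcondr; congr Rintegral; apply/seteqP; split => x; first by case.
  move=> h; split => //; move: h; rewrite /= !in_itv/= => /andP[x1 x2].
  by have /andP[h1 h2] := a01 n; apply/andP; split; lra.
have h1 : (fun n => Rintegral mu `]- a n, a n[ f + 2 * (F pi - F (a n))) @ \oo --> 0 + 2 * (F pi - L).
  apply: cvgD; last by apply: cvgM; [exact: cvg_cst|apply: cvgB => //; exact: cvg_cst].
  under eq_fun do rewrite -hh.
  rewrite (_ : 0 = Rintegral mu D (cst 0))//.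
  by rewrite Rintegral_cst ?mul0r//; exact: mD.
have h2 : (fun n : nat => Rintegral mu D f) @ \oo --> Rintegral mu D f by exact: cvg_cst.
rewrite -[RHS]add0r -(cvg_lim (@Rhausdorff R) h1) -[LHS](cvg_lim (@Rhausdorff R) h2).
by congr (lim (_ @ \oo)); apply/funext => n; rewrite -E.
Qed.

End EvenIntegrals.

Section SingularWeight.
Context {R : realType}.
Local Notation W := (wiener R).
Local Notation mu := (@lebesgue_measure R).
Local Notation D := [set` `](- (pi : R)), (pi : R)]%R].

Definition wsing (l : R) : R := 2 - 2 * cos l.

Lemma cos_lt1 (l : R) : D l -> l != 0 -> cos l < 1.
Proof.
rewrite /= in_itv/= => /andP[l1 l2] l0; have p0 := pi_gt0 R.
rewrite -cos_norm -[ltRHS]cos0 ltr_cos ?in_itv/= ?lexx ?normr_ge0 ?normr_gt0 ?pi_ge0//.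
by rewrite ler_norml l2 ltW.
Qed.

Lemma wsing_gt0 (l : R) : D l -> l != 0 -> 0 < wsing l.
Proof. by move=> Dl l0; have := cos_lt1 Dl l0; rewrite /wsing; lra. Qed.

Lemma wsing_ge0 (l : R) : 0 <= wsing l.
Proof. by have := cos_le1 l; rewrite /wsing; lra. Qed.

Lemma wpoly_wsing (r l : R) : wpoly r l = (1 - r) ^+ 2 + r * wsing l.
Proof. by rewrite /wpoly /wsing; ring. Qed.

Lemma wpoly_gt0 (r l : R) : 0 <= r -> r < 1 -> 0 < wpoly r l.
Proof.
by move=> r0 r1; rewrite wpoly_wsing ltr_pwDl ?exprn_gt0 ?subr_gt0// mulr_ge0// wsing_ge0.
Qed.

Lemma powR_expR (a x : R) : 0 < a -> a `^ x = expR (x * ln a).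
Proof. by move=> a0; rewrite /powR gt_eqF. Qed.

(** A majorant uniform in r. For [d >= 0] it comes from [wpoly r l >= wsing l / 2], for [d < 0] from
    [wpoly r l <= 4]; a power of 2 with exponent in [0, 1 / 2] is at most 2. *)
Lemma wpoly_powR_le (r d l : R) : 1 / 2 <= r -> r < 1 -> `|d| < 1 / 2 -> D l -> l != 0 ->
  wpoly r l `^ (- d) <= 2 * wsing l `^ (- d) + 4.
Proof.
move=> r0 r1 d2 Dl l0; have w0 := wsing_gt0 Dl l0.
have wr0 : 0 < wpoly r l by apply: wpoly_gt0; lra.
have p1 := powR_gt0 (- d) w0.
have e2 (x : R) : 0 <= x -> x <= 1 / 2 -> expR (x * ln 2) <= 2.
  move=> x0 x1; apply: (@le_trans _ _ (expR (ln 2))); last by rewrite lnK ?posrE.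
  by rewrite ler_expR; have := @ln_ge0 R 2 (ltac:(by rewrite ler1n)); nra.
move: d2; rewrite ltr_norml => /andP[d1 d2].
have [d0|d0] := lerP 0 d.
  have h : wpoly r l `^ (- d) <= (wsing l / 2) `^ (- d).
    have h2 : wsing l / 2 <= wpoly r l by rewrite wpoly_wsing; nra.
    rewrite !powR_expR// ?divr_gt0// ler_expR !mulNr lerN2 ler_wpM2l// ler_ln ?posrE// divr_gt0//.
  apply: (le_trans h); rewrite -[leLHS]addr0 lerD//.
  have -> : (wsing l / 2) `^ (- d) = wsing l `^ (- d) * 2^-1 `^ (- d) by rewrite powRM ?invr_ge0 ?ltW.
  rewrite mulrC ler_pM2r// powR_expR ?invr_gt0// lnV ?posrE// mulrNN.
  by apply: e2 => //; lra.
apply: (@le_trans _ _ 4); last by rewrite lerDr mulr_ge0// ltW.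
have w4 : wpoly r l <= 4 by rewrite /wpoly; have := cos_geN1 l; nra.
apply: (@le_trans _ _ (4 `^ (- d))).
  by rewrite ge0_ler_powR ?nnegrE//; lra.
rewrite powR_expR// (_ : 4 = 2 * 2 :> R); last by ring.
rewrite lnM ?posrE// mulrDr expRD; apply: ler_pM; rewrite ?expR_ge0//; apply: e2; lra.
Qed.

Lemma powR_cvg (a : nat -> R) (b x : R) : 0 < b -> (forall n, 0 < a n) -> a @ \oo --> b ->
  (fun n => a n `^ x) @ \oo --> b `^ x.
Proof.
move=> b0 a0 ab; rewrite powR_expR//; under eq_fun do rewrite powR_expR//.
apply: continuous_cvg; first exact: continuous_expR.
apply: cvgM; first exact: cvg_cst.
by apply: continuous_cvg => //; exact: continuous_ln.
Qed.

Lemma measurable_wpow (r x : R) : measurable_fun D (fun l => wpoly r l `^ x).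
Proof.
apply: (@measurableT_comp _ _ _ _ _ _ (fun y : R => y `^ x)); first exact: measurable_powR.
apply: measurable_funTS; apply: continuous_measurable_fun => l; rewrite /wpoly.
apply: cvgD; last exact: cvg_cst.
apply: cvgB; first exact: cvg_cst.
by apply: cvgM; [exact: cvg_cst|exact: continuous_cos].
Qed.

Lemma wsing_wpoly (l : R) : wsing l = wpoly 1 l.
Proof. by rewrite /wpoly /wsing; ring. Qed.

Lemma integrable_scale (A : set (measurableTypeR R)) (f : R -> R) (c : R) : measurable A -> mu.-integrable A (EFin \o f) ->
  mu.-integrable A (EFin \o (fun x => c * f x)).
Proof. by move=> mA h; exact: (integrableZl mA c h). Qed.

Lemma integrable_sub (A : set (measurableTypeR R)) (f g : R -> R) : measurable A -> mu.-integrable A (EFin \o f) ->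
  mu.-integrable A (EFin \o g) -> mu.-integrable A (EFin \o (fun x => f x - g x)).
Proof.
move=> mA hf hg; have := integrableB mA hf hg.
by apply: eq_integrable => // x _; rewrite /= EFinB.
Qed.

Lemma integrable_add (A : set (measurableTypeR R)) (f g : R -> R) : measurable A -> mu.-integrable A (EFin \o f) ->
  mu.-integrable A (EFin \o g) -> mu.-integrable A (EFin \o (fun x => f x + g x)).
Proof.
move=> mA hf hg; have := integrableD mA hf hg.
by apply: eq_integrable => // x _; rewrite /= EFinD.
Qed.

Lemma pi_seq_cvg0 : (fun n : nat => pi / n.+2%:R : R) @ \oo --> 0.
Proof.
rewrite -[X in _ --> X](mulr0 (pi : R)); apply: cvgM; first exact: cvg_cst.
by have := @cvg_harmonic R; rewrite -cvg_shiftS; exact.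
Qed.

Section PureRecursion.
Variables (d : R) (dhalf : `|d| < 1 / 2).
Hypothesis iw : mu.-integrable D (EFin \o (fun l => wsing l `^ (- d))).

Lemma iw_cos (k : int) : mu.-integrable D (EFin \o (fun l : R => wsing l `^ (- d) * cos (k%:~R * l))).
Proof.
have mw : measurable_fun D (fun l => wsing l `^ (- d)).
  rewrite (_ : (fun l => _) = (fun l => wpoly 1 l `^ (- d))); first exact: measurable_wpow.
  by apply/funext => l; rewrite wsing_wpoly.
apply: le_integrable iw => //.
- apply/measurable_EFinP; apply: measurable_funM => //.
  apply: measurable_funTS; apply: continuous_measurable_fun; exact: cos_lin_continuous.
- move=> l _; rewrite lee_fin normrM -[leRHS]mulr1 ler_wpM2l//; exact: cos_max.
Qed.

Lemma sin_le_id (x : R) : 0 <= x -> sin x <= x.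
Proof.
move=> x0; have := @mvt_bound R sin cos 0 x 1 x0; rewrite sin0 !subr0 mul1r => h.
apply: (le_trans (ler_norm _)); by apply: h => t _; exact: cos_max.
Qed.

Lemma wsing_half (l : R) : wsing l = (2 * sin (l / 2)) ^+ 2.
Proof.
rewrite /wsing; have -> : cos l = cos ((l / 2) *+ 2) by congr cos; rewrite mulr2n; field.
by rewrite cos_mulr2n exprMn sin2cos2; ring.
Qed.

(** The difference of the two integrands is the derivative of [(2 sin (l / 2))^(1 - 2 d) cos ((k + 1
    / 2) l)], which vanishes at pi because of the cosine and tends to 0 at the origin because
    [1 - 2 d > 0]. No closed form of the covariances is required. *)
Lemma pure_rec (k : nat) :
  (k.+1%:R - d) * Rintegral mu D (fun l : R => wsing l `^ (- d) * cos (k.+1%:R * l)) =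
  (k%:R + d) * Rintegral mu D (fun l : R => wsing l `^ (- d) * cos (k%:R * l)).
Proof.
have p0 := pi_gt0 R; move: (dhalf); rewrite ltr_norml => /andP[d1 d2].
have i1 := iw_cos k.+1; have i2 := iw_cos k; rewrite -!pmulrn in i1 i2.
apply/eqP; rewrite -subr_eq0 -!RintegralZl//; [|exact: mD..].
rewrite -RintegralB; [|exact: mD|exact: integrable_scale..].
pose f (l : R) := (k.+1%:R - d) * (wsing l `^ (- d) * cos (k.+1%:R * l)) - (k%:R + d) * (wsing l `^ (- d) * cos (k%:R * l)).
rewrite -[X in X == 0]/(Rintegral mu D f).
pose F (l : R) := (2 * sin (l / 2)) `^ (1 - 2 * d) * cos ((k%:R + 1 / 2) * l).
have ws (l : R) : 0 < l <= pi -> 0 < 2 * sin (l / 2).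
  by move=> /andP[l1 l2]; rewrite mulr_gt0// sin_gt0_pi//; apply/andP; split; lra.
have dF (l : R) : 0 < l <= pi -> is_derive l 1 F (f l).
  move=> hl; have s0 := ws l hl.
  have h1 : is_derive l 1 (fun l : R => 2 * sin (l / 2)) (cos (l / 2)).
    apply: (d_ext (dZ 2 (dsin (dZ 2^-1 (did l))))) => [t|]; first by rewrite mulrC [_ / 2]mulrC mulrC.
    by rewrite mulr1 [2^-1 * l]mulrC mulrCA divff ?mulr1.
  have h2 := @dpowR R (fun l : R => 2 * sin (l / 2)) l _ (1 - 2 * d) s0 h1.
  have h3 := dcos (dZ (k%:R + 1 / 2) (did l)).
  apply: (d_ext (dM h2 h3)) => // .
  have -> : (2 * sin (l / 2)) `^ (1 - 2 * d) = 2 * sin (l / 2) * (2 * sin (l / 2)) `^ (- 2 * d).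
    by rewrite -mulr_powRB1 ?(ltW s0)//; [congr (_ * _ `^ _); ring|lra].
  have -> : 1 - 2 * d - 1 = - 2 * d by ring.
  rewrite /f; have -> : wsing l `^ (- d) = (2 * sin (l / 2)) `^ (- 2 * d).
    rewrite wsing_half -powR_mulrn ?ltW// -powRrM; congr (_ `^ _); ring.
  rewrite -[k.+1%:R]natr1.
  set q := _ `^ _.
  have c1 : cos ((k%:R + 1) * l) = cos ((k%:R + 1 / 2) * l) * cos (l / 2) - sin ((k%:R + 1 / 2) * l) * sin (l / 2).
    by rewrite -cosD; congr cos; field.
  have c2 : cos (k%:R * l) = cos ((k%:R + 1 / 2) * l) * cos (l / 2) + sin ((k%:R + 1 / 2) * l) * sin (l / 2).
    by rewrite -cosB; congr cos; field.
  by rewrite c1 c2; field.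
have ef (l : R) : f (- l) = f l by rewrite /f /wsing !mulrN !cosN.
have cf (l : R) : 0 < l <= pi -> {for l, continuous f}.
  move=> hl; have w0 : 0 < wsing l by rewrite wsing_half exprn_gt0// ws.
  have hw : is_derive l 1 (fun t => wsing t `^ (- d)) (- d * wsing l `^ (- d - 1) * (2 * sin l)).
    apply: (dpowR _ w0); apply: (d_ext (dB (dcst l 2) (dZ 2 (is_derive_cos l)))) => //; ring.
  have hc (c : R) := dM hw (dcos (dZ c (did l))).
  exact: d_cont (dB (dZ (k.+1%:R - d) (hc k.+1%:R)) (dZ (k%:R + d) (hc k%:R))).
have iF : mu.-integrable D (EFin \o f).
  have h1 := integrable_scale (k.+1%:R - d) (@mD R) i1; have h2 := integrable_scale (k%:R + d) (@mD R) i2.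
  exact: (integrable_sub (@mD R) h1 h2).
rewrite (@circle_antiderivative R f F 0 iF ef dF cf).
  rewrite subr0 /F (_ : (k%:R + 1 / 2) * pi = k%:R * pi + pi / 2); last by field.
  by rewrite cosDpihalf -[k%:R]/(k%:Z%:~R) sin_pi_int oppr0 !mulr0.
rewrite /F; apply/norm_cvg0P; apply: (@squeeze_cvgr _ _ _ _ (cst 0) (fun n : nat => (pi / n.+2%:R) `^ (1 - 2 * d))).
- near=> n; rewrite normr_ge0/= normrM.
  have s0 := ws (pi / n.+2%:R) (ltac:(by rewrite divr_gt0//= ler_pdivrMr// ler_pMr// ler1n)).
  rewrite ger0_norm ?powR_ge0// -[leRHS]mulr1; apply: ler_pM => //; rewrite ?powR_ge0 ?cos_max//.
  apply: ge0_ler_powR; rewrite ?nnegrE ?(ltW s0) ?divr_ge0 ?(ltW p0)//; first lra.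
  have x0 : 0 <= pi / n.+2%:R :> R by rewrite divr_ge0// ltW.
  move: (pi / n.+2%:R) x0 => x x0; have h : sin (x / 2) <= x / 2 by apply: sin_le_id; lra.
  by move: (sin (x / 2)) h => y h; lra.
- exact: cvg_cst.
have e0 : 0 < 1 - 2 * d by lra.
have h : forall u : nat -> R, (forall n, 0 < u n) /\ u @ \oo --> 0 -> (fun n => u n `^ (1 - 2 * d)) @ \oo --> 0.
  by apply/(cvg_at_rightP (fun x : R => x `^ (1 - 2 * d))); exact: powR_cvg0.
by apply: h; split; [move=> n; rewrite divr_gt0|exact: pi_seq_cvg0].
Unshelve. all: by end_near.
Qed.

End PureRecursion.

End SingularWeight.

(** * The singular weight as a limit of regular weights *)

Section CoreWeight.
Context {R : realType}.
Local Notation W := (wiener R).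
Local Notation mu := (@lebesgue_measure R).
Local Notation D := [set` `](- (pi : R)), (pi : R)]%R].
Variables (d : R) (dhalf : `|d| < 1 / 2).
Hypothesis iw : mu.-integrable D (EFin \o (fun l => wsing l `^ (- d))).

Definition rseq (m : nat) : R := m.+1%:R / m.+2%:R.
Lemma rseqE m : rseq m = 1 - m.+2%:R^-1.
Proof. by rewrite /rseq -[m.+2%:R]natr1; field; rewrite lt0r_neq0// ltr_wpDl. Qed.
Lemma rseq0 m : 0 <= rseq m. Proof. by rewrite divr_ge0. Qed.
Lemma rseq1 m : rseq m < 1. Proof. by rewrite rseqE ltrBlDr ltrDl invr_gt0. Qed.
Lemma rseq_half m : 1 / 2 <= rseq m.
Proof.
rewrite rseqE; have : m.+2%:R^-1 <= 2^-1 :> R by rewrite lef_pV2 ?posrE// ler_nat.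
by move: (m.+2%:R^-1) => x h; lra.
Qed.
Lemma rseq_cvg : rseq @ \oo --> (1 : R).
Proof.
rewrite (_ : rseq = fun m => 1 - m.+2%:R^-1); last by apply/funext => m; rewrite rseqE.
rewrite -[X in _ --> X]subr0; apply: cvgB; first exact: cvg_cst.
by have := @cvg_harmonic R; rewrite -cvg_shiftS; exact.
Qed.

Definition smooth (l0 : R) (Ll : W) (l : R) : R := expR (l0 + 2 * wcos Ll l).
Definition acov l0 Ll (k : nat) : R := Rintegral mu D (fun l : R => smooth l0 Ll l * wsing l `^ (- d) * cos (k%:R * l)).
Definition rfactor Ll m : W := Exp (Ll + lpure d (rseq0 m) (rseq1 m)).
Definition racov l0 Ll (m k : nat) : R := 2 * pi * expR l0 * (rfactor Ll m * rev (rfactor Ll m)) k.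

Lemma rfactor_even Ll m : rev (rfactor Ll m * rev (rfactor Ll m)) = rfactor Ll m * rev (rfactor Ll m).
Proof. by rewrite revM revK mulrC. Qed.

Lemma racov_int l0 Ll m (k : int) : racov l0 Ll m `|k|%N = 2 * pi * expR l0 * (rfactor Ll m * rev (rfactor Ll m)) k.
Proof.
case: k => n; first by rewrite absz_nat.
rewrite /racov -[in RHS]rfactor_even revE; congr (_ * (_ : W) _); lia.
Qed.

Lemma racovE l0 Ll m (k : nat) :
  racov l0 Ll m k = Rintegral mu D (fun l : R => smooth l0 Ll l * wpoly (rseq m) l `^ (- d) * cos (k%:R * l)).
Proof.
set x := rfactor Ll m * rev (rfactor Ll m).
have -> : racov l0 Ll m k = expR l0 * (pi * (x k + x (- k%:Z))).
  rewrite (_ : x (- k%:Z) = x k); last by rewrite /x -[in LHS]rfactor_even revE opprK.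
  by rewrite /racov -/x; ring.
rewrite -circle_wcos -RintegralZl; [|exact: mD|exact: wcos_cos_integrable].
apply: eq_circle => l _; rewrite -pmulrn mulrA; congr (_ * _).
rewrite /x /rfactor Exp_rev -ExpD wcos_Exp_even; last by rewrite revD revK addrC.
rewrite -expRD /smooth wcosD wcos_rev wcosD wcos_lpure.
rewrite powR_expR ?wpoly_gt0 ?rseq0 ?rseq1// -expRD; congr expR; by field.
Qed.

Lemma acov_cvg l0 Ll (k : nat) : (fun m => racov l0 Ll m k) @ \oo --> acov l0 Ll k.
Proof.
have ms : measurable_fun D (smooth l0 Ll).
  apply: measurableT_comp => //; apply: measurable_funD => //.
  by apply: measurable_funM => //; exact: wcos_measurable.
have mc : measurable_fun D (fun l : R => cos (k%:R * l)).
  apply: measurable_funTS; apply: continuous_measurable_fun; exact: cos_lin_continuous.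
have mF r : measurable_fun D (fun l : R => smooth l0 Ll l * wpoly r l `^ (- d) * cos (k%:R * l)).
  apply: measurable_funM => //; apply: measurable_funM => //.
  exact: measurable_wpow.
under eq_fun do rewrite racovE.
pose B := expR (l0 + 2 * n1 Ll).
have sB l : 0 <= smooth l0 Ll l <= B.
  rewrite expR_ge0 ler_expR lerD2l ler_pM2l//; exact: le_trans (ler_norm _) (wcos_le _ _).
apply: (@circle_dct R _ _ (fun l => B * (2 * wsing l `^ (- d) + 4)) _ _ _ _ _).2.
- by move=> m; exact: mF.
- rewrite (_ : (fun l : R => _) = (fun l : R => smooth l0 Ll l * wpoly 1 l `^ (- d) * cos (k%:R * l))); first exact: mF.
  by apply/funext => l; rewrite wsing_wpoly.
- apply: integrable_scale; first exact: mD.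
  have h4 : mu.-integrable D (EFin \o (cst 4 : R -> R)) by apply: cont_integrableD; exact: cst_continuous.
  exact: (integrable_add (@mD R) (integrable_scale 2 (@mD R) iw) h4).
- move=> l Dl l0'; apply: cvgM; last exact: cvg_cst.
  apply: cvgM; first exact: cvg_cst.
  apply: powR_cvg; first exact: wsing_gt0.
    by move=> m; rewrite wpoly_gt0 ?rseq0 ?rseq1.
  rewrite wsing_wpoly /wpoly; apply: cvgD; last first.
    by rewrite expr2; under eq_fun do rewrite expr2; apply: cvgM; exact: rseq_cvg.
  apply: cvgB; first exact: cvg_cst.
  apply: cvgM; last exact: cvg_cst.
  by apply: cvgM; [exact: cvg_cst|exact: rseq_cvg].
- move=> m l Dl l0'; have /andP[s0 s1] := sB l.
  rewrite !normrM -[leRHS]mulr1; apply: ler_pM; rewrite ?mulr_ge0 ?cos_max//.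
  rewrite (ger0_norm s0) [X in _ * X]ger0_norm ?powR_ge0//.
  apply: ler_pM; rewrite ?powR_ge0//; apply: wpoly_powR_le => //; [exact: rseq_half|exact: rseq1].
Qed.

(** The limiting prediction variance of the weight [smooth l0 Ll * wsing^(-d)] when Ll has no
    constant coefficient: the logarithms of the remaining factors have mean zero. *)
Definition kvar (l0 : R) : R := 2 * pi * expR l0.
Lemma kvar_gt0 l0 : 0 < kvar l0.
Proof. by rewrite /kvar !mulr_gt0 ?pi_gt0 ?expR_gt0. Qed.

Lemma racov_var l0 Ll m n : supp_ge 1 Ll -> kvar l0 <= lvar (racov l0 Ll m) n.
Proof.
move=> sL; have sL' : supp_ge 1 (Ll + lpure d (rseq0 m) (rseq1 m)).
  by move=> k k1; rewrite wD sL// lpure_supp// addr0.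
exact: (lpoly_pred (exp_outer sL') (kvar_gt0 l0) (racov_int l0 Ll m) n).1.
Qed.

Lemma core_cvg l0 Ll n : supp_ge 1 Ll -> [/\ kvar l0 <= lvar (acov l0 Ll) n,
  (fun m => lvar (racov l0 Ll m) n) @ \oo --> lvar (acov l0 Ll) n &
  forall j, (fun m => lpoly (racov l0 Ll m) n j) @ \oo --> lpoly (acov l0 Ll) n j].
Proof.
move=> sL; apply: (levinson_cvg (kvar_gt0 l0)) => [m i|k]; first exact: racov_var.
exact: acov_cvg.
Qed.

Hypothesis d0 : d != 0.

(** The recurrences of [pure_refl] need [m - d] and [m + d] to be nonzero for all integers m, which
    follows from [0 < |d| < 1 / 2]. *)
Lemma pure_lpoly n : (0 < n)%N -> lpoly (acov 0 0) n n = - d / (n%:R - d).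
Proof.
have s0 : supp_ge 1 (0 : W) by move=> k _; rewrite w0.
case: n => // n _; rewrite lpoly_last; apply: pure_refl.
- move=> m; move: dhalf d0; rewrite ltr_norml => /andP[d1 d2] d0'; apply/eqP => e.
  have m0 : m = 0.
    have h1 : m%:~R < 1%:~R :> R by rewrite e; lra.
    have h2 : (-1)%:~R < m%:~R :> R by rewrite e; lra.
    by rewrite !ltr_int in h1 h2; lia.
  by move: d0'; rewrite -e m0 eqxx.
- move=> m; move: dhalf d0; rewrite ltr_norml => /andP[d1 d2] d0'; apply/eqP => e.
  have e' : m%:~R = - d by lra.
  have m0 : m = 0.
    have h1 : m%:~R < 1%:~R :> R by rewrite e'; lra.
    have h2 : (-1)%:~R < m%:~R :> R by rewrite e'; lra.
    by rewrite !ltr_int in h1 h2; lia.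
  by move: e'; rewrite m0 => e'; move: d0'; rewrite -[d]opprK -e' oppr0 eqxx.
- move=> k; have E j : acov 0 0 j = Rintegral mu D (fun l : R => wsing l `^ (- d) * cos (j%:R * l)).
    apply: eq_circle => l _; rewrite /smooth (_ : wcos 0 l = 0) ?mulr0 ?addr0 ?expR0 ?mul1r//.
    by rewrite -wcst0 wcos_cst.
  by rewrite !E; exact: pure_rec.
move=> m; have [h _ _] := core_cvg 0 m s0.
by rewrite gt_eqF// (lt_le_trans (kvar_gt0 0)).
Qed.

Theorem core_asymptotics (l0 M : R) (Ll : W) : 0 <= M -> decays M Ll -> supp_ge 1 Ll ->
  exists C : R, exists N0 : nat, 0 <= C /\ forall n : nat, (N0 <= n)%N -> (0 < n)%N ->
    `|lpoly (acov l0 Ll) n n + d / (n%:R - d)| <= C / (n%:R * Num.sqrt n%:R) /\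
    kvar l0 <= lvar (acov l0 Ll) n <= kvar l0 * (1 + C / Num.sqrt n%:R).
Proof.
move=> M0 LM sL; have [N0 hN] := phase_tail Ll dhalf M0.
have s0 : supp_ge 1 (0 : W) by move=> k _; rewrite w0.
set rho := (1 + Num.sqrt (1 - cos (pi * d) ^+ 2)) / 2 in hN.
pose K : R := 1 + (392 * expR (32 * (2 * M))) ^+ 2.
pose C1 := (1 + 64 * (1 + K) ^+ 2 / (1 - rho) ^+ 2) * (1 + K).
pose C2 := 4 * (1 + K) / (1 - rho).
have /andP[rho0 rho1] := rho01 dhalf; rewrite -/rho in rho0 rho1.
have r1 : 0 < 1 - rho by rewrite subr_gt0.
have K0 : 0 < 1 + K by apply: addr_gt0 => //; apply: (lt_le_trans ltr01); rewrite lerDl sqr_ge0.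
have C10 : 0 <= C1.
  by rewrite mulr_ge0 ?(ltW K0)// addr_ge0// divr_ge0 ?exprn_ge0 ?(ltW r1)// mulr_ge0// exprn_ge0// ltW.
have C20 : 0 <= C2 by rewrite divr_ge0 ?(ltW r1)// mulr_ge0// ltW.
(* The constants do not involve m, so both inequalities survive the limit over m. *)
have H n m : (N0 <= n)%N -> (0 < n)%N ->
    `|lpoly (racov l0 Ll m) n n - lpoly (racov 0 0 m) n n| <= C1 / (n%:R * Num.sqrt n%:R) /\
    lvar (racov l0 Ll m) n <= kvar l0 * (1 + C2 / Num.sqrt n%:R).
  apply: (@levinson_compare R d M Ll dhalf M0 LM sL (rseq m) (rseq0 m) (rseq1 m) (rseq_half m) n N0
    (racov l0 Ll m) (racov 0 0 m) (kvar l0) (kvar 0) hN (kvar_gt0 l0) (kvar_gt0 0) (racov_int l0 Ll m)).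
  by move=> k; rewrite racov_int /rfactor add0r.
clearbody C1 C2; exists (C1 + C2), N0; split; first exact: addr_ge0.
move=> n Nn n0; have n0' : 0 < n%:R :> R by rewrite ltr0n.
have [vge cv cp] := core_cvg l0 n sL; have [_ _ cp0] := core_cvg 0 n s0.
split.
  have -> : lpoly (acov l0 Ll) n n + d / (n%:R - d) = lpoly (acov l0 Ll) n n - lpoly (acov 0 0) n n.
    by congr (_ + _); rewrite (pure_lpoly n0) mulNr opprK.
  have cd : (fun m => `|lpoly (racov l0 Ll m) n n - lpoly (racov 0 0 m) n n|) @ \oo --> `|lpoly (acov l0 Ll) n n - lpoly (acov 0 0) n n|.
    by apply: cvg_norm; apply: cvgB.
  apply: (@le_trans _ _ (C1 / (n%:R * Num.sqrt n%:R))); last first.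
    by rewrite ler_wpM2r ?lerDl// invr_ge0 mulr_ge0 ?sqrtr_ge0// ltW.
  by apply: (cvgr_to_le cd); exists 0%N => // m _; exact: (H n m Nn n0).1.
rewrite vge/=; apply: (@le_trans _ _ (kvar l0 * (1 + C2 / Num.sqrt n%:R))); last first.
  by rewrite ler_pM2l ?kvar_gt0// lerD2l ler_wpM2r ?lerDr// invr_ge0 sqrtr_ge0.
by apply: (cvgr_to_le cv); exists 0%N => // m _; exact: (H n m Nn n0).2.
Qed.

End CoreWeight.

(** * Prediction of stationary processes *)

Section ProcessPrediction.
Context {disp : measure_display} {T : measurableType disp} {R : realType}
  {P : probability T R}.
Variable X : int -> {RV P >-> R}.
Hypothesis Xcent : centered X.
Hypothesis Xstat : weakly_stationary X.
Implicit Types Y Z V : T -> R.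

Local Notation L2 Y := (Y \in Lfun P 2%:E).

Definition ip Y Z : R := fine ('E_P[Y \* Z])%E.
Definition lc (s : seq int) (c : int -> R) : T -> R := fun w => \sum_(j <- s) c j * X j w.

Let XL2 k : L2 (X k : T -> R). Proof. by have [h _ _] := Xstat. Qed.

Let p12 : (1 <= 2%:E :> \bar R)%E. Proof. by rewrite lee_fin ler1n. Qed.

Let L2D Y Z : L2 Y -> L2 Z -> L2 (fun w => Y w + Z w).
Proof. by move=> hY hZ; exact: ((Lfun_addr_closed P p12).2 _ _ hY hZ). Qed.

Let L2Z Y (a : R) : L2 Y -> L2 (fun w => a * Y w).
Proof.
move=> hY; have := @Lfun_scale _ _ _ P Y a 2 (ltac:(by rewrite ler1n)) hY.
by rewrite (_ : a \o* Y = fun w => a * Y w)//; apply/funext => w /=; rewrite mulrC.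
Qed.

Let L2B Y Z : L2 Y -> L2 Z -> L2 (fun w => Y w - Z w).
Proof.
move=> hY hZ; rewrite (_ : (fun w => _) = fun w => Y w + -1 * Z w); first by apply: L2D => //; exact: L2Z.
by apply/funext => w; rewrite mulN1r.
Qed.

Let L2_lc s c : L2 (lc s c).
Proof.
rewrite /lc; elim: s => [|j s IH].
  by under eq_fun do rewrite big_nil; exact: Lfun_cst.
by under eq_fun do rewrite big_cons; apply: L2D => //; exact: L2Z.
Qed.

Let iprod Y Z : L2 Y -> L2 Z -> P.-integrable setT (EFin \o (fun w => Y w * Z w)).
Proof. by move=> hY hZ; apply/Lfun1_integrable; exact: Lfun2_mul_Lfun1. Qed.

Let ipI Y Z : ip Y Z = Rintegral P setT (fun w => Y w * Z w).
Proof. by rewrite /ip unlock. Qed.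

Let ipE Y Z : L2 Y -> L2 Z -> ('E_P[Y \* Z])%E = (ip Y Z)%:E.
Proof. by move=> hY hZ; rewrite /ip fineK// expectation_fin_num// Lfun2_mul_Lfun1. Qed.

Let ipC Y Z : ip Y Z = ip Z Y.
Proof. by rewrite !ipI; apply: eq_Rintegral => w _; rewrite mulrC. Qed.

Let ipD Y Y' Z : L2 Y -> L2 Y' -> L2 Z -> ip (fun w => Y w + Y' w) Z = ip Y Z + ip Y' Z.
Proof.
move=> hY hY' hZ; rewrite !ipI -RintegralD//; [|exact: iprod..].
by apply: eq_Rintegral => w _; rewrite mulrDl.
Qed.

Let ipB Y Y' Z : L2 Y -> L2 Y' -> L2 Z -> ip (fun w => Y w - Y' w) Z = ip Y Z - ip Y' Z.
Proof.
move=> hY hY' hZ; rewrite !ipI -RintegralB//; [|exact: iprod..].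
by apply: eq_Rintegral => w _; rewrite mulrBl.
Qed.

Let ipZ Y Z (a : R) : L2 Y -> L2 Z -> ip (fun w => a * Y w) Z = a * ip Y Z.
Proof.
move=> hY hZ; rewrite !ipI -RintegralZl//; last exact: iprod.
by apply: eq_Rintegral => w _; rewrite mulrA.
Qed.

Let ip_lc s c Z : L2 Z -> ip (lc s c) Z = \sum_(j <- s) c j * ip (X j) Z.
Proof.
move=> hZ; elim: s => [|j s IH].
  by rewrite big_nil ipI (@eq_Rintegral _ _ _ _ _ (cst 0)) ?Rintegral_cst ?mul0r// => w _; rewrite /lc big_nil mul0r.
rewrite big_cons -IH -(ipZ (c j) (XL2 j) hZ) -(ipD (L2Z (c j) (XL2 j)) (L2_lc s c) hZ).
by rewrite !ipI; apply: eq_Rintegral => w _; rewrite /lc big_cons.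
Qed.

Let cov_ip Y Z : ('E_P[Y] = 0)%E -> ('E_P[Z] = 0)%E -> covariance P Y Z = ('E_P[Y \* Z])%E.
Proof.
move=> hY hZ; rewrite unlock hY hZ /=; congr expectation.
by apply/funext => w /=; rewrite !fctE/= !subr0.
Qed.

Let X1 (k : int) : (X k : T -> R) \in Lfun P 1.
Proof.
have h : L2 (cst 1 : T -> R) by exact: Lfun_cst.
have := Lfun2_mul_Lfun1 (XL2 k) h.
by rewrite (_ : (X k : T -> R) \* cst 1 = X k)//; apply/funext => w /=; rewrite mulr1.
Qed.

Lemma ip_gamma (i j : int) : ip (X i) (X j) = gamma X (j - i).
Proof.
have [_ _ st] := Xstat.
have := st 0 (j - i) i; rewrite add0r subrK !cov_ip// => h.
by rewrite /ip h.
Qed.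

Lemma gamma_abs (k : int) : gamma X k = gamma X `|k|%N.
Proof.
case: k => n; first by rewrite absz_nat.
rewrite (_ : Negz n = 0 - n.+1%:Z); last by rewrite NegzE sub0r.
by rewrite -ip_gamma ipC ip_gamma subr0 sub0r abszN.
Qed.

Let E1 Y : L2 Y -> ('E_P[Y] = (ip Y (cst 1))%:E)%E.
Proof.
move=> hY; rewrite -ipE//; last exact: Lfun_cst.
by congr expectation; apply/funext => w /=; rewrite mulr1.
Qed.

Let expect_lc0 s c : ip (lc s c) (cst 1) = 0.
Proof.
rewrite ip_lc; last exact: Lfun_cst.
by rewrite big1// => j _; have := Xcent j; rewrite E1// => -[->]; rewrite mulr0.
Qed.

Definition is_proj (k m : int) Z Y := lin_span X k m Y /\ forall V, lin_span X k m V -> ip (fun w => Z w - Y w) V = 0.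

Let span_L2 k m Y : lin_span X k m Y -> L2 Y.
Proof. by move=> [s _ [c ->]]; exact: L2_lc. Qed.

Lemma orth_projP k m Z Y : L2 Z -> is_proj k m Z Y -> is_proj k m Z (orth_proj X k m Z).
Proof.
move=> hZ [sY oY].
have : [set Y | lin_span X k m Y /\ forall V, lin_span X k m V -> ('E_P[((Z \- Y) \* V)%R] = 0)%E] Y.
  split => // V sV; rewrite ipE ?(span_L2 sV)//; last by apply: L2B => //; exact: span_L2 sY.
  by rewrite -[LHS]/((ip (fun w => Z w - Y w) V)%:E) oY.
move=> /(xgetI (cst 0)) [s o]; split => // V sV.
by have := o V sV; rewrite /ip /orth_proj => ->.
Qed.

(** [orth_proj] is an unspecified choice among projections that agree almost surely; orthogonality
    allows an explicit projection to replace it in inner products. *)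
Lemma residual_ip k m Z Z' Y Y' : L2 Z -> L2 Z' -> is_proj k m Z Y -> is_proj k m Z' Y' ->
  ip (residual X k m Z) (residual X k m Z') = ip Z (fun w => Z' w - Y' w).
Proof.
move=> hZ hZ' pY pY'; have [sY oY] := orth_projP hZ pY; have [sY1 oY1] := orth_projP hZ' pY'.
have [sY' oY'] := pY'.
rewrite /residual; set y := orth_proj X k m Z in sY oY *; set y' := orth_proj X k m Z' in sY1 oY1 *.
have ly := span_L2 sY; have ly1 := span_L2 sY1; have ly' := span_L2 sY'.
have lr : L2 (fun w => Z w - y w) by exact: L2B.
have a1 : ip (fun w => Z w - y w) (fun w => Z' w - y' w) = ip (fun w => Z w - y w) Z'.
  by rewrite ipC ipB// [ip y' _]ipC oY// subr0 ipC.
have a2 : ip (fun w => Z w - y w) (fun w => Z' w - Y' w) = ip (fun w => Z w - y w) Z'.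
  by rewrite ipC ipB// [ip Y' _]ipC oY// subr0 ipC.
rewrite -[LHS]/(ip (fun w => Z w - y w) (fun w => Z' w - y' w)) a1 -a2 ipB//; last exact: L2B.
by rewrite [ip y _]ipC oY'// subr0.
Qed.

Let c (k : nat) : R := gamma X k.
Let gammaC (k : int) : gamma X k = c `|k|%N. Proof. exact: gamma_abs. Qed.
Hypothesis vnz : forall n, lvar c n != 0.

Let isum (F : int -> R) N : \sum_(j <- [seq (i.+1)%:Z | i <- iota 0 N]) F j = \sum_(i < N) F i.+1.
Proof. by rewrite big_map -(big_mkord xpredT (fun i => F i.+1)) /index_iota subn0. Qed.

Let spanI N (a : int -> R) : lin_span X 1 (N.+1%:Z - 1) (lc [seq (i.+1)%:Z | i <- iota 0 N] a).
Proof.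
exists [seq (i.+1)%:Z | i <- iota 0 N]; last by exists a.
by rewrite all_map; apply/allP => i; rewrite mem_iota => hi /=; lia.
Qed.

Let proj_of N Z (a : int -> R) : L2 Z ->
  (forall m : int, 1 <= m <= N%:Z -> ip (X m) (fun w => Z w - lc [seq (i.+1)%:Z | i <- iota 0 N] a w) = 0) ->
  is_proj 1 (N.+1%:Z - 1) Z (lc [seq (i.+1)%:Z | i <- iota 0 N] a).
Proof.
move=> hZ h; split; first exact: spanI.
move=> V [s /allP hs [b ->]]; rewrite ipC ip_lc; last exact: L2B.
rewrite big_seq big1// => j /hs hj; rewrite h ?mulr0//; lia.
Qed.

Let ip_res N Z (a : int -> R) m : L2 Z ->
  ip (X m) (fun w => Z w - lc [seq (i.+1)%:Z | i <- iota 0 N] a w) =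
  ip (X m) Z - \sum_(i < N) a i.+1 * gamma X (i.+1%:Z - m).
Proof.
move=> hZ; rewrite ipC ipB// [ip Z _]ipC ip_lc// isum; congr (_ - _).
by apply: eq_bigr => i _; rewrite ipC ip_gamma.
Qed.

(** By stationarity one polynomial serves both ends: read backwards it predicts [X (N + 1)] from
    [X 1, ..., X N], read forwards it predicts [X 0] from the same variables. *)
Let fwd N (i : int) : R := - lpoly c N `|N.+1%:Z - i|%N.
Let bwd N (i : int) : R := - lpoly c N `|i|%N.

Let fwdE N m : ip (X m) (fun w => X N.+1 w - lc [seq (i.+1)%:Z | i <- iota 0 N] (fwd N) w) = lerr c N (N.+1%:Z - m).
Proof.
rewrite ip_res// ip_gamma /lerr big_ord_recl lpoly0 mul1r subr0 gammaC; congr (_ + _).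
rewrite (reindex_inj rev_ord_inj)/= -sumrN; apply: eq_bigr => i _.
rewrite /fwd mulNr opprK gammaC /bump/=; have := ltn_ord i => hi.
congr (lpoly _ _ _ * c _); lia.
Qed.

Let bwdE N m : ip (X m) (fun w => X 0 w - lc [seq (i.+1)%:Z | i <- iota 0 N] (bwd N) w) = lerr c N m.
Proof.
rewrite ip_res// ip_gamma /lerr big_ord_recl lpoly0 mul1r subr0 gammaC sub0r abszN; congr (_ + _).
rewrite -sumrN; apply: eq_bigr => i _; rewrite /bwd mulNr opprK gammaC; have := ltn_ord i => hi.
rewrite [lift ord0 i : nat]/= /bump/=; congr (lpoly _ _ _ * c _); lia.
Qed.

Let orth N := lerr_orth (fun i (_ : (i < N)%N) => vnz i).

Let fwd_proj N : is_proj 1 (N.+1%:Z - 1) (X N.+1) (lc [seq (i.+1)%:Z | i <- iota 0 N] (fwd N)).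
Proof. by apply: proj_of => // m hm; rewrite fwdE (orth N).2//; lia. Qed.

Let bwd_proj N : is_proj 1 (N.+1%:Z - 1) (X 0) (lc [seq (i.+1)%:Z | i <- iota 0 N] (bwd N)).
Proof. by apply: proj_of => // m hm; rewrite bwdE (orth N).2//; lia. Qed.

(** The index shifts by one because X_(N+1) is predicted from N variables. *)
Lemma pred_errorE N : pred_error X N.+1 = lvar c N.
Proof.
rewrite /pred_error -[LHS]/(ip (residual X 1 (N.+1%:Z - 1) (X N.+1)) (residual X 1 (N.+1%:Z - 1) (X N.+1))).
by rewrite (residual_ip _ _ (fwd_proj N) (fwd_proj N))// fwdE subrr (orth N).1.
Qed.

(** For n = M + 1 >= 2 both residuals have variance [lvar c M], so the correlation is the quotient
    [lerr c M (M + 1) / lvar c M], which is minus the next reflection coefficient. *)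
Lemma partial_corrE n : (0 < n)%N -> partial_corr X n = - lpoly c n n.
Proof.
case: n => // N _; rewrite lpoly_last.
have main : - lrefl c N = lerr c N N.+1 / lvar c N.
  by apply: (mulIf (vnz N)); rewrite divfK// mulNr lreflE// opprK.
(* For n = 1 the partial correlation has its own definition, which is the same quotient. *)
case: N main => [|N] main.
  rewrite main /partial_corr/= lerr_next big_ord_recl big_ord0 lpoly0 mul1r addr0.
  by rewrite /lvar/= /c.
set M := N.+1 in main *.
rewrite /partial_corr/= -/M /correlation main.
set e0 := residual X 1 (M.+1%:Z - 1) (X 0); set en := residual X 1 (M.+1%:Z - 1) (X M.+1).
have E0 Z k m : L2 Z -> ('E_P[Z] = 0)%E -> is_proj k m Z (orth_proj X k m Z) -> L2 (residual X k m Z) /\ ('E_P[residual X k m Z] = 0)%E.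
  move=> hZ eZ [[s _ [b sb]] _]; rewrite /residual sb; split; first by apply: L2B => //; exact: L2_lc.
  have h1 : ip Z (cst 1) = 0 by move: eZ; rewrite E1// => -[].
  have lz : L2 (fun w => Z w - lc s b w) by apply: L2B => //; exact: L2_lc.
  have l1 : L2 (cst 1 : T -> R) by exact: Lfun_cst.
  by have := E1 lz; rewrite (ipB hZ (L2_lc s b) l1) h1 expect_lc0 subr0.
have [l0 x0] := E0 (X 0) 1 (M.+1%:Z - 1) (XL2 0) (Xcent 0) (orth_projP (XL2 0) (bwd_proj M)).
have [l1 x1] := E0 (X M.+1) 1 (M.+1%:Z - 1) (XL2 M.+1) (Xcent M.+1) (orth_projP (XL2 M.+1) (fwd_proj M)).
rewrite /variance !cov_ip// -!/(ip _ _) (residual_ip _ _ (bwd_proj M) (fwd_proj M))//.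
rewrite (residual_ip _ _ (bwd_proj M) (bwd_proj M))// (residual_ip _ _ (fwd_proj M) (fwd_proj M))//.
rewrite !fwdE bwdE subr0 subrr (orth M).1 -expr2 sqrtr_sqr ger0_norm//.
rewrite -pred_errorE /pred_error fine_ge0// expectation_ge0// => w; exact: sqr_ge0.
Qed.

End ProcessPrediction.

(** * From reflection coefficients to asymptotic equivalents *)

Section Asymptotics.
Context {R : realType}.
Variables (d kappa C : R) (N0 : nat) (p v : nat -> R).
Hypothesis dhalf : `|d| < 1 / 2.
Hypothesis d0 : d != 0.
Hypothesis kappa0 : 0 < kappa.
Hypothesis C0 : 0 <= C.
Hypothesis hp : forall n : nat, (N0 <= n)%N -> (0 < n)%N -> `|p n + d / (n%:R - d)| <= C / (n%:R * Num.sqrt n%:R).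
Hypothesis hv : forall n : nat, (N0 <= n)%N -> (0 < n)%N -> kappa <= v n <= kappa * (1 + C / Num.sqrt n%:R).
Hypothesis vS : forall n, v n - v n.+1 = v n * p n.+1 ^+ 2.

Lemma sqrt_large (A : R) : exists N : nat, forall n : nat, (N <= n)%N -> A <= Num.sqrt n%:R :> R.
Proof.
have [m hm] : exists m : nat, A ^+ 2 <= m%:R.
  by exists (Num.bound (A ^+ 2)); apply: ltW; apply: archi_boundP; exact: sqr_ge0.
exists m => n mn; apply: le_trans (ler_norm _) _; rewrite -sqrtr_sqr ler_wsqrtr//.
by apply: le_trans hm _; rewrite ler_nat.
Qed.

Lemma refl_near (e : R) : 0 < e -> exists N : nat, forall n : nat, (N <= n)%N -> (0 < n)%N ->
  `|n%:R * p n + d| <= e.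
Proof.
move=> e0; have hC := C0; have [N1 h1] := sqrt_large ((1 + C) / e); exists (maxn N0 N1) => n.
rewrite geq_max => /andP[Na Nb] n0; have := hp Na n0; have := h1 n Nb.
set s := Num.sqrt _ => hs.
have n1 : 1 <= n%:R :> R by rewrite ler1n.
have s2 : s ^+ 2 = n%:R by rewrite sqr_sqrtr.
have s0 : 0 < s by rewrite sqrtr_gt0 ltr0n.
have s1 : 1 <= s by rewrite -sqrtr1 ler_wsqrtr.
move: (dhalf); rewrite ltr_norml => /andP[d1 d2].
have nd : 0 < n%:R - d by lra.
move=> h; have -> : n%:R * p n + d = n%:R * (p n + d / (n%:R - d)) - d ^+ 2 / (n%:R - d).
  by field; rewrite gt_eqF.
have a1 : `|n%:R * (p n + d / (n%:R - d))| <= C / s.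
  rewrite normrM ger0_norm//; apply: (@le_trans _ _ (n%:R * (C / (n%:R * s)))).
    by rewrite ler_wpM2l.
  by rewrite le_eqVlt; apply/orP; left; apply/eqP; field; rewrite !gt_eqF// ltr0n.
have a2 : `|d ^+ 2 / (n%:R - d)| <= 1 / s.
  rewrite ger0_norm; last by rewrite divr_ge0 ?sqr_ge0// ltW.
  rewrite ler_pdivrMr// mulrAC ler_pdivlMr// mul1r.
  have dd : d ^+ 2 <= 1 / 4 by nra.
  by rewrite -s2; nra.
apply: le_trans (ler_normB _ _) _; apply: (@le_trans _ _ (C / s + 1 / s)); first exact: lerD.
rewrite -mulrDl ler_pdivrMr//; move: hs; rewrite ler_pdivrMr//; lra.
Qed.

Lemma refl_equiv : (fun n => - p n) ~_\oo (fun n : nat => d / n%:R).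
Proof.
apply/eqaddoP => e e0; have de : 0 < e * `|d| by rewrite mulr_gt0 ?normr_gt0.
have [N h] := refl_near de; near=> n.
have n0 : (0 < n)%N by near: n; exact: nbhs_infty_gt.
have n0' : 0 < n%:R :> R by rewrite ltr0n.
have Nn : (N <= n)%N by near: n; exact: nbhs_infty_ge.
have := h n Nn n0; rewrite !fctE /=.
have -> : - p n - d / n%:R = - ((n%:R * p n + d) / n%:R) by field; rewrite gt_eqF.
rewrite normrN !normrM normfV (ger0_norm (ltW n0')) mulrA.
by rewrite ler_pM2r ?invr_gt0.
Unshelve. all: by end_near.
Qed.

Lemma v_near (e : R) : 0 < e -> exists N : nat, forall n : nat, (N <= n)%N ->
  kappa <= v n <= kappa * (1 + e).
Proof.
move=> e0; have [N1 h1] := sqrt_large (C / e); exists (maxn 1 (maxn N0 N1)) => n.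
rewrite !geq_max => /and3P[n0 Na Nb]; have /andP[-> h] := hv Na n0.
apply: le_trans h _; rewrite ler_pM2l// lerD2l ler_pdivrMr ?sqrtr_gt0 ?ltr0n//.
by have := h1 n Nb; rewrite ler_pdivrMr// mulrC.
Qed.

Lemma v_cvg : v @ \oo --> kappa.
Proof.
apply/cvgrPdist_le => e e0; have ek : 0 < e / kappa by rewrite divr_gt0.
have [N h] := v_near ek; exists N => // n /= /h /andP[h1 h2].
rewrite distrC ger0_norm ?subr_ge0//; move: h2; rewrite mulrDr mulr1 mulrCA divff ?mulr1 ?gt_eqF//; lra.
Qed.

(** The weight [n * (n + 1)] is chosen because its inverse [1 / n - 1 / (n + 1)] telescopes
    exactly. *)
Lemma step_near (e : R) : 0 < e -> exists N : nat, forall n : nat, (N <= n)%N -> (0 < n)%N ->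
  `|(v n.-1 - v n) * (n%:R * n.+1%:R) - kappa * d ^+ 2| <= e.
Proof.
move=> e0.
have cp : (fun n => n%:R * p n) @ \oo --> - d.
  apply/cvgrPdist_le => x x0; have [N h] := refl_near x0; exists (maxn 1 N) => // n /=.
  by rewrite geq_max => /andP[n0 Nn]; rewrite (_ : - d - n%:R * p n = - (n%:R * p n + d)); [rewrite normrN; exact: h|ring].
have c1 : (fun n : nat => 1 + n.+1%:R^-1 : R) @ \oo --> (1 : R).
  by rewrite -[X in _ --> X]addr0; apply: cvgD; [exact: cvg_cst|exact: cvg_harmonic].
have cv : (fun n => v n * ((n.+1%:R * p n.+1) * (n.+1%:R * p n.+1)) * (1 + n.+1%:R^-1)) @ \oo --> kappa * ((- d) * (- d)) * 1.
  apply: cvgM => //; apply: cvgM; first exact: v_cvg.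
  by apply: cvgM; rewrite (cvg_shiftS (fun n => n%:R * p n)).
have [N _ h] := (@cvgrPdist_le _ _ _ _ _ _ _).1 cv e e0.
exists N.+1 => -[//|n] /h /= hn _; move: hn; rewrite distrC; apply: le_trans.
rewrite le_eqVlt; apply/orP; left; apply/eqP; congr (`| _ |).
by rewrite vS -[n.+2%:R]natr1; field; rewrite gt_eqF ?ltr0n.
Qed.

(** Sum the increments from n to n + m and let m tend to infinity; the tolerance e telescopes along
    with the main term. *)
Lemma error_near (e : R) : 0 < e -> exists N : nat, forall n : nat, (N <= n)%N -> (0 < n)%N ->
  `|v n.-1 - kappa - kappa * d ^+ 2 / n%:R| <= e / n%:R.
Proof.
move=> e0; have [N h] := step_near e0; exists N => n Nn n0.
have fin m : `|v n.-1 - v (n + m)%N.-1 - kappa * d ^+ 2 * (n%:R^-1 - (n + m)%:R^-1)| <= e * (n%:R^-1 - (n + m)%:R^-1).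
  elim: m => [|m IH]; first by rewrite addn0 !subrr !mulr0 subr0 normr0.
  have nm0 : (0 < n + m)%N by rewrite addn_gt0 n0.
  have := h (n + m)%N (leq_trans Nn (leq_addr _ _)) nm0; rewrite addnS /=.
  set a := (n + m)%:R : R; have a0 : 0 < a by rewrite ltr0n.
  rewrite -[(n + m).+1%:R]natr1 -/a => h1.
  have a1 : 0 < a * (a + 1) by rewrite mulr_gt0// addr_gt0.
  have h2 : `|v (n + m)%N.-1 - v (n + m)%N - kappa * d ^+ 2 * (a^-1 - (a + 1)^-1)| <= e * (a^-1 - (a + 1)^-1).
    have E (x : R) : 0 < x -> x^-1 - (x + 1)^-1 = (x * (x + 1))^-1.
      by move=> x0; field; rewrite !gt_eqF// addr_gt0.
    rewrite (E a a0) ler_pdivlMr// -[X in _ * X]ger0_norm ?(ltW a1)// -normrM mulrBl divfK ?gt_eqF//.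
  have -> : v n.-1 - v (n + m)%N - kappa * d ^+ 2 * (n%:R^-1 - (a + 1)^-1) =
     (v n.-1 - v (n + m)%N.-1 - kappa * d ^+ 2 * (n%:R^-1 - a^-1)) +
     (v (n + m)%N.-1 - v (n + m)%N - kappa * d ^+ 2 * (a^-1 - (a + 1)^-1)) by ring.
  apply: le_trans (ler_normD _ _) _.
  have -> : e * (n%:R^-1 - (a + 1)^-1) = e * (n%:R^-1 - a^-1) + e * (a^-1 - (a + 1)^-1) by ring.
  exact: lerD.
have ci : (fun m => (n + m)%:R^-1 : R) @ \oo --> (0 : R).
  have := @cvg_harmonic R; rewrite -(cvg_shiftn n.-1) => hh; apply: cvg_trans hh.
  apply: near_eq_cvg; near=> m => /=; congr (_%:R^-1); lia.
have cvn : (fun m => v (n + m)%N.-1) @ \oo --> kappa.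
  have := v_cvg; rewrite -(cvg_shiftn n.-1) => hh; apply: cvg_trans hh.
  apply: near_eq_cvg; near=> m => /=; congr v; lia.
have L : (fun m => `|v n.-1 - v (n + m)%N.-1 - kappa * d ^+ 2 * (n%:R^-1 - (n + m)%:R^-1)|) @ \oo -->
  `|v n.-1 - kappa - kappa * d ^+ 2 * (n%:R^-1 - 0)|.
  apply: cvg_norm; apply: cvgB; first by apply: cvgB => //; exact: cvg_cst.
  by apply: cvgM; [exact: cvg_cst|apply: cvgB => //; exact: cvg_cst].
rewrite subr0 in L; apply: (cvgr_to_le L); near=> m.
apply: le_trans (fin m) _; rewrite ler_pM2l// lerBlDr lerDl invr_ge0//.
Unshelve. all: by end_near.
Qed.

Lemma error_equiv : (fun n => v n.-1 - kappa) ~_\oo (fun n : nat => kappa * (d ^+ 2 / n%:R)).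
Proof.
apply/eqaddoP => e e0; have kd : 0 < kappa * d ^+ 2 by rewrite mulr_gt0// exprn_even_gt0.
have de : 0 < e * (kappa * d ^+ 2) by rewrite mulr_gt0.
have [N h] := error_near de; near=> n.
have n0 : (0 < n)%N by near: n; exact: nbhs_infty_gt.
have Nn : (N <= n)%N by near: n; exact: nbhs_infty_ge.
have := h n Nn n0; rewrite !fctE /= mulrA => hn; apply: le_trans hn _.
rewrite ger0_norm; last by rewrite divr_ge0// ltW.
by rewrite !mulrA.
Unshelve. all: by end_near.
Qed.

End Asymptotics.

(** * Fourier coefficients of piecewise smooth functions *)

Section EvenFunctions.
Context {R : realType}.
Local Notation W := (wiener R).
Local Notation mu := (@lebesgue_measure R).
Local Notation D := [set` `](- (pi : R)), (pi : R)]%R].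

Lemma even_cont_measurable (f : R -> R) : (forall x, f (- x) = f x) ->
  (forall x, 0 < x <= pi -> {for x, continuous f}) -> measurable_fun D f.
Proof.
move=> ev cf; have p0 := pi_gt0 R.
have cf' x : - pi <= x -> x < 0 -> {for x, continuous f}.
  move=> x1 x2; have e : f = f \o -%R by apply/funext => y; rewrite /= ev.
  have h : {for - x, continuous f} by apply: cf; apply/andP; split; lra.
  by rewrite e; apply: continuous_comp; [exact: opp_continuous|exact: h].
have E : D = (`]- pi, 0[ `|` `]0, pi[ `|` ([set 0] `|` [set pi]))%classic.
  apply/seteqP; split => x /=; rewrite !in_itv/=.
    move=> /andP[x1 x2]; have [x0|x0|->] := ltgtP x 0; last by right; left.
      by left; left; rewrite x1.
    by move: x2; rewrite le_eqVlt => /predU1P[->|x2]; [right; right|left; right].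
  by move=> [[/andP[x1 x2]|/andP[x1 x2]]|[->|->]]; apply/andP; split; lra.
have mo a b : (forall x, a < x < b -> {for x, continuous f}) -> measurable_fun `]a, b[ f.
  move=> h; apply: open_continuous_measurable_fun; first exact: interval_open.
  by move=> x /set_mem/=; rewrite in_itv/= => /h.
have m1 x : measurable_fun [set x] f by exact: measurable_fun_set1.
rewrite E; apply/measurable_funU; try by (apply: measurableU; exact: measurable_itv) || by apply: measurableU.
split; apply/measurable_funU => //; split => //; apply: mo => x /andP[x1 x2].
  by apply: cf'; [exact: ltW|].
by apply: cf; rewrite x1 ltW.
Qed.

Variables (F F1 F2 : R -> R) (K e : R).
Hypothesis Fev : forall l, F (- l) = F l.
Hypothesis dF : forall l, 0 < l <= pi -> is_derive l 1 F (F1 l).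
Hypothesis dF1 : forall l, 0 < l <= pi -> is_derive l 1 F1 (F2 l).
Hypothesis cF2 : forall l, 0 < l <= pi -> {for l, continuous F2}.
Hypothesis K0 : 0 <= K.
Hypothesis e1 : -1 < e.
Hypothesis F2K : forall l, 0 < l <= pi -> `|F2 l| <= K * (1 + l `^ e).

(** The integral of the majorant [K * (1 + l^e)] over ]0, pi], finite because [e > -1]. *)
Let KI := K * (pi + pi `^ (e + 1) / (e + 1)).

Lemma cont_sub (f : R -> R) (a : R) : 0 < a -> (forall x, 0 < x <= pi -> {for x, continuous f}) ->
  {within `[a, pi], continuous f}.
Proof.
move=> a0 cf; apply: continuous_in_subspaceT => x /set_mem/=; rewrite in_itv/= => /andP[x1 x2].
by apply: cf; rewrite (lt_le_trans a0).
Qed.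

Lemma int_sub (f : R -> R) (a : R) : 0 < a -> (forall x, 0 < x <= pi -> {for x, continuous f}) ->
  mu.-integrable `[a, pi] (EFin \o f).
Proof.
by move=> a0 cf; apply: continuous_compact_integrable; [exact: segment_compact|exact: cont_sub].
Qed.

Lemma int_bound (f : R -> R) (a : R) : 0 < a < pi -> (forall x, 0 < x <= pi -> {for x, continuous f}) ->
  (forall x, 0 < x <= pi -> `|f x| <= K * (1 + x `^ e)) -> `|Rintegral mu `[a, pi] f| <= KI.
Proof.
move=> /andP[a0 ap] cf fK; have p0 := pi_gt0 R; have he := e1; have e2 : 0 < e + 1 by lra.
pose g x := K * (1 + x `^ e); pose G (x : R) := K * (x + (e + 1)^-1 * x `^ (e + 1)).
have dpow (x p : R) : 0 < x -> is_derive x 1 (fun t : R => t `^ p) (p * x `^ (p - 1)).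
  by move=> x0; have := dpowR p x0 (did x); rewrite mulr1.
have cg x : 0 < x <= pi -> {for x, continuous g}.
  by move=> /andP[x0 _]; exact: d_cont (dZ K (dD (dcst x 1) (dpow x e x0))).
have dG x : 0 < x <= pi -> is_derive x 1 G (g x).
  move=> /andP[x0 _]; apply: (d_ext (dZ K (dD (did x) (dZ (e + 1)^-1 (dpow x (e + 1) x0))))) => //.
  by rewrite mulrA mulVf ?gt_eqF// mul1r addrK.
have If : mu.-integrable `[a, pi] (EFin \o f) by exact: int_sub.
have Ig : mu.-integrable `[a, pi] (EFin \o g) by exact: int_sub.
apply: le_trans (le_normr_Rintegral _ If) _ => //.
apply: (@le_trans _ _ (Rintegral mu `[a, pi] g)).
  apply: le_Rintegral => //; first exact: integrable_norm If.
  by move=> x /=; rewrite in_itv/= => /andP[x1 x2]; apply: fK; rewrite (lt_le_trans a0).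
have -> : Rintegral mu `[a, pi] g = G pi - G a.
  apply: Rintegral_FTC => // [x /andP[x1 x2]|]; last exact: cont_sub.
  by apply: dG; rewrite (lt_le_trans a0).
rewrite /G -mulrBr /KI ler_wpM2l// [pi `^ _ / _]mulrC lerBlDr lerDl addr_ge0 ?(ltW a0)//.
by rewrite mulr_ge0 ?powR_ge0// invr_ge0 ltW.
Qed.

Let B1 := `|F1 pi| + KI.

Let cF l : 0 < l <= pi -> {for l, continuous F}. Proof. by move/dF; exact: d_cont. Qed.

Lemma F1_bound l : 0 < l <= pi -> `|F1 l| <= B1.
Proof.
move=> /andP[l0]; rewrite le_eqVlt => /predU1P[->|lp].
  rewrite lerDl /KI mulr_ge0// addr_ge0 ?pi_ge0// divr_ge0 ?powR_ge0//; have := e1; lra.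
have h : Rintegral mu `[l, pi] F2 = F1 pi - F1 l.
  apply: Rintegral_FTC => // [x /andP[x1 x2]|]; last exact: cont_sub.
  by apply: dF1; rewrite (lt_le_trans l0).
have lp' : 0 < l < pi by rewrite l0.
have := int_bound lp' cF2 F2K; rewrite h => hb.
have -> : F1 l = F1 pi - (F1 pi - F1 l) by ring.
by apply: le_trans (ler_normB _ _) _; rewrite lerD2l.
Qed.

Let B0 := `|F 0| + `|F pi| + B1 * pi.

Let B1_ge0 : 0 <= B1.
Proof. by apply: le_trans (normr_ge0 (F1 pi)) (F1_bound _); rewrite pi_gt0 lexx. Qed.

Lemma F_bound l : D l -> `|F l| <= B0.
Proof.
have p0 := pi_gt0 R.
have pos x : 0 < x <= pi -> `|F x| <= B0.
  move=> /andP[x0 xp]; have := @mvt_bound R F F1 x pi B1 xp.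
  move=> h; have {}h : `|F pi - F x| <= B1 * (pi - x).
    apply: h => t /andP[t1 t2]; first by apply: dF; rewrite (lt_le_trans x0).
    by apply: F1_bound; rewrite (lt_trans x0 t1) ltW.
  have -> : F x = F pi - (F pi - F x) by ring.
  apply: le_trans (ler_normB _ _) _; rewrite /B0 -addrA; apply: le_trans (ler_wpDl (normr_ge0 _) (lexx _)).
  rewrite lerD2l; apply: le_trans h _; apply: ler_wpM2l => //; lra.
rewrite /= in_itv/= => /andP[l1 l2]; have [l0|l0|->] := ltgtP l 0.
- by rewrite -Fev; apply: pos; apply/andP; split; lra.
- by apply: pos; rewrite l0.
- by rewrite /B0 -addrA lerDl addr_ge0// mulr_ge0// ltW.
Qed.

Lemma F_meas : measurable_fun D F.
Proof. exact: even_cont_measurable. Qed.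

Let cosk_ev (k : nat) l : F (- l) * cos (k%:R * - l) = F l * cos (k%:R * l).
Proof. by rewrite Fev mulrN cosN. Qed.

Lemma Fcos_int (k : nat) : mu.-integrable D (EFin \o (fun l : R => F l * cos (k%:R * l))).
Proof.
apply: measurable_bounded_integrable => //.
- by rewrite [X in (X < _)%E]muD ltry.
- apply: measurable_funM; first exact: F_meas.
  by apply: measurable_funTS; apply: continuous_measurable_fun; exact: cos_lin_continuous.
exists B0; split; first exact: num_real.
move=> y yB x Dx /=; apply: le_trans (ltW yB); rewrite normrM -[leRHS]mulr1.
by apply: ler_pM => //; [exact: F_bound|exact: cos_max].
Qed.

Definition fcoef (k : nat) : R := (2 * pi)^-1 * Rintegral mu D (fun l : R => F l * cos (k%:R * l)).

Let M := (2 * pi)^-1 * (2 * B0 + 2 * (B1 + (B0 + B1) + KI)).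

(** Two integrations by parts cannot reach 0, where the derivatives of F have no prescribed
    behaviour; they are done on [[a, pi]] with [a = k^-2]. The middle interval costs O(a), and so
    does the boundary term [F a * sin (k * a) / k], because [sin (k * a) <= k * a]. *)
Lemma fcoef_decay (k : nat) : (0 < k)%N -> `|fcoef k| <= M / k%:R ^+ 2.
Proof.
move=> k0; have p0 := pi_gt0 R; have k0' : 0 < k%:R :> R by rewrite ltr0n.
have k1 : 1 <= k%:R :> R by rewrite ler1n.
rewrite /fcoef normrM ger0_norm; last by rewrite invr_ge0 mulr_ge0// ltW.
rewrite /M -mulrA ler_pM2l ?invr_gt0 ?mulr_gt0//.
pose a : R := (k%:R ^+ 2)^-1.
have a0 : 0 < a by rewrite invr_gt0 exprn_gt0.
have a1 : a <= 1 by rewrite invf_le1 ?exprn_gt0// exprn_ege1.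
have ap : 0 < a < pi by rewrite a0 (le_lt_trans a1)//; have := @pi_ge2 R; lra.
have ck (l : R) := dcos (dZ k%:R (did l)); have sk (l : R) := dsin (dZ k%:R (did l)).
have cFc l : 0 < l <= pi -> {for l, continuous (fun l : R => F l * cos (k%:R * l))}.
  by move=> hl; exact: d_cont (dM (dF hl) (ck l)).
rewrite (circle_split ap (Fcos_int k) (cosk_ev k)) => [|x /andP[x1 x2]]; last first.
  by apply: cFc; rewrite (lt_le_trans a0).
have hmid : `|Rintegral mu `]- a, a[ (fun l : R => F l * cos (k%:R * l))| <= 2 * B0 * a.
  have mI : measurable (`]- a, a[ : set (measurableTypeR R)) by exact: measurable_itv.
  have sD : (`]- a, a[ : set R) `<=` D.
    by move=> x; rewrite /= !in_itv/= => /andP[x1 x2]; case/andP: ap => y1 y2; apply/andP; split; lra.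
  have I1 : mu.-integrable `]- a, a[ (EFin \o (fun l : R => F l * cos (k%:R * l))).
    by apply: (@integrableS _ _ _ mu D) => //; exact: Fcos_int.
  have I2 : mu.-integrable `]- a, a[ (EFin \o (cst B0 : R -> R)).
    by apply: (@integrableS _ _ _ mu D) => //; apply: cont_integrableD; exact: cst_continuous.
  apply: le_trans (le_normr_Rintegral _ I1) _ => //.
  apply: (@le_trans _ _ (Rintegral mu `]- a, a[ (cst B0))).
    apply: le_Rintegral => //; first exact: integrable_norm I1.
    move=> x /sD Dx; rewrite normrM -[leRHS]mulr1; apply: ler_pM => //; [exact: F_bound|exact: cos_max].
  have E : mu `]- a, a[ = (a - - a)%:E by rewrite lebesgue_measure_itv/= lte_fin ifT ?EFinB//; lra.
  rewrite Rintegral_cst// [X in fine X]E /=.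
  by rewrite le_eqVlt; apply/orP; left; apply/eqP; ring.
pose G (l : R) := F l * sin (k%:R * l) / k%:R + F1 l * cos (k%:R * l) / k%:R ^+ 2.
have dG l : 0 < l <= pi -> is_derive l 1 G (F l * cos (k%:R * l) + F2 l * cos (k%:R * l) * a).
  move=> hl; have h1 := dM (dF hl) (sk l); have h2 := dM (dF1 hl) (ck l).
  apply: (d_ext (dD (dZ k%:R^-1 h1) (dZ a h2))) => [t|]; first by rewrite /G /a; ring.
  by rewrite /a; field; rewrite gt_eqF.
have cf1 l : 0 < l <= pi -> {for l, continuous (fun l : R => F2 l * cos (k%:R * l) * a)}.
  by move=> hl; apply: cvgM; [apply: cvgM; [exact: cF2|exact: (d_cont (ck l))]|exact: cvg_cst].
have E : Rintegral mu `[a, pi] (fun l : R => F l * cos (k%:R * l)) =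
   G pi - G a - a * Rintegral mu `[a, pi] (fun l : R => F2 l * cos (k%:R * l)).
  have I1 : mu.-integrable `[a, pi] (EFin \o (fun l : R => F l * cos (k%:R * l))) by exact: int_sub.
  have I2 : mu.-integrable `[a, pi] (EFin \o (fun l : R => F2 l * cos (k%:R * l) * a)) by exact: int_sub.
  have : Rintegral mu `[a, pi] (fun l : R => F l * cos (k%:R * l) + F2 l * cos (k%:R * l) * a) = G pi - G a.
    apply: Rintegral_FTC => //; first by case/andP: ap.
      by move=> x /andP[x1 x2]; apply: dG; rewrite (lt_le_trans a0).
    by apply: cont_sub => // x hx; apply: cvgD; [exact: cFc|exact: cf1].
  rewrite RintegralD// => <-; rewrite RintegralZr//; first by ring.
  apply: int_sub => // l hl; apply: cvgM; [exact: cF2|exact: (d_cont (ck l))].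
rewrite E; have IB : `|Rintegral mu `[a, pi] (fun l : R => F2 l * cos (k%:R * l))| <= KI.
  apply: int_bound => // [x hx|x hx].
    by apply: cvgM; [exact: cF2|exact: (d_cont (ck x))].
  rewrite normrM -[leRHS]mulr1; apply: ler_pM => //; [exact: F2K|exact: cos_max].
have hpi : `|G pi| <= B1 * a.
  have s0 : sin (k%:R * pi) = 0 :> R by have := @sin_pi_int R k; rewrite -pmulrn.
  rewrite /G s0 mulr0 mul0r add0r normrM [X in _ * X]ger0_norm ?(ltW a0)// ler_wpM2r ?(ltW a0)//.
  rewrite normrM -[leRHS]mulr1; apply: ler_pM => //; last exact: cos_max.
  by apply: F1_bound; rewrite p0 lexx.
have ha : `|G a| <= (B0 + B1) * a.
  have aD : D a by rewrite /= in_itv/=; case/andP: ap => ? ?; apply/andP; split; lra.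
  have ap' : 0 < a <= pi by case/andP: ap => -> /ltW ->.
  rewrite /G mulrDl; apply: le_trans (ler_normD _ _) _; apply: lerD.
    rewrite -mulrA normrM; apply: ler_pM => //; first exact: F_bound.
    have hs : `|sin (k%:R * a)| <= k%:R * a.
      rewrite ger0_norm; first by apply: sin_le_id; rewrite mulr_ge0// ltW.
      apply: sin_ge0_pi; rewrite mulr_ge0 ?(ltW a0)//=.
      have : k%:R * a <= 1 by rewrite /a expr2 invfM mulrA divff ?gt_eqF// mul1r invf_le1.
      have := @pi_ge2 R; lra.
    by rewrite normrM normfV (ger0_norm (ltW k0')) ler_pdivrMr// [a * _]mulrC.
  rewrite normrM [X in _ * X]ger0_norm ?(ltW a0)// ler_wpM2r ?(ltW a0)//.
  by rewrite normrM -[leRHS]mulr1; apply: ler_pM => //; [exact: F1_bound|exact: cos_max].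
apply: le_trans (ler_normD _ _) _.
have -> : (2 * B0 + 2 * (B1 + (B0 + B1) + KI)) / k%:R ^+ 2 = 2 * B0 * a + 2 * (B1 * a + (B0 + B1) * a + KI * a).
  by rewrite /a; ring.
apply: lerD => //; rewrite normrM ger0_norm// ler_pM2l//.
apply: le_trans (ler_normB _ _) _; apply: lerD.
  by apply: le_trans (ler_normB _ _) _; exact: lerD.
by rewrite normrM (ger0_norm (ltW a0)) mulrC ler_wpM2r// ltW.
Qed.

End EvenFunctions.

Section CircleLinearity.
Context {R : realType}.
Local Notation mu := (@lebesgue_measure R).
Local Notation D := [set` `](- (pi : R)), (pi : R)]%R].
Implicit Types f g : R -> R.

Lemma circleZ f (c : R) : mu.-integrable D (EFin \o f) -> Rintegral mu D (fun x => c * f x) = c * Rintegral mu D f.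
Proof. by move=> h; apply: RintegralZl => //; exact: mD. Qed.

Lemma circleD f g : mu.-integrable D (EFin \o f) -> mu.-integrable D (EFin \o g) ->
  Rintegral mu D (fun x => f x + g x) = Rintegral mu D f + Rintegral mu D g.
Proof. by move=> h k; apply: RintegralD => //; exact: mD. Qed.

Lemma circleB f g : mu.-integrable D (EFin \o f) -> mu.-integrable D (EFin \o g) ->
  Rintegral mu D (fun x => f x - g x) = Rintegral mu D f - Rintegral mu D g.
Proof. by move=> h k; apply: RintegralB => //; exact: mD. Qed.

Lemma circle_cst (c : R) : Rintegral mu D (fun _ => c) = c * (2 * pi).
Proof.
rewrite Rintegral_cst; last exact: mD.
by rewrite [X in fine X]muD.
Qed.

Lemma circle_cst_int (c : R) : mu.-integrable D (EFin \o (fun _ : R => c)).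
Proof. by apply: cont_integrableD; exact: cst_continuous. Qed.

End CircleLinearity.

(** * Uniqueness of cosine coefficients *)

Section Uniqueness.
Context {R : realType}.
Local Notation mu := (@lebesgue_measure R).
Local Notation D := [set` `](- (pi : R)), (pi : R)]%R].

Definition cos_null (G : R -> R) := [/\ measurable_fun D G, exists B : R, forall l, D l -> `|G l| <= B &
  forall k : int, Rintegral mu D (fun l : R => G l * cos (k%:~R * l)) = 0].

Lemma cos_null_int (G : R -> R) (k : int) : cos_null G -> mu.-integrable D (EFin \o (fun l : R => G l * cos (k%:~R * l))).
Proof.
move=> [mG [B hB] _]; apply: measurable_bounded_integrable => //.
- by rewrite [X in (X < _)%E]muD ltry.
- apply: measurable_funM => //.
  by apply: measurable_funTS; apply: continuous_measurable_fun; exact: cos_lin_continuous.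
exists B; split; first exact: num_real.
move=> y yB x Dx /=; apply: le_trans (ltW yB); rewrite normrM -[leRHS]mulr1.
by apply: ler_pM => //; [exact: hB|exact: cos_max].
Qed.

Lemma cos_nullD (G H : R -> R) (a : R) : cos_null G -> cos_null H -> cos_null (fun l => G l + a * H l).
Proof.
move=> nG nH; have [mG [B hB] zG] := nG; have [mH [C hC] zH] := nH; split.
- by apply: measurable_funD => //; apply: measurable_funM.
- exists (B + `|a| * C) => l Dl; apply: le_trans (ler_normD _ _) _; rewrite normrM.
  by apply: lerD; [exact: hB|rewrite ler_wpM2l//; exact: hC].
move=> k; have iG := cos_null_int k nG; have iH := cos_null_int k nH.
rewrite (@eq_circle _ _ (fun l : R => G l * cos (k%:~R * l) + a * (H l * cos (k%:~R * l)))); last by move=> l _; ring.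
rewrite (circleD iG) ?zG; last by apply: integrable_scale; [exact: mD|exact: iH].
by rewrite (circleZ _ iH) zH mulr0 addr0.
Qed.

Lemma cos_null_cos (G : R -> R) : cos_null G -> cos_null (fun l => G l * cos l).
Proof.
move=> nG; have [mG [B hB] zG] := nG; split.
- apply: measurable_funM => //.
  by apply: measurable_funTS; apply: continuous_measurable_fun; exact: continuous_cos.
- exists B => l Dl; rewrite normrM -[leRHS]mulr1; apply: ler_pM => //; [exact: hB|exact: cos_max].
move=> k.
rewrite (@eq_circle _ _ (fun l : R => 2^-1 * (G l * cos ((k + 1)%:~R * l)) + 2^-1 * (G l * cos ((k - 1)%:~R * l)))); last first.
  move=> l _; rewrite !rmorphD/= rmorphN/= !mulrDl mul1r mulN1r cosD cosB; by field.
have i (j : int) : mu.-integrable D (EFin \o (fun l : R => 2^-1 * (G l * cos (j%:~R * l)))).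
  by apply: integrable_scale; [exact: mD|exact: cos_null_int].
rewrite circleD; [|exact: i|exact: i].
by rewrite (circleZ _ (cos_null_int (k + 1) nG)) (circleZ _ (cos_null_int (k - 1) nG)) !zG !mulr0 addr0.
Qed.

(* Its powers concentrate at the points where cos l = x1 (Landau's kernel). *)
Definition bump (x1 l : R) : R := 1 - (cos l - x1) ^+ 2 / 4.

Lemma cos_null_bump (G : R -> R) (x1 : R) n : cos_null G -> cos_null (fun l => G l * bump x1 l ^+ n).
Proof.
move=> nG; elim: n => [|n IH]; first by under eq_fun do rewrite expr0 mulr1.
have h1 := cos_null_cos IH; have h2 := cos_null_cos h1.
have := cos_nullD (x1 / 2) (cos_nullD (- (1 / 4)) IH h2) (cos_nullD (- (x1 / 2)) h1 IH).
rewrite (_ : (fun l => _) = (fun l => G l * bump x1 l ^+ n.+1))//.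
by apply/funext => l; rewrite exprS /bump; field.
Qed.

(** Suppose [G l1 > 0]. Wherever [G l < G l1 / 2] the bump is at most q, while on a short interval
    to the right of l1 it is at least Q > q. As G integrates to 0 against every power of the bump,
    Q^n would be O(q^n). *)
Lemma cos_null_le0 (G : R -> R) (l1 : R) : cos_null G -> (forall l, G (- l) = G l) ->
    (forall l, 0 < l <= pi -> {for l, continuous G}) -> 0 < l1 < pi -> G l1 <= 0.
Proof.
have p0 := pi_gt0 R.
move=> nG ev cG /andP[l10 l1p]; rewrite leNgt; apply/negP => G0.
have [mG [B hB] _] := nG.
have B0 : 0 <= B by apply: le_trans (normr_ge0 (G pi)) (hB _ _); rewrite /= in_itv/= lexx andbT; lra.
pose de := G l1 / 2; have de0 : 0 < de by rewrite divr_gt0.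
have [eta [eta0 ea eb hnear]] : exists eta : R, [/\ 0 < eta, eta < l1, eta < pi - l1 &
    forall l, `|l - l1| < eta -> de <= G l].
  have c1 : {for l1, continuous G} by apply: cG; rewrite l10 ltW.
  have [e1 e10 h1] := (@cvgrPdist_lt _ _ _ _ _ _ _).1 c1 de de0.
  exists (Num.min e1 (Num.min (l1 / 2) ((pi - l1) / 2))).
  rewrite !lt_min !gt_min; split.
  - by rewrite e10/=; apply/andP; split; lra.
  - by apply/orP; right; apply/orP; left; lra.
  - by apply/orP; right; apply/orP; right; lra.
  move=> l; rewrite !lt_min => /andP[hl _].
  have := h1 l; rewrite /= /ball_/= distrC => /(_ hl); rewrite ltr_norml => /andP[_ ]; rewrite /de; lra.
pose x1 := cos l1; pose a := cos (l1 - eta) - x1; pose b := x1 - cos (l1 + eta).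
have a0 : 0 < a by rewrite subr_gt0 ltr_cos ?in_itv/=; [lra|apply/andP; split; lra|apply/andP; split; lra].
have b0 : 0 < b by rewrite subr_gt0 ltr_cos ?in_itv/=; [lra|apply/andP; split; lra|apply/andP; split; lra].
pose ro := Num.min a b; have ro0 : 0 < ro by rewrite lt_min a0.
have roa : ro <= a by rewrite ge_min lexx.
have rob : ro <= b by rewrite ge_min lexx orbT.
have ro2 : ro <= 2 by apply: le_trans roa _; have := cos_le1 (l1 - eta); have := cos_geN1 l1; rewrite /a /x1; lra.
have bump0 l : 0 <= bump x1 l.
  have := cos_le1 l; have := cos_geN1 l; have := cos_le1 l1; have := cos_geN1 l1.
  by rewrite /bump /x1; nra.
have far l : D l -> G l < de -> bump x1 l <= 1 - ro ^+ 2 / 4.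
  rewrite /= in_itv/= => /andP[d1 d2] Gl.
  have GN : G `|l| = G l by case: ger0P => // _; rewrite ev.
  have lp : `|l| <= pi by rewrite ler_norml d2 ltW.
  have : eta <= `| `|l| - l1| by rewrite leNgt; apply/negP => /hnear; rewrite GN leNgt Gl.
  rewrite ler_normr => h; rewrite /bump -(cos_norm l); have n0 := normr_ge0 l.
  have key : (cos `|l| <= x1 - b) || (x1 + a <= cos `|l|).
    case/orP: h => h; apply/orP; [left|right].
      rewrite /b opprB addrC subrK leNgt ltr_cos ?in_itv/= -?leNgt; [lra|apply/andP; split; lra|apply/andP; split; lra].
    rewrite /a addrC subrK leNgt ltr_cos ?in_itv/= -?leNgt; [lra|apply/andP; split; lra|apply/andP; split; lra].
  by move: (cos `|l|) key => c /orP[] h2; nra.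
(* The cosine being 1-Lipschitz, this width keeps [|cos l - x1|] below [ro / 2], half the distance
   available in [far]. *)
pose eta' := Num.min eta (ro / 2).
have e'0 : 0 < eta' by rewrite lt_min eta0 divr_gt0.
have e'1 : eta' <= eta by rewrite ge_min lexx.
have e'2 : eta' <= ro / 2 by rewrite ge_min lexx orbT.
pose N := [set` `]l1, (l1 + eta')[%R] : set (measurableTypeR R).
have ND : N `<=` D by move=> x; rewrite /N /= !in_itv/= => /andP[? ?]; apply/andP; split; lra.
have nearN l : N l -> 1 - ro ^+ 2 / 16 <= bump x1 l /\ de <= G l.
  rewrite /N /= in_itv/= => /andP[h1 h2]; split; last first.
    by apply: hnear; rewrite ger0_norm; lra.
  have := @mvt_bound R cos (fun t => - sin t) l1 l 1 (ltW h1).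
  rewrite mul1r => hh; have {}hh : `|cos l - cos l1| <= l - l1.
    by apply: hh => t _; rewrite normrN; exact: sin_max.
  rewrite /bump -/x1; have : `|cos l - x1| <= ro / 2 by apply: le_trans hh _; lra.
  by rewrite ler_norml => /andP[h3 h4]; nra.
pose q := 1 - ro ^+ 2 / 4; pose Q := 1 - ro ^+ 2 / 16.
have q0 : 0 <= q by rewrite /q; nra.
have qQ : q < Q by rewrite /q /Q; nra.
have Q0 : 0 < Q by exact: le_lt_trans qQ.
have main n : de * Q ^+ n * eta' <= B * q ^+ n * (2 * pi).
  have nGn := cos_null_bump x1 n nG; have [_ _ zn] := nGn.
  have in0 := cos_null_int 0 nGn.
  have c0 (l : R) : cos ((0 : int)%:~R * l) = 1 by rewrite mul0r cos0.
  have mN : measurable N by exact: measurable_itv.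
  have iN : mu.-integrable D (EFin \o (\1_N : R -> R)).
    apply: (@bounded_integrableD R _ 1); first exact: measurable_indic.
    by move=> x; rewrite indicE ger0_norm ?lern1 ?leq_b1.
  have i1 := integrable_scale (de * Q ^+ n) (@mD R) iN.
  have i2 := @circle_cst_int R (B * q ^+ n).
  have iL := integrable_sub (@mD R) i1 i2.
  have : Rintegral mu D (fun l : R => (de * Q ^+ n) * \1_N l - B * q ^+ n) <= 0.
    rewrite -[leRHS](zn 0); apply: le_Rintegral => //.
    move=> l Dl; rewrite c0 mulr1 indicE.
    have Gl := hB l Dl; have bn := bump0 l; have bn' : 0 <= bump x1 l ^+ n by rewrite exprn_ge0.
    case: (ltrP (G l) de) => h.
      have hf := far l Dl h.
      have nN : (l \in N) = false by apply/negbTE/negP => /set_mem /nearN[_]; rewrite leNgt h.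
      rewrite nN mulr0 sub0r.
      have b1 : bump x1 l ^+ n <= q ^+ n by apply: lerXn2r; rewrite ?nnegrE.
      have b2 : - B <= G l by move: Gl; rewrite ler_norml => /andP[].
      have b3 : B * bump x1 l ^+ n <= B * q ^+ n by rewrite ler_wpM2l.
      by nra.
    have qn : 0 <= B * q ^+ n by rewrite mulr_ge0// exprn_ge0.
    case: (boolP (l \in N)) => [/set_mem /nearN[h1 _]|_].
      have b1 : Q ^+ n <= bump x1 l ^+ n by apply: lerXn2r; rewrite ?nnegrE ?(ltW Q0).
      rewrite mulr1; have Qn : 0 <= Q ^+ n by rewrite exprn_ge0// ltW.
      by nra.
    rewrite mulr0 sub0r; have : 0 <= G l * bump x1 l ^+ n by rewrite mulr_ge0// (le_trans (ltW de0)).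
    lra.
  rewrite (circleB i1 i2) (circleZ _ iN) circle_cst.
  have -> : Rintegral mu D (\1_N : R -> R) = eta'.
    rewrite /Rintegral integral_indic//.
    have mE : mu (N `&` D) = eta'%:E.
      rewrite setIidl// /N lebesgue_measure_itv/= lte_fin ifT; last by lra.
      by rewrite -EFinD; congr EFin; ring.
    by rewrite [X in fine X]mE.
  by rewrite subr_le0.
have cq : (fun n => B * (2 * pi) * (q / Q) ^+ n) @ \oo --> B * (2 * pi) * 0.
  apply: cvgM; first exact: cvg_cst.
  by apply: cvg_expr; rewrite ger0_norm ?divr_ge0 ?(ltW Q0)// ltr_pdivrMr// mul1r.
have : de * eta' <= B * (2 * pi) * 0.
  apply: (cvgr_to_ge cq); exists 0%N => // n _ /=; have := main n.
  rewrite expr_div_n [X in _ -> _ <= X](_ : _ = B * q ^+ n * (2 * pi) / Q ^+ n); last by ring.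
  by rewrite ler_pdivlMr ?exprn_gt0// mulrAC.
by rewrite mulr0; have := mulr_gt0 de0 e'0; lra.
Qed.

Lemma cos_null_eq0 (E : R -> R) : cos_null E -> (forall l, E (- l) = E l) ->
  (forall l, 0 < l <= pi -> {for l, continuous E}) -> forall l, D l -> l != 0 -> E l = 0.
Proof.
have p0 := pi_gt0 R; have pos := cos_null_le0.
move=> nE ev cE.
have nN : cos_null (fun l => - E l).
  have := cos_nullD (- 2) nE nE; rewrite (_ : (fun l => _) = fun l => - E l)//.
  by apply/funext => l; ring.
have zero l : 0 < l < pi -> E l = 0.
  move=> hl; apply/le_anti/andP; split; first exact: pos.
  rewrite -oppr_le0; apply: (pos (fun l => - E l)) => // [x|x hx]; first by rewrite ev.
  by apply: cvgN; exact: cE.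
have zpi : E pi = 0.
  have c1 : {for pi, continuous E} by apply: cE; rewrite p0 lexx.
  have u1 : (fun n : nat => pi - pi / n.+2%:R : R) @ \oo --> (pi : R).
    by rewrite -[X in _ --> X]subr0; apply: cvgB; [exact: cvg_cst|exact: pi_seq_cvg0].
  have h1 : (fun n : nat => E (pi - pi / n.+2%:R)) @ \oo --> E pi by apply: continuous_cvg.
  have h2 : (fun n : nat => E (pi - pi / n.+2%:R)) @ \oo --> (0 : R).
    apply: cvg_near_cst; near=> n; apply: zero.
    have n1 : pi / n.+2%:R < pi :> R by rewrite ltr_pdivrMr// ltr_pMr// ltr1n.
    have n2 : 0 < pi / n.+2%:R :> R by rewrite divr_gt0.
    by rewrite subr_gt0 n1 ltrBlDr ltrDl n2.
  exact: (cvg_unique _ h1 h2).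
move=> l; rewrite /= in_itv/= => /andP[l1 l2] l0.
have zp x : 0 < x <= pi -> E x = 0.
  by move=> /andP[x0]; rewrite le_eqVlt => /predU1P[->//|xp]; apply: zero; rewrite x0.
case: (ltgtP l 0) => h; last by rewrite h eqxx in l0.
  by rewrite -ev; apply: zp; apply/andP; split; lra.
by apply: zp; rewrite h.
Unshelve. all: by end_near.
Qed.

End Uniqueness.

Section FourierRepresentation.
Context {R : realType}.
Local Notation W := (wiener R).
Local Notation mu := (@lebesgue_measure R).
Local Notation D := [set` `](- (pi : R)), (pi : R)]%R].

(* The exponent e may be negative: F behaves like |l|^(e + 2) at the origin. *)
Record piecewise_smooth (F : R -> R) : Prop := PiecewiseSmooth {
  ps_even : forall l, F (- l) = F l;
  ps_F1 : exists F1 F2 : R -> R, exists K e : R, [/\ 0 <= K, -1 < e,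
    forall l, 0 < l <= pi -> is_derive l 1 F (F1 l),
    forall l, 0 < l <= pi -> is_derive l 1 F1 (F2 l) &
    forall l, 0 < l <= pi -> {for l, continuous F2} /\ `|F2 l| <= K * (1 + l `^ e)] }.

Variable F : R -> R.
Hypothesis Fps : piecewise_smooth F.

(** The factor 4 comes from [(1 + k)^2 <= 4 k^2] for k >= 1. *)
Lemma one_sided_coef (M : R) (a : nat -> R) : (forall k, (0 < k)%N -> `|a k| <= M / k%:R ^+ 2) ->
  exists2 L : W, decays (4 * M) L & forall k : int, L k = if 0 < k then a `|k|%N else 0.
Proof.
move=> ha; pose f (k : int) := if 0 < k then a `|k|%N else 0.
have M0 : 0 <= M by have := ha 1%N isT; rewrite expr1n divr1; exact: le_trans.
have hf k : `|f k| <= 4 * M * omega k.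
  rewrite /f /omega; case: ifP => k0; last by rewrite normr0 mulr_ge0 ?mulr_ge0// invr_ge0 exprn_ge0// addr_ge0.
  have kp : (0 < `|k|)%N by lia.
  apply: le_trans (ha _ kp) _; have h1 : 1 <= `|k|%N%:R :> R by rewrite ler1n.
  move: (`|k|%N%:R) h1 => t t1; rewrite [4 * M]mulrC -mulrA ler_wpM2l//.
  rewrite -[leLHS]mul1r ler_pdivrMr ?exprn_gt0 ?(lt_le_trans ltr01)// mulrAC ler_pdivlMr ?exprn_gt0//; first nra.
  lra.
have sf : summ f := le_summ_ge0 hf (summZ (4 * M) (@omega_summ R).1).
by exists (mkW sf).
Qed.

(** Subtracting the cosine series leaves an even function all of whose cosine moments vanish. The
    origin is excluded because F need not be continuous there. *)
Theorem fourier_rep : exists M : R, exists L : W, [/\ 0 <= M, decays M L, supp_ge 1 L,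
  forall l, D l -> l != 0 -> F l = fcoef F 0 + 2 * wcos L l & mu.-integrable D (EFin \o F)].
Proof.
case: Fps => ev [F1 [F2 [K [e [K0 e1 d1 d2 h2]]]]].
have c2 l (hl : 0 < l <= pi) := (h2 l hl).1; have b2 l (hl : 0 < l <= pi) := (h2 l hl).2.
have hdec := fcoef_decay ev d1 d2 c2 K0 e1 b2.
have hb := F_bound ev d1 d2 c2 K0 e1 b2.
set B0 := (X in forall l, D l -> _ <= X) in hb.
set M := (X in forall k : nat, (0 < k)%N -> _ <= X / _) in hdec.
have [L dL LE] := one_sided_coef hdec.
have M0 : 0 <= M by have := hdec 1%N isT; rewrite expr1n divr1; exact: le_trans.
have sL : supp_ge 1 L by move=> k k1; rewrite LE ifF//; lia.
have iF (k : nat) := Fcos_int ev d1 d2 c2 K0 e1 b2 k.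
exists (4 * M), L; split => //; first exact: mulr_ge0.
  pose x : W := wcst (fcoef F 0) + (L + rev L).
  have xE l : wcos x l = fcoef F 0 + 2 * wcos L l by rewrite !wcosD wcos_cst wcos_rev; ring.
  pose E l := F l - wcos x l.
  have nullE : cos_null E.
    split.
    - apply: measurable_funB; last exact: wcos_measurable.
      exact: (F_meas ev d1).
    - exists (B0 + n1 x) => l Dl; apply: le_trans (ler_normB _ _) _.
      by apply: lerD; [exact: hb|exact: wcos_le].
    move=> k; rewrite (@eq_circle _ _ (fun l : R => F l * cos (`|k|%N%:R * l) - wcos x l * cos (k%:~R * l))); last first.
      move=> l _; rewrite /E mulrBl; congr (_ * _ - _).
      by case: k => n //; rewrite NegzE mulrNz mulNr cosN.
    rewrite circleB; [|exact: iF|exact: wcos_cos_integrable].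
    rewrite circle_wcos; have -> : Rintegral mu D (fun l : R => F l * cos (`|k|%N%:R * l)) = 2 * pi * fcoef F `|k|%N.
      by rewrite /fcoef mulrA divff ?mul1r// mulf_neq0// gt_eqF// pi_gt0.
    have -> : x k + x (- k) = 2 * fcoef F `|k|%N.
      rewrite /x !wD !revE opprK !LE !wcstE oppr_eq0.
      have [->|k0] := eqVneq k 0.
        by rewrite oppr0 !ltxx absz0 /=; ring.
      rewrite abszN; case: (ltgtP 0 k) => hk; last by rewrite hk eqxx in k0.
        by rewrite ifF /=; [ring|lia].
      by rewrite ifT /=; [ring|lia].
    by ring.
  have E0 := cos_null_eq0 nullE.
  move=> l Dl l0; rewrite -xE; apply/eqP; rewrite -subr_eq0; apply/eqP; apply: (E0 _ _ l Dl l0).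
    by move=> t; rewrite /E ev !xE; congr (_ - (_ + _ * _)); apply: eq_rsum => k; rewrite mulrN cosN.
  by move=> t ht; apply: cvgB; [exact: (d_cont (d1 t ht))|exact: wcos_continuous].
have := iF 0%N; rewrite (_ : (fun l : R => _) = F)//.
by apply/funext => l; rewrite mul0r cos0 mulr1.
Qed.

End FourierRepresentation.

(** * Fractional Gaussian noise *)

Section Calculus.
Context {R : realType}.
Implicit Types f g : R -> R.

Lemma d_quadratic f (x c B r : R) : 0 < r ->
  (forall y, `|y - x| < r -> `|f y - f x - (y - x) * c| <= B * (y - x) ^+ 2) -> is_derive x 1 f c.
Proof.
move=> r0 h.
have B0 : 0 <= B.
  have := h (x + r / 2); rewrite addrAC subrr add0r ger0_norm; last by rewrite divr_ge0// ltW.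
  move=> /(_ (ltac:(by lra))) => h1; have := le_trans (normr_ge0 _) h1.
  by rewrite pmulr_lge0// exprn_gt0// divr_gt0.
have lim : (fun t => t^-1 *: (f (t *: 1 + x) - f x)) @ 0^' --> c.
  apply/cvgrPdist_le => e e0; near=> t.
  have t0 : t != 0 by near: t; exact: nbhs_dnbhs_neq.
  have t1 : `|t| < r by near: t; apply: dnbhs0_lt.
  have t2 : `|t| < e / (B + 1) by near: t; apply: dnbhs0_lt; rewrite divr_gt0// ltr_pwDr.
  have := h (t + x); rewrite addrK => /(_ t1) h1.
  rewrite /GRing.scale/= mulr1 distrC.
  have -> : t^-1 * (f (t + x) - f x) - c = t^-1 * (f (t + x) - f x - t * c) by field.
  rewrite normrM normfV ler_pdivrMl ?normr_gt0//; apply: le_trans h1 _.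
  rewrite -[t ^+ 2]real_normK ?num_real// expr2 mulrCA ler_pM2l ?normr_gt0//.
  move: t2; rewrite ltr_pdivlMr ?ltr_pwDr// => t2; have := normr_ge0 t; nra.
split; first by apply/cvg_ex; exists c.
exact: cvg_lim lim.
Unshelve. all: by end_near.
Qed.

Lemma taylor2 f (f1 f2 : R -> R) (a b B x y : R) : a <= x <= b -> a <= y <= b ->
  (forall t, a <= t <= b -> is_derive t 1 f (f1 t)) ->
  (forall t, a <= t <= b -> is_derive t 1 f1 (f2 t)) ->
  (forall t, a <= t <= b -> `|f2 t| <= B) ->
  `|f y - f x - (y - x) * f1 x| <= B * (y - x) ^+ 2.
Proof.
move=> /andP[ax xb] /andP[ay yb] d1 d2 fB.
have B0 : 0 <= B by apply: le_trans (normr_ge0 _) (fB x _); rewrite ax.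
have lip s t : a <= s -> s <= t -> t <= b -> `|f1 t - f1 s| <= B * (t - s).
  move=> as_ st tb; apply: (mvt_bound (df := f2)) => // u /andP[u1 u2].
    by apply: d2; rewrite (le_trans as_ u1) (le_trans u2 tb).
  by apply: fB; rewrite (le_trans as_ (ltW u1)) (le_trans (ltW u2) tb).
pose g t := f t - t * f1 x.
have dg t : a <= t <= b -> is_derive t 1 g (f1 t - f1 x).
  by move=> h; apply: (d_ext (dB (d1 t h) (dZ (f1 x) (did t)))) => [s|]; rewrite /g; ring.
have E : f y - f x - (y - x) * f1 x = g y - g x by rewrite /g; ring.
rewrite E; case: (lerP x y) => xy.
  apply: le_trans (mvt_bound (df := fun t => f1 t - f1 x) (M := B * (y - x)) xy _ _) _; last by rewrite expr2 mulrA.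
    by move=> t /andP[t1 t2]; apply: dg; rewrite (le_trans ax t1) (le_trans t2 yb).
  move=> t /andP[t1 t2]; apply: le_trans (lip x t ax (ltW t1) (le_trans (ltW t2) yb)) _.
  by apply: ler_wpM2l => //; lra.
rewrite distrC; apply: le_trans (mvt_bound (df := fun t => f1 t - f1 x) (M := B * (x - y)) (ltW xy) _ _) _.
- by move=> t /andP[t1 t2]; apply: dg; rewrite (le_trans ay t1) (le_trans t2 xb).
- move=> t /andP[t1 t2]; rewrite distrC; apply: le_trans (lip t x (le_trans ay (ltW t1)) (ltW t2) xb) _.
  by apply: ler_wpM2l => //; lra.
by rewrite -mulrA -expr2 -sqrrN opprB.
Qed.

Lemma d_near f g (x a r : R) : 0 < r -> (forall y, `|y - x| < r -> g y = f y) -> is_derive x 1 g a -> is_derive x 1 f a.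
Proof.
move=> r0 h; apply: near_eq_is_derive; exists r => // y /= hy; apply: h.
by rewrite distrC.
Qed.

Lemma dpow (x p : R) : 0 < x -> is_derive x 1 (fun t : R => t `^ p) (p * x `^ (p - 1)).
Proof. by move=> x0; have := dpowR p x0 (did x); rewrite mulr1. Qed.

End Calculus.

(** * Hurwitz sums and their derivatives *)

Section Hurwitz.
Context {R : realType}.

Definition zterm (p : R) (k : nat) : R := k.+1%:R `^ (- p).

Lemma zterm_ge0 p k : 0 <= zterm p k. Proof. exact: powR_ge0. Qed.

(** The mean value theorem for [t^(1 - p)] takes the place of the integral test. *)
Lemma zterm_tele (p : R) (k : nat) : 1 < p ->
  zterm p k.+1 <= (k.+1%:R `^ (1 - p) - k.+2%:R `^ (1 - p)) / (p - 1).
Proof.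
move=> p1; have k0 : 0 < k.+1%:R :> R by [].
have kk : k.+1%:R < k.+2%:R :> R by rewrite ltr_nat.
have [|| c] := @MVT R (fun t => t `^ (1 - p)) (fun t => (1 - p) * t `^ (1 - p - 1)) _ _ kk.
- by move=> t; rewrite in_itv/= => /andP[t1 _]; apply: dpow; exact: lt_trans t1.
- apply: derivable_within_continuous => t; rewrite in_itv/= => /andP[t1 _].
  by have [] := dpow (1 - p) (lt_le_trans k0 t1).
rewrite in_itv/= => /andP[c1 c2] E.
rewrite ler_pdivlMr ?subr_gt0//.
have -> : k.+1%:R `^ (1 - p) - k.+2%:R `^ (1 - p) = - (k.+2%:R `^ (1 - p) - k.+1%:R `^ (1 - p)) by ring.
rewrite E -[k.+2%:R]natr1 [k.+1%:R + 1 - _]addrAC subrr add0r mulr1.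
rewrite (_ : 1 - p - 1 = - p); last by ring.
rewrite -mulNr opprB mulrC ler_pM2l ?subr_gt0// /zterm.
have c0 : 0 < c by exact: lt_trans c1.
by rewrite !powRN lef_pV2 ?posrE ?powR_gt0//; apply: ge0_ler_powR; rewrite ?nnegrE ?(ltW c2) ?(ltW c0)//; lra.
Qed.

Lemma zterm_summ (p : R) : 1 < p -> summ (zterm p).
Proof.
move=> p1; have p1' : 0 < p - 1 by rewrite subr_gt0.
have H N : \sum_(i < N.+1) zterm p i <= 1 + (1 - N.+1%:R `^ (1 - p)) / (p - 1).
  elim: N => [|N IH]; first by rewrite big_ord_recl big_ord0 addr0 /zterm !powR1 subrr mul0r addr0.
  rewrite big_ord_recr/=; apply: le_trans (lerD IH (zterm_tele N p1)) _.
  by rewrite -addrA -mulrDl addrA subrK.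
apply: (@rsum_le_bound _ _ (1 + (p - 1)^-1) _ _).1 => [|N]; first exact: zterm_ge0.
case: N => [|N]; first by rewrite big_ord0 addr_ge0// invr_ge0 ltW.
apply: le_trans (H N) _; rewrite lerD2l ler_pdivrMr// mulVf ?gt_eqF// lerBlDr lerDl powR_ge0.
Qed.

(* (2 pi)^(-p) times the Hurwitz zeta function at (p, 1 + x / (2 pi)). *)
Definition hz (p x : R) : R := rsum (fun k : nat => (2 * pi * k.+1%:R + x) `^ (- p)).

(** The range [|x| <= 3 pi / 2] extends beyond pi because derivatives at [l = pi] are two-sided; on
    it the terms are still dominated by those of the zeta series. *)
Lemma hz_base (x : R) (k : nat) : `|x| <= 3 * pi / 2 -> k.+1%:R <= 2 * pi * k.+1%:R + x.
Proof.
rewrite ler_norml => /andP[x1 _]; have := @pi_ge2 R; have : 1 <= k.+1%:R :> R by rewrite ler1n.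
by move: (k.+1%:R : R) (pi : R) x1 => t q *; nra.
Qed.

Lemma hz_term_le (p x : R) (k : nat) : 0 <= p -> `|x| <= 3 * pi / 2 ->
  0 <= (2 * pi * k.+1%:R + x) `^ (- p) <= zterm p k.
Proof.
move=> p0 hx; rewrite powR_ge0/= /zterm !powRN; have hb := hz_base k hx.
have k0 : 0 < k.+1%:R :> R by [].
have b0 := lt_le_trans k0 hb.
by rewrite lef_pV2 ?posrE ?powR_gt0//; apply: ge0_ler_powR => //; rewrite nnegrE ltW.
Qed.

Lemma hz_summ (p x : R) : 1 < p -> `|x| <= 3 * pi / 2 -> summ (fun k : nat => (2 * pi * k.+1%:R + x) `^ (- p)).
Proof.
move=> p1 hx; apply: (le_summ_ge0 _ (zterm_summ p1)) => k.
by have /andP[h0 h] := hz_term_le k (ltW (lt_trans ltr01 p1)) hx; rewrite ger0_norm.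
Qed.

Lemma hz_ge0 (p x : R) : 1 < p -> `|x| <= 3 * pi / 2 -> 0 <= hz p x.
Proof.
move=> p1 hx; have -> : 0 = rsum (fun _ : nat => 0 : R) by rewrite rsum0.
apply: ler_rsum; [|exact: hz_summ|by move=> k; exact: powR_ge0].
by apply: (le_summ_ge0 _ (zterm_summ p1)) => k; rewrite normr0 zterm_ge0.
Qed.

Lemma hz_le (p x : R) : 1 < p -> `|x| <= 3 * pi / 2 -> hz p x <= rsum (zterm p).
Proof.
move=> p1 hx; apply: ler_rsum; [exact: hz_summ|exact: zterm_summ|] => k.
by have /andP[_ h] := hz_term_le k (ltW (lt_trans ltr01 p1)) hx.
Qed.

(** Termwise differentiation: each term has a quadratic Taylor remainder whose constants are
    summable over k. *)
Lemma hz_derive (p x : R) : 1 < p -> `|x| < 3 * pi / 2 -> is_derive x 1 (hz p) (- p * hz (p + 1) x).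
Proof.
move=> p1 hx; set b : R := 3 * pi / 2 in hx *.
have p2 : 1 < p + 1 by rewrite ltrDr (lt_trans ltr01).
have p3 : 1 < p + 2 by rewrite ltrDr in p2; lra.
pose B := p * (p + 1) * rsum (zterm (p + 2)).
have r0 : 0 < b - `|x| by rewrite subr_gt0.
apply: (@d_quadratic _ _ x _ B (b - `|x|) r0) => y hy.
have yb : `|y| <= b.
  have -> : y = (y - x) + x by ring.
  by apply: le_trans (ler_normD _ _) _; lra.
have xb := ltW hx.
have bnd (t : R) : - b <= t <= b -> `|t| <= b by rewrite ler_norml.
pose a k (t : R) := 2 * pi * k.+1%:R + t.
have a0 k t : - b <= t <= b -> 0 < a k t.
  by move=> ht; apply: lt_le_trans (hz_base k (bnd t ht)); rewrite ltr0n.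
have da k t q : - b <= t <= b -> is_derive t 1 (fun t => a k t `^ (- q)) (- q * a k t `^ (- (q + 1))).
  move=> ht; have h : is_derive t 1 (a k) 1.
    by apply: (d_ext (dD (dcst t (2 * pi * k.+1%:R)) (did t))) => //; rewrite add0r.
  have := @dpowR R (a k) t 1 (- q) (a0 k t ht) h.
  by rewrite mulr1 (_ : - q - 1 = - (q + 1)); last by ring.
have tay k : `|a k y `^ (- p) - a k x `^ (- p) - (y - x) * (- p * a k x `^ (- (p + 1)))| <=
    p * (p + 1) * zterm (p + 2) k * (y - x) ^+ 2.
  apply: (@taylor2 _ _ (fun t => - p * a k t `^ (- (p + 1))) (fun t => - p * (- (p + 1) * a k t `^ (- (p + 1 + 1)))) (- b) b).
  - by rewrite -ler_norml.
  - by rewrite -ler_norml.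
  - by move=> t ht; apply: dZ; exact: da.
  move=> t ht; rewrite mulrA mulrNN ger0_norm; last first.
    by rewrite mulr_ge0 ?powR_ge0// mulr_ge0; lra.
  have pp : 0 <= p * (p + 1) by apply: mulr_ge0; lra.
  apply: ler_wpM2l => //.
  rewrite (_ : p + 1 + 1 = p + 2); last by ring.
  by have /andP[] := hz_term_le k (ltW (lt_trans ltr01 p3)) (bnd t ht).
have s1 := hz_summ p1 yb; have s2 := hz_summ p1 xb; have s3 := summZ (- p) (hz_summ p2 xb).
have s4 := summZ (y - x) s3.
have -> : hz p y - hz p x - (y - x) * (- p * hz (p + 1) x) =
  rsum (fun k => a k y `^ (- p) - a k x `^ (- p) - (y - x) * (- p * a k x `^ (- (p + 1)))).
  rewrite rsumB//; last exact: summB.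
  by rewrite rsumB// !rsumZ// ; exact: hz_summ.
apply: le_trans (ler_norm_rsum _) _; first by apply: summB => //; exact: summB.
have -> : B * (y - x) ^+ 2 = rsum (fun k => p * (p + 1) * zterm (p + 2) k * (y - x) ^+ 2).
  rewrite rsumZr ?rsumZ//; [exact: zterm_summ|apply: summZ; exact: zterm_summ].
apply: ler_rsum; [|by apply: summZr; apply: summZ; exact: zterm_summ|exact: tay].
by apply: summ_abs; apply: summB => //; exact: summB.
Qed.

End Hurwitz.

(** * Bounds on second derivatives of logarithms *)

Section SineBounds.
Context {R : realType}.

Lemma mvt_ge0 (f df : R -> R) (a b : R) : a <= b -> (forall t, a <= t <= b -> is_derive t 1 f (df t)) ->
  (forall t, a < t < b -> 0 <= df t) -> f a <= f b.
Proof.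
rewrite le_eqVlt => /predU1P[->//|ab] hf hM.
have [|| c] := @MVT R f df a b ab.
- by move=> t; rewrite in_itv/= => /andP[at_ tb]; apply: hf; rewrite !ltW.
- by apply: derivable_within_continuous => t; rewrite in_itv/= => tab; have [] := hf t tab.
by rewrite in_itv/= => cab E; rewrite -subr_ge0 E mulr_ge0 ?hM// subr_ge0 ltW.
Qed.

Lemma cos_ge_quad (y : R) : 0 <= y -> 1 - y ^+ 2 / 2 <= cos y.
Proof.
move=> y0; have -> : cos y = cos ((y / 2) *+ 2) by congr cos; rewrite mulr2n; field.
rewrite cos_mulr2n cos2sin2; have h := @sin_le_id R (y / 2) (ltac:(by rewrite divr_ge0)).
have h2 : - (y / 2) <= sin (y / 2).
  have := mvt_ge0 (f := fun t => sin t + t) (df := fun t => cos t + 1) (a := 0) (b := y / 2).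
  rewrite sin0 addr0 divr_ge0// => /(_ isT) h1; rewrite -subr_ge0 opprK; apply: h1.
  by move=> t _; have := cos_geN1 t; lra.
by move: (sin (y / 2)) h h2 => t h h2; nra.
Qed.

Lemma sin_ge_cubic (y : R) : 0 <= y -> y - y ^+ 3 / 6 <= sin y.
Proof.
move=> y0; have := mvt_ge0 (f := fun t => sin t - (t - 6^-1 * t ^+ 3)) (df := fun t => cos t - (1 - 6^-1 * (3%:R * t ^+ 2 * 1))) (a := 0) (b := y) y0.
rewrite sin0 expr0n mulr0 !subr0 => h; rewrite [y ^+ 3 / 6]mulrC -subr_ge0; apply: h.
  by move=> t _; exact: dB (is_derive_sin t) (dB (did t) (dZ 6^-1 (dX 2 (did t)))).
by move=> t /andP[t0 _]; have := cos_ge_quad (ltW t0); lra.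
Qed.

Lemma pi_half2 : (pi : R) <= 4.
Proof. by have [/andP[_ h] _] := @pihalf_02_cos_pihalf R; lra. Qed.

Lemma sin_ge_third (y : R) : 0 <= y <= 2 -> y / 3 <= sin y.
Proof. by move=> /andP[y0 y2]; apply: le_trans (sin_ge_cubic y0); nra. Qed.

(** [sinc1] and [sinc2] are the first two derivatives of [ln (2 sin (l / 2)) - ln l]; the poles at 0
    cancel. *)
Definition sinc1 (l : R) : R := cos (l / 2) / (2 * sin (l / 2)) - l^-1.
Definition sinc2 (l : R) : R := (l ^+ 2)^-1 - ((2 * sin (l / 2)) ^+ 2)^-1.

Lemma dhalf_sin (l : R) : is_derive l 1 (fun l : R => 2 * sin (l / 2)) (cos (l / 2)).
Proof.
apply: (d_ext (dZ 2 (dsin (dZ 2^-1 (did l))))) => [t|]; first by rewrite mulrC [_ / 2]mulrC mulrC.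
by rewrite mulr1 [2^-1 * l]mulrC mulrCA divff ?mulr1.
Qed.

Lemma half_sin_gt0 (l : R) : 0 < l < 2 * pi -> 0 < 2 * sin (l / 2).
Proof. by move=> /andP[l0 lp]; rewrite mulr_gt0// sin_gt0_pi//; apply/andP; split; lra. Qed.

Lemma dsinc (l : R) : 0 < l < 2 * pi ->
  is_derive l 1 (fun l : R => ln (2 * sin (l / 2)) - ln l) (sinc1 l).
Proof.
move=> hl; have s0 := half_sin_gt0 hl; have /andP[l0 _] := hl.
have h1 := @dln R (fun l : R => 2 * sin (l / 2)) l _ s0 (dhalf_sin l).
have h2 := @dln R (fun l : R => l) l 1 l0 (did l).
by apply: (d_ext (dB h1 h2)) => //; rewrite /sinc1 mul1r.
Qed.

Lemma dsinc1 (l : R) : 0 < l < 2 * pi -> is_derive l 1 sinc1 (sinc2 l).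
Proof.
move=> hl; have s0 := half_sin_gt0 hl; have /andP[l0 _] := hl.
have h1 := @dV R (fun l : R => 2 * sin (l / 2)) l _ (lt0r_neq0 s0) (dhalf_sin l).
have h2 := @dV R (fun l : R => l) l 1 (lt0r_neq0 l0) (did l).
have h3 : is_derive l 1 (fun l : R => cos (l / 2)) (- sin (l / 2) / 2).
  apply: (d_ext (dcos (dZ 2^-1 (did l)))) => [t|]; first by rewrite mulrC.
  by rewrite mulr1 [2^-1 * l]mulrC.
apply: (d_ext (dB (dM h3 h1) h2)) => // .
rewrite /sinc2; have := cos2Dsin2 (l / 2); move: (sin (l / 2)) (cos (l / 2)) s0 => t c s0 E.
have t0 : t != 0 by apply: lt0r_neq0; move: s0; rewrite pmulr_rgt0.
have E' : c ^+ 2 = 1 - t ^+ 2 by lra.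
have -> : - t / 2 / (2 * t) + c * (- c / (2 * t) ^+ 2) - - 1 / l ^+ 2 =
  (l ^+ 2)^-1 - (4 * t ^+ 2)^-1 * (t ^+ 2 + c ^+ 2) by field; rewrite t0 gt_eqF.
by rewrite E'; field; rewrite t0 gt_eqF.
Qed.

(** With y = l / 2, the bounds [y - sin y <= y^3 / 6] and [sin y >= y / 3] make the quotient at most
    [(y^4 / 3) / (4 y^4 / 9) = 3 / 4]. *)
Lemma sinc2_bound (l : R) : 0 < l <= pi -> `|sinc2 l| <= 3 / 4.
Proof.
move=> /andP[l0 lp]; rewrite /sinc2; pose y := l / 2; have p4 := pi_half2.
have ly : l = 2 * y by rewrite /y; field.
have y0 : 0 < y by rewrite divr_gt0.
have y2 : y <= 2 by rewrite /y; lra.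
have h1 := sin_ge_third (y := y); rewrite (ltW y0) y2 in h1; have {}h1 := h1 isT.
have h2 := sin_ge_cubic (ltW y0); have h3 := sin_le_id (ltW y0).
rewrite -/y ly; move: (sin y) h1 h2 h3 => t h1 h2 h3; clearbody y; clear l l0 lp ly.
have t0 : 0 < t by apply: lt_le_trans h1; rewrite divr_gt0.
have -> : ((2 * y) ^+ 2)^-1 - ((2 * t) ^+ 2)^-1 = - ((y - t) * (y + t) / (4 * (y ^+ 2 * t ^+ 2))).
  by field; rewrite !gt_eqF.
have d0 : 0 < 4 * (y ^+ 2 * t ^+ 2) by rewrite !mulr_gt0 ?exprn_gt0.
rewrite normrN ger0_norm; last by rewrite divr_ge0 ?(ltW d0)// mulr_ge0; lra.
rewrite ler_pdivrMr//.
have a1 : (y - t) * (y + t) <= y ^+ 3 / 6 * (2 * y).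
  by apply: ler_pM; lra.
have a2 : (y / 3) ^+ 2 <= t ^+ 2 by rewrite ler_pXn2r ?nnegrE ?(ltW t0)// divr_ge0// ltW.
have y2' : 0 < y ^+ 2 by rewrite exprn_gt0.
apply: le_trans a1 _; have -> : y ^+ 3 / 6 * (2 * y) = 3 * (y ^+ 2 * (y / 3) ^+ 2) by field.
by rewrite (_ : 3 / 4 * (4 * (y ^+ 2 * t ^+ 2)) = 3 * (y ^+ 2 * t ^+ 2)); [rewrite ler_pM2l// ler_pM2l|field].
Qed.

End SineBounds.

Section TailAlgebra.
Context {R : realType}.

Lemma pow_split (s l : R) : 1 < s -> s < 3 -> 0 < l -> l <= 4 ->
  [/\ 0 < l `^ (s - 2), l `^ (s - 1) = l * l `^ (s - 2), l `^ s = l * (l * l `^ (s - 2)) & l * (l * l `^ (s - 2)) <= 64].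
Proof.
move=> s1 s3 l0 l4; have rho0 : 0 < l `^ (s - 2) by exact: powR_gt0.
have e1 : l `^ (s - 1) = l * l `^ (s - 2).
  have -> : s - 1 = (s - 2) + 1 by ring.
  by rewrite powRD ?(gt_eqF l0) ?implybT// powRr1 ?(ltW l0)// mulrC.
have e2 : l `^ s = l * (l * l `^ (s - 2)).
  have -> : l `^ s = l `^ (s - 1 + 1) by congr (_ `^ _); ring.
  by rewrite powRD ?(gt_eqF l0) ?implybT// powRr1 ?(ltW l0)// mulrC e1.
split => //; rewrite -e2.
apply: (@le_trans _ _ (4 `^ s)); first by apply: ge0_ler_powR; rewrite ?nnegrE //; lra.
apply: (@le_trans _ _ (4 `^ 3%:R)); first by apply: ler_powR; lra.
have -> : 4 `^ 3%:R = 4 ^+ 3 :> R by apply: powR_mulrn.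
lra.
Qed.

(** The second derivative of [ln (1 + tailU)] in independent variables: rho stands for [l^(s - 2)],
    i for [1 / (1 + tailU)], and r, q, q2 for combinations of Hurwitz sums. The constants are 270 =
    6 + 72 + 192 and 14400 = 9 * 64 * 25. *)
Lemma tail_algebra (s l rho Z r q q2 i : R) : 1 < s -> s < 3 -> 0 < l -> l <= 4 -> 0 < rho -> l * (l * rho) <= 64 ->
  0 <= Z -> `|r| <= Z -> `|q| <= Z -> `|q2| <= Z -> 0 < i -> i <= 1 ->
  `|rho * (s * (s - 1) * r - 2 * s * s * l * q + s * (s + 1) * l * l * q2) * i - (s * (l * rho) * (r - l * q) * i) ^+ 2|
    <= (270 * Z + 14400 * Z ^+ 2) * rho.
Proof.
move=> s1 s3 l0 l4 rho0 ls Z0 R0 Q1 Q2 i0 i1.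
set X := _ - _ + _; set Y := s * (l * rho) * (r - l * q).
have bU2 : `|rho * X| <= 270 * Z * rho.
  rewrite normrM (ger0_norm (ltW rho0)) mulrC ler_pM2r//.
  apply: le_trans (ler_normD _ _) _; apply: (@le_trans _ _ ((6 * Z + 72 * Z) + 192 * Z)); last lra.
  have m3 (x y z w A : R) : 0 <= x <= A -> `|y| <= Z -> `|x * y| <= A * Z.
    by move=> /andP[x0 xA] yZ; rewrite normrM (ger0_norm x0); apply: ler_pM.
  apply: lerD; [apply: le_trans (ler_normB _ _) _; apply: lerD|].
  - by apply: (m3 _ _ 0 0) => //; apply/andP; split; nra.
  - apply: (m3 _ _ 0 0) => //; apply/andP; split; first by rewrite !mulr_ge0; lra.
    have h9 : s * s <= 9 by nra.
    by rewrite -[2 * s * s]mulrA; nra.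
  apply: (m3 _ _ 0 0) => //; apply/andP; split; first by rewrite !mulr_ge0//; lra.
  have h12 : s * (s + 1) <= 12 by nra.
  have h12' : 0 <= s * (s + 1) by nra.
  have h16 : l * l <= 16 by nra.
  by rewrite -mulrA; nra.
have bU1 : Y ^+ 2 <= 14400 * Z ^+ 2 * rho.
  have hq : `|r - l * q| <= 5 * Z.
    apply: le_trans (ler_normB _ _) _; apply: (@le_trans _ _ (Z + 4 * Z)); last lra.
    by apply: lerD => //; rewrite normrM (ger0_norm (ltW l0)); apply: ler_pM; rewrite // ltW.
  have hq2 : (r - l * q) ^+ 2 <= 25 * Z ^+ 2.
    rewrite -[leLHS]real_normK ?num_real//; have := normr_ge0 (r - l * q); nra.
  have -> : Y ^+ 2 = s ^+ 2 * (l * (l * rho)) * rho * (r - l * q) ^+ 2 by rewrite /Y; ring.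
  have hs9 : 0 <= s ^+ 2 <= 9 by apply/andP; split; nra.
  have /andP[hs90 hs91] := hs9.
  have w0 : 0 <= l * (l * rho) by rewrite !mulr_ge0// ltW.
  have ww : s ^+ 2 * (l * (l * rho)) <= 9 * 64 by apply: ler_pM.
  have ww0 : 0 <= s ^+ 2 * (l * (l * rho)) by exact: mulr_ge0.
  have -> : 14400 * Z ^+ 2 * rho = 9 * 64 * rho * (25 * Z ^+ 2) by ring.
  apply: ler_pM; [by apply: mulr_ge0 => //; exact: ltW|exact: sqr_ge0|by rewrite ler_pM2r|exact: hq2].
rewrite mulrDl; apply: le_trans (ler_normB _ _) _; apply: lerD.
  by rewrite normrM (ger0_norm (ltW i0)) -[leRHS]mulr1; apply: ler_pM => //; exact: ltW.
have i2 : i ^+ 2 <= 1 by apply: exprn_ile1 => //; exact: ltW.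
have -> : (Y * i) ^+ 2 = Y ^+ 2 * i ^+ 2 by exact: exprMn.
rewrite ger0_norm; last by apply: mulr_ge0; exact: sqr_ge0.
by rewrite -[leRHS]mulr1; apply: ler_pM => //; exact: sqr_ge0.
Qed.

Lemma norm_pair (x y a b c : R) : 0 <= x -> x <= a -> 0 <= y -> y <= a -> 0 <= b -> 0 <= c ->
  [/\ `|x + y| <= 2 * (a + b + c), `|x + y| <= 2 * (b + c + a) & `|x - y| <= 2 * (b + a + c)].
Proof. by move=> *; rewrite !ler_norml; split; apply/andP; split; lra. Qed.

End TailAlgebra.

Section SingularPart.
Context {R : realType}.
Variable s : R.
Hypothesis s1 : 1 < s.
Hypothesis s3 : s < 3.

Let r0 (l : R) := hz s l + hz s (- l).
Let q1 (l : R) := hz (s + 1) l - hz (s + 1) (- l).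
Let q2 (l : R) := hz (s + 2) l + hz (s + 2) (- l).
(** The terms k <> 0 of the lattice sum relative to the term k = 0, which is [l^(-s)]. It is O(l^s)
    at 0, and its second derivative O(l^(s - 2)); for fractional noise [s - 2] is [2 d]. *)
Definition tailU (l : R) : R := l `^ s * (hz s l + hz s (- l)).
Definition tailU1 (l : R) : R := s * (l `^ (s - 1) * (hz s l + hz s (- l))) - s * (l `^ s * (hz (s + 1) l - hz (s + 1) (- l))).
Definition tailU2 (l : R) : R :=
  s * ((s - 1) * (l `^ (s - 2) * (hz s l + hz s (- l)))) - 2 * (s * (s * (l `^ (s - 1) * (hz (s + 1) l - hz (s + 1) (- l)))))
  + s * ((s + 1) * (l `^ s * (hz (s + 2) l + hz (s + 2) (- l)))).

Lemma dneg (f : R -> R) (x a : R) : is_derive (- x) 1 f a -> is_derive x 1 (fun t => f (- t)) (- a).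
Proof.
move=> h; have := dcomp (f := f) (g := fun t => - t) h (dN (did x)).
by rewrite mulrN1.
Qed.

Let dom (l : R) := 0 < l < 3 * pi / 2.
Let domN l : dom l -> `|l| < 3 * pi / 2 /\ `|- l| < 3 * pi / 2.
Proof. by move=> /andP[l0 l1]; rewrite normrN ger0_norm ?ltW. Qed.

Let dhz (p l : R) : 1 < p -> dom l -> is_derive l 1 (hz p) (- p * hz (p + 1) l) /\
  is_derive l 1 (fun l => hz p (- l)) (p * hz (p + 1) (- l)).
Proof.
move=> p1 /domN[h1 h2]; split; first exact: hz_derive.
by have := dneg (hz_derive p1 h2); rewrite mulNr opprK.
Qed.

Lemma dtailU l : dom l -> is_derive l 1 tailU (tailU1 l).
Proof.
move=> hl; have [h1 h2] := dhz s1 hl; have /andP[l0 _] := hl.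
apply: (d_ext (dM (dpow s l0) (dD h1 h2))) => //; rewrite /tailU1.
move: (l `^ s) (l `^ (s - 1)) (hz s l) (hz s (- l)) (hz (s + 1) l) (hz (s + 1) (- l)) => *; ring.
Qed.

Lemma dtailU1 l : dom l -> is_derive l 1 tailU1 (tailU2 l).
Proof.
move=> hl; have [h1 h2] := dhz s1 hl; have /andP[l0 _] := hl.
have s2 : 1 < s + 1 by move: (s1); lra.
have [h3 h4] := dhz s2 hl.
apply: (d_ext (dB (dZ s (dM (dpow (s - 1) l0) (dD h1 h2))) (dZ s (dM (dpow s l0) (dB h3 h4))))) => //.
rewrite (_ : s - 1 - 1 = s - 2); last by ring.
rewrite (_ : s + 1 + 1 = s + 2); last by ring.
rewrite /tailU2.
move: (l `^ s) (l `^ (s - 1)) (l `^ (s - 2)) (hz s l) (hz s (- l)) (hz (s + 1) l) (hz (s + 1) (- l)) (hz (s + 2) l) (hz (s + 2) (- l)) => *; ring.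
Qed.

Definition log_tail1 (l : R) := tailU1 l / (1 + tailU l).
Definition log_tail2 (l : R) := tailU2 l / (1 + tailU l) - log_tail1 l ^+ 2.

Lemma tailU_ge0 l : dom l -> 0 <= tailU l.
Proof.
by move=> /domN[/ltW h1 /ltW h2]; rewrite mulr_ge0 ?powR_ge0// addr_ge0// hz_ge0.
Qed.

Lemma dlog_tail l : dom l -> is_derive l 1 (fun l => ln (1 + tailU l)) (log_tail1 l).
Proof.
move=> hl; have u0 : 0 < 1 + tailU l by rewrite ltr_pwDl// tailU_ge0.
have h : is_derive l 1 (fun l => 1 + tailU l) (tailU1 l).
  by apply: (d_ext (dD (dcst l 1) (dtailU hl))) => //; rewrite add0r.
exact: (@dln R (fun l => 1 + tailU l) l _ u0 h).
Qed.

Lemma dlog_tail1 l : dom l -> is_derive l 1 log_tail1 (log_tail2 l).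
Proof.
move=> hl; have u0 : 0 < 1 + tailU l by rewrite ltr_pwDl// tailU_ge0.
have h : is_derive l 1 (fun l => 1 + tailU l) (tailU1 l).
  by apply: (d_ext (dD (dcst l 1) (dtailU hl))) => //; rewrite add0r.
have h2 := @dV R (fun l => 1 + tailU l) l _ (lt0r_neq0 u0) h.
by apply: (d_ext (dM (dtailU1 hl) h2)) => //; rewrite /log_tail2 /log_tail1; field; exact: lt0r_neq0.
Qed.

Lemma tailU2_cont l : dom l -> {for l, continuous tailU2}.
Proof.
move=> hl; have /andP[l0 _] := hl.
have s2 : 1 < s + 1 by move: (s1); lra.
have s4 : 1 < s + 2 by move: (s1); lra.
have [h1 h2] := dhz s1 hl; have [h3 h4] := dhz s2 hl; have [h5 h6] := dhz s4 hl.
have a1 := dZ s (dZ (s - 1) (dM (dpow (s - 2) l0) (dD h1 h2))).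
have a2 := dZ 2 (dZ s (dZ s (dM (dpow (s - 1) l0) (dB h3 h4)))).
have a3 := dZ s (dZ (s + 1) (dM (dpow s l0) (dD h5 h6))).
exact: d_cont (dD (dB a1 a2) a3).
Qed.

Lemma log_tail2_cont l : dom l -> {for l, continuous log_tail2}.
Proof.
move=> hl; have u0 : 0 < 1 + tailU l by rewrite ltr_pwDl// tailU_ge0.
have cU : {for l, continuous (fun l => 1 + tailU l)}.
  by apply: cvgD; [exact: cvg_cst|exact: (d_cont (dtailU hl))].
have c1 : {for l, continuous (fun l => (1 + tailU l)^-1)}.
  by apply: cvgV; [exact: lt0r_neq0|exact: cU].
have c2 := d_cont (dlog_tail1 hl).
apply: cvgB; first by apply: cvgM; [exact: tailU2_cont|exact: c1].
by rewrite expr2; under eq_fun do rewrite expr2; apply: cvgM.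
Qed.

Lemma log_tail2_bound : exists2 K : R, 0 <= K & forall l, 0 < l <= pi -> `|log_tail2 l| <= K * l `^ (s - 2).
Proof.
have hs1 := s1; have hs3 := s3; have p2 := @pi_ge2 R; have p4 := @pi_half2 R.
pose Z := 2 * (rsum (zterm s) + rsum (zterm (s + 1)) + rsum (zterm (s + 2)) : R).
have z0 p : 0 <= rsum (zterm (p : R)) by apply: rsum_ge0 => k; exact: zterm_ge0.
have Z0 : 0 <= Z by apply: mulr_ge0 => //; apply: addr_ge0; [apply: addr_ge0|]; exact: z0.
exists (270 * Z + 14400 * Z ^+ 2); first by have := sqr_ge0 Z; lra.
move=> l /andP[l0 lp]; have hl : dom l by apply/andP; split => //; lra.
have [/ltW n1 /ltW n2] := domN hl.
have l4 : l <= 4 by lra.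
have B p : 1 < p -> 0 <= hz p l <= rsum (zterm p) /\ 0 <= hz p (- l) <= rsum (zterm p).
  by move=> p1; rewrite !hz_ge0// !hz_le.
have s2 : 1 < s + 1 by lra.
have s4 : 1 < s + 2 by lra.
have [/andP[a1 a2] /andP[a3 a4]] := B s s1; have [/andP[b1 b2] /andP[b3 b4]] := B (s + 1) s2; have [/andP[c1 c2] /andP[c3 c4]] := B (s + 2) s4.
have zs := z0 s; have zs1 := z0 (s + 1); have zs2 := z0 (s + 2).
have [R0 _ _] := norm_pair a1 a2 a3 a4 zs1 zs2.
have [_ _ Q1] := norm_pair b1 b2 b3 b4 zs zs2.
have [_ Q2 _] := norm_pair c1 c2 c3 c4 zs zs1.
rewrite -/Z -/(r0 l) in R0; rewrite -/Z -/(q1 l) in Q1; rewrite -/Z -/(q2 l) in Q2.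
have r00 : 0 <= r0 l by exact: addr_ge0 a1 a3.
have [rho0 e1 e2 ls] := pow_split hs1 hs3 l0 l4; move: rho0 e1 e2 ls; have [rho e0] : exists rho, l `^ (s - 2) = rho by exists (l `^ (s - 2)).
rewrite e0 => rho0 e1 e2 ls.
have EU : tailU l = l * (l * rho) * r0 l by rewrite /tailU e2.
have EU1 : tailU1 l = s * (l * rho) * (r0 l - l * q1 l) by rewrite /tailU1 e1 e2 -/(r0 l) -/(q1 l); move: (r0 l) (q1 l) => u v; clear; ring.
have EU2 : tailU2 l = rho * (s * (s - 1) * r0 l - 2 * s * s * l * q1 l + s * (s + 1) * l * l * q2 l).
  by rewrite /tailU2 e0 e1 e2 -/(r0 l) -/(q1 l) -/(q2 l); move: (r0 l) (q1 l) (q2 l) => u v w; clear; ring.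
have U0 := tailU_ge0 hl.
have inv1 : 0 < (1 + tailU l)^-1 <= 1.
  by rewrite invr_gt0 ltr_pwDl//= invf_le1 ?ltr_pwDl// lerDl.
have /andP[i0 i1] := inv1.
rewrite /log_tail2 /log_tail1 EU1 EU2.
exact: tail_algebra.
Qed.

End SingularPart.

Section ComplexModulus.
Context {R : realType}.

Lemma cmod_sqr (z : R[i]) : cmod z ^+ 2 = complex.Re z ^+ 2 + complex.Im z ^+ 2.
Proof. by case: z => a b; rewrite /cmod /= sqr_sqrtr// addr_ge0 ?sqr_ge0. Qed.

Lemma cmodE (z : R[i]) : `|z| = (cmod z)%:C%C.
Proof. by case: z => a b; rewrite /cmod. Qed.

Lemma cmodM (z w : R[i]) : cmod (z * w) = cmod z * cmod w.
Proof. by apply: (@complexI R); rewrite -cmodE normrM !cmodE rmorphM. Qed.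

Lemma cmodV (z : R[i]) : cmod z^-1 = (cmod z)^-1.
Proof. by apply: (@complexI R); rewrite -cmodE normfV cmodE fmorphV. Qed.

Lemma cmod_ge0 (z : R[i]) : 0 <= cmod z.
Proof. by case: z => a b; exact: sqrtr_ge0. Qed.

Lemma cmod_gt0 (z : R[i]) : (0 < cmod z) = (z != 0).
Proof. by rewrite -(@ltcR R) -cmodE normr_gt0. Qed.

Lemma cmod_expi (l : R) : cmod (1 - expi l) ^+ 2 = wsing l.
Proof. by rewrite cmod_sqr /= /wsing sub0r sqrrN; have := cos2Dsin2 l; set a := cos l; set b := sin l => h; nra. Qed.

End ComplexModulus.

Section GammaPositive.
Context {R : realType}.
Local Notation mu := (@lebesgue_measure R).

Let g (x t : R) := t `^ (x - 1) * expR (- t).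

Let g_ge0 x t : 0 <= g x t.
Proof. by rewrite mulr_ge0 ?powR_ge0 ?expR_ge0. Qed.

Let g_meas x (A : set (measurableTypeR R)) : measurable_fun A (g x).
Proof.
apply: measurable_funTS; apply: measurable_funM.
  exact: measurable_powR.
by apply: measurableT_comp => //; exact: measurableT_comp.
Qed.

Let g_le x t : 1 < x -> x < 3 -> 0 < t -> g x t <= 32 * exponential_pdf (1 / 2) t.
Proof.
move=> x1 x3 t0; rewrite exponential_pdfE ?(ltW t0)// /g.
have a1 : t `^ (x - 1) <= 1 + t ^+ 2.
  have [t1|t1] := leP t 1.
    apply: (@le_trans _ _ (1 `^ (x - 1))); first by apply: ge0_ler_powR; rewrite ?nnegrE//; lra.
    by rewrite powR1 lerDl sqr_ge0.
  apply: (@le_trans _ _ (t `^ 2%:R)); first by apply: ler_powR; lra.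
  by rewrite powR_mulrn ?(ltW t0)// lerDr.
have a2 : 1 + t ^+ 2 <= 16 * expR (t / 2).
  have -> : t / 2 = t / 4 + t / 4 by field.
  rewrite expRD; have := @expR_ge1Dx R (t / 4); move: (expR (t / 4)) => E h; nra.
have -> : 32 * (1 / 2 * expR (- (1 / 2) * t)) = 16 * expR (t / 2) * expR (- t).
  rewrite -(mulrA 16) -expRD; have -> : t / 2 + - t = - (1 / 2) * t by field.
  by move: (expR _) => E; field.
by rewrite ler_pM2r ?expR_gt0//; exact: le_trans a2.
Qed.

Local Notation I0 := (`]0%R, +oo[%classic : set (measurableTypeR R)).
Local Notation I1 := (`[1%R, 2%R]%classic : set (measurableTypeR R)).

(** [Gamma] is the [fine] of an extended integral, which would turn an infinite value into 0, so
    finiteness has to be shown too; the majorant is a multiple of an exponential density. Positivity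
    comes from the interval [1, 2]. *)
Lemma Gamma_gt0 (x : R) : 1 < x -> x < 3 -> 0 < Gamma x.
Proof.
move=> x1 x3; rewrite /Gamma /Rintegral -/(g x).
have mp (A : set (measurableTypeR R)) : measurable_fun A (fun t : R => 32 * exponential_pdf (1 / 2) t).
  apply: measurable_funTS; apply: measurable_funM => //.
  exact: measurable_exponential_pdf.
have up : (\int[mu]_(t in I0) (g x t)%:E < +oo)%E.
  have h : mu.-integrable setT (EFin \o (fun t : R => 32 * exponential_pdf (1 / 2) t)).
    by apply: integrable_scale => //; apply: integrable_exponential_pdf.
  apply: (@le_lt_trans _ _ (\int[mu]_(t in I0) (32 * exponential_pdf (1 / 2) t)%:E)%E).
    apply: ge0_le_integral => //.
    - by move=> t _; rewrite lee_fin.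
    - apply/measurable_EFinP. apply: g_meas.
    - by apply/measurable_EFinP; apply: mp.
    by move=> t; rewrite /= in_itv/= andbT => t0; rewrite lee_fin g_le.
  apply: (@le_lt_trans _ _ (\int[mu]_t (32 * exponential_pdf (1 / 2) t)%:E)%E).
    apply: ge0_subset_integral => //; first by have /integrableP[] := h.
    by move=> t _; rewrite lee_fin mulr_ge0// exponential_pdf_ge0.
  have /integrableP[_] := h; suff -> : (\int[mu]_t (32 * exponential_pdf (1 / 2) t)%:E =
    \int[mu]_t `|(EFin \o (fun t : R => 32 * exponential_pdf (1 / 2) t)%R) t|)%E by [].
  by apply: eq_integral => t _; rewrite /= ger0_norm// mulr_ge0// exponential_pdf_ge0.
have low : ((expR (- 2))%:E <= \int[mu]_(t in I0) (g x t)%:E)%E.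
  apply: (@le_trans _ _ (\int[mu]_(t in I1) (expR (- 2) : R)%:E)%E).
    rewrite integral_cst//= lebesgue_measure_itv/= lte_fin ifT; last lra.
    by rewrite -EFinD -EFinM lee_fin; have := expR_ge0 (- 2 : R); lra.
  apply: (@le_trans _ _ (\int[mu]_(t in I1) (g x t)%:E)%E).
    apply: ge0_le_integral => //.
    - apply/measurable_EFinP. apply: g_meas.
    move=> t; rewrite /= in_itv/= => /andP[t1 t2]; rewrite lee_fin /g.
    apply: (@le_trans _ _ (expR (- t))); first by rewrite ler_expR lerN2.
    rewrite ler_peMl ?expR_ge0//; apply: (@le_trans _ _ (1 `^ (x - 1))); first by rewrite powR1.
    by apply: ge0_ler_powR; rewrite ?nnegrE//; lra.
  apply: ge0_subset_integral => //; first by apply/measurable_EFinP; apply: g_meas.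
    by move=> t _; rewrite lee_fin.
  by move=> t; rewrite /= !in_itv/= andbT => /andP[t1 _]; exact: lt_le_trans t1.
apply: fine_gt0; apply/andP; split; last exact: up.
by apply: lt_le_trans low; rewrite lte_fin expR_gt0.
Qed.

End GammaPositive.

Section Lattice.
Context {R : realType}.

Lemma rsum_cvg (f : nat -> R) : (forall k, 0 <= f k) -> summ f ->
  (fun N => \sum_(k < N) f k) @ \oo --> rsum f.
Proof.
move=> f0 sf; set u := (fun N : nat => _).
have nd : nondecreasing_seq u.
  by apply/nondecreasing_seqP => n; rewrite /u big_ord_recr/= lerDl.
have cu : cvgn u by apply: nondecreasing_is_cvgn => //; exists (rsum f) => _ [N _ <-]; exact: sum_le_rsum.
suff -> : rsum f = limn u by [].
apply/eqP; rewrite eq_le; apply/andP; split; last first.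
  by apply: limr_le => //; apply: nearW => N; exact: sum_le_rsum.
by apply: (rsum_le_bound f0 _).2 => N; exact: (nondecreasing_cvgn_le nd cu N).
Qed.

Variables (s l : R).
Hypothesis s1 : 1 < s.
Hypothesis l0 : 0 < l.
Hypothesis lb : l <= 3 * pi / 2.

Let lf (k : int) : R := `|l + 2 * pi * k%:~R| `^ (- s).

Let lf_pos (k : nat) : lf (Posz k.+1) = (2 * pi * k.+1%:R + l) `^ (- s).
Proof.
rewrite /lf ger0_norm; first by rewrite addrC.
by apply: addr_ge0; [exact: ltW|rewrite !mulr_ge0// pi_ge0].
Qed.

Let lf_neg (k : nat) : lf (Negz k) = (2 * pi * k.+1%:R + - l) `^ (- s).
Proof.
have h : k.+1%:R <= 2 * pi * k.+1%:R + - l by apply: hz_base; rewrite normrN ger0_norm// ltW.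
by rewrite /lf NegzE mulrNz mulrN distrC ger0_norm//; apply: le_trans h.
Qed.

Let lb1 : `|l| <= 3 * pi / 2. Proof. by rewrite ger0_norm// ltW. Qed.
Let lb2 : `|- l| <= 3 * pi / 2. Proof. by rewrite normrN. Qed.

Let lf_trunc (N : nat) : itrunc N.+1 lf = l `^ (- s) + \sum_(k < N) (2 * pi * k.+1%:R + l) `^ (- s) +
  \sum_(k < N.+1) (2 * pi * k.+1%:R + - l) `^ (- s).
Proof.
rewrite /itrunc big_split/=; congr (_ + _); last by apply: eq_bigr => k _; exact: lf_neg.
rewrite big_ord_recl; congr (_ + _); last by apply: eq_bigr => k _; rewrite -lf_pos.
by rewrite /lf mulr0 addr0 gtr0_norm.
Qed.

(** The positive k give [hz s l], the negative ones [hz s (- l)]. *)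
Lemma lattice_sum : fine (\esum_(k in [set: int]) (`|l + 2 * pi * k%:~R| `^ (- s))%:E) =
  l `^ (- s) + (hz s l + hz s (- l)).
Proof.
have g1 := hz_summ s1 lb1; have g2 := hz_summ s1 lb2.
have p1 k : 0 <= (2 * pi * k.+1%:R + l) `^ (- s) by exact: powR_ge0.
have p2 k : 0 <= (2 * pi * k.+1%:R + - l) `^ (- s) by exact: powR_ge0.
have sf : summ lf.
  apply: (@summ_itrunc R _ (l `^ (- s) + hz s l + hz s (- l)) _).1 => N.
  have -> : (fun k => `|lf k|) = lf by apply/funext => k; rewrite ger0_norm// powR_ge0.
  apply: (@le_trans _ _ (itrunc N.+1 lf)).
    by rewrite /itrunc big_ord_recr/= lerDl addr_ge0// powR_ge0.
  rewrite lf_trunc; apply: lerD; first apply: lerD => //.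
    exact: (sum_le_rsum _ g1 p1).
  exact: (sum_le_rsum _ g2 p2).
have -> : fine (\esum_(k in [set: int]) (`|l + 2 * pi * k%:~R| `^ (- s))%:E) = rsum lf.
  by rewrite rsum_ge0E// => k; exact: powR_ge0.
have h1 := itrunc_cvg sf.
have h2 : (fun N => itrunc N.+1 lf) @ \oo --> l `^ (- s) + hz s l + hz s (- l).
  under eq_fun do rewrite lf_trunc.
  apply: cvgD; first by apply: cvgD; [exact: cvg_cst|exact: rsum_cvg].
  by have := rsum_cvg p2 g2; rewrite -cvg_shiftS; exact.
rewrite addrA; apply: (cvg_unique _ _ h2) => //.
by have := h1; rewrite -cvg_shiftS; exact.
Qed.

End Lattice.

(** * The mean of the logarithmic singularity *)

Section LogSingularity.
Context {R : realType}.
Local Notation mu := (@lebesgue_measure R).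
Local Notation D := [set` `](- (pi : R)), (pi : R)]%R].

Lemma limn_einf_ge (u : nat -> \bar R) (c : \bar R) : (forall n, (c <= u n)%E) -> (c <= limn_einf u)%E.
Proof.
move=> h; rewrite limn_einf_lim; apply: lime_ge; first exact: is_cvg_einfs.
by apply: nearW => n; apply: le_ereal_inf_tmp => _ [m _ <-].
Qed.

Lemma measurable_limn_einf (disp : measure_display) (T : measurableType disp) (A : set T) (f : nat -> T -> \bar R) :
  (forall n, measurable_fun A (f n)) -> measurable_fun A (fun x => limn_einf (f ^~ x)).
Proof.
move=> mf; rewrite /limn_einf.
have mo := oppe_measurable (D := [set: \bar R]).
apply: (measurableT_comp mo); apply: (measurable_fun_limn_esup (f := fun n x => (- f n x)%E)) => n.
exact: (measurableT_comp mo).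
Qed.

Lemma measurable_ln_wpoly (r : R) : measurable_fun D (fun l => ln (wpoly r l)).
Proof.
apply: (@measurableT_comp _ _ _ _ _ _ (@ln R)); first exact: measurable_ln.
apply: measurable_funTS; apply: continuous_measurable_fun => l; rewrite /wpoly.
apply: cvgD; last exact: cvg_cst.
apply: cvgB; first exact: cvg_cst.
by apply: cvgM; [exact: cvg_cst|exact: continuous_cos].
Qed.

Lemma wpoly_rseq_cvg (l : R) : (fun n => wpoly (rseq n) l) @ \oo --> wsing l.
Proof.
have -> : wsing l = 1 - 2 * 1 * cos l + 1 ^+ 2 by rewrite /wsing; ring.
rewrite /wpoly; have c := @rseq_cvg R; apply: cvgD; last by apply: cvgM.
apply: cvgB; first exact: cvg_cst.
by apply: cvgM; [apply: cvgM => //; exact: cvg_cst|exact: cvg_cst].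
Qed.

(** [ln (wpoly r)] is the real part of the transform of [lpure] with parameter -2, whose constant
    coefficient is 0. *)
Lemma circle_ln_wpoly (r : R) : 0 <= r -> r < 1 ->
  mu.-integrable D (EFin \o (fun l => ln (wpoly r l))) /\ Rintegral mu D (fun l => ln (wpoly r l)) = 0.
Proof.
move=> r0 r1; have E : (fun l => ln (wpoly r l)) = (fun l => wcos (lpure (- 2) r0 r1) l * cos (0%:~R * l)).
  by apply/funext => l; rewrite mul0r cos0 mulr1 wcos_lpure -[LHS]mul1r; congr (_ * _); field.
rewrite E circle_wcos !lpureE/= addr0 mulr0; split => //.
exact: wcos_cos_integrable.
Qed.

Lemma wpoly_le4 (r l : R) : 0 <= r -> r < 1 -> wpoly r l <= 4.
Proof.
move=> r0 r1; have := cos_geN1 l; rewrite /wpoly; move: (cos l) => c; nra.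
Qed.

(** Without an integrable majorant at hand, Fatou's lemma is applied to the nonnegative functions
    [ln 4 - ln (wpoly r)], whose integrals are all equal by [circle_ln_wpoly]. The result then
    supplies the majorant for [circle_ln_wsing]. *)
Lemma ln_wsing_integrable : mu.-integrable D (EFin \o (fun l => ln (wsing l))).
Proof.
have mw : measurable_fun D (fun l => ln (wsing l)).
  rewrite (_ : (fun l => _) = fun l => ln (wpoly 1 l)); first exact: measurable_ln_wpoly.
  by apply/funext => l; rewrite wsing_wpoly.
pose h n (l : R) := ln 4 - ln (wpoly (rseq n) l).
pose h0 (l : R) := ln 4 - ln (wsing l).
have w4 (l : R) : wsing l <= 4 by have := cos_geN1 l; rewrite /wsing; lra.
have l4 : 0 <= ln (4 : R) by apply: ln_ge0; lra.
have hn0 n l : 0 <= h n l.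
  by rewrite subr_ge0 ler_ln ?posrE ?wpoly_le4 ?wpoly_gt0 ?rseq0 ?rseq1.
have mh n : measurable_fun D (h n).
  by apply: measurable_funB => //; exact: measurable_ln_wpoly.
have mh0 : measurable_fun D h0 by apply: measurable_funB.
have h00 l : 0 <= h0 l.
  rewrite subr_ge0; have [w0|w0] := ltP 0 (wsing l); first by rewrite ler_ln ?posrE.
  by rewrite ln0.
have ih n : (\int[mu]_(l in D) (h n l)%:E = (ln 4 * (2 * pi))%:E)%E.
  have [i1 e1] := circle_ln_wpoly (rseq0 n) (rseq1 n).
  have ihn : mu.-integrable D (EFin \o h n) by apply: integrable_sub => //; exact: circle_cst_int.
  rewrite -(fineK (integrable_fin_num _ ihn))//; congr EFin.
  transitivity (Rintegral mu D (h n)) => //.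
  rewrite circleB//; last exact: circle_cst_int.
  by rewrite e1 subr0 circle_cst.
have fat := @fatou _ _ R mu D (@mD R) (fun n => EFin \o h n).
have {fat}fat : (\int[mu]_(l in D) (h0 l)%:E <= (ln 4 * (2 * pi))%:E)%E.
  have L : (\int[mu]_(l in D) (h0 l)%:E <= \int[mu]_(l in D) limn_einf (fun n => (h n l)%:E))%E.
    apply: ge0_le_integral => //.
    - by move=> l _; rewrite lee_fin.
    - exact/measurable_EFinP.
    - apply: (measurable_limn_einf (f := fun n => EFin \o h n)) => n.
      by apply/measurable_EFinP; exact: mh.
    (* At 0 there is no convergence to [h0 0], as [ln 0] is 0 by convention, but the inequality
       still holds. *)
    move=> l Dl; have [->|l0] := eqVneq l 0.
      apply: limn_einf_ge => n; have w00 : ln (wsing 0) = 0 :> R by rewrite ln0// /wsing cos0; lra.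
      rewrite lee_fin lerD2l lerN2 w00 wpoly_wsing /wsing cos0 mulr1 subrr mulr0 addr0 ln_le0//.
      by have := @rseq0 R n; have := @rseq1 R n; move: (rseq n) => r; nra.
    have c : (fun n => (h n l)%:E) @ \oo --> (h0 l)%:E.
      apply: cvg_EFin; first by near=> n.
      apply: cvgB; first exact: cvg_cst.
      apply: continuous_cvg; first by apply: continuous_ln; exact: wsing_gt0.
      exact: wpoly_rseq_cvg.
    rewrite is_cvg_limn_einfE; last by apply/cvg_ex; exists (h0 l)%:E.
    by rewrite (cvg_lim _ c).
  apply: le_trans L _; apply: le_trans (fat _ _) _.
  - by move=> n; apply/measurable_EFinP; exact: mh.
  - by move=> n l _; rewrite lee_fin.
  rewrite (_ : (fun n => _) = (fun=> (ln 4 * (2 * pi))%:E)); last by apply/funext => n; exact: ih.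
  by rewrite is_cvg_limn_einfE; [rewrite lim_cst|exact: is_cvg_cst].
have i0 : mu.-integrable D (EFin \o h0).
  apply/integrableP; split; first exact/measurable_EFinP.
  apply: le_lt_trans (ltry (ln 4 * (2 * pi))); apply: le_trans fat.
  rewrite le_eqVlt; apply/orP; left; apply/eqP; apply: eq_integral => l _.
  by rewrite /= ger0_norm.
have := integrable_sub (@mD R) (circle_cst_int (ln 4)) i0.
rewrite (_ : (fun x => _) = (fun l => ln (wsing l)))//.
by apply/funext => l; rewrite /h0 opprB addrC subrK.
Unshelve. all: by end_near. Qed.

Lemma circle_ln_wsing : Rintegral mu D (fun l => ln (wsing l)) = 0.
Proof.
have [|||||_] := @circle_dct R (fun n l => ln (wpoly (rseq n) l)) (fun l => ln (wsing l))
  (fun l => `|ln (wsing l)| + 2 * ln 4).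
- by move=> n; exact: measurable_ln_wpoly.
- by have := ln_wsing_integrable => /integrableP[/measurable_EFinP].
- apply: integrable_add => //; last exact: circle_cst_int.
  exact: (integrable_norm ln_wsing_integrable).
- move=> l Dl l0; apply: continuous_cvg; first by apply: continuous_ln; exact: wsing_gt0.
  exact: wpoly_rseq_cvg.
- move=> n l Dl l0; have w0 := wsing_gt0 Dl l0; set r := rseq n.
  have r0 : 0 <= r := rseq0 n; have r1 : r < 1 := rseq1 n; have rh : 1 / 2 <= r := rseq_half n.
  have p0 := wpoly_gt0 l r0 r1; have p4 := wpoly_le4 l r0 r1.
  have l2 : 0 <= ln (2 : R) by apply: ln_ge0; lra.
  have l4 : ln (4 : R) = ln 2 + ln 2 by rewrite -lnM ?posrE//; congr ln; lra.
  have u1 : ln (wpoly r l) <= ln 4 by rewrite ler_ln ?posrE.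
  have u2 : ln (wsing l / 2) <= ln (wpoly r l).
    by rewrite ler_ln ?posrE ?divr_gt0// wpoly_wsing; have := sqr_ge0 (1 - r); nra.
  rewrite ln_div ?posrE// in u2.
  have n1 := ler_norm (ln (wsing l)); have n2 := ler_norm (- ln (wsing l)); rewrite normrN in n2.
  have n3 := normr_ge0 (ln (wsing l)).
  rewrite ler_norml; apply/andP; split; lra.
move=> h; apply: (cvg_unique _ h) => //.
rewrite (_ : (fun n => _) = (fun=> 0)); first exact: cvg_cst.
by apply/funext => n; have [_] := circle_ln_wpoly (rseq0 n) (rseq1 n).
Qed.

End LogSingularity.

(** * The logarithm of the noise density *)

Section FgnSpectrum.
Context {R : realType}.
Local Notation mu := (@lebesgue_measure R).
Local Notation D := [set` `](- (pi : R)), (pi : R)]%R].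
Local Notation W := (wiener R).
Variable d : R.
Hypothesis hd : - (1 / 2) < d < 1 / 2.

Let s : R := 2 * d + 2.
Let s1 : 1 < s. Proof. by have /andP[h _] := hd; rewrite /s; lra. Qed.
Let s3 : s < 3. Proof. by have /andP[_ h] := hd; rewrite /s; lra. Qed.
Let c0 : R := (2 * pi)^-1 * Gamma (2 * d + 2) * cos (pi * d).

Lemma fgn_const_gt0 : 0 < c0.
Proof.
have p0 := pi_gt0 R; have /andP[h1 h2] := hd.
apply: mulr_gt0; first by apply: mulr_gt0; [rewrite invr_gt0 mulr_gt0|exact: Gamma_gt0].
by apply: cos_gt0_pihalf; apply/andP; split; nra.
Qed.

Lemma fgn_densityE l : 0 < l <= 3 * pi / 2 ->
  fgn_density d l = c0 * wsing l * (l `^ (- s) * (1 + tailU s l)).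
Proof.
move=> /andP[l0 lb]; rewrite /fgn_density cmod_expi -/c0; congr (_ * _).
have -> : - 2 * d - 2 = - s by rewrite /s; ring.
rewrite (lattice_sum s1 l0 lb) mulrDr mulr1 /tailU mulrA; congr (_ + _).
by rewrite -powRD ?(gt_eqF l0) ?implybT// addNr powRr0 mul1r.
Qed.

Lemma fgn_densityN l : fgn_density d (- l) = fgn_density d l.
Proof.
rewrite /fgn_density !cmod_expi /wsing cosN; congr (_ * fine _).
rewrite (reindex_esum setT setT (@GRing.opp int)).
  by apply: eq_esum => k _; rewrite mulrNz mulrN -opprD normrN.
by split.
Qed.

Lemma fgn_density0 : fgn_density d 0 = 0.
Proof. by rewrite /fgn_density cmod_expi /wsing cos0 mulr1 subrr mulr0 mul0r. Qed.

Definition fgn_log (l : R) : R := ln (fgn_density d l) + d * ln (wsing l).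

(** The exponents match: [wsing l] is [(2 sin (l / 2))^2] and occurs with exponent [1 + d], while
    [2 (1 + d)] is the exponent s of [l^(-s)]; the two combine into the function differentiated in
    [dsinc]. *)
Lemma fgn_logE l : 0 < l < 3 * pi / 2 ->
  fgn_log l = ln c0 + (s * (ln (2 * sin (l / 2)) - ln l) + ln (1 + tailU s l)).
Proof.
move=> /andP[l0 lb]; have p0 := pi_gt0 R.
have h0 : 0 < 2 * sin (l / 2) by apply: half_sin_gt0; apply/andP; split => //; lra.
have u0 : 0 < 1 + tailU s l by rewrite ltr_pwDl// tailU_ge0//; apply/andP; split => //; lra.
have L0 : 0 < l `^ (- s) by exact: powR_gt0.
rewrite /fgn_log fgn_densityE ?l0 ?(ltW lb)// wsing_half.
move: h0; set t := 2 * sin (l / 2) => h0; have t2 : 0 < t ^+ 2 by rewrite exprn_gt0.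
have c00 := fgn_const_gt0.
have e1 : ln (c0 * t ^+ 2 * (l `^ (- s) * (1 + tailU s l))) =
  ln c0 + ln (t ^+ 2) + (ln (l `^ (- s)) + ln (1 + tailU s l)).
  by rewrite lnM ?posrE ?(mulr_gt0 c00 t2) ?(mulr_gt0 L0 u0)// lnM ?posrE// lnM ?posrE.
rewrite e1 ln_powR lnXn// /s mulr2n.
move: (ln _) (ln t) (ln l) (ln (1 + _)) => a b c e; ring.
Qed.

Lemma fgn_smooth : piecewise_smooth fgn_log.
Proof.
have p0 := pi_gt0 R; split.
  by move=> l; rewrite /fgn_log fgn_densityN /wsing cosN.
have [K K0 hK] := log_tail2_bound s1 s3.
exists (fun l => s * sinc1 l + log_tail1 s l), (fun l => s * sinc2 l + log_tail2 s l).
exists (9 / 4 + K), (s - 2).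
have dm (l : R) : 0 < l <= pi -> 0 < l < 3 * pi / 2 by move=> /andP[a b]; apply/andP; split => //; lra.
have dm2 (l : R) : 0 < l <= pi -> 0 < l < 2 * pi by move=> /andP[a b]; apply/andP; split => //; lra.
split.
- by apply: addr_ge0 => //; lra.
- by have := s1; lra.
- move=> l hl; have /andP[l0 lp] := hl.
  have r0 : 0 < Num.min l (pi / 2) by rewrite lt_min l0/=; lra.
  have h := dD (dcst l (ln c0)) (dD (dZ s (dsinc (dm2 l hl))) (dlog_tail s1 (dm l hl))).
  rewrite add0r in h; apply: (d_near r0 _ h) => y; rewrite lt_min => /andP[y1 y2].
  rewrite fgn_logE//; move: y1 y2; rewrite !ltr_norml => /andP[a1 a2] /andP[b1 b2].
  by apply/andP; split; lra.
- by move=> l hl; exact: (dD (dZ s (dsinc1 (dm2 l hl))) (dlog_tail1 s1 (dm l hl))).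
move=> l hl; have /andP[l0 lp] := hl; split.
  have h0 := half_sin_gt0 (dm2 l hl).
  apply: cvgD; last exact: (log_tail2_cont s1 (dm l hl)).
  apply: cvgM; first exact: cvg_cst.
  have c1 : (fun y : R => y) @ l --> l by exact: cvg_id.
  have c2 := d_cont (dhalf_sin l).
  apply: cvgB; apply: cvgV; rewrite ?expf_neq0 ?gt_eqF//; under eq_fun do rewrite expr2.
    by rewrite expr2; exact: cvgM.
  by rewrite expr2; exact: cvgM.
apply: le_trans (ler_normD _ _) _; rewrite normrM (ger0_norm (x := s)); last by have := s1; lra.
have b1 := sinc2_bound hl; have b2 := hK l hl; have P0 : 0 <= l `^ (s - 2) by exact: powR_ge0.
have b3 := s1; have b4 := s3; have b5 := normr_ge0 (sinc2 l).
move: b1 b2 P0 b5; move: (`|sinc2 l|) (`|log_tail2 s l|) (l `^ (s - 2)) => x y z b1 b2 P0 b5.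
have h : s * x <= 9 / 4 by nra.
nra.
Qed.

(** The Kolmogorov variance is that of [fgn_log], because [ln wsing] has mean zero on the circle. *)
Theorem fgn_spectrum : exists M : R, exists L : W, exists l0 : R,
  [/\ 0 <= M, decays M L, supp_ge 1 L,
      forall l, D l -> l != 0 -> fgn_density d l = smooth l0 L l * wsing l `^ (- d) &
      kolmogorov_variance (fgn_density d) = kvar l0].
Proof.
have p0 := pi_gt0 R.
have [M [L [M0 dL sL E iF]]] := fourier_rep fgn_smooth.
exists M, L, (fcoef fgn_log 0); split => //.
  move=> l Dl l0; rewrite /smooth -E// powR_expR ?wsing_gt0// -expRD /fgn_log mulNr addrK lnK//.
  have pos (t : R) : 0 < t <= pi -> 0 < fgn_density d t.
    move=> /andP[t0 tp]; have u0 : 0 < 1 + tailU s t.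
      by rewrite ltr_pwDl// tailU_ge0//; apply/andP; split => //; lra.
    rewrite fgn_densityE; last by apply/andP; split => //; lra.
    apply: mulr_gt0; last by rewrite mulr_gt0 ?powR_gt0.
    apply: mulr_gt0; first exact: fgn_const_gt0.
    by apply: wsing_gt0; [rewrite /= in_itv/= tp andbT; lra|exact: lt0r_neq0].
  move: Dl; rewrite /= in_itv/= => /andP[l1 l2]; rewrite posrE.
  have [h|h|h] := ltrgtP l 0; last by rewrite h eqxx in l0.
    by rewrite -fgn_densityN; apply: pos; apply/andP; split; lra.
  by apply: pos; rewrite h.
rewrite /kolmogorov_variance /kvar; congr (_ * expR _).
rewrite /fcoef; congr (_ * _).
rewrite (@eq_circle _ _ (fun l => fgn_log l - d * ln (wsing l))); last by move=> l _; rewrite /fgn_log addrK.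
have iw := @ln_wsing_integrable R; have idw := integrable_scale d (@mD R) iw.
rewrite circleB// circleZ// circle_ln_wsing mulr0 subr0.
by apply: eq_circle => l _; rewrite mul0r cos0 mulr1.
Qed.

End FgnSpectrum.

(** * Rational factors *)

Section RationalFactor.
Context {R : realType}.
Local Notation W := (wiener R).
Implicit Types (u : R[i]) (l : R).

Lemma expiN l : expi (- l) = conjc (expi l).
Proof. by rewrite /expi cosN sinN. Qed.

Lemma expiX l k : expi l ^+ k = expi (k%:R * l).
Proof.
elim: k => [|k IH]; first by rewrite expr0 /expi mul0r cos0 sin0.
rewrite exprS IH /expi; simpc; have -> : k.+1%:R * l = l + k%:R * l by rewrite -[k.+1%:R]natr1; ring.
by rewrite cosD sinD; congr (_ +i* _)%C; ring.
Qed.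

Lemma cmod_expi1 l : cmod (expi l) = 1.
Proof.
have h : cmod (expi l) ^+ 2 = 1 by rewrite cmod_sqr /= cos2Dsin2.
by apply/eqP; rewrite -(@eqrXn2 _ 2) ?cmod_ge0// h expr1n.
Qed.

Lemma cmod1 : cmod (1 : R[i]) = 1.
Proof. by rewrite /cmod normr1. Qed.

Lemma cmodX u k : cmod (u ^+ k) = cmod u ^+ k.
Proof. by elim: k => [|k IH]; [rewrite !expr0 /cmod normr1|rewrite !exprS cmodM IH]. Qed.

Lemma Re_le_cmod u : `|complex.Re u| <= cmod u.
Proof.
rewrite -(@ler_sqr R) ?nnegrE ?cmod_ge0// cmod_sqr real_normK ?num_real//.
by rewrite lerDl sqr_ge0.
Qed.

Lemma cmod_conjc u : cmod (conjc u) = cmod u.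
Proof. by rewrite /cmod normcJ. Qed.

(** Gives |u|^k = O(1 / k), hence coefficients Re (u^k) / k of order k^-2. *)
Lemma natmul_geometric_le (r : R) k : 0 <= r -> r < 1 -> (1 - r) * (k%:R * r ^+ k) <= 1.
Proof.
move=> r0 r1; apply: (@le_trans _ _ ((1 - r) * \sum_(i < k) r ^+ i)).
  apply: ler_wpM2l; first by rewrite subr_ge0 ltW.
  rewrite mulr_natl -[k in _ *+ k]card_ord -sumr_const; apply: ler_sum => i _.
  by apply: ler_wiXn2l; [exact: r0|exact: ltW|exact: ltnW].
by rewrite -[1 - r]opprB mulNr -subrX1 opprB lerBlDr lerDl exprn_ge0.
Qed.

Lemma log_modulus_series u l : cmod u < 1 ->
  (fun N => \sum_(k < N) complex.Re (u ^+ k.+1 * expi (k.+1%:R * l)) / k.+1%:R) @ \oo -->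
  - (ln (cmod (1 - u * expi l) ^+ 2) / 2).
Proof.
move=> u1; pose w := u * expi l; pose c k := complex.Re (w ^+ k).
have cw k : w ^+ k = u ^+ k * expi (k%:R * l) by rewrite exprMn expiX.
have mw : cmod w = cmod u by rewrite cmodM cmod_expi1 mulr1.
have hsq : complex.Re w ^+ 2 + complex.Im w ^+ 2 <= cmod u ^+ 2 by rewrite -cmod_sqr mw.
have := @log_series R _ _ _ (cmod_ge0 u) u1 hsq c.
have -> : (1 - complex.Re w) ^+ 2 + complex.Im w ^+ 2 = cmod (1 - w) ^+ 2.
  by rewrite cmod_sqr; case: w {c cw mw hsq} => a b /=; rewrite sub0r sqrrN.
have -> : (fun N : nat => \sum_(k < N) c k.+1 / k.+1%:R) =
    (fun N : nat => \sum_(k < N) complex.Re (u ^+ k.+1 * expi (k.+1%:R * l)) / k.+1%:R).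
  by apply/funext => N; apply: eq_bigr => k _; rewrite /c cw.
apply.
- by rewrite /c expr0.
- by rewrite /c expr1.
- move=> k; rewrite /c !exprS; case: (w ^+ k) => a b; case: w {c cw mw hsq} => x y /=; ring.
- by move=> k; rewrite /c -mw -cmodX; exact: Re_le_cmod.
Qed.

(** A factor with non-real u is not even in l. The product of its values at l and - l is, and its
    logarithm has the real coefficients [- Re (u^k) / k]. *)
Lemma linear_factor u : cmod u < 1 -> exists M : R, exists L : W,
  [/\ 0 <= M, decays M L, supp_ge 1 L &
      forall l, cmod (1 - u * expi l) ^+ 2 * cmod (1 - u * expi (- l)) ^+ 2 = expR (4 * wcos L l)].
Proof.
move=> u1; pose a (k : nat) : R := - complex.Re (u ^+ k) / k%:R.
have r0 := cmod_ge0 u.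
have ha k : (0 < k)%N -> `|a k| <= (1 - cmod u)^-1 / k%:R ^+ 2.
  move=> k0; have k1 : 0 < k%:R :> R by rewrite ltr0n.
  rewrite /a normrM normrN normfV (ger0_norm (ltW k1)).
  have h1 := Re_le_cmod (u ^+ k); rewrite cmodX in h1.
  have h2 := natmul_geometric_le k r0 u1.
  rewrite ler_pdivrMr// (_ : (1 - cmod u)^-1 / k%:R ^+ 2 * k%:R = (1 - cmod u)^-1 / k%:R); last first.
    by field; rewrite subr_eq0 !gt_eqF.
  apply: le_trans h1 _; by rewrite ler_pdivlMr// -[leRHS]mulr1 ler_pdivlMl ?subr_gt0// [_ * k%:R]mulrC.
have [L dL LE] := one_sided_coef ha.
have sL : supp_ge 1 L by move=> k k1; rewrite LE ifF//; lia.
exists (4 * (1 - cmod u)^-1), L; split => //.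
  by rewrite mulr_ge0// invr_ge0 subr_ge0 ltW.
move=> l; have nz t : 0 < cmod (1 - u * expi t) ^+ 2.
  rewrite exprn_gt0// cmod_gt0 subr_eq0; apply/eqP => /(congr1 cmod).
  rewrite cmodM cmod_expi1 mulr1 cmod1 => h.
  by move: u1; rewrite -h ltxx.
apply: ln_inj; [by rewrite posrE mulr_gt0|by rewrite posrE expR_gt0|rewrite expRK lnM ?posrE//].
have c1 := @log_modulus_series u l u1; have c2 := @log_modulus_series u (- l) u1.
have c3 := @wcos_onesided R L l sL.
have c4 : (fun N : nat => - 2 * \sum_(k < N) L k.+1 * cos (k.+1%:R * l)) @ \oo --> - 2 * wcos L l.
  by apply: cvgM; [exact: cvg_cst|exact: c3].
have c5 : (fun N : nat => \sum_(k < N) complex.Re (u ^+ k.+1 * expi (k.+1%:R * l)) / k.+1%:R +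
     \sum_(k < N) complex.Re (u ^+ k.+1 * expi (k.+1%:R * - l)) / k.+1%:R) @ \oo -->
    - (ln (cmod (1 - u * expi l) ^+ 2) / 2) + - (ln (cmod (1 - u * expi (- l)) ^+ 2) / 2) by exact: cvgD.
suff E : (fun N : nat => - 2 * \sum_(k < N) L k.+1 * cos (k.+1%:R * l)) =
  (fun N : nat => \sum_(k < N) complex.Re (u ^+ k.+1 * expi (k.+1%:R * l)) / k.+1%:R +
     \sum_(k < N) complex.Re (u ^+ k.+1 * expi (k.+1%:R * - l)) / k.+1%:R).
  have h : - 2 * wcos L l = - (ln (cmod (1 - u * expi l) ^+ 2) / 2) + - (ln (cmod (1 - u * expi (- l)) ^+ 2) / 2).
    by rewrite -E in c5; exact: (cvg_unique (@Rhausdorff R) c4 c5).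
  by move: h; move: (ln _) (ln _) (wcos L l) => x y t h; lra.
apply/funext => N; rewrite -big_split mulr_sumr; apply: eq_bigr => k _ /=.
rewrite LE /= /a mulrN expiN; case: (u ^+ k.+1) => x y /=.
move: (cos _) (sin _) => C S; have k0 : k.+1%:R != 0 :> R by rewrite pnatr_eq0.
by move: (k.+1%:R : R) k0 => t t0; field.
Qed.

Lemma reflect_factor u l : u != 0 -> cmod (1 - u * expi l) = cmod u * cmod (1 - (conjc u)^-1 * expi l).
Proof.
move=> u0; rewrite -(cmod_conjc u) -cmodM mulrBr mulr1 mulrA divff ?conjc_eq0// mul1r.
have e0 : expi l != 0 by rewrite -cmod_gt0 cmod_expi1.
have -> : conjc u - expi l = - (expi l * conjc (1 - u * expi l)).
  have -> : conjc (1 - u * expi l) = 1 - conjc u * expi (- l) by rewrite expiN rmorphB rmorph1 rmorphM.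
  rewrite mulrBr mulr1 mulrCA.
  have -> : expi l * expi (- l) = 1.
    by rewrite /expi cosN sinN; simpc; rewrite -!expr2 cos2Dsin2 [sin l * _]mulrC addrC subrr.
  by rewrite mulr1 opprB.
by rewrite -[in RHS]mulN1r !cmodM cmod_expi1 cmod_conjc /cmod normrN1 !mul1r.
Qed.

Lemma circle_factor u : cmod u != 1 -> exists M : R, exists L : W,
  [/\ 0 <= M, decays M L, supp_ge 1 L &
      forall l, cmod (1 - u * expi l) ^+ 2 * cmod (1 - u * expi (- l)) ^+ 2 =
        (if 1 < cmod u then cmod u ^+ 2 else 1) ^+ 2 * expR (4 * wcos L l)].
Proof.
move=> u1; case: (ltgtP 1 (cmod u)) => h; last by rewrite -h eqxx in u1.
- have u0 : u != 0 by rewrite -cmod_gt0; exact: lt_trans h.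
  have v1 : cmod (conjc u)^-1 < 1 by rewrite cmodV cmod_conjc invf_lt1// (lt_trans ltr01 h).
  have [M [L [M0 dL sL E]]] := linear_factor v1; exists M, L; split => // l.
  by rewrite -E !(reflect_factor _ u0) !exprMn; ring.
by have [M [L [M0 dL sL E]]] := linear_factor h; exists M, L; split => // l; rewrite expr1n mul1r.
Qed.

Lemma wcos0 l : wcos (0 : W) l = 0.
Proof. by have := wcosD (0 : W) 0 l; rewrite addr0; lra. Qed.

Lemma product_factor (I : eqType) (s : seq I) (u : I -> R[i]) : (forall i, i \in s -> cmod (u i) != 1) ->
  exists M : R, exists L : W, [/\ 0 <= M, decays M L, supp_ge 1 L &
    forall l, cmod (\prod_(i <- s) (1 - u i * expi l)) ^+ 2 * cmod (\prod_(i <- s) (1 - u i * expi (- l))) ^+ 2 =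
      (\prod_(i <- s | 1 < cmod (u i)) cmod (u i) ^+ 2) ^+ 2 * expR (4 * wcos L l)].
Proof.
elim: s => [|i s IH] hs.
  exists 0, 0; split => //; first by move=> k; rewrite w0 normr0 mul0r.
  by move=> l; rewrite !big_nil cmod1 wcos0 mulr0 expR0 !expr1n !mulr1.
have [M [L [M0 dL sL E]]] := IH (fun j js => hs j (mem_behead (s := i :: s) js)).
have [M' [L' [M0' dL' sL' E']]] := circle_factor (hs i (mem_head _ _)).
exists (M' + M), (L' + L); split; first exact: addr_ge0.
- move=> k; rewrite wD mulrDl; apply: le_trans (ler_normD _ _) _; exact: lerD.
- by move=> k k1; rewrite wD sL// sL'// addr0.
move=> l; rewrite !big_cons !cmodM wcosD mulrDr expRD; move: (E l) (E' l).
set a := cmod _; set b := cmod _; set a' := cmod _; set b' := cmod _.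
set G := expR _; set G' := expR _; set Q := \prod_(_ <- _ | _) _.
case: ifP => _ e e'.
  have -> : (a' * a) ^+ 2 * (b' * b) ^+ 2 = (a' ^+ 2 * b' ^+ 2) * (a ^+ 2 * b ^+ 2) by ring.
  by rewrite e e'; ring.
have -> : (a' * a) ^+ 2 * (b' * b) ^+ 2 = (a' ^+ 2 * b' ^+ 2) * (a ^+ 2 * b ^+ 2) by ring.
by rewrite e e'; ring.
Qed.

Lemma conjc_cpoly (p : {poly R}) u : (cpoly p).[conjc u] = conjc (cpoly p).[u].
Proof.
rewrite -(horner_map (@conjc R)); congr (_.[_]); rewrite /cpoly -map_poly_comp.
by apply: eq_map_poly => x; rewrite /= oppr0.
Qed.

Lemma cmod_cpolyN (p : {poly R}) l : cmod (cpoly p).[expi (- l)] = cmod (cpoly p).[expi l].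
Proof. by rewrite expiN conjc_cpoly cmod_conjc. Qed.

(** A real polynomial has the same modulus at l and - l, so the symmetrised identity of
    [product_factor] is the square of the one wanted. *)
Lemma cpoly_circle (p : {poly R}) (I : eqType) (s : seq I) (z : I -> R[i]) :
  (forall u, (cpoly p).[u] = \prod_(i <- s) (1 - (z i)^-1 * u)) ->
  (forall i, i \in s -> z i != 0 /\ cmod (z i) != 1) ->
  exists M : R, exists L : W, [/\ 0 <= M, decays M L, supp_ge 1 L &
    forall l, cmod (cpoly p).[expi l] ^+ 2 =
      \prod_(i <- s | cmod (z i) < 1) (cmod (z i) ^+ 2)^-1 * expR (2 * wcos L l)].
Proof.
move=> pE hz; have [i si|M [L [M0 dL sL E]]] := @product_factor _ s (fun i => (z i)^-1).
  by rewrite cmodV invr_eq1; have [] := hz i si.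
exists M, L; split => // l.
have {E} := E l; rewrite -!pE cmod_cpolyN -expr2.
have -> : expR (4 * wcos L l) = expR (2 * wcos L l) ^+ 2 by rewrite expr2 -expRD; congr expR; ring.
rewrite -exprMn => /eqP; rewrite eqrXn2 ?sqr_ge0 ?mulr_ge0 ?expR_ge0//; last first.
  by apply: prodr_ge0 => i _; exact: sqr_ge0.
move=> /eqP ->; congr (_ * _); rewrite big_seq_cond [RHS]big_seq_cond; apply: eq_big => i.
  case: (boolP (i \in s)) => //= si; have [z0 _] := hz i si.
  by rewrite cmodV invf_gt1 ?cmod_gt0.
by move=> _; rewrite cmodV exprVn.
Qed.

Lemma cpoly_roots (p : {poly R}) : p.[0] = 1 -> exists s : seq R[i],
  (forall u, (cpoly p).[u] = \prod_(z <- s) (1 - z^-1 * u)) /\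
  forall z, z \in s -> z != 0 /\ root (cpoly p) z.
Proof.
move=> p0; have [s E] := closed_field_poly_normal (cpoly p).
have c0 : (cpoly p).[0] = 1 by rewrite /cpoly -(rmorph0 (real_complex R)) horner_map/= p0.
have lc0 : lead_coef (cpoly p) != 0.
  by apply/eqP => h; move: c0; rewrite E h scale0r horner0 => /eqP; rewrite eq_sym oner_eq0.
have rs z : z \in s -> root (cpoly p) z by rewrite E rootZ// root_prod_XsubC.
have nz z : z \in s -> z != 0.
  by move=> /rs; apply: contraTneq => ->; rewrite rootE c0 oner_eq0.
exists s; split => [u|z zs]; last by split; [exact: nz|exact: rs].
have ev v : (cpoly p).[v] = lead_coef (cpoly p) * \prod_(z <- s) (v - z).
  by rewrite {1}E hornerZ horner_prod; congr (_ * _); apply: eq_bigr => z _; rewrite hornerXsubC.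
have -> : (cpoly p).[u] = (cpoly p).[u] / (cpoly p).[0] by rewrite c0 divr1.
rewrite !ev invfM mulrACA divff// mul1r -prodf_div big_seq [RHS]big_seq.
apply: eq_bigr => z /nz z0; rewrite sub0r invrN mulrN -mulNr opprB mulrBl divff//.
by rewrite [u * _]mulrC.
Qed.

Lemma normc_lt1 u : (`|u| < 1) = (cmod u < 1).
Proof. by rewrite cmodE -(@ltcR R). Qed.

Lemma conjc_id_sqr u : conjc u = u -> u ^+ 2 = (cmod u ^+ 2)%:C%C.
Proof.
case: u => a b /= [h]; have -> : b = 0 by lra.
by rewrite cmod_sqr /= expr0n addr0 expr2; simpc; rewrite -expr2.
Qed.

Section ZeroList.
Variables (q : nat) (theta : {poly R}) (z : q.-tuple R[i]).
Hypothesis size_theta : size theta = q.+1.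
Hypothesis thetaE : cpoly theta = \prod_(j < q) (1 - (tnth z j)^-1 *: 'X).

Lemma zero_list_eval u : (cpoly theta).[u] = \prod_(x <- z) (1 - x^-1 * u).
Proof.
rewrite thetaE horner_prod big_tuple; apply: eq_bigr => j _.
by rewrite hornerD hornerN hornerZ hornerX hornerC.
Qed.

(** The inverse of 0 being 0, a zero entry would turn its factor into 1 and leave a polynomial of
    degree below q. *)
Lemma zero_list_neq0 j : tnth z j != 0.
Proof.
apply/eqP => zj; have : (size (cpoly theta) <= q)%N; last first.
  by rewrite /cpoly size_map_poly size_theta ltnn.
rewrite thetaE (bigD1 j)//= zj invr0 scale0r subr0 mul1r.
apply: leq_trans (size_poly_prod_leq _ _) _.
have hs (i : 'I_q) : (size (1 - (tnth z i)^-1 *: 'X : {poly R[i]})%R <= 2)%N.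
  apply: leq_trans (size_polyD _ _) _; rewrite geq_max size_poly1 size_polyN.
  by apply: leq_trans (size_scale_leq _ _) _; rewrite size_polyX.
have c : #|[pred i : 'I_q | i != j]| = q.-1 by rewrite cardC1 card_ord.
apply: (@leq_trans ((\sum_(i < q | i != j) 2).+1 - #|[pred i : 'I_q | i != j]|)%N).
  by apply: leq_sub2r; rewrite ltnS; apply: leq_sum => i _; exact: hs.
rewrite sum_nat_const c; have := ltn_ord j; lia.
Qed.

Lemma zero_list_root j : root (cpoly theta) (tnth z j).
Proof.
rewrite rootE zero_list_eval big_tuple (bigD1 j)//= mulVf ?zero_list_neq0//.
by rewrite subrr mul0r.
Qed.

(** Conjugation fixes theta, hence its leading constant and its monic part; uniqueness of the
    factorisation gives the permutation with multiplicities. *)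
Lemma zero_list_conj : perm_eq (map conjc z) z.
Proof.
have E : cpoly theta = (\prod_(x <- z) - x^-1) *: \prod_(x <- z) ('X - x%:P).
  rewrite thetaE !big_tuple -scaler_prod; apply: eq_bigr => j _.
  have e : (tnth z j)^-1 *: (tnth z j)%:P = 1 :> {poly R[i]}.
    by rewrite -mul_polyC -polyCM mulVf ?zero_list_neq0.
  by rewrite scalerBr !scaleNr e opprK addrC.
have C : map_poly conjc (cpoly theta) = cpoly theta.
  by rewrite /cpoly -map_poly_comp; apply: eq_map_poly => x; rewrite /= oppr0.
set a := \prod_(x <- z) _ in E.
have a0 : a != 0.
  by rewrite prodf_seq_neq0; apply/allP => x /tnthP[j ->]; rewrite oppr_eq0 invr_eq0 zero_list_neq0.
have C1 : conjc a *: \prod_(x <- map conjc z) ('X - x%:P) = a *: \prod_(x <- z) ('X - x%:P).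
  by rewrite -E -C E map_polyZ map_prod_XsubC big_map.
have C2 : conjc a = a.
  have := congr1 lead_coef C1; rewrite !lead_coefZ !lead_coef_prod_XsubC !mulr1; exact.
by apply: prod_XsubC_eq; apply: (scalerI a0); rewrite -[in LHS]C2 C1.
Qed.

(** Conjugation permutes the zeros in the disk, so their product B is real and [B^2 = |B|^2],
    although the single z_j^2 need not be real. *)
Lemma zero_list_inner : \prod_(j < q | `|tnth z j| < 1) (1 / tnth z j ^+ 2) =
  (\prod_(x <- z | cmod x < 1) (cmod x ^+ 2)^-1)%:C%C.
Proof.
pose B := \prod_(x <- z | cmod x < 1) x.
have cB : conjc B = B.
  rewrite /B rmorph_prod/= -[RHS](perm_big _ zero_list_conj)/= big_map.
  by apply: eq_bigl => x; rewrite cmod_conjc.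
transitivity ((B ^+ 2)^-1).
  rewrite /B -prodrXl -prodfV big_tuple; apply: eq_big => j; first exact: normc_lt1.
  by rewrite div1r.
rewrite (conjc_id_sqr cB) -fmorphV; congr (_%:C)%C.
have cm : {morph (@cmod R) : x y / x * y >-> x * y} by exact: cmodM.
rewrite /B (big_morph _ cm cmod1) -prodrXl -prodfV.
by [].
Qed.

End ZeroList.

End RationalFactor.

(** * The full spectral density *)

Section FarimaSpectrum.
Context {R : realType}.
Local Notation W := (wiener R).

Lemma farima_spectrum (d : R) (q : nat) (phi theta : {poly R}) (z : q.-tuple R[i]) :
  - (1 / 2) < d < 1 / 2 -> d != 0 -> size theta = q.+1 -> phi.[0] = 1 ->
  (forall w : R[i], `|w| <= 1 -> ~~ root (cpoly phi) w) ->
  (forall w : R[i], `|w| = 1 -> ~~ root (cpoly theta) w) ->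
  cpoly theta = \prod_(j < q) (1 - (tnth z j)^-1 *: 'X) ->
  exists M : R, exists L : W, exists l0 : R, [/\ 0 <= M, decays M L, supp_ge 1 L,
    forall l, l \in `](- pi), pi] -> farima_fgn_density d phi theta l = smooth l0 L l * wsing l `^ (- d) &
    kvar l0 = (\prod_(x <- z | cmod x < 1) (cmod x ^+ 2)^-1) * kolmogorov_variance (fgn_density d)].
Proof.
move=> hd d0 sth phi0 hphi htheta thE.
have [Mf [Lf [lf [Mf0 dLf sLf Ef kE]]]] := fgn_spectrum hd.
have [s [phE hs]] := cpoly_roots phi0.
have sphi x : x \in s -> x != 0 /\ 1 < cmod x.
  move=> /hs [x0 rx]; split => //; rewrite ltNge; apply/negP => h.
  by have := hphi x; rewrite cmodE -(@lecR R _ 1) in h *; rewrite h rx => /(_ isT).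
have [x xs|Mp [Lp [Mp0 dLp sLp Ep]]] := @cpoly_circle R phi _ s id phE.
  by have [h1 h2] := sphi x xs; split => //; rewrite gt_eqF.
have [x xz|Mt [Lt [Mt0 dLt sLt Et]]] := @cpoly_circle R theta _ z id (zero_list_eval thE).
  have /tnthP[j ->] := xz; split; first exact: (zero_list_neq0 sth thE).
  apply/eqP => h; have := htheta (tnth z j); rewrite (zero_list_root sth thE) => /(_ _)/negP; apply => //.
  by rewrite cmodE h.
set Q := \prod_(x <- z | _) _ in Et.
have Q0 : 0 < Q.
  rewrite /Q big_seq_cond; apply: prodr_gt0 => x /andP[/tnthP[j ->] _].
  by rewrite invr_gt0 exprn_gt0// cmod_gt0 (zero_list_neq0 sth thE).
have {}Ep l : cmod (cpoly phi).[expi l] ^+ 2 = expR (2 * wcos Lp l).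
  rewrite Ep big_seq_cond big1 ?mul1r// => x /andP[/sphi [_ h] h'].
  by have := lt_trans h h'; rewrite ltxx.
exists (Mt + Mp + Mf), (Lt - Lp + Lf), (ln Q + lf); split.
- by rewrite !addr_ge0.
- move=> k; rewrite wD wB !mulrDl; apply: le_trans (ler_normD _ _) _; apply: lerD; last exact: dLf.
  by apply: le_trans (ler_normB _ _) _; apply: lerD; [exact: dLt|exact: dLp].
- by move=> k k1; rewrite wD wB sLt// sLp// sLf// subrr addr0.
(* At the origin both sides are 0 by convention: the density by [fgn_density0], the power of
   [wsing 0 = 0] because its exponent [- d] is nonzero. *)
- move=> l Dl; have [->|l0] := eqVneq l 0.
    by rewrite /farima_fgn_density fgn_density0 mulr0 /wsing cos0 mulr1 subrr powR0 ?mulr0// oppr_eq0.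
  rewrite /farima_fgn_density Ef// cmodM cmodV exprMn exprVn Et Ep /smooth mulrA; congr (_ * _).
  rewrite wcosD wcosB -expRN -[Q]lnK ?posrE// -!expRD lnK ?posrE//; congr expR.
  by move: (ln _) => a; ring.
by rewrite -/Q kE /kvar expRD lnK ?posrE// mulrCA.
Qed.

End FarimaSpectrum.

(** * Passage from the spectral density to the process *)

Section Assembly.
Context {R : realType}.
Local Notation W := (wiener R).
Local Notation mu := (@lebesgue_measure R).
Local Notation D := [set` `](- (pi : R)), (pi : R)]%R].

Lemma equiv_near (f g h : nat -> R) : (\forall n \near \oo, f n = g n) -> f ~_\oo h -> g ~_\oo h.
Proof.
move=> fg /eqaddoP fh; apply/eqaddoP => e e0.
by apply: filterS2 fg (fh e e0) => n /= fgn; rewrite !fctE fgn.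
Qed.

(** Integrability of the singular weight is inherited from the spectral density, since the smooth
    factor is bounded below by a positive constant. *)
Lemma weight_integrable (d l0 : R) (L : W) (f : R -> R) : mu.-integrable D (EFin \o f) ->
  (forall l, D l -> f l = smooth l0 L l * wsing l `^ (- d)) ->
  mu.-integrable D (EFin \o (fun l : R => wsing l `^ (- d))).
Proof.
move=> intf fE; pose B : R := expR (`|l0| + 2 * n1 L).
have mw : measurable_fun D (fun l => wsing l `^ (- d)).
  rewrite (_ : (fun l => _) = fun l => wpoly 1 l `^ (- d)); first exact: measurable_wpow.
  by apply/funext => l; rewrite wsing_wpoly.
apply: (le_integrable _ _ _ (integrable_scale B (@mD R) intf)) => //.
  exact/measurable_EFinP.
move=> l Dl; rewrite lee_fin fE// ger0_norm ?powR_ge0// ger0_norm; last first.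
  by rewrite !mulr_ge0 ?expR_ge0 ?powR_ge0.
rewrite mulrA ler_peMl ?powR_ge0// /B /smooth -expRD; apply: (@le_trans _ _ (expR 0)); first by rewrite expR0.
rewrite ler_expR.
have h1 := wcos_le L l; have h2 := ler_norm (- wcos L l); rewrite normrN in h2.
have h3 := ler_norm (- l0); rewrite normrN in h3; lra.
Qed.

End Assembly.

Theorem theorem1p4 (disp : measure_display) (T : measurableType disp)
    (R : realType) (P : probability T R) (X : int -> {RV P >-> R})
    (d : R) (p q : nat) (phi theta : {poly R}) (z : q.-tuple R[i])
    (hd : - (1 / 2) < d < 1 / 2) (hd0 : d != 0)
    (hcent : centered X) (hstat : weakly_stationary X)
    (hdens : spectral_density X (farima_fgn_density d phi theta))
    (hphi_deg : size phi = p.+1) (htheta_deg : size theta = q.+1)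
    (hphi0 : phi.[0] = 1) (htheta0 : theta.[0] = 1)
    (hcoprime : coprimep phi theta)
    (hphi : forall w : R[i], `|w| <= 1 -> ~~ root (cpoly phi) w)
    (htheta : forall w : R[i], `|w| = 1 -> ~~ root (cpoly theta) w)
    (hz : cpoly theta = \prod_(j < q) (1 - (tnth z j)^-1 *: 'X)) :
  (partial_corr X ~_\oo (fun n : nat => d / n%:R)) /\
  exists2 C : R,
    (C%:C)%C = \prod_(j < q | `|tnth z j| < 1) (1 / tnth z j ^+ 2) &
    rel_pred_error X ~_\oo
      (fun n : nat => C * kolmogorov_variance (fgn_density d) * (d ^+ 2 / n%:R)).
Proof.
have [M [L [l0 [M0 dL sL fE kE]]]] := farima_spectrum hd hd0 htheta_deg hphi0 hphi htheta hz.
have [_ intf hgamma] := hdens.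
have iw := weight_integrable intf fE.
have dhalf : `|d| < 1 / 2 by rewrite ltr_norml.
set kappa := kvar l0 in kE; have kappa0 : 0 < kappa := kvar_gt0 l0.
have cE : (fun k : nat => gamma X k) = acov d l0 L.
  apply/funext => k; have := congr1 (@complex.Re R) (hgamma k) => /= <-.
  rewrite /acov; apply: eq_circle => l Dl.
  by rewrite /= mul0r subr0 cosN -fE.
have [C [N0 [C0 H]]] := core_asymptotics dhalf iw hd0 l0 M0 dL sL.
have vk n : kappa <= lvar (acov d l0 L) n by have [] := core_cvg dhalf iw l0 n sL.
have vnz n : lvar (fun k : nat => gamma X k) n != 0.
  by rewrite cE gt_eqF// (lt_le_trans kappa0).
pose a n := lpoly (acov d l0 L) n n; pose v := lvar (acov d l0 L).
have hp n : (N0 <= n)%N -> (0 < n)%N -> `|a n + d / (n%:R - d)| <= C / (n%:R * Num.sqrt n%:R).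
  by move=> h1 h2; have [] := H n h1 h2.
have hv n : (N0 <= n)%N -> (0 < n)%N -> kappa <= v n <= kappa * (1 + C / Num.sqrt n%:R).
  by move=> h1 h2; have [] := H n h1 h2.
have vS n : v n - v n.+1 = v n * a n.+1 ^+ 2.
  by rewrite /v /a lpoly_last lvarS; ring.
split.
  apply: equiv_near (refl_equiv dhalf hd0 C0 hp).
  by exists 1%N => // n /= n0; rewrite (partial_corrE hcent hstat vnz n0) cE.
exists (\prod_(x <- z | cmod x < 1) (cmod x ^+ 2)^-1); first by rewrite (zero_list_inner htheta_deg hz).
rewrite -kE; have peE n : pred_error X n.+1 = v n by rewrite (pred_errorE hcent hstat vnz) cE.
have v_lim : v @ \oo --> kappa by exact: (v_cvg kappa0 hv).
have lim_v : pred_error_lim X = kappa.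
  apply: (cvg_lim (@Rhausdorff R)); rewrite -cvg_shiftS.
  by rewrite (_ : (fun n => _) = v)//; apply/funext.
apply: equiv_near (error_equiv dhalf hd0 kappa0 C0 hp hv vS).
by exists 1%N => // -[//|n] _; rewrite /rel_pred_error lim_v peE.
Qed.
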